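(* Let $\mathbf H$ be a positive semi-definite smooth periodic Hankel operator. Then no band function of $\mathbf H$ is constant (the non-zero spectrum of $\mathbf H$ has no flat bands and consists entirely of non-flat bands). Moreover, enumerating the band functions as $E_0(k)>E_1(k)>\cdots>0$ for $k\in(0,\omega/2)$, one has for each $k\in(0,\omega/2)$ $$(-1)^{n+1}\frac{d}{dk}E_n(k)>0,\qquad n=0,1,\dots;$$ i.e. $E_0,E_2,\dots$ attain a maximum at $k=0$ and a minimum at $k=\omega/2$, while $E_1,E_3,\dots$ attain a minimum at $k=0$ and a maximum at $k=\omega/2$.
   Context: Fix $T>0$, $\omega=2\pi/T$. $p$ is a real-valued $T$-periodic function with Fourier coefficients $\widetilde p_\ell=\frac1T\int_0^Te^{-i\ell\omega x}p(x)dx$ satisfying $\sum_\ell|\widetilde p_\ell|(1+\ell^2)^{1/4}<\infty$; $\mathbf H$ is the Hankel operator on $L^2(\mathbb R_+)$ with kernel $h(t)=p(\log t)/t$ (a smooth periodic Hankel operator). For $k\in\mathbb R$, $H(k)$ is the trace class self-adjoint operator on $\ell^2(\mathbb Z)$ with matrix $[H(k)]_{n,m}=B(\frac12-i\omega n-ik,\frac12+i\omega m+ik)\widetilde p_{n-m}$, $B(z_1,z_2)=\Gamma(z_1)\Gamma(z_2)/\Gamma(z_1+z_2)$. Band functions: there is a (unique up to ordering) finite or countable list $\mathcal E$, repetitions allowed, of non-vanishing real analytic real-valued functions on $\mathbb R$ such that for every $k$ the non-zero eigenvalues of $H(k)$, counted with multiplicity, are exactly the values $E(k)$, $E\in\mathcal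 E$, counted with repetition. A flat band is a non-zero eigenvalue of $\mathbf H$, equivalently a constant band function. *)

(* Defs.v *)
From mathcomp Require Import all_boot all_order all_algebra.
From mathcomp Require Import all_classical all_reals all_analysis.
From mathcomp Require Import complex.
Set Implicit Arguments. Unset Strict Implicit. Unset Printing Implicit Defensive.
Import Order.TTheory GRing.Theory Num.Theory.
Import numFieldNormedType.Exports.
Local Open Scope classical_set_scope.
Local Open Scope ring_scope.
Local Open Scope complex_scope.

Section Defs.
Variable R : realType.
Notation mu := (@lebesgue_measure R).
Definition Rpos : set R := `]0, +oo[.
Definition I0T (T : R) : set R := `[0, T].

Definition omg (T : R) : R := 2 * pi / T.

Definition normc' (z : R[i]) : R := Num.sqrt (complex.Re z ^+ 2 + complex.Im z ^+ 2).

Definition cvgC (u : nat -> R[i]) (l : R[i]) : Prop :=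
  ((fun N => complex.Re (u N)) @ \oo --> complex.Re l) /\ ((fun N => complex.Im (u N)) @ \oo --> complex.Im l).

Definition fourier (p : R -> R) (T : R) (l : int) : R[i] :=
  (T^-1 * Rintegral mu (I0T T) (fun x => cos (l%:~R * omg T * x) * p x))
  +i* (- (T^-1 * Rintegral mu (I0T T) (fun x => sin (l%:~R * omg T * x) * p x))).

(* Euler's Gamma function, Gamma(z) = int_0^oo t^{z-1} e^{-t} dt (complex.Re z > 0),
   with t^{a+ib-1} = t^{a-1} (cos (b ln t) + i sin (b ln t)). *)
Definition Gammac (z : R[i]) : R[i] :=
  (Rintegral mu Rpos
     (fun t => powR t (complex.Re z - 1) * expR (- t) * cos (complex.Im z * ln t)))
  +i* (Rintegral mu Rpos
     (fun t => powR t (complex.Re z - 1) * expR (- t) * sin (complex.Im z * ln t))).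

Definition Betac (z1 z2 : R[i]) : R[i] := Gammac z1 * Gammac z2 / Gammac (z1 + z2).

Definition Hk (p : R -> R) (T k : R) (n m : int) : R[i] :=
  Betac ((2^-1) +i* (- (omg T * n%:~R + k))) ((2^-1) +i* (omg T * m%:~R + k))
  * fourier p T (n - m).

Definition l2Z (x : int -> R[i]) : Prop :=
  cvg (series (fun N : nat => normc' (x N%:Z) ^+ 2 + normc' (x (- N%:Z)) ^+ 2) @ \oo).

Definition in_eigenspace (p : R -> R) (T k lam : R) (x : int -> R[i]) : Prop :=
  l2Z x /\
  forall n : int,
    cvgC (fun N : nat => \sum_(0 <= j < (N.*2).+1)
                           Hk p T k n (j%:Z - N%:Z) * x (j%:Z - N%:Z))
         (lam%:C * x n).

Definition eig_dim_ge (p : R -> R) (T k lam : R) (m : nat) : Prop :=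
  exists v : 'I_m -> int -> R[i],
    (forall i, in_eigenspace p T k lam (v i)) /\
    forall c : 'I_m -> R[i],
      (forall n, \sum_(i < m) c i * v i n = 0) -> forall i, c i = 0.

Definition eig_mult (p : R -> R) (T k lam : R) (m : nat) : Prop :=
  eig_dim_ge p T k lam m /\ ~ eig_dim_ge p T k lam m.+1.

Definition in_idx (Nb : option nat) (j : nat) : Prop :=
  if Nb is Some N then (j < N)%N else True.

Definition count_vals (Nb : option nat) (E : nat -> R -> R) (k lam : R) (m : nat) : Prop :=
  exists s : seq nat, uniq s /\ size s = m /\
    forall j, j \in s <-> (in_idx Nb j /\ E j k = lam).

Definition real_analytic (f : R -> R) : Prop :=
  forall x0 : R, exists2 r : R, 0 < r &
    exists a : nat -> R, forall x, `|x - x0| < r ->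
      series (fun n => a n * (x - x0) ^+ n) @ \oo --> f x.

Definition band_functions (p : R -> R) (T : R) (Nb : option nat) (E : nat -> R -> R) : Prop :=
  (forall j, in_idx Nb j -> real_analytic (E j) /\ forall k, E j k != 0) /\
  (forall k lam m, lam != 0 -> (eig_mult p T k lam m <-> count_vals Nb E k lam m)).

Definition hankel_kernel (p : R -> R) (t : R) : R := p (ln t) / t.

Definition hankel_psd (p : R -> R) : Prop :=
  forall f : R -> R, measurable_fun Rpos f ->
    (\int[mu]_(x in Rpos) ((f x) ^+ 2)%:E < +oo)%E ->
    0 <= Rintegral mu Rpos
           (fun t => Rintegral mu Rpos (fun s => hankel_kernel p (t + s) * f s) * f t).

Definition smooth_periodic_symbol (p : R -> R) (T : R) : Prop :=
  0 < T /\ (forall x, p (x + T) = p x) /\ measurable_fun setT p /\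
  mu.-integrable (I0T T) (EFin \o p) /\
  cvg (series (fun l : nat =>
         (normc' (fourier p T l%:Z) + (if l == 0%N then 0 else normc' (fourier p T (- l%:Z))))
         * powR (1 + l%:R ^+ 2) (4^-1)) @ \oo).

End Defs.

(* Main.v *)
(* The substitution [w_n = conj (Gamma (1/2 - i a_n)) x_n], [a_n = omega n + k],
   turns the eigenvalue equation of [H(k)] into
   [lambda c_n w_n = sum_m q_(n-m) w_m] with [c_n = cosh (pi a_n) / pi], and
   positivity of the Hankel form makes [q] a positive semi-definite Toeplitz
   symbol. Put [X = sum_n w_n exp (- pi a_n / 2)], [Y = sum_n w_n exp (pi a_n / 2)].
   Product formulas for cosh express [|X|^2 + |Y|^2] and [X Y] through the kernel
   sech, and the representation of sech as a Fourier transform then yields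
   [|X| <> |Y|] for every eigenvector when [0 < k < omega / 2]. Hence eigenvalues are
   simple (two independent eigenvectors would have a combination with [X = Y]),
   and, since [|X|^2 - |Y|^2 = - 2 sum_n sinh (pi a_n) |w_n|^2], this flux never
   vanishes. By Hellmann-Feynman [E' = - E flux / sum_n c_n |w_n|^2]. The sign of
   the flux is found by deforming [q] to [q_0 delta_0] through positive
   semi-definite symbols: the n-th eigenvalue moves continuously and its flux keeps
   its sign, and at the end point the eigenvectors are
   [delta_0, delta_(-1), delta_1, delta_(-2), ...], whose fluxes alternate. *)
From HB Require Import structures.
Require Import Defs.
From mathcomp Require Import all_boot all_order all_algebra.
From mathcomp Require Import all_classical all_reals all_analysis.
From mathcomp Require Import measurable_realfun.
From mathcomp Require Import complex.
From mathcomp Require Import ring lra zify.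
Import Order.TTheory GRing.Theory Num.Theory.
Import numFieldNormedType.Exports.
Local Open Scope classical_set_scope.
Local Open Scope ring_scope.
Set Implicit Arguments. Unset Strict Implicit. Unset Printing Implicit Defensive.
Local Open Scope complex_scope.

(** * Sums over the integers *)

(** The inequality [|X| <> |Y|] is a strict form of [2 |X Y| <= |X|^2 + |Y|^2]. By the eigenvalue
    equation both sides become, up to one common factor and after truncation, integrals over the
    line against a positive sech weight: the right one of [nu |W|^2], the left one (in modulus) of
    [nu W^2]. Here [nu >= 0] is a trigonometric polynomial made from [q], and
    [W (y) = sum_n w_n exp (i a_n y)]. Translation by [T] fixes [nu |W|^2], multiplies [nu W^2] by
    [exp (2 i k T)] and changes the weight at most by a factor [exp T]. The ratio of the two
    integrals is therefore at most [(e^T - 1 + 2 |cos (k T)|) / (e^T + 1)]. This is below 1 because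
    [0 < k T < pi], and becomes trivial at both ends of the interval. Two devices recur. Positivity,
    known for finite Toeplitz sections only, reaches infinite sums through Cesaro means. Limits of
    eigenvectors are taken along ultrafilters, where a uniform exponential majorant keeps the limit
    nonzero. *)

Section PartialSums.
Context {V : zmodType}.
Implicit Types f g : int -> V.

(** The sum over [|n| <= N], indexed exactly as the row sums in [in_eigenspace], so that the two
    match without re-indexing. *)
Definition psum f (N : nat) : V := \sum_(0 <= j < (N.*2).+1) f (j%:Z - N%:Z).

Lemma psum0 f : psum f 0 = f 0.
Proof. by rewrite /psum big_nat1. Qed.

Lemma psumS f N : psum f N.+1 = f (- N.+1%:Z) + psum f N + f N.+1%:Z.
Proof.
rewrite /psum doubleS big_nat_recl // big_nat_recr //= addrA; congr (f _ + _ + f _).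
- by rewrite add0r.
- apply: eq_bigr => j _; congr f; lia.
- lia.
Qed.

Lemma eq_psum f g N : f =1 g -> psum f N = psum g N.
Proof. by move=> fg; apply: eq_bigr => j _. Qed.

Lemma psumD f g N : psum (fun n => f n + g n) N = psum f N + psum g N.
Proof. exact: big_split. Qed.

Lemma psumN f N : psum (fun n => - f n) N = - psum f N.
Proof. exact: sumrN. Qed.

Lemma psum_opp f N : psum (fun n => f (- n)) N = psum f N.
Proof.
elim: N => [|N IH]; first by rewrite !psum0 oppr0.
by rewrite !psumS IH opprK [LHS]addrC [_ + psum f N]addrC addrA.
Qed.

Lemma psum_shift1 f N :
  psum (fun n => f (n + 1)) N + f (- N%:Z) = psum f N + f N.+1%:Z.
Proof.
elim: N => [|N IH]; first by rewrite !psum0 add0r oppr0 addrC.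
rewrite !psumS.
have -> : (- N.+1%:Z + 1) = - N%:Z by lia.
have -> : (N.+1%:Z + 1) = N.+2%:Z by lia.
by rewrite [f (- N%:Z) + _]addrC IH addrC !addrA.
Qed.
End PartialSums.

Section RealSums.
Context {R : realType}.
Implicit Types f g : int -> R.

Lemma psum_le f g N : (forall n, f n <= g n) -> psum f N <= psum g N.
Proof. by move=> fg; apply: ler_sum => j _; exact: fg. Qed.

Lemma psum_nd f : (forall n, 0 <= f n) -> nondecreasing_seq (psum f).
Proof.
move=> f0; apply/nondecreasing_seqP => N.
by rewrite psumS addrAC lerDr addr_ge0.
Qed.

Definition rsummable f := exists B, forall N, psum (fun n => `|f n|) N <= B.
Definition rsum f : R := lim (psum f @ \oo).

(** [f] is the difference of [|f| + f] and [|f|], whose partial sums are nondecreasing and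
    bounded. *)
Lemma rsummable_cvg f : rsummable f -> psum f @ \oo --> rsum f.
Proof.
move=> [B HB].
have c1 : cvgn (psum (fun n => `|f n|)).
  apply: nondecreasing_is_cvgn; first by apply: psum_nd.
  by exists B => _ [N _ <-].
have c2 : cvgn (psum (fun n => `|f n| + f n)).
  apply: nondecreasing_is_cvgn.
    by apply: psum_nd => n; rewrite -lerBlDr sub0r -normrN ler_norm.
  exists (B + B) => _ [N _ <-]; rewrite psumD lerD //.
  by apply: le_trans (HB N); apply: psum_le => n; exact: ler_norm.
suff : cvgn (psum f) by [].
rewrite (_ : psum f = (fun N => psum (fun n => `|f n| + f n) N - psum (fun n => `|f n|) N)).
  exact: is_cvgB.
by apply/funext => N; rewrite psumD addrAC subrr add0r.
Qed.

Lemma rsummable_le f g : (forall n, `|f n| <= g n) -> rsummable g -> rsummable f.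
Proof.
move=> fg [B HB]; exists B => N; apply: le_trans (HB N); apply: psum_le => n.
exact: le_trans (fg n) (ler_norm _).
Qed.

Lemma psum_dist f g N M : (forall n, `|f n| <= g n) -> (N <= M)%N ->
  `|psum f M - psum f N| <= psum g M - psum g N.
Proof.
move=> fg; elim: M => [|M IH]; first by rewrite leqn0 => /eqP ->; rewrite !subrr normr0.
rewrite leq_eqVlt => /orP[/eqP ->|]; first by rewrite !subrr normr0.
rewrite ltnS => /IH {}IH; rewrite !psumS.
have -> : f (- M.+1%:Z) + psum f M + f M.+1%:Z - psum f N =
  (psum f M - psum f N) + (f (- M.+1%:Z) + f M.+1%:Z) by ring.
have -> : g (- M.+1%:Z) + psum g M + g M.+1%:Z - psum g N =
  (psum g M - psum g N) + (g (- M.+1%:Z) + g M.+1%:Z) by ring.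
apply: le_trans (ler_normD _ _) _; apply: lerD => //.
by apply: le_trans (ler_normD _ _) _; apply: lerD; exact: fg.
Qed.

Lemma rsum_tail f g N : (forall n, `|f n| <= g n) -> rsummable g ->
  `|rsum f - psum f N| <= rsum g - psum g N.
Proof.
move=> fg sg; have sf := rsummable_le fg sg.
have h1 : `|psum f M - psum f N| @[M --> \oo] --> `|rsum f - psum f N|.
  by apply: cvg_norm; apply: cvgB; [exact: rsummable_cvg|exact: cvg_cst].
have h2 : psum g M - psum g N @[M --> \oo] --> rsum g - psum g N.
  by apply: cvgB; [exact: rsummable_cvg|exact: cvg_cst].
apply: (ler_cvg_to h1 h2).
by near=> M; apply: psum_dist => //; near: M; exact: nbhs_infty_ge.
Unshelve. all: by end_near. Qed.

Lemma psum_cvg {T : Type} {F : set_system T} {FF : Filter F} (f_ : T -> int -> R) f N :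
  (forall n, f_ t n @[t --> F] --> f n) -> psum (f_ t) N @[t --> F] --> psum f N.
Proof.
move=> fc; elim: N => [|N IH].
  by rewrite psum0; under eq_fun do rewrite psum0; exact: fc.
rewrite psumS; under eq_fun do rewrite psumS.
by apply: cvgD; [apply: cvgD|].
Qed.

(** Tannery's theorem along an arbitrary filter: the limits to come run over ultrafilters and
    punctured neighbourhoods as well as over sequences. The bound on [f] is assumed separately since
    [F] may be improper. *)
Lemma rsum_dominated {T : Type} {F : set_system T} {FF : Filter F}
    (f_ : T -> int -> R) f g :
  (\forall t \near F, forall n, `|f_ t n| <= g n) -> (forall n, `|f n| <= g n) ->
  rsummable g -> (forall n, f_ t n @[t --> F] --> f n) ->
  rsum (f_ t) @[t --> F] --> rsum f.
Proof.
move=> fg f0g sg fc; apply/cvgrPdist_le => e e0.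
have e3 : 0 < e / 3 by lra.
have [N _ /(_ N) /(_ (leqnn _)) /= HN] :
    \forall N \near \oo, `|rsum g - psum g N| <= e / 3.
  by move/cvgrPdist_le: (rsummable_cvg sg); exact.
have /cvgrPdist_le /(_ _ e3) HF : psum (f_ t) N @[t --> F] --> psum f N.
  exact: psum_cvg.
near=> t.
have ft : forall n, `|f_ t n| <= g n by near: t.
have h1 := rsum_tail N f0g sg; have h2 := rsum_tail N ft sg.
have h3 : `|psum f N - psum (f_ t) N| <= e / 3 by near: t.
have := ler_norm (rsum g - psum g N).
have -> : rsum f - rsum (f_ t) = (rsum f - psum f N) + (psum f N - psum (f_ t) N) -
  (rsum (f_ t) - psum (f_ t) N) by ring.
move=> h4; apply: le_trans (ler_normB _ _) _.
have := ler_normD (rsum f - psum f N) (psum f N - psum (f_ t) N).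
lra.
Unshelve. all: by end_near. Qed.

End RealSums.

Local Open Scope complex_scope.
Local Notation cj := (@conjc _).
Local Notation nc := (@ComplexField.Normc.normc _).
Local Notation Re := (@complex.Re _).
Local Notation Im := (@complex.Im _).

(** * Moduli and coordinatewise limits of complex numbers *)

Section ComplexNorm.
Context {R : realType}.
Implicit Types z w : R[i].

Lemma nc_ge0 z : 0 <= nc z. Proof. by case: z => a b; exact: sqrtr_ge0. Qed.
Lemma sqr_nc z : nc z ^+ 2 = Re z ^+ 2 + Im z ^+ 2.
Proof. by case: z => a b /=; rewrite sqr_sqrtr // addr_ge0 // sqr_ge0. Qed.
Lemma ncM z w : nc (z * w) = nc z * nc w.
Proof. exact: ComplexField.Normc.normcM. Qed.
Lemma ncD z w : nc (z + w) <= nc z + nc w. Proof. exact: le_normcD. Qed.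
Lemma ncN z : nc (- z) = nc z. Proof. exact: normcN. Qed.
Lemma ncB z w : nc (z - w) <= nc z + nc w. Proof. by rewrite -(ncN w) ncD. Qed.
Lemma ncV z : nc z^-1 = (nc z)^-1. Proof. exact: ComplexField.Normc.normcV. Qed.
Lemma nc_conj z : nc (cj z) = nc z. Proof. by case: z => a b /=; rewrite sqrrN. Qed.
Lemma nc0 : nc (0 : R[i]) = 0. Proof. exact: ComplexField.Normc.normc0. Qed.
Lemma nc_eq0 z : (nc z == 0) = (z == 0).
Proof. by apply/eqP/eqP => [/ComplexField.Normc.eq0_normc|->] //; exact: nc0. Qed.
Lemma nc_gt0 z : (0 < nc z) = (z != 0).
Proof. by rewrite lt_def nc_eq0 nc_ge0 andbT. Qed.
Lemma ncR (x : R) : nc x%:C = `|x|.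
Proof. by rewrite /= expr0n addr0 sqrtr_sqr. Qed.
Lemma Re_le_nc z : `|Re z| <= nc z.
Proof.
by rewrite -(ler_pXn2r (ltn0Sn 1)) ?nnegrE ?nc_ge0 // sqr_nc real_normK ?num_real // lerDl sqr_ge0.
Qed.
Lemma Im_le_nc z : `|Im z| <= nc z.
Proof.
by rewrite -(ler_pXn2r (ltn0Sn 1)) ?nnegrE ?nc_ge0 // sqr_nc real_normK ?num_real // lerDr sqr_ge0.
Qed.
Lemma nc_le z : nc z <= `|Re z| + `|Im z|.
Proof.
rewrite -(ler_pXn2r (ltn0Sn 1)) ?nnegrE ?nc_ge0 ?addr_ge0 //.
rewrite sqr_nc sqrrD !real_normK ?num_real // -addrA lerD2l lerDr.
by rewrite mulrn_wge0 // mulr_ge0.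
Qed.
Lemma mul_conj z : z * (cj z) = (nc z ^+ 2)%:C.
Proof. by rewrite sqr_nc; case: z => a b /=; simpc; congr (_ +i* _); ring. Qed.
Lemma ReD z w : Re (z + w) = Re z + Re w. Proof. by case: z w => ? ? []. Qed.
Lemma ImD z w : Im (z + w) = Im z + Im w. Proof. by case: z w => ? ? []. Qed.
Lemma ReN z : Re (- z) = - Re z. Proof. by case: z. Qed.
Lemma ImN z : Im (- z) = - Im z. Proof. by case: z. Qed.
Lemma ReB z w : Re (z - w) = Re z - Re w. Proof. by rewrite ReD ReN. Qed.
Lemma ReM z w : Re (z * w) = Re z * Re w - Im z * Im w. Proof. by case: z w => ? ? []. Qed.
Lemma ImM z w : Im (z * w) = Re z * Im w + Im z * Re w. Proof. by case: z w => ? ? []. Qed.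
Lemma ReC (x : R) z : Re (x%:C * z) = x * Re z. Proof. by rewrite ReM /= mul0r subr0. Qed.
Lemma Re_conj z : Re (cj z) = Re z. Proof. by case: z. Qed.
Lemma Im_conj z : Im (cj z) = - Im z. Proof. by case: z. Qed.
Lemma complex_ext z w : Re z = Re w -> Im z = Im w -> z = w.
Proof. by case: z w => ? ? [] ? ? /= -> ->. Qed.
Lemma conjM z w : (cj (z * w)) = (cj z) * (cj w).
Proof. by case: z w => ? ? [? ?]; simpc; congr (_ +i* _); ring. Qed.
Lemma conjD z w : (cj (z + w)) = (cj z) + (cj w).
Proof. by case: z w => ? ? [? ?]; simpc; congr (_ +i* _); ring. Qed.
Lemma conjN z : (cj (- z)) = - (cj z). Proof. by case: z => ? ?; simpc. Qed.
Lemma conjB z w : (cj (z - w)) = (cj z) - (cj w). Proof. by case: z w => ? ? [? ?]; simpc; congr (_ +i* _); ring. Qed.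
Lemma conj1 : (cj (1 : R[i])) = 1. Proof. exact: (rmorph1 (@conjc R)). Qed.
Lemma conj0 : (cj (0 : R[i])) = 0. Proof. exact: (rmorph0 (@conjc R)). Qed.
Lemma conjR (x : R) : (cj x%:C) = x%:C. Proof. exact: conjc_real. Qed.
Lemma RCM (x y : R) : (x * y)%:C = x%:C * y%:C. Proof. exact: rmorphM. Qed.
Lemma RCD (x y : R) : (x + y)%:C = x%:C + y%:C. Proof. exact: rmorphD. Qed.
Lemma RCB (x y : R) : (x - y)%:C = x%:C - y%:C. Proof. exact: rmorphB. Qed.
Lemma RC_eq0 (x : R) : (x%:C == 0) = (x == 0). Proof. by rewrite eq_complex /= eqxx andbT. Qed.
End ComplexNorm.

Section ComplexLimits.
Context {R : realType} {T : Type} {F : set_system T} {FF : Filter F}.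
Implicit Types (f g : T -> R[i]) (l m : R[i]).

(** For [G] equal to [\oo] this unfolds to [cvgC]. *)
Definition ccvg_to (G : set_system T) f l :=
  (Re (f t) @[t --> G] --> Re l) /\ (Im (f t) @[t --> G] --> Im l).

Lemma ccvg_cst l : ccvg_to F (fun=> l) l.
Proof. by split; exact: cvg_cst. Qed.

Lemma ccvgD f g l m : ccvg_to F f l -> ccvg_to F g m ->
  ccvg_to F (fun t => f t + g t) (l + m).
Proof.
move=> [f1 f2] [g1 g2]; split.
  by rewrite ReD; under eq_fun do rewrite ReD; exact: cvgD.
by rewrite ImD; under eq_fun do rewrite ImD; exact: cvgD.
Qed.

Lemma ccvgN f l : ccvg_to F f l -> ccvg_to F (fun t => - f t) (- l).
Proof.
move=> [f1 f2]; split.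
  by rewrite ReN; under eq_fun do rewrite ReN; exact: cvgN.
by rewrite ImN; under eq_fun do rewrite ImN; exact: cvgN.
Qed.

Lemma ccvgM f g l m : ccvg_to F f l -> ccvg_to F g m ->
  ccvg_to F (fun t => f t * g t) (l * m).
Proof.
move=> [f1 f2] [g1 g2]; split.
  by rewrite ReM; under eq_fun do rewrite ReM; apply: cvgB; exact: cvgM.
by rewrite ImM; under eq_fun do rewrite ImM; apply: cvgD; exact: cvgM.
Qed.

Lemma ccvg_conj f l : ccvg_to F f l -> ccvg_to F (fun t => (cj (f t))) (cj l).
Proof.
move=> [f1 f2]; split.
  by rewrite Re_conj; under eq_fun do rewrite Re_conj.
by rewrite Im_conj; under eq_fun do rewrite Im_conj; exact: cvgN.
Qed.

Lemma ccvg_nc f l : ccvg_to F f l -> nc (f t) @[t --> F] --> nc l.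
Proof.
move=> [f1 f2].
have E z : nc z = Num.sqrt (Re z ^+ 2 + Im z ^+ 2) by case: z.
rewrite E; under eq_fun do rewrite E.
apply: continuous_cvg; first exact: sqrt_continuous.
by apply: cvgD; under eq_fun do rewrite expr2; rewrite expr2; exact: cvgM.
Qed.

Lemma ccvgR (f : T -> R) (l : R) : f t @[t --> F] --> l -> ccvg_to F (fun t => (f t)%:C) l%:C.
Proof. by move=> fl; split => //=; exact: cvg_cst. Qed.

End ComplexLimits.

Lemma ccvg_unique {R : realType} {T : Type} {F : set_system T} {FF : ProperFilter F}
  (f : T -> R[i]) l m : ccvg_to F f l -> ccvg_to F f m -> l = m.
Proof.
move=> [f1 f2] [g1 g2]; apply: complex_ext.
  exact: (cvg_unique _ f1 g1).
exact: (cvg_unique _ f2 g2).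
Qed.

Lemma filter_ler_cvg {R : realType} {T : Type} {F : set_system T} {FF : ProperFilter F}
    (f g : T -> R) (l m : R) :
  f t @[t --> F] --> l -> g t @[t --> F] --> m -> (\forall t \near F, f t <= g t) -> l <= m.
Proof.
move=> fl gm fg; rewrite -subr_ge0.
apply: (@closed_cvg _ _ F FF (fun t => g t - f t) (fun x => 0 <= x)).
- exact: closed_ge.
- by apply: filterS fg => t; rewrite subr_ge0.
- exact: cvgB.
Qed.

Section MoreRealSums.
Context {R : realType}.
Implicit Types f g : int -> R.

Lemma eq_rsum f g : f =1 g -> rsum f = rsum g.
Proof. by move=> /funext ->. Qed.

Lemma rsummable_ge0 f B : (forall n, 0 <= f n) -> (forall N, psum f N <= B) -> rsummable f.
Proof.
move=> f0 fB; exists B => N; apply: le_trans (fB N).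
by rewrite le_eqVlt; apply/orP; left; apply/eqP/eq_psum => n; rewrite ger0_norm.
Qed.

Lemma rsummableD f g : rsummable f -> rsummable g -> rsummable (fun n => f n + g n).
Proof.
move=> [A fA] [B gB]; exists (A + B) => N.
apply: (@le_trans _ _ (psum (fun n => `|f n| + `|g n|) N)).
  by apply: psum_le => n; exact: ler_normD.
by rewrite psumD lerD.
Qed.

Lemma psumZ (c : R) f N : psum (fun n => c * f n) N = c * psum f N.
Proof. by rewrite /psum mulr_sumr. Qed.

Lemma rsummableZ c f : rsummable f -> rsummable (fun n => c * f n).
Proof.
move=> [A fA]; exists (`|c| * A) => N.
under eq_psum do rewrite normrM.
by rewrite psumZ ler_wpM2l.
Qed.

Lemma rsummable_norm f : rsummable f -> rsummable (fun n => `|f n|).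
Proof. by move=> [A fA]; exists A => N; under eq_psum do rewrite normr_id. Qed.

Lemma rsum_unique f l : psum f @ \oo --> l -> rsum f = l.
Proof. by move=> fl; apply/cvg_lim. Qed.

Lemma rsumD f g : rsummable f -> rsummable g ->
  rsum (fun n => f n + g n) = rsum f + rsum g.
Proof.
move=> sf sg; apply: rsum_unique.
rewrite (_ : psum _ = fun N => psum f N + psum g N); last by apply/funext => N; rewrite psumD.
by apply: cvgD; exact: rsummable_cvg.
Qed.

Lemma rsumZ c f : rsummable f -> rsum (fun n => c * f n) = c * rsum f.
Proof.
move=> sf; apply: rsum_unique.
rewrite (_ : psum _ = fun N => c * psum f N); last by apply/funext => N; rewrite psumZ.
by apply: cvgM; [exact: cvg_cst|exact: rsummable_cvg].
Qed.

Lemma rsumN f : rsummable f -> rsum (fun n => - f n) = - rsum f.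
Proof.
move=> sf; apply: rsum_unique.
rewrite (_ : psum _ = fun N => - psum f N); last by apply/funext => N; rewrite psumN.
by apply: cvgN; exact: rsummable_cvg.
Qed.

Lemma rsum_opp f : rsum (fun n => f (- n)) = rsum f.
Proof.
by rewrite /rsum (_ : psum (fun n => f (- n)) = psum f) //; apply/funext => N; exact: psum_opp.
Qed.

Lemma rsummable_opp f : rsummable f -> rsummable (fun n => f (- n)).
Proof. by move=> [B fB]; exists B => N; rewrite (psum_opp (fun n => `|f n|)). Qed.

Lemma le_psum_rsum f N : (forall n, 0 <= f n) -> rsummable f -> psum f N <= rsum f.
Proof.
move=> f0 sf; have h := rsummable_cvg sf.
apply: (nondecreasing_cvgn_le (psum_nd f0)).
by apply/cvg_ex; exists (rsum f).
Qed.

Lemma rsum_le f g : (forall n, f n <= g n) -> rsummable f -> rsummable g -> rsum f <= rsum g.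
Proof.
move=> fg sf sg; apply: (ler_cvg_to (rsummable_cvg sf) (rsummable_cvg sg)).
by near=> N; exact: psum_le.
Unshelve. all: by end_near. Qed.

Lemma rsum_ge0 f : (forall n, 0 <= f n) -> rsummable f -> 0 <= rsum f.
Proof.
move=> f0 sf; apply: le_trans (le_psum_rsum 0 f0 sf).
by rewrite psum0.
Qed.

Lemma rsum_bound f B : rsummable f -> (forall N, psum f N <= B) -> rsum f <= B.
Proof.
move=> sf fB; apply: (ler_cvg_to (rsummable_cvg sf) (cvg_cst B)).
by near=> N.
Unshelve. all: by end_near. Qed.

Lemma psum_ge_term f n : (forall m, 0 <= f m) -> f n <= psum f `|n|%N.
Proof.
move=> f0; case: n => [[|N]|N].
- by rewrite psum0.
- rewrite absz_nat psumS lerDr addr_ge0 //.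
  by rewrite -[0](psum0 (fun=> 0)) psum0; apply: sumr_ge0.
- rewrite NegzE abszN absz_nat psumS -addrA lerDl addr_ge0 //.
  by apply: sumr_ge0.
Qed.

Lemma rsum_ge_term f n : (forall m, 0 <= f m) -> rsummable f -> f n <= rsum f.
Proof. move=> f0 sf; exact: le_trans (psum_ge_term n f0) (le_psum_rsum _ f0 sf). Qed.

Lemma rsum_gt0 f n : (forall m, 0 <= f m) -> rsummable f -> 0 < f n -> 0 < rsum f.
Proof. by move=> f0 sf fn; apply: lt_le_trans fn (rsum_ge_term n f0 sf). Qed.

Lemma rsummable_shift1 f : rsummable f -> rsummable (fun n => f (n + 1)).
Proof.
move=> [B fB]; exists B => N; apply: le_trans (fB N.+1).
have := psum_shift1 (fun n => `|f n|) N; rewrite psumS.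
have := normr_ge0 (f (- N%:Z)); have := normr_ge0 (f (- N.+1%:Z)); lra.
Qed.

Lemma rsummable_ends f : rsummable f ->
  (f N.+1%:Z @[N --> \oo] --> 0) /\ (f (- N%:Z) @[N --> \oo] --> 0).
Proof.
move=> sf; have /rsummable_cvg c := rsummable_norm sf.
have c0 : `|f (- N.+1%:Z)| + `|f N.+1%:Z| @[N --> \oo] --> 0.
  rewrite -[0](subrr (rsum (fun n => `|f n|))).
  rewrite (_ : (fun N : nat => _) =
    (fun N => psum (fun n => `|f n|) N.+1 - psum (fun n => `|f n|) N)).
    by apply: cvgB => //; rewrite (cvg_shiftS (psum (fun n => `|f n|))).
  by apply/funext => N; rewrite psumS; ring.
split; last rewrite -(cvg_shiftS (fun N : nat => f (- N%:Z))).
all: apply/norm_cvg0P; apply: (squeeze_cvgr _ (cvg_cst 0) c0).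
all: by near=> N; rewrite normr_ge0 /= ?lerDr ?lerDl.
Unshelve. all: by end_near. Qed.

Lemma rsum_shift1 f : rsummable f -> rsum (fun n => f (n + 1)) = rsum f.
Proof.
move=> sf; apply: rsum_unique; have [e1 e2] := rsummable_ends sf.
rewrite (_ : psum _ = fun N => psum f N + f N.+1%:Z - f (- N%:Z)); last first.
  by apply/funext => N; rewrite -psum_shift1 addrK.
rewrite (_ : rsum f = rsum f + 0 - 0); last by rewrite addr0 subr0.
by apply: cvgB => //; apply: cvgD => //; exact: rsummable_cvg.
Qed.

Lemma rsum_shift_nat (r : nat) f : rsummable f ->
  rsummable (fun n => f (n + r%:Z)) /\ rsum (fun n => f (n + r%:Z)) = rsum f.
Proof.
move=> sf; elim: r => [|r [IH1 IH2]].
  by under eq_fun do rewrite addr0.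
rewrite (_ : (fun n : int => f (n + r.+1%:Z)) = (fun n => (fun m => f (m + r%:Z)) (n + 1))).
  split; first exact: (@rsummable_shift1 (fun m => f (m + r%:Z))).
  by rewrite (@rsum_shift1 (fun m => f (m + r%:Z))).
by apply/funext => n; congr f; lia.
Qed.

Lemma rsum_shift (r : int) f : rsummable f ->
  rsummable (fun n => f (n + r)) /\ rsum (fun n => f (n + r)) = rsum f.
Proof.
move=> sf; case: (intP r) => [|{}r|{}r]; [exact: (rsum_shift_nat 0)|exact: rsum_shift_nat|].
have [h1 h2] := rsum_shift_nat r.+1 (rsummable_opp sf).
rewrite (_ : (fun n : int => f (n - r.+1%:Z)) = (fun n => (fun m => f (- (m + r.+1%:Z))) (- n))).
  by split; [exact: (rsummable_opp h1)|rewrite (rsum_opp (fun m => f (- (m + r.+1%:Z)))) h2 rsum_opp].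
by apply/funext => n; congr f; lia.
Qed.
End MoreRealSums.

(** * Absolutely convergent complex sums *)

Section ComplexSums.
Context {R : realType}.
Implicit Types f g : int -> R[i].

Definition csummable f := rsummable (fun n => nc (f n)).
Definition csum f : R[i] := rsum (fun n => Re (f n)) +i* rsum (fun n => Im (f n)).

Lemma eq_csum f g : f =1 g -> csum f = csum g.
Proof. by move=> /funext ->. Qed.

Lemma csummable_le f (g : int -> R) : (forall n, nc (f n) <= g n) -> rsummable g -> csummable f.
Proof. by move=> fg; apply: rsummable_le => n; rewrite ger0_norm ?nc_ge0. Qed.

Lemma csummable_Re f : csummable f -> rsummable (fun n => Re (f n)).
Proof. by apply: rsummable_le => n; exact: Re_le_nc. Qed.

Lemma csummable_Im f : csummable f -> rsummable (fun n => Im (f n)).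
Proof. by apply: rsummable_le => n; exact: Im_le_nc. Qed.

Lemma psum_Re f N : Re (psum f N) = psum (fun n => Re (f n)) N.
Proof.
by elim: N => [|N IH]; [rewrite !psum0|rewrite !psumS !ReD IH].
Qed.

Lemma psum_Im f N : Im (psum f N) = psum (fun n => Im (f n)) N.
Proof.
by elim: N => [|N IH]; [rewrite !psum0|rewrite !psumS !ImD IH].
Qed.

Lemma csummable_cvg f : csummable f -> ccvg_to \oo (psum f) (csum f).
Proof.
move=> sf; split.
  by under eq_fun do rewrite psum_Re; exact/rsummable_cvg/csummable_Re.
by under eq_fun do rewrite psum_Im; exact/rsummable_cvg/csummable_Im.
Qed.

Lemma csum_unique f l : ccvg_to \oo (psum f) l -> csum f = l.
Proof.
move=> [h1 h2]; apply: complex_ext => /=; apply: rsum_unique.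
  by move: h1; under eq_fun do rewrite psum_Re.
by move: h2; under eq_fun do rewrite psum_Im.
Qed.

Lemma csummable_ext f g : f =1 g -> csummable f -> csummable g.
Proof. by move=> /funext ->. Qed.

Lemma csummableD f g : csummable f -> csummable g -> csummable (fun n => f n + g n).
Proof. by move=> sf sg; apply: csummable_le (rsummableD sf sg) => n; exact: ncD. Qed.

Lemma csummableN f : csummable f -> csummable (fun n => - f n).
Proof. by move=> sf; apply: csummable_le sf => n; rewrite ncN. Qed.

Lemma csummableZ c f : csummable f -> csummable (fun n => c * f n).
Proof. by move=> sf; apply: csummable_le (rsummableZ (nc c) sf) => n; rewrite ncM. Qed.

Lemma csummable_conj f : csummable f -> csummable (fun n => (cj (f n))).
Proof. by move=> sf; apply: csummable_le sf => n; rewrite nc_conj. Qed.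

Lemma csummable0 : csummable (fun=> 0).
Proof.
by exists 0 => N; rewrite (eq_psum (g := fun=> 0)) ?/psum ?big1 // => n; rewrite nc0 normr0.
Qed.

Lemma csumD f g : csummable f -> csummable g ->
  csum (fun n => f n + g n) = csum f + csum g.
Proof.
move=> sf sg; apply: csum_unique.
rewrite (_ : psum _ = fun N => psum f N + psum g N); last by apply/funext => N; rewrite psumD.
by apply: ccvgD; exact: csummable_cvg.
Qed.

Lemma csumN f : csummable f -> csum (fun n => - f n) = - csum f.
Proof.
move=> sf; apply: csum_unique.
rewrite (_ : psum _ = fun N => - psum f N); last by apply/funext => N; rewrite psumN.
by apply: ccvgN; exact: csummable_cvg.
Qed.

Lemma csumB f g : csummable f -> csummable g ->
  csum (fun n => f n - g n) = csum f - csum g.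
Proof. by move=> sf sg; rewrite csumD ?csumN //; exact: csummableN. Qed.

Lemma csumZ c f : csummable f -> csum (fun n => c * f n) = c * csum f.
Proof.
move=> sf; apply: csum_unique.
rewrite (_ : psum _ = fun N => c * psum f N); last by apply/funext => N; rewrite /psum mulr_sumr.
by apply: ccvgM; [exact: ccvg_cst|exact: csummable_cvg].
Qed.

Lemma csumZr c f : csummable f -> csum (fun n => f n * c) = csum f * c.
Proof. by move=> sf; rewrite mulrC -csumZ //; apply: eq_csum => n; rewrite mulrC. Qed.

Lemma csum_conj f : csummable f -> csum (fun n => (cj (f n))) = (cj (csum f)).
Proof.
move=> sf; apply: complex_ext => /=; first by apply: eq_rsum => n; rewrite Re_conj.
by rewrite -rsumN; [apply: eq_rsum => n; rewrite Im_conj|exact: csummable_Im].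
Qed.

Lemma csum_opp f : csum (fun n => f (- n)) = csum f.
Proof.
by apply: complex_ext; rewrite /= ?(rsum_opp (fun n => Re (f n))) ?(rsum_opp (fun n => Im (f n))).
Qed.

Lemma csummable_shift r f : csummable f -> csummable (fun n => f (n + r)).
Proof. by move=> /(rsum_shift r) []. Qed.

Lemma csum_shift r f : csummable f -> csum (fun n => f (n + r)) = csum f.
Proof.
move=> sf; apply: complex_ext => /=.
  by have [_ ->] := rsum_shift r (csummable_Re sf).
by have [_ ->] := rsum_shift r (csummable_Im sf).
Qed.

Lemma nc_csum f (g : int -> R) : (forall n, nc (f n) <= g n) -> rsummable g ->
  nc (csum f) <= rsum g.
Proof.
move=> fg sg; have sf := csummable_le fg sg.
apply: (ler_cvg_to (ccvg_nc (csummable_cvg sf)) (rsummable_cvg sg)).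
near=> N; elim: (N) => [|M IH]; first by rewrite !psum0.
rewrite !psumS; apply: le_trans (ncD _ _) _; apply: lerD => //.
by apply: le_trans (ncD _ _) _; apply: lerD.
Unshelve. all: by end_near. Qed.

Lemma csum_dominated {T : Type} {F : set_system T} {FF : ProperFilter F}
    (f_ : T -> int -> R[i]) f (g : int -> R) :
  (\forall t \near F, forall n, nc (f_ t n) <= g n) -> rsummable g ->
  (forall n, ccvg_to F (fun t => f_ t n) (f n)) ->
  ccvg_to F (fun t => csum (f_ t)) (csum f).
Proof.
move=> fg sg fc.
have f0g n : nc (f n) <= g n.
  have h1 : nc (f_ t n) @[t --> F] --> nc (f n) by exact: ccvg_nc.
  have h2 : g n @[t --> F] --> g n by exact: cvg_cst.
  apply: (filter_ler_cvg h1 h2).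
  by apply: filterS fg => t.
split; apply: (@rsum_dominated _ _ _ _ _ _ g) => //.
- by apply: filterS fg => t h n; apply: le_trans (h n); exact: Re_le_nc.
- by move=> n; apply: le_trans (f0g n); exact: Re_le_nc.
- by move=> n; have [] := fc n.
- by apply: filterS fg => t h n; apply: le_trans (h n); exact: Im_le_nc.
- by move=> n; apply: le_trans (f0g n); exact: Im_le_nc.
- by move=> n; have [] := fc n.
Qed.

Lemma csum_psum (h : int -> int -> R[i]) N : (forall n, csummable (h n)) ->
  csummable (fun m => psum (fun n => h n m) N) /\
  psum (fun n => csum (h n)) N = csum (fun m => psum (fun n => h n m) N).
Proof.
move=> sh; elim: N => [|N [IH1 IH2]].
  by rewrite psum0; under eq_fun do rewrite psum0.
rewrite psumS IH2; under eq_fun do rewrite psumS.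
have s1 := sh (- N.+1%:Z); have s2 := sh N.+1%:Z.
by split; [apply: csummableD => //; exact: csummableD|rewrite !csumD //; exact: csummableD].
Qed.

(** Partial sums in [n] may be exchanged with the full sum in [m]; the majorant [f n * g m] bounds
    them by a fixed multiple of [g m], so the limit in [n] passes under the sum. *)
Lemma csum_exchange (h : int -> int -> R[i]) (f g : int -> R) :
  (forall n m, nc (h n m) <= f n * g m) -> rsummable f -> rsummable g ->
  csum (fun n => csum (h n)) = csum (fun m => csum (fun n => h n m)).
Proof.
move=> hfg sf sg.
have f0 n : 0 <= `|f n| by [].
have hfg' n m : nc (h n m) <= `|f n| * `|g m|.
  by apply: le_trans (hfg n m) _; rewrite -normrM ler_norm.
have {}sf := rsummable_norm sf; have {}sg := rsummable_norm sg.
have s1 n : csummable (h n).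
  exact: csummable_le (hfg' n) (rsummableZ _ sg).
have s2 m : csummable (fun n => h n m).
  by apply: csummable_le (rsummableZ `|g m| sf) => n; rewrite mulrC.
have L : ccvg_to \oo (fun N => csum (fun m => psum (fun n => h n m) N))
    (csum (fun m => csum (fun n => h n m))).
  apply: (@csum_dominated _ _ _ (fun N m => psum (fun n => h n m) N)
     _ (fun m => rsum (fun n => `|f n|) * `|g m|)).
  - near=> N => m; apply: (@le_trans _ _ (psum (fun n => `|f n|) N * `|g m|)).
      elim: (N) => [|M IH]; first by rewrite !psum0.
      rewrite !psumS !mulrDl; apply: le_trans (ncD _ _) _; apply: lerD => //.
      by apply: le_trans (ncD _ _) _; apply: lerD.
    by rewrite ler_wpM2r // le_psum_rsum.
  - exact: rsummableZ.
  - by move=> m; exact: csummable_cvg.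
have sh : csummable (fun n => csum (h n)).
  apply: (@csummable_le _ (fun n => rsum (fun m => `|g m|) * `|f n|)).
    by move=> n; rewrite mulrC -rsumZ //; apply: nc_csum => //; exact: rsummableZ.
  exact: rsummableZ.
have := csummable_cvg sh.
rewrite (_ : psum _ = fun N => csum (fun m => psum (fun n => h n m) N)).
  by move=> /ccvg_unique; exact.
by apply/funext => N; have [_ ->] := csum_psum N s1.
Unshelve. all: by end_near. Qed.

End ComplexSums.

(** * Hyperbolic functions *)

Section Hyperbolic.
Context {R : realType}.
Implicit Types x y : R.

Lemma pi_neq0 : (pi : R) != 0. Proof. exact: lt0r_neq0 (pi_gt0 R). Qed.

Definition coshR x : R := (expR x + expR (- x)) / 2.
Definition sinhR x : R := (expR x - expR (- x)) / 2.

Lemma coshR_norm_le x : expR `|x| / 2 <= coshR x.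
Proof.
rewrite /coshR ler_pM2r ?invr_gt0 //.
have := expR_ge0 x; have := expR_ge0 (- x).
by case: (leP 0 x) => h; rewrite ?(ger0_norm h) ?(ltr0_norm h); lra.
Qed.

Lemma coshR_gt0 x : 0 < coshR x.
Proof. by apply: lt_le_trans (coshR_norm_le x); rewrite divr_gt0 ?expR_gt0. Qed.

Lemma coshR_neq0 x : coshR x != 0. Proof. by rewrite gt_eqF ?coshR_gt0. Qed.

Lemma coshRN x : coshR (- x) = coshR x.
Proof. by rewrite /coshR opprK addrC. Qed.

Lemma sinhRN x : sinhR (- x) = - sinhR x.
Proof. by rewrite /sinhR opprK; lra. Qed.

Lemma coshR0 : coshR 0 = 1.
Proof. by rewrite /coshR oppr0 expR0; lra. Qed.

Lemma coshRD x y : coshR (x + y) = coshR x * coshR y + sinhR x * sinhR y.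
Proof. by rewrite /coshR /sinhR opprD !expRD; field. Qed.

Lemma coshR_sqr x : coshR x ^+ 2 = 1 + sinhR x ^+ 2.
Proof.
rewrite /coshR /sinhR; have := expRxMexpNx_1 x.
set u := expR x; set v := expR (- x) => uv.
have -> : ((u + v) / 2) ^+ 2 = u * v + ((u - v) / 2) ^+ 2 by field.
by rewrite uv.
Qed.

Lemma coshR_ge1 x : 1 <= coshR x.
Proof.
by have := coshR_sqr x; have := sqr_ge0 (sinhR x); have := coshR_gt0 x; nra.
Qed.

Lemma coshR_add x y : coshR x + coshR y = 2 * coshR ((x + y) / 2) * coshR ((x - y) / 2).
Proof.
have h u v : coshR (u + v) + coshR (u - v) = 2 * coshR u * coshR v.
  by rewrite !coshRD coshRN sinhRN; ring.
by rewrite -h; congr (coshR _ + coshR _); lra.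
Qed.

Lemma coshR_sub x y : coshR x - coshR y = 2 * sinhR ((x + y) / 2) * sinhR ((x - y) / 2).
Proof.
have h u v : coshR (u + v) - coshR (u - v) = 2 * sinhR u * sinhR v.
  by rewrite !coshRD coshRN sinhRN; ring.
by rewrite -h; congr (coshR _ - coshR _); lra.
Qed.

Lemma sinhR_gt0 x : (0 < sinhR x) = (0 < x).
Proof. by rewrite /sinhR pmulr_lgt0 ?invr_gt0 // subr_gt0 ltr_expR; lra. Qed.

Lemma sinhR_lt0 x : (sinhR x < 0) = (x < 0).
Proof. by rewrite -oppr_gt0 -sinhRN sinhR_gt0 oppr_gt0. Qed.

Lemma sinhR_eq0 x : (sinhR x == 0) = (x == 0).
Proof. by rewrite !eq_le !leNgt sinhR_gt0 sinhR_lt0. Qed.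

Lemma ltr_coshR x y : (coshR x < coshR y) = (`|x| < `|y|).
Proof.
have cn z : coshR z = coshR `|z|.
  by case: (leP 0 z) => h; rewrite ?(ger0_norm h) ?(ltr0_norm h) ?coshRN.
rewrite cn (cn y); move: (normr_ge0 x) (normr_ge0 y); move: `|x| `|y| => {x y} x y x0 y0.
rewrite -subr_lt0 coshR_sub -mulrA pmulr_rlt0 //.
have [->|xn0] := eqVneq x 0.
  have [->|yn0] := eqVneq y 0; first by rewrite addr0 mul0r subrr mul0r /sinhR oppr0 subrr !mul0r !ltxx.
  rewrite pmulr_rlt0 ?sinhR_gt0 ?sinhR_lt0; lra.
rewrite pmulr_rlt0 ?sinhR_gt0 ?sinhR_lt0; lra.
Qed.

(* With the factor [pi / 2] this is the Fourier transform of [sech / pi]. *)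
Definition sechf x : R := (coshR (pi * x / 2))^-1.

Lemma sechfN x : sechf (- x) = sechf x.
Proof. by rewrite /sechf mulrN mulNr coshRN. Qed.

Lemma sechf_gt0 x : 0 < sechf x. Proof. by rewrite invr_gt0 coshR_gt0. Qed.

Lemma sechf0 : sechf 0 = 1.
Proof. by rewrite /sechf mulr0 mul0r coshR0 invr1. Qed.

Lemma sechf_le x : sechf x <= 2 * expR (- (pi / 2 * `|x|)).
Proof.
have h : pi / 2 * `|x| = `|pi * x / 2|.
  by rewrite !normrM (ger0_norm (pi_ge0 _)) (ger0_norm (_ : 0 <= 2^-1)) //; ring.
rewrite /sechf expRN h -[2]invrK -invfM lef_pV2 ?posrE ?coshR_gt0 ?mulr_gt0 ?invr_gt0 ?expR_gt0 //.
by rewrite mulrC coshR_norm_le.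
Qed.
End Hyperbolic.

Section Geometric.
Context {R : realType}.

(** The common majorant of the whole development: eigenvectors and [1 / c_n] are of order
    [geo (pi * om)], the weights in [X] and [Y] of order [1 / geo (pi * om / 2)]. *)
Definition geo (c : R) (n : int) : R := expR (- (c * `|n%:~R|)).

Lemma geo_gt0 c n : 0 < geo c n. Proof. exact: expR_gt0. Qed.
Lemma geo_ge0 c n : 0 <= geo c n. Proof. exact: expR_ge0. Qed.

Lemma geoD c d n : geo (c + d) n = geo c n * geo d n.
Proof. by rewrite /geo -expRD; congr expR; ring. Qed.

Lemma geo_summable c : 0 < c -> rsummable (geo c).
Proof.
move=> c0; set r := expR (- c).
have r1 : r < 1 by rewrite /r expR_lt1 oppr_lt0.
have r0 : 0 < r by exact: expR_gt0.
apply: (@rsummable_ge0 _ _ ((1 + r) / (1 - r))); first exact: geo_ge0.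
move=> N; rewrite ler_pdivlMr ?subr_gt0 //.
have g m : geo c m%:Z = r ^+ m.
  by rewrite /geo /r -expRM_natr; congr expR; rewrite normr_nat; ring.
have gN m : geo c (- m%:Z) = r ^+ m by rewrite -g /geo mulrNz normrN.
have -> : psum (geo c) N * (1 - r) = 1 + r - 2 * r ^+ N.+1; last first.
  by rewrite gerBl mulr_ge0 // exprn_ge0 // ltW.
elim: N => [|N IH]; first by rewrite psum0 (g 0%N) expr0 expr1; ring.
by rewrite psumS g gN !mulrDl IH !exprS; ring.
Qed.
End Geometric.

(** * The Toeplitz eigenvalue equation *)

Section Core.
Context {R : realType}.
Implicit Types (q w u v : int -> R[i]) (om k lam : R).

Definition freq om k (n : int) : R := om * n%:~R + k.
(** The reciprocal of [|Gamma (1/2 - i a_n)|^2], see [nc_Gm]. *)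
Definition cwt om k n : R := coshR (pi * freq om k n) / pi.
Definition toep q w (n : int) : R[i] := csum (fun m => q (n - m) * w m).
(* [w] is summable for every square-summable [x] because [Gamma (1/2 - i a_n)] decays
   exponentially, so that [toep] is an absolutely convergent series. *)
Definition eigw om k q lam w :=
  csummable w /\ forall n, (lam * cwt om k n)%:C * w n = toep q w n.
(** Only differences of indices enter, so the sections with indices [0, ..., M - 1] test every
    finite section of the Toeplitz matrix. *)
Definition psdq q := (forall l, q (- l) = (cj (q l))) /\
  forall (M : nat) (z : nat -> R[i]),
    0 <= Re (\sum_(0 <= i < M) \sum_(0 <= j < M) z i * (cj (z j)) * q (i%:Z - j%:Z)).

(** The rate is twice the growth rate of [exp (pi |a_n| / 2)], so that a full factor
    [geo (pi * om / 2)] is left after weighting. *)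
Definition decays om w := exists C, forall n, nc (w n) <= C * geo (pi * om) n.

Lemma cwt_gt0 om k n : 0 < cwt om k n.
Proof. by rewrite divr_gt0 ?coshR_gt0 ?pi_gt0. Qed.

Lemma geo_half om n : geo (pi * om) n = geo (pi * om / 2) n * geo (pi * om / 2) n.
Proof. by rewrite -geoD; congr (geo _ n); lra. Qed.

Lemma freq_abs om k n : 0 < om -> om * `|n%:~R| - `|k| <= `|freq om k n|.
Proof.
move=> om0; rewrite /freq lerBlDr -{1}(ger0_norm (ltW om0)) -normrM.
by have := ler_normB (om * n%:~R + k) k; rewrite addrK.
Qed.

Lemma freq_abs_le om k n : 0 < om -> `|freq om k n| <= om * `|n%:~R| + `|k|.
Proof.
move=> om0; rewrite /freq; apply: le_trans (ler_normD _ _) _.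
by rewrite normrM (ger0_norm (ltW om0)).
Qed.

Lemma cwtV_le om k n : 0 < om ->
  (cwt om k n)^-1 <= 2 * pi * expR (pi * `|k|) * geo (pi * om) n.
Proof.
move=> om0; rewrite /cwt invf_div ler_pdivrMr ?coshR_gt0 //.
have p0 := pi_gt0 R.
have -> : 2 * pi * expR (pi * `|k|) * geo (pi * om) n * coshR (pi * freq om k n) =
  pi * (expR (pi * `|k|) * geo (pi * om) n * (2 * coshR (pi * freq om k n))) by ring.
rewrite ler_peMr ?(ltW p0) // /geo -expRD.
apply: (@le_trans _ _ (expR (pi * `|k| - pi * om * `|n%:~R|) * expR `|pi * freq om k n|)).
  rewrite -expRD -[leLHS]expR0 ler_expR normrM (ger0_norm (ltW p0)).
  have := ler_wpM2l (ltW p0) (freq_abs k n om0). lra.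
rewrite ler_wpM2l ?expR_ge0 //.
by have := coshR_norm_le (pi * freq om k n); lra.
Qed.

Lemma expR_freq_le om k (c : R) n : 0 < om -> `|c| = pi / 2 ->
  expR (c * freq om k n) <= expR (pi * `|k| / 2) * (geo (pi * om / 2) n)^-1.
Proof.
move=> om0 hc; rewrite /geo -expRN opprK -expRD ler_expR.
apply: le_trans (ler_norm _) _; rewrite normrM hc.
have p0 : 0 <= pi / 2 :> R by have := pi_ge0 R; lra.
have := ler_wpM2l p0 (freq_abs_le k n om0); lra.
Qed.

(** Positivity is tested on a vector with two nonzero entries at distance [|l|], whose relative
    phase makes both cross terms equal to [- nc (q l)]; this leaves [2 q_0 - 2 |q_l| >= 0]. *)
Lemma psdq_bound q l : psdq q -> nc (q l) <= Re (q 0).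
Proof.
move=> [qh qp].
have q0im : Im (q 0) = 0.
  by have := qh 0; rewrite oppr0; case: (q 0) => a b [] /=; lra.
have q00 : 0 <= Re (q 0).
  have := qp 1%N (fun=> 1); rewrite !big_nat1 subrr.
  by cbv beta; rewrite conj1 !mul1r.
have [->|ql0] := eqVneq (q l) 0; first by rewrite nc0.
have [->|l0] := eqVneq l 0.
  by apply: le_trans (nc_le _) _; rewrite q0im normr0 addr0 ger0_norm.
wlog : l ql0 l0 / exists n : nat, l = n.+1%:Z.
  move=> H; case: l ql0 l0 => [[|n]|n] // ql0 _; first by apply: H => //; exists n.
  rewrite NegzE qh nc_conj; apply: H => //; last by exists n.
  by move: ql0; rewrite NegzE qh conjc_eq0.
move=> [n ln]; rewrite {}ln in ql0 l0 *.
set a := q n.+1%:Z in ql0 *.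
have na0 : nc a != 0 by rewrite nc_eq0.
have naC : (nc a)%:C != 0 :> R[i] by rewrite eq_complex /= eqxx andbT.
pose th : R[i] := - (a / (nc a)%:C); have thE : th = - (a / (nc a)%:C) by [].
clearbody th.
have := qp n.+2 (fun i => if i == 0%N then th else if i == n.+1 then 1 else 0).
have S (f : nat -> nat -> R[i]) : \sum_(0 <= i < n.+2) \sum_(0 <= j < n.+2)
   (if i == 0%N then th else if i == n.+1 then 1 else 0) *
   (cj (if j == 0%N then th else if j == n.+1 then 1 else 0)) * f i j =
   th * (cj th) * f 0%N 0%N + th * f 0%N n.+1 + ((cj th) * f n.+1 0%N + f n.+1 n.+1).
  have E (y c d : R[i]) (g : nat -> R[i]) : \sum_(0 <= j < n.+2)
     (if j == 0%N then c else if j == n.+1 then d else 0) * g j = c * g 0%N + d * g n.+1.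
    rewrite big_nat_recl // big_nat_recr //= eqxx big1_seq ?add0r //.
    move=> i /andP[_]; rewrite mem_index_iota => /andP[_ hi].
    by rewrite eqSS ltn_eqF // mul0r.
  transitivity (\sum_(0 <= i < n.+2)
     (if i == 0%N then th else if i == n.+1 then 1 else 0) * ((cj th) * f i 0%N + (cj 1) * f i n.+1)).
    apply: eq_bigr => i _; rewrite -(E 0) mulr_sumr; apply: eq_bigr => j _.
    rewrite -mulrA; congr (_ * (_ * _)); case: ifP => // _; case: ifP => // _.
    exact: conj0.
  by rewrite (E 0) conj1; ring.
rewrite S !subrr subr0 sub0r qh -/a.
have -> : th * (cj th) = 1.
  rewrite mul_conj thE ncN ncM ncV ncR ger0_norm ?nc_ge0 //.
  by rewrite divff // expr1n.
have H : th * (cj a) = - (nc a)%:C.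
  rewrite thE mulNr mulrAC mul_conj; congr (- _).
  by rewrite expr2 rmorphM /= -mulrA divff ?mulr1.
have -> : (cj th) * a = - (nc a)%:C.
  by have := congr1 (@conjc R) H; rewrite conjM conjcK conjN conjR.
rewrite H mul1r !ReD !ReN /=; lra.
Qed.
End Core.

(** * Double sums with a product majorant *)

Section DoubleSums.
Context {R : realType}.
Implicit Types h : int -> int -> R[i].

(** The shape of majorant that [csum_exchange] asks for; it is stable under transposition. *)
Definition prodbound h := exists f g : int -> R,
  [/\ rsummable f, rsummable g & forall n m, nc (h n m) <= f n * g m].
Definition csum2 h := csum (fun n => csum (h n)).

Lemma prodbound_row h n : prodbound h -> csummable (h n).
Proof. by move=> [f [g [sf sg hfg]]]; apply: csummable_le (hfg n) _; exact: rsummableZ. Qed.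

Lemma prodbound_csum h : prodbound h -> csummable (fun n => csum (h n)).
Proof.
move=> [f [g [sf sg hfg]]].
apply: (@csummable_le _ _ (fun n => rsum g * f n)); last exact: rsummableZ.
by move=> n; rewrite mulrC -rsumZ //; apply: nc_csum => //; exact: rsummableZ.
Qed.

Lemma prodbound_le h h' : (forall n m, nc (h' n m) <= nc (h n m)) -> prodbound h -> prodbound h'.
Proof.
move=> hh [f [g [sf sg hfg]]]; exists f, g; split => // n m.
exact: le_trans (hh n m) (hfg n m).
Qed.

Lemma prodbound_tr h : prodbound h -> prodbound (fun n m => h m n).
Proof. by move=> [f [g [sf sg hfg]]]; exists g, f; split => // n m; rewrite mulrC. Qed.

Lemma prodboundZ (c : R[i]) h : prodbound h -> prodbound (fun n m => c * h n m).
Proof.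
move=> [f [g [sf sg hfg]]]; exists (fun n => nc c * f n), g; split => //.
  exact: rsummableZ.
by move=> n m; rewrite ncM -mulrA ler_wpM2l ?nc_ge0.
Qed.

Lemma csum2_swap h : prodbound h -> csum2 h = csum2 (fun n m => h m n).
Proof. by move=> [f [g [sf sg hfg]]]; apply: (csum_exchange hfg). Qed.

Lemma csum2D h h' : prodbound h -> prodbound h' ->
  csum2 (fun n m => h n m + h' n m) = csum2 h + csum2 h'.
Proof.
move=> ph ph'; rewrite /csum2 -csumD; try exact: prodbound_csum.
by apply: eq_csum => n; rewrite csumD //; exact: prodbound_row.
Qed.

Lemma csum2Z (c : R[i]) h : prodbound h -> csum2 (fun n m => c * h n m) = c * csum2 h.
Proof.
move=> ph; rewrite /csum2 -csumZ; last exact: prodbound_csum.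
by apply: eq_csum => n; rewrite csumZ //; exact: prodbound_row.
Qed.

Lemma csum2N h : prodbound h -> csum2 (fun n m => - h n m) = - csum2 h.
Proof.
move=> ph; rewrite /csum2 -csumN; last exact: prodbound_csum.
by apply: eq_csum => n; rewrite csumN //; exact: prodbound_row.
Qed.

Lemma csum2_conj h : prodbound h -> csum2 (fun n m => cj (h n m)) = cj (csum2 h).
Proof.
move=> ph; rewrite /csum2 -csum_conj; last exact: prodbound_csum.
by apply: eq_csum => n; rewrite csum_conj //; exact: prodbound_row.
Qed.

Lemma csum_mul (f g : int -> R[i]) : csummable f -> csummable g ->
  csum f * csum g = csum2 (fun n m => f n * g m).
Proof.
move=> sf sg; rewrite mulrC -csumZ // /csum2; apply: eq_csum => n.
by rewrite csumZ // mulrC.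
Qed.

Lemma prodbound_mul (f g : int -> R[i]) : csummable f -> csummable g ->
  prodbound (fun n m => f n * g m).
Proof. by move=> sf sg; exists (fun n => nc (f n)), (fun n => nc (g n)); split => // n m; rewrite ncM. Qed.

Lemma eq_csum2 h h' : (forall n m, h n m = h' n m) -> csum2 h = csum2 h'.
Proof. by move=> hh; apply: eq_csum => n; apply: eq_csum => m. Qed.
End DoubleSums.

(** * Quadratic identities for eigenvectors *)

Section EigenIdentities.
Context {R : realType}.
Variables (om k : R) (om0 : 0 < om).
Implicit Types (q w u v : int -> R[i]) (lam : R).
Let b := pi * om / 2.
Let a := freq om k.
Let c := cwt om k.
Let g := geo b.

Lemma pihalf_om_gt0 : 0 < pi * om / 2.
Proof. by rewrite divr_gt0 // mulr_gt0 // pi_gt0. Qed.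

Lemma toep_bound q w n : psdq q -> csummable w ->
  nc (toep q w n) <= Re (q 0) * rsum (fun m => nc (w m)).
Proof.
move=> qp sw; rewrite -rsumZ //; apply: nc_csum; last exact: rsummableZ.
by move=> m; rewrite ncM ler_wpM2r ?nc_ge0 // psdq_bound.
Qed.

Lemma toep_summable q w n : psdq q -> csummable w -> csummable (fun m => q (n - m) * w m).
Proof.
move=> qp sw; apply: (@csummable_le _ _ (fun m => Re (q 0) * nc (w m))).
  by move=> m; rewrite ncM ler_wpM2r ?nc_ge0 // psdq_bound.
exact: rsummableZ.
Qed.

Lemma eigw_bound q lam w n : psdq q -> 0 < lam -> eigw om k q lam w ->
  c n * nc (w n) <= Re (q 0) / lam * rsum (fun m => nc (w m)).
Proof.
move=> qp lam0 [sw we]; rewrite [leRHS]mulrAC ler_pdivlMr //.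
apply: le_trans (toep_bound n qp sw); rewrite -we ncM ncR.
have lc : 0 <= lam * c n by rewrite mulr_ge0 // ltW // cwt_gt0.
by rewrite (ger0_norm lc) mulrC mulrA.
Qed.

Lemma bounded_decays w B : (forall n, c n * nc (w n) <= B) ->
  forall n, nc (w n) <= B * (2 * pi * expR (pi * `|k|)) * geo (pi * om) n.
Proof.
move=> wB n.
have B0 : 0 <= B by apply: le_trans (wB n); rewrite mulr_ge0 ?nc_ge0 ?(ltW (cwt_gt0 _ _ _)).
have c0 := cwt_gt0 om k n.
rewrite -mulrA; apply: le_trans (ler_wpM2l B0 (cwtV_le k n om0)).
by rewrite ler_pdivlMr // mulrC.
Qed.

(** A bootstrap: [w] is summable, hence [toep q w] is bounded, hence [w n] is of order [1 / c_n] by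
    the eigenvalue equation. *)
Lemma eigw_decays q lam w : psdq q -> 0 < lam -> eigw om k q lam w -> decays om w.
Proof.
move=> qp lam0 ew; eexists; apply: bounded_decays => n.
exact: eigw_bound qp lam0 ew.
Qed.

Lemma decays_half w : decays om w -> exists C, forall n, nc (w n) <= C * (g n * g n).
Proof. by move=> [C wC]; exists C => n; rewrite -geo_half. Qed.

Lemma decays_summable w : decays om w -> csummable w.
Proof.
move=> [C wC]; apply: csummable_le wC _; apply: rsummableZ; apply: geo_summable.
by rewrite mulr_gt0 // pi_gt0.
Qed.

Lemma decays_conj w : decays om w -> decays om (fun n => cj (w n)).
Proof. by move=> [C wC]; exists C => n; rewrite nc_conj. Qed.

Definition cbounded u := exists B, forall n, nc (u n) <= B.
(** The asymmetry is deliberate. The growth in [m] is absorbed by half of the decay of the second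
    vector, and a factor [g] remains in each variable. *)
Definition kbounded (K : int -> int -> R) :=
  exists C, forall n m, `|K n m| <= C * g n * (g m)^-1.

Lemma kernel_prodbound K u v : kbounded K -> cbounded u -> decays om v ->
  prodbound (fun n m => u n * v m * (K n m)%:C).
Proof.
move=> [C KC] [B uB] /decays_half [D vD].
have gs : rsummable g := geo_summable pihalf_om_gt0.
exists (fun n => B * C * g n), (fun m => D * g m); split.
- exact: rsummableZ.
- exact: rsummableZ.
move=> n m; rewrite !ncM ncR.
have gm : 0 < g m := geo_gt0 _ _.
apply: (@le_trans _ _ (B * (D * (g m * g m)) * (C * g n * (g m)^-1))).
  by rewrite ler_pM ?mulr_ge0 ?nc_ge0 // ler_pM ?nc_ge0.
rewrite le_eqVlt; apply/orP; left; apply/eqP; field; exact: lt0r_neq0.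
Qed.

Definition sform (K : int -> int -> R) u v := csum2 (fun n m => u n * v m * (K n m)%:C).

(** For a symmetric kernel the weight [c n + c m] splits into two sums carrying one weight each.
    This brings in the product [c w], which the eigenvalue equation turns into [toep q w / lam]. *)
Lemma sform_symm K u v : kbounded K -> (forall n m, K n m = K m n) ->
  decays om u -> decays om v ->
  cbounded (fun n => (c n)%:C * u n) -> cbounded (fun n => (c n)%:C * v n) ->
  csum2 (fun n m => u n * v m * (pi * (c n + c m) * K n m)%:C) =
  pi%:C * (sform K (fun n => (c n)%:C * u n) v + sform K (fun n => (c n)%:C * v n) u).
Proof.
move=> bK sK du dv bu bv.
have p1 := kernel_prodbound bK bu dv; have p2 := kernel_prodbound bK bv du.
transitivity (csum2 (fun n m => pi%:C * ((c n)%:C * u n * v m * (K n m)%:C) +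
    pi%:C * ((c m)%:C * v m * u n * (K m n)%:C))).
  apply: eq_csum2 => n m; rewrite (sK m n); move: (K n m) (c n) (c m) => x y z.
  by rewrite !RCM RCD; ring.
have p2' := prodbound_tr p2.
rewrite csum2D; [|exact: prodboundZ|exact: prodboundZ].
by rewrite !csum2Z // mulrDr /sform [in RHS](csum2_swap p2).
Qed.

Definition Ksum (n m : int) : R := sechf (a n + a m).
Definition Kdif (n m : int) : R := sechf (a n - a m).

Lemma Kdif_bounded : kbounded Kdif.
Proof.
exists 2 => n m; rewrite ger0_norm ?(ltW (sechf_gt0 _)) //.
apply: le_trans (sechf_le _) _; rewrite -[leRHS]mulrA ler_pM2l // /g /geo -expRN opprK -expRD ler_expR.
have -> : a n - a m = om * (n%:~R - m%:~R) by rewrite /a /freq; ring.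
rewrite normrM (gtr0_norm om0) /b.
have := lerB_dist (n%:~R : R) m%:~R; have := pihalf_om_gt0; nra.
Qed.

Lemma Ksum_bounded : kbounded Ksum.
Proof.
exists (2 * expR (pi * `|k|)) => n m; rewrite ger0_norm ?(ltW (sechf_gt0 _)) //.
apply: le_trans (sechf_le _) _; rewrite -[leRHS]mulrA -[leRHS]mulrA ler_pM2l // /g /geo -expRN opprK -!expRD ler_expR.
have -> : a n + a m = (om * n%:~R + 2 * k) + om * m%:~R by rewrite /a /freq; ring.
have h1 := lerB_normD (om * n%:~R + 2 * k) (om * m%:~R).
have h2 := lerB_normD (om * n%:~R) (2 * k).
rewrite !normrM !(gtr0_norm om0) (gtr0_norm (ltr0Sn _ 1)) in h1 h2.
have p0 : 0 <= pi / 2 :> R by have := pi_ge0 R; lra.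
have h3 := ler_wpM2l p0 h1; have h4 := ler_wpM2l p0 h2; rewrite /b; lra.
Qed.

Definition Xval w := csum (fun n => w n * (expR (- (pi / 2) * a n))%:C).
Definition Yval w := csum (fun n => w n * (expR (pi / 2 * a n))%:C).

Lemma decays_expR w (s : R) : `|s| = pi / 2 -> decays om w ->
  exists C, forall n, nc (w n * (expR (s * a n))%:C) <= C * g n.
Proof.
move=> hs /decays_half [C wC]; exists (C * expR (pi * `|k| / 2)) => n.
rewrite ncM ncR ger0_norm ?expR_ge0 //.
apply: (@le_trans _ _ (C * (g n * g n) * (expR (pi * `|k| / 2) * (g n)^-1))).
  by rewrite ler_pM ?nc_ge0 ?expR_ge0 //; exact: expR_freq_le.
rewrite le_eqVlt; apply/orP; left; apply/eqP; field; exact: lt0r_neq0 (geo_gt0 _ _).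
Qed.

Lemma expR_summable w (s : R) : `|s| = pi / 2 -> decays om w ->
  csummable (fun n => w n * (expR (s * a n))%:C).
Proof.
move=> hs /(decays_expR hs) [C wC]; apply: csummable_le wC _; apply: rsummableZ.
exact: geo_summable pihalf_om_gt0.
Qed.

Lemma norm_pihalf : `|pi / 2| = pi / 2 :> R.
Proof. by rewrite ger0_norm // divr_ge0 ?pi_ge0. Qed.

Lemma norm_Npihalf : `|- (pi / 2)| = pi / 2 :> R.
Proof. by rewrite normrN norm_pihalf. Qed.

Lemma coshR_pihalf (x : R) : (expR (- (pi / 2) * x) + expR (pi / 2 * x)) = 2 * coshR (pi * x / 2).
Proof.
rewrite /coshR mulrCA divff // mulr1 addrC.
by congr (expR _ + expR _); lra.
Qed.

Lemma cosh_freq_add n m : 2 * coshR (pi * (a n + a m) / 2) = pi * (c n + c m) * Kdif n m.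
Proof.
rewrite /Kdif /sechf /c /cwt -/(a n) -/(a m) -mulrDl coshR_add.
have -> : (pi * a n + pi * a m) / 2 = pi * (a n + a m) / 2 by ring.
have -> : (pi * a n - pi * a m) / 2 = pi * (a n - a m) / 2 by ring.
move: (coshR_neq0 (pi * (a n - a m) / 2)) (lt0r_neq0 (pi_gt0 R)).
move: (coshR (pi * (a n - a m) / 2)) (coshR (pi * (a n + a m) / 2)) (pi : R) => x y z x0 z0.
by field; rewrite ?x0 ?z0.
Qed.

Lemma cosh_freq_sub n m : 2 * coshR (pi * (a n - a m) / 2) = pi * (c n + c m) * Ksum n m.
Proof.
rewrite /Ksum /sechf /c /cwt -/(a n) -/(a m) -mulrDl coshR_add.
have -> : (pi * a n + pi * a m) / 2 = pi * (a n + a m) / 2 by ring.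
have -> : (pi * a n - pi * a m) / 2 = pi * (a n - a m) / 2 by ring.
move: (coshR_neq0 (pi * (a n + a m) / 2)) (lt0r_neq0 (pi_gt0 R)).
move: (coshR (pi * (a n + a m) / 2)) (coshR (pi * (a n - a m) / 2)) (pi : R) => x y z x0 z0.
by field; rewrite ?x0 ?z0.
Qed.

Section W.
Variable w : int -> R[i].
Hypotheses (dw : decays om w) (bw : cbounded (fun n => (c n)%:C * w n)).

Let dcw := decays_conj dw.
Let X := Xval w.
Let Y := Yval w.

(* [2 cosh (pi (a_n + a_m) / 2)] and [2 cosh (pi (a_n - a_m) / 2)] divide
   [cosh (pi a_n) + cosh (pi a_m)]: this brings the weights [c] back in. *)
Lemma XX_YY : nc X ^+ 2 + nc Y ^+ 2 =
  2 * pi * Re (sform Kdif (fun n => (c n)%:C * w n) (fun n => cj (w n))).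
Proof.
have sX := expR_summable norm_Npihalf dw; have sY := expR_summable norm_pihalf dw.
have sX' := csummable_conj sX; have sY' := csummable_conj sY.
have bcw : cbounded (fun n => (c n)%:C * cj (w n)).
  by have [B wB] := bw; exists B => n; move: (wB n); rewrite !ncM nc_conj.
have E : (nc X ^+ 2 + nc Y ^+ 2)%:C = pi%:C *
    (sform Kdif (fun n => (c n)%:C * w n) (fun n => cj (w n)) +
     cj (sform Kdif (fun n => (c n)%:C * w n) (fun n => cj (w n)))).
  have -> : cj (sform Kdif (fun n => (c n)%:C * w n) (fun n => cj (w n))) =
      sform Kdif (fun n => (c n)%:C * cj (w n)) w.
    rewrite /sform -csum2_conj; last exact: kernel_prodbound Kdif_bounded bw dcw.
    by apply: eq_csum2 => n m; rewrite !conjM !conjR conjcK.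
  rewrite -sform_symm //; [|exact: Kdif_bounded|by move=> n m; rewrite /Kdif -sechfN opprB].
  rewrite RCD -!mul_conj /X /Y /Xval /Yval -!csum_conj // !csum_mul // -csum2D; try exact: prodbound_mul.
  apply: eq_csum2 => n m.
  rewrite -cosh_freq_add -coshR_pihalf.
  have e s : expR (s * (a n + a m)) = expR (s * a n) * expR (s * a m).
    by rewrite -expRD -mulrDr.
  rewrite !e !conjM !conjR.
  move: (expR (- (pi / 2) * a n)) (expR (- (pi / 2) * a m)) => x1 x2.
  move: (expR (pi / 2 * a n)) (expR (pi / 2 * a m)) => y1 y2.
  by rewrite RCD !RCM; ring.
have := congr1 Re E; rewrite ReC ReD Re_conj /= => ->; ring.
Qed.

Lemma XY_YX : X * Y = pi%:C * sform Ksum (fun n => (c n)%:C * w n) w.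
Proof.
have sX := expR_summable norm_Npihalf dw; have sY := expR_summable norm_pihalf dw.
have E : X * Y + Y * X = pi%:C *
    (sform Ksum (fun n => (c n)%:C * w n) w + sform Ksum (fun n => (c n)%:C * w n) w).
  rewrite -sform_symm //; [|exact: Ksum_bounded|by move=> n m; rewrite /Ksum addrC].
  rewrite /X /Y /Xval /Yval !csum_mul // -csum2D; try exact: prodbound_mul.
  apply: eq_csum2 => n m.
  rewrite -cosh_freq_sub -coshR_pihalf.
  have e s : expR (s * (a n - a m)) = expR (s * a n) * expR (- s * a m).
    by rewrite -expRD; congr expR; ring.
  rewrite !e opprK.
  move: (expR (- (pi / 2) * a n)) (expR (- (pi / 2) * a m)) => x1 x2.
  move: (expR (pi / 2 * a n)) (expR (pi / 2 * a m)) => y1 y2.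
  by rewrite RCD !RCM; ring.
have two : (2 : R[i]) != 0 by rewrite pnatr_eq0.
apply: (mulfI two); rewrite !mulr_natl !mulr2n [X in _ + X]mulrC E mulrDr; ring.
Qed.
End W.
End EigenIdentities.

(** * The flux identity *)

Section Wronskian.
Context {R : realType}.
Variables (om k : R) (om0 : 0 < om).
Implicit Types (q w u v : int -> R[i]) (lam : R).
Let b := pi * om / 2.
Let a := freq om k.
Let c := cwt om k.

Definition flux w : R := rsum (fun n => sinhR (pi * freq om k n) * nc (w n) ^+ 2).

Lemma csum_single (f : int -> R[i]) : (forall n, n != 0 -> f n = 0) -> csum f = f 0.
Proof.
move=> f0; apply: csum_unique.
rewrite (_ : psum f = fun=> f 0); first exact: ccvg_cst.
apply/funext; elim => [|N IH]; first by rewrite psum0.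
by rewrite psumS IH (f0 (- N.+1%:Z)) ?oppr_eq0 // (f0 N.+1%:Z) // addr0 add0r.
Qed.

Lemma csum_reflect (f : int -> R[i]) n : csummable f -> csum (fun N => f (n - N)) = csum f.
Proof.
move=> sf; rewrite -(csum_shift n sf) -[RHS]csum_opp.
by apply: eq_csum => N; congr f; lia.
Qed.

(** From [|N| <= |n| + |n - N|]: decay in the two indices is traded for decay in one index and in
    their difference, which permits summation along diagonals. *)
Lemma geo_reflect (d : R) (n N : int) : 0 <= d ->
  geo d n * geo d (n - N) <= geo (d / 2) n * geo (d / 2) N.
Proof.
move=> d0; rewrite /geo -!expRD ler_expR.
have := ler_normB (n%:~R : R) (n - N)%:~R; rewrite -rmorphB /= opprB addrC subrK => h.
have := normr_ge0 ((n - N)%:~R : R); nra.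
Qed.

(** A Hermitian Toeplitz matrix is self-adjoint and commutes with shifts; here it is moved across
    the pairing of [w] with its translate by [N]. *)
Lemma toep_pairing q w N : psdq q -> csummable w ->
  csum (fun n => toep q w n * cj (w (n - N))) =
  csum (fun n => w n * cj (toep q w (n - N))).
Proof.
move=> qp sw.
have pb1 : prodbound (fun n j => q (n + N - j) * w j * cj (w n)).
  exists (fun n => Re (q 0) * nc (w n)), (fun j => nc (w j)); split => //; first exact: rsummableZ.
  move=> n j; rewrite !ncM nc_conj mulrAC ler_wpM2r ?nc_ge0 // ler_wpM2r ?nc_ge0 // psdq_bound //.
transitivity (csum2 (fun n j => q (n + N - j) * w j * cj (w n))).
  have s1 : csummable (fun n => toep q w n * cj (w (n - N))).
    apply: (@csummable_le _ _ (fun n => Re (q 0) * rsum (fun m => nc (w m)) * nc (w (n - N)))).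
      by move=> n; rewrite ncM nc_conj ler_wpM2r ?nc_ge0 // toep_bound.
    exact/rsummableZ/(csummable_shift (- N) sw).
  rewrite -(csum_shift N s1); apply: eq_csum => n; rewrite addrK /toep -csumZr //.
  exact: toep_summable.
rewrite (csum2_swap pb1); apply: eq_csum => n.
rewrite /toep -csum_conj; last exact: toep_summable.
rewrite -csumZ; last by apply: csummable_conj; exact: toep_summable.
apply: eq_csum => j; rewrite conjM -(proj1 qp) mulrCA mulrA.
by congr (q _ * _ * _); lia.
Qed.

Lemma wronskian_alg (l s x y : R) (z u : R[i]) : s != 0 ->
  (l * s / pi)%:C * (z * u * ((- pi * (x - y)) / s)%:C) =
  z * ((l * y)%:C * u) - (l * x)%:C * z * u.
Proof.
move=> s0; transitivity (z * u * ((l * s / pi) * ((- pi * (x - y)) / s))%:C).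
  by rewrite (RCM (l * s / pi)) mulrCA.
have -> : l * s / pi * (- pi * (x - y) / s) = l * (y - x).
  by move: (pi : R) (@pi_neq0 R) => p p0; field; rewrite ?s0 ?p0.
by rewrite !RCM RCB; ring.
Qed.

(** The left side is the double sum with kernel [-2 sinh (pi (a_n + a_m) / 2)]. On the diagonal
    [n - m = N] with [N <> 0] this kernel is [c_n - c_(n-N)] times the constant
    [- pi / sinh (pi om N / 2)], and the sum of [(c_n - c_(n-N)) w_n conj w_(n-N)] vanishes by
    [toep_pairing] and the eigenvalue equation. Only [N = 0] contributes. *)
Lemma wronskian q lam w : psdq q -> 0 < lam -> eigw om k q lam w ->
  nc (Xval om k w) ^+ 2 - nc (Yval om k w) ^+ 2 = - 2 * flux w.
Proof.
move=> qp lam0 ew; have dw := eigw_decays om0 qp lam0 ew.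
have [sw we] := ew.
have sX := expR_summable k om0 norm_Npihalf dw; have sY := expR_summable k om0 norm_pihalf dw.
have sX' := csummable_conj sX; have sY' := csummable_conj sY.
have XY : (nc (Xval om k w) ^+ 2 - nc (Yval om k w) ^+ 2)%:C =
    Xval om k w * cj (Xval om k w) - Yval om k w * cj (Yval om k w).
  by rewrite RCB !mul_conj.
pose S n m := - 2 * sinhR (pi * (a n + a m) / 2).
have SS n m : S n m = - 2 * sinhR (pi * (a n + a m) / 2) by [].
have SE n m : S n m = expR (- (pi / 2) * a n) * expR (- (pi / 2) * a m) -
                      expR (pi / 2 * a n) * expR (pi / 2 * a m).
  rewrite SS /sinhR -!expRD -!mulrDr.
  have -> : - (pi / 2) * (a n + a m) = - (pi * (a n + a m) / 2) by lra.
  have -> : pi / 2 * (a n + a m) = pi * (a n + a m) / 2 by lra.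
  by field.
clearbody S.
pose h n m := w n * cj (w m) * (S n m)%:C.
have hE : (nc (Xval om k w) ^+ 2 - nc (Yval om k w) ^+ 2)%:C = csum2 h.
  rewrite XY /Xval /Yval.
  rewrite -(csum_conj sX) -(csum_conj sY) (csum_mul sX sX') (csum_mul sY sY').
  rewrite -(csum2N (prodbound_mul sY sY')) -csum2D; [|exact: prodbound_mul|].
    apply: eq_csum2 => n m; rewrite /h SE !conjM !conjR -/a.
    move: (expR (- (pi / 2) * a n)) (expR (- (pi / 2) * a m)) => x1 x2.
    move: (expR (pi / 2 * a n)) (expR (pi / 2 * a m)) => y1 y2.
    by rewrite RCB !RCM; ring.
  by apply: prodbound_le (prodbound_mul sY sY') => n m; rewrite ncN.
have [C1 hC1] := decays_expR k om0 norm_Npihalf dw.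
have [C2 hC2] := decays_expR k om0 norm_pihalf dw.
have b0 := pihalf_om_gt0 om0; have b20 : 0 < b / 2 by rewrite divr_gt0.
have hb n m : nc (h n m) <= (C1 * C1 + C2 * C2) * (geo b n * geo b m).
  have -> : h n m = w n * (expR (- (pi / 2) * a n))%:C * cj (w m * (expR (- (pi / 2) * a m))%:C)
     - w n * (expR (pi / 2 * a n))%:C * cj (w m * (expR (pi / 2 * a m))%:C).
    rewrite /h SE !conjM !conjR.
    move: (expR (- (pi / 2) * a n)) (expR (- (pi / 2) * a m)) => x1 x2.
    move: (expR (pi / 2 * a n)) (expR (pi / 2 * a m)) => y1 y2.
    by rewrite RCB !RCM; ring.
  apply: le_trans (ncB _ _) _; rewrite [leRHS]mulrDl; apply: lerD; rewrite ncM nc_conj mulrACA.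
    by apply: ler_pM; rewrite ?nc_ge0 //; exact: hC1.
  by apply: ler_pM; rewrite ?nc_ge0 //; exact: hC2.
have CC : 0 <= C1 * C1 + C2 * C2 by rewrite -!expr2 addr_ge0 // sqr_ge0.
have ph : prodbound h.
  exists (fun n => (C1 * C1 + C2 * C2) * geo b n), (geo b); split; [|exact: geo_summable|].
    exact/rsummableZ/geo_summable.
  by move=> n m; rewrite -mulrA; exact: hb.
have ph' : prodbound (fun n N => h n (n - N)).
  exists (fun n => (C1 * C1 + C2 * C2) * geo (b / 2) n), (geo (b / 2)); split.
  - exact/rsummableZ/geo_summable.
  - exact: geo_summable.
  move=> n N; apply: le_trans (hb _ _) _; rewrite -mulrA ler_wpM2l //.
  by apply: geo_reflect; exact: ltW.
(* Summation by diagonals: [m] is replaced by [n - N]. *)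
have E : csum2 h = csum2 (fun N n => h n (n - N)).
  rewrite -(csum2_swap ph'); apply: eq_csum => n; rewrite csum_reflect //.
  exact: prodbound_row ph.
have sub0 : csum2 (fun N n => h n (n - N)) = csum (fun n => h n (n - 0)).
  apply: (@csum_single (fun N => csum (fun n => h n (n - N)))) => N N0.
  pose sN : R := sinhR (pi * (om * N%:~R) / 2).
  have sNE : sN = sinhR (pi * (om * N%:~R) / 2) by [].
  have sN0 : sN != 0.
    rewrite sinhR_eq0; apply: mulf_neq0; last by rewrite invr_eq0 pnatr_eq0.
    apply: mulf_neq0; first exact: pi_neq0.
    by apply: mulf_neq0; [rewrite lt0r_neq0|rewrite intr_eq0].
  clearbody sN.
  have lN : (lam * sN / pi)%:C != 0 :> R[i].
    rewrite RC_eq0; apply: mulf_neq0; first by apply: mulf_neq0 => //; exact: lt0r_neq0.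
    by rewrite invr_eq0 lt0r_neq0 // pi_gt0.
  apply: (mulfI lN); rewrite mulr0 -csumZ; last exact: prodbound_row (prodbound_tr ph').
  have s1 : csummable (fun n => toep q w n * cj (w (n - N))).
    apply: (@csummable_le _ _ (fun n => Re (q 0) * rsum (fun m => nc (w m)) * nc (w (n - N)))).
      by move=> n; rewrite ncM nc_conj ler_wpM2r ?nc_ge0 // toep_bound.
    exact/rsummableZ/(csummable_shift (- N) sw).
  have s2 : csummable (fun n => w n * cj (toep q w (n - N))).
    apply: (@csummable_le _ _ (fun n => Re (q 0) * rsum (fun m => nc (w m)) * nc (w n))).
      by move=> n; rewrite ncM nc_conj mulrC ler_wpM2r ?nc_ge0 // toep_bound.
    exact: rsummableZ.
  transitivity (csum (fun n => w n * cj (toep q w (n - N)) - toep q w n * cj (w (n - N)))).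
    apply: eq_csum => n; rewrite -!we conjM conjR /h.
    have -> : S n (n - N) = (- pi * (c n - c (n - N))) / sN.
      apply: (mulIf sN0); rewrite divfK // SS /c /cwt.
      have -> : pi * (freq om k n) = pi * a n by [].
      have -> : pi * (freq om k (n - N)) = pi * a (n - N) by [].
      rewrite -mulrBl coshR_sub sNE.
      have -> : (pi * a n + pi * a (n - N)) / 2 = pi * (a n + a (n - N)) / 2 by lra.
      have -> : (pi * a n - pi * a (n - N)) / 2 = pi * (om * N%:~R) / 2.
        by rewrite /a /freq rmorphB /=; lra.
      move: (sinhR (pi * (a n + a (n - N)) / 2)) (sinhR (pi * (om * N%:~R) / 2)) => x y.
      by move: (pi : R) (@pi_neq0 R) => z z0; field.
    exact: wronskian_alg.
  by rewrite csumB // toep_pairing // subrr.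
have := congr1 Re (etrans hE (etrans E sub0)); rewrite /= => ->.
rewrite /flux -rsumZ.
  apply: eq_rsum => n; rewrite subr0 /h mul_conj -RCM /= SS.
  have -> : pi * (a n + a n) / 2 = pi * a n by lra.
  by rewrite -/a; ring.
apply: (@rsummable_le _ _ (fun n => (C1 * C1 + C2 * C2) / 2 * geo (b + b) n)).
  move=> n; have := hb n n; rewrite /h !ncM nc_conj ncR SS.
  have -> : pi * (a n + a n) / 2 = pi * a n by lra.
  rewrite (normrM (- 2)) normrN (ger0_norm (_ : 0 <= 2)) // geoD -/a.
  rewrite (normrM (sinhR (pi * a n))) (ger0_norm (sqr_ge0 (nc (w n)))) expr2; lra.
by apply/rsummableZ/geo_summable; rewrite addr_gt0.
Qed.

End Wronskian.

(** * Positivity of sech-weighted forms *)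

Section Fejer.
Context {R : realType}.
Implicit Types (f phi : int -> R[i]).

(** On both sides [f l] receives the Fejer weight [M - |l|]. *)
Lemma sum_square f M : \sum_(0 <= i < M) \sum_(0 <= j < M) f (i%:Z - j%:Z) =
  \sum_(0 <= i < M) psum f i.
Proof.
elim: M => [|M IH]; first by rewrite !big_nil.
rewrite big_nat_recr // [RHS]big_nat_recr //= -IH.
under eq_bigr do rewrite big_nat_recr //=.
rewrite big_split /= -addrA; congr (_ + _).
rewrite /psum [in RHS](big_cat_nat (n := M)) /=; [|by []|by lia].
congr (_ + _); rewrite -[X in _ = \sum_(X <= _ < _) _]add0n big_addn.
have -> : ((M.*2).+1 - M)%N = M.+1 by lia.
rewrite [LHS]big_nat_rev; apply: eq_big_nat => i /andP[_ hi] /=; congr f.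
by move: hi; rewrite add0n; lia.
Qed.

(** Divided by [M], the sums over squares are Cesaro means of the partial sums of [phi], and these
    converge to the full sum. *)
Lemma fejer_ge0 phi : csummable phi ->
  (forall M, 0 <= Re (\sum_(0 <= i < M) \sum_(0 <= j < M) phi (i%:Z - j%:Z))) ->
  0 <= Re (csum phi).
Proof.
move=> sp H; have [h _] := csummable_cvg sp.
have h2 := cesaro h.
have h0 : (fun=> 0 : R) @ \oo --> (0 : R) by exact: cvg_cst.
apply: (filter_ler_cvg h0 h2); near=> n.
rewrite /arithmetic_mean mulr_ge0 //.
have := H n.+1; rewrite sum_square.
rewrite (_ : Re _ = series (fun t => Re (psum phi t)) n.+1) //.
by rewrite /series /=; elim: (n.+1) => [|m IH]; rewrite ?big_nil // !big_nat_recr //= ReD IH.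
Unshelve. all: by end_near. Qed.

Definition trunc (L : nat) f (n : int) : R[i] := if (`|n| <= L)%N then f n else 0.

Lemma psum_trunc L f N : (L <= N)%N -> psum (trunc L f) N = psum f L.
Proof.
have e M : (M <= L)%N -> psum (trunc L f) M = psum f M.
  move=> ML; apply: eq_big_nat => j /andP[_ hj]; rewrite /trunc ifT //; lia.
elim: N => [|N IH]; first by rewrite leqn0 => /eqP L0; rewrite e // L0.
rewrite leq_eqVlt => /orP[/eqP <-|]; first exact: e.
rewrite ltnS => LN; rewrite psumS IH // /trunc !ifF ?addr0 ?add0r //; lia.
Qed.

Lemma csum_trunc L f : csum (trunc L f) = psum f L.
Proof.
apply: csum_unique; split; apply: cvg_near_cst; near=> N; rewrite psum_trunc //;
  near: N; exact: nbhs_infty_ge.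
Unshelve. all: by end_near. Qed.

Lemma trunc_le L f n : nc (trunc L f n) <= nc (f n).
Proof. by rewrite /trunc; case: ifP => // _; rewrite nc0 nc_ge0. Qed.

Lemma trunc_cvg f n : ccvg_to \oo (fun L => trunc L f n) (f n).
Proof.
split; apply: cvg_near_cst; near=> L; rewrite /trunc ifT //; near: L; exact: nbhs_infty_ge.
Unshelve. all: by end_near. Qed.

End Fejer.

(** * From finite Toeplitz sections to infinite forms *)

Section Forms.
Context {R : realType}.
Variables (om : R) (om0 : 0 < om) (q : int -> R[i]) (qp : psdq q).
Variables (k1 k2 : int -> R[i]) (K : R).
Let b := pi * om / 2.
Hypothesis k1K : forall n m, nc (k1 (n - m)) <= K * geo b n * (geo b m)^-1.
Hypothesis k2K : forall n m, nc (k2 (n + m)) <= K * geo b n * (geo b m)^-1.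

Definition form w := csum2 (fun n m => toep q w n * (cj (w m) * k1 (n - m) + w m * k2 (n + m))).

(** The coefficient of [q l] in [form (trunc L w)], obtained by the substitution [n = l + j] in the
    sum that defines [toep]. *)
Definition finform w (L : nat) (l : int) : R[i] :=
  psum (fun m => psum (fun j => w j * (cj (w m) * k1 (l + j - m) + w m * k2 (l + j + m))) L) L.

Variable w : int -> R[i].
Hypothesis dw : decays om w.
Let q0 := Re (q 0).

Let K0 : 0 <= K.
Proof.
have := k1K 0 0; rewrite -mulrA divff ?lt0r_neq0 ?geo_gt0 // mulr1.
exact: le_trans (nc_ge0 _).
Qed.

Let q00 : 0 <= q0. Proof. exact: le_trans (nc_ge0 _) (psdq_bound 0 qp). Qed.

Let sw : csummable w. Proof. exact (decays_summable om0 dw). Qed.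

Let sumq n : csummable (fun m => q (n - m) * w m).
Proof. exact: toep_summable. Qed.

Lemma trunc_summable L : csummable (trunc L w).
Proof. by apply: csummable_le sw => n; exact: trunc_le. Qed.

Lemma toep_trunc_bound L n : nc (toep q (trunc L w) n) <= q0 * rsum (fun m => nc (w m)).
Proof.
apply: le_trans (toep_bound n qp (trunc_summable L)) _; rewrite ler_wpM2l //.
apply: rsum_le => //; last exact: trunc_summable.
by move=> m; exact: trunc_le.
Qed.

Lemma toep_trunc_cvg n : ccvg_to \oo (fun L => toep q (trunc L w) n) (toep q w n).
Proof.
apply: (@csum_dominated _ _ _ _ _ _ (fun m => q0 * nc (w m))).
- near=> L => m; rewrite ncM ler_pM ?nc_ge0 ?psdq_bound //; exact: trunc_le.
- exact: rsummableZ.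
- by move=> m; apply: ccvgM; [exact: ccvg_cst|exact: trunc_cvg].
Unshelve. all: by end_near. Qed.

Let kb n m (v : int -> R[i]) : nc (v m) <= nc (w m) ->
  nc (cj (v m) * k1 (n - m) + v m * k2 (n + m)) <=
  nc (w m) * (2 * K * geo b n * (geo b m)^-1).
Proof.
move=> vw; apply: le_trans (ncD _ _) _; rewrite !ncM nc_conj.
have -> : nc (w m) * (2 * K * geo b n * (geo b m)^-1) =
  nc (w m) * (K * geo b n * (geo b m)^-1) + nc (w m) * (K * geo b n * (geo b m)^-1) by ring.
by apply: lerD; rewrite ler_pM ?nc_ge0.
Qed.

Let wgeo : exists2 C, 0 <= C & forall n m,
  nc (w m) * (2 * K * geo b n * (geo b m)^-1) <= C * geo b n * geo b m.
Proof.
have [C wC] := decays_half dw.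
have C0 : 0 <= C.
  by rewrite -(pmulr_lge0 _ (mulr_gt0 (geo_gt0 b 0) (geo_gt0 b 0))); apply: le_trans (wC 0); exact: nc_ge0.
exists (2 * K * C) => [|n m]; first by rewrite !mulr_ge0.
have gm := geo_gt0 b m.
have h : 0 <= 2 * K * geo b n * (geo b m)^-1.
  by rewrite !mulr_ge0 ?geo_ge0 ?invr_ge0 // geo_ge0.
apply: le_trans (ler_wpM2r h (wC m)) _.
by rewrite le_eqVlt; apply/orP; left; apply/eqP; field; rewrite lt0r_neq0.
Qed.

Lemma form_trunc_cvg : ccvg_to \oo (fun L => form (trunc L w)) (form w).
Proof.
have [C C0 wC] := wgeo.
have sg : rsummable (geo b) by exact: geo_summable (pihalf_om_gt0 om0).
pose B := q0 * rsum (fun m => nc (w m)).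
have B0 : 0 <= B by rewrite mulr_ge0 // rsum_ge0 // => n; exact: nc_ge0.
have bd L n m : nc (toep q (trunc L w) n *
   (cj (trunc L w m) * k1 (n - m) + trunc L w m * k2 (n + m))) <= B * C * geo b n * geo b m.
  rewrite ncM; apply: le_trans (ler_pM _ _ (toep_trunc_bound L n) (le_trans (kb _ _) (wC n m))) _;
    rewrite ?nc_ge0 //; first exact: trunc_le.
  by rewrite /B !mulrA.
apply: (@csum_dominated _ _ _ _ _ _ (fun n => rsum (geo b) * (B * C) * geo b n)).
- near=> L => n; rewrite -mulrA mulrC -rsumZ //; apply: nc_csum; last exact: rsummableZ.
  exact: bd.
- exact: rsummableZ.
move=> n; apply: (@csum_dominated _ _ _ _ _ _ (fun m => B * C * geo b n * geo b m)).
- by near=> L => m; exact: bd.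
- exact: rsummableZ.
move=> m; apply: ccvgM; first exact: toep_trunc_cvg.
apply: ccvgD; apply: ccvgM; try exact: ccvg_cst; last exact: trunc_cvg.
exact/ccvg_conj/trunc_cvg.
Unshelve. all: by end_near. Qed.

Let k1s j m : csummable (fun l => k1 (l + j - m)).
Proof.
have sg : rsummable (geo b) by exact: geo_summable (pihalf_om_gt0 om0).
have h : csummable (fun l => k1 (l - m)).
  apply: (@csummable_le _ _ (fun l => K * (geo b m)^-1 * geo b l)); last exact: rsummableZ.
  by move=> l; rewrite mulrAC.
exact: (csummable_shift j h).
Qed.

Let k2s j m : csummable (fun l => k2 (l + j + m)).
Proof.
have sg : rsummable (geo b) by exact: geo_summable (pihalf_om_gt0 om0).
have h : csummable (fun l => k2 (l + m)).
  apply: (@csummable_le _ _ (fun l => K * (geo b m)^-1 * geo b l)); last exact: rsummableZ.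
  by move=> l; rewrite mulrAC.
exact: (csummable_shift j h).
Qed.

Let Ls j m : csummable (fun l => w j * (cj (w m) * k1 (l + j - m) + w m * k2 (l + j + m))).
Proof. by apply/csummableZ/csummableD; exact: csummableZ. Qed.

Let qLs j m : csummable (fun l => q l * (w j * (cj (w m) * k1 (l + j - m) + w m * k2 (l + j + m)))).
Proof.
apply: csummable_le (rsummableZ q0 (Ls j m)) => l.
by rewrite ncM ler_wpM2r ?nc_ge0 // psdq_bound.
Qed.

Lemma form_truncE L : csummable (fun l => q l * finform w L l) /\
  form (trunc L w) = csum (fun l => q l * finform w L l).
Proof.
pose G m j l := q l * (w j * (cj (w m) * k1 (l + j - m) + w m * k2 (l + j + m))).
have sG m j : csummable (G m j) by exact: qLs.
have sH m : csummable (fun l => psum (fun j => G m j l) L).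
  by have [] := csum_psum L (sG m).
have E l : q l * finform w L l = psum (fun m => psum (fun j => G m j l) L) L.
  rewrite /finform /psum mulr_sumr; apply: eq_bigr => m _.
  by rewrite mulr_sumr.
have [s1 s2] := csum_psum L sH.
split; first by apply: csummable_ext s1 => l; rewrite E.
transitivity (csum (fun l => psum (fun m => psum (fun j => G m j l) L) L)); last first.
  by apply: eq_csum => l; rewrite E.
rewrite -s2.
pose H m n := toep q (trunc L w) n * (cj (w m) * k1 (n - m) + w m * k2 (n + m)).
have HE m : csummable (H m) /\ csum (H m) = csum (fun l => psum (fun j => G m j l) L).
  have [_ <-] := csum_psum L (sG m).
  have sG' j : csummable (fun n => G m j (n - j)) by exact: (csummable_shift (- j) (sG m j)).
  have [t1 t2] := csum_psum L sG'.
  have HG n : H m n = psum (fun j => G m j (n - j)) L.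
    rewrite /H /toep; have -> : (fun j => q (n - j) * trunc L w j) = trunc L (fun j => q (n - j) * w j).
      by apply/funext => j; rewrite /trunc; case: ifP => //; rewrite mulr0.
    rewrite csum_trunc /psum mulr_suml; apply: eq_bigr => j _.
    by rewrite /G subrK mulrA.
  split; first by apply: csummable_ext t1 => n; rewrite HG.
  rewrite (eq_csum HG) -t2; apply: eq_psum => j.
  exact: (csum_shift (- j) (sG m j)).
have [u1 u2] := csum_psum L (fun m => proj1 (HE m)).
transitivity (psum (fun m => csum (H m)) L); last by apply: eq_psum => m; case: (HE m).
rewrite u2; apply: eq_csum => n.
rewrite -csum_trunc; apply: eq_csum => m; rewrite /H /trunc.
by case: ifP => // _; rewrite conj0 !mul0r addr0 mulr0.
Qed.

(** Two limits are involved: [L] truncates the vector, and for fixed [L] the sum over [l] is reached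
    by Cesaro means in [M]. *)
Lemma form_ge0 :
  (forall M L, 0 <= Re (\sum_(0 <= i < M) \sum_(0 <= j < M)
                      q (i%:Z - j%:Z) * finform w L (i%:Z - j%:Z))) ->
  0 <= Re (form w).
Proof.
move=> H; have [h _] := form_trunc_cvg.
have h0 : (fun=> 0 : R) @ \oo --> (0 : R) by exact: cvg_cst.
apply: (filter_ler_cvg h0 h); near=> L.
have [s ->] := form_truncE L.
by apply: fejer_ge0 => // M; exact: H.
Unshelve. all: by end_near. Qed.
End Forms.

(** * Unit complex numbers and roots of unity *)

Section Cis.
Context {R : realType}.
Implicit Types x y : R.

Definition cis x : R[i] := cos x +i* sin x.

Lemma cisD x y : cis (x + y) = cis x * cis y.
Proof. by rewrite /cis cosD sinD; apply: complex_ext; rewrite ?ReM ?ImM //=; ring. Qed.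
Lemma cis0 : cis 0 = 1. Proof. by rewrite /cis cos0 sin0. Qed.
Lemma nc_cis x : nc (cis x) = 1. Proof. by rewrite /= cos2Dsin2 sqrtr1. Qed.
Lemma cj_cis x : cj (cis x) = cis (- x). Proof. by rewrite /cis cosN sinN. Qed.
Lemma cis_natr n x : cis (n%:R * x) = cis x ^+ n.
Proof.
elim: n => [|n IH]; first by rewrite mul0r cis0.
by rewrite exprS -IH -cisD -[n.+1]add1n natrD mulrDl mul1r.
Qed.
Lemma cis_2pi : cis (2 * pi) = 1.
Proof. by rewrite /cis mulr_natl cos2pi sin2pi. Qed.
Lemma cis_int (n : int) : cis (n%:~R * (2 * pi)) = 1.
Proof.
case: n => [n|n]; first by rewrite cis_natr cis_2pi expr1n.
by rewrite NegzE mulrNz mulNr -cj_cis cis_natr cis_2pi expr1n conj1.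
Qed.
Lemma one_add_cis x : 1 + cis (2 * x) = (2 * cos x)%:C * cis x.
Proof.
rewrite /cis mulr_natl cos_mulr2n sin_mulr2n; apply: complex_ext.
  by rewrite ReC /=; ring.
by rewrite ImM /=; ring.
Qed.

Lemma cis_neq1 x : 0 < x < 2 * pi -> cis x != 1.
Proof.
move=> /andP[x0 x1]; apply/eqP => /(congr1 Re) /=.
have -> : x = (x / 2) *+ 2 by rewrite -mulr_natl mulrC divfK.
rewrite cos_mulr2n cos2sin2.
have := @sin_gt0_pi R (x / 2); rewrite (_ : 0 < x / 2 < pi); last by apply/andP; split; lra.
by move=> /(_ isT) h1 h2; have := exprn_gt0 2 h1; move: h2; rewrite mulrnBl; lra.
Qed.

Lemma cis_sum (M : nat) (N : int) : (0 < M)%N -> (`|N| < M)%N ->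
  \sum_(0 <= l < M) cis (2 * pi * N%:~R * (l%:R / M%:R)) = if N == 0 then M%:R else 0.
Proof.
move=> M0 NM; have [->|N0] := eqVneq N 0.
  under eq_bigr do rewrite mulr0 mul0r cis0.
  by rewrite big_mkord sumr_const card_ord.
have MR : 0 < (M%:R : R) by rewrite ltr0n.
pose z := cis (2 * pi * N%:~R / M%:R).
have E l : cis (2 * pi * N%:~R * (l%:R / M%:R)) = z ^+ l.
  by rewrite /z -cis_natr; congr cis; ring.
under eq_bigr do rewrite E.
have z1 : z - 1 != 0.
  rewrite subr_eq0 /z; have p0 := pi_gt0 R.
  have h (m : nat) : (0 < m < M)%N -> cis (2 * pi * m%:R / M%:R) != 1.
    move=> /andP[m0 mM]; apply: cis_neq1; apply/andP; split.
      by rewrite divr_gt0 // mulr_gt0 ?ltr0n // mulr_gt0.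
    by rewrite ltr_pdivrMr // ltr_pM2l ?ltr_nat // mulr_gt0.
  case: N N0 NM {E z} => [n|n] N0 NM.
    by apply: h; rewrite NM andbT lt0n; apply: contra N0 => /eqP ->.
  rewrite NegzE mulrNz mulrN mulNr -cj_cis; apply/eqP => e.
  by have := congr1 cj e; rewrite conjcK conj1; apply/eqP/h.
apply: (mulfI z1); rewrite mulr0 big_mkord -subrX1 /z -cis_natr.
have -> : M%:R * (2 * pi * N%:~R / M%:R) = N%:~R * (2 * pi) :> R.
  by rewrite mulrC divfK ?gt_eqF //; ring.
by rewrite cis_int subrr.
Qed.
End Cis.

(** Positive definiteness of sech, together with a Harnack inequality: translating the nonnegative
    trigonometric function by [t] multiplies its sech average at most by [expR t]. It is kept as a
    hypothesis until the Fourier transform of sech is available ([sech_bochner_holds]). *)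
Definition sech_bochner (R : realType) := forall (I : finType) (z : I -> R[i]) (xi : I -> R),
  (forall y, 0 <= Re (\sum_i z i * cis (xi i * y))) ->
  0 <= Re (\sum_i z i * (sechf (xi i))%:C) /\
  forall t, 0 <= t -> Re (\sum_i z i * cis (xi i * t) * (sechf (xi i))%:C) <=
    expR t * Re (\sum_i z i * (sechf (xi i))%:C).

Section FinitePositivity.
Context {R : realType}.
Hypothesis HB : sech_bochner R.
Variables (T om k : R) (T0 : 0 < T) (omT : om * T = 2 * pi).
Variables (q : int -> R[i]) (qp : psdq q) (w : int -> R[i]) (M L : nat).

Let D := (L.*2).+1.
(** An index consists of two rows of the Toeplitz section and two positions in the truncated vector.
    Then [zA], [xA] and [zB], [xB] are the coefficients and frequencies of the expansions of
    [nu |W|^2] and [nu W^2]. *)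
Let I : finType := ('I_M * 'I_M * ('I_D * 'I_D))%type.
Let idx (j : 'I_D) : int := j%:Z - L%:Z.
Let qI (i : I) := q (i.1.1%:Z - i.1.2%:Z).
Let zA (i : I) := qI i * (w (idx i.2.2) * cj (w (idx i.2.1))).
Let zB (i : I) := qI i * (w (idx i.2.2) * w (idx i.2.1)).
Let NA (i : I) : int := i.1.1%:Z - i.1.2%:Z + idx i.2.2 - idx i.2.1.
Let NB (i : I) : int := i.1.1%:Z - i.1.2%:Z + idx i.2.2 + idx i.2.1.
Let xA i := om * (NA i)%:~R.
Let xB i := om * (NB i)%:~R + 2 * k.

Lemma finsumE (k1 k2 : int -> R[i]) :
  \sum_(0 <= i < M) \sum_(0 <= j < M)
     q (i%:Z - j%:Z) * finform k1 k2 w L (i%:Z - j%:Z) =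
  \sum_i (zA i * k1 (NA i) + zB i * k2 (NB i)).
Proof.
rewrite big_mkord; under eq_bigr do rewrite big_mkord.
rewrite pair_big /= -(pair_big xpredT xpredT
  (fun p r => zA (p, r) * k1 (NA (p, r)) + zB (p, r) * k2 (NB (p, r)))) /=.
apply: eq_bigr => -[a b] _; rewrite /finform /psum big_mkord mulr_sumr.
under [LHS]eq_bigr do rewrite big_mkord mulr_sumr.
rewrite pair_big /=; apply: eq_bigr => -[m j] _ /=.
by rewrite /zA /zB /qI /NA /NB /idx /=; ring.
Qed.

Let nu y := \sum_(a < M) \sum_(b < M) q (a%:Z - b%:Z) * cis (om * (a%:Z - b%:Z)%:~R * y).
Let W y := \sum_(j < D) w (idx j) * cis ((om * (idx j)%:~R + k) * y).

Lemma nu_ge0 y : 0 <= Re (nu y) /\ Im (nu y) = 0.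
Proof.
have cE (a b : nat) : cis (om * a%:R * y) * cj (cis (om * b%:R * y)) =
    cis (om * (a%:Z - b%:Z)%:~R * y).
  by rewrite cj_cis -cisD; congr cis; rewrite rmorphB /=; ring.
split.
  have := proj2 qp M (fun a => cis (om * a%:R * y)).
  rewrite big_mkord; under eq_bigr do rewrite big_mkord.
  congr (0 <= Re _); apply: eq_bigr => a _; apply: eq_bigr => b _.
  by rewrite cE mulrC.
have : cj (nu y) = nu y.
  have conj_sum (J : finType) (f : J -> R[i]) : cj (\sum_j f j) = \sum_j cj (f j).
    by elim/big_rec2: _ => [|j x u _ <-]; [exact: conj0|exact: conjD].
  rewrite /nu conj_sum.
  under eq_bigr do rewrite conj_sum.
  rewrite exchange_big /=; apply: eq_bigr => a _; apply: eq_bigr => b _.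
  rewrite conjM cj_cis -(proj1 qp) opprB; congr (_ * cis _).
  by rewrite !rmorphB /=; ring.
by move/(congr1 Im); rewrite Im_conj; lra.
Qed.

Lemma sumA_fact y : \sum_i zA i * cis (xA i * y) = nu y * (W y * cj (W y)).
Proof.
rewrite -(pair_big xpredT xpredT (fun p r => zA (p, r) * cis (xA (p, r) * y))) /=.
rewrite /nu [in RHS]pair_big /= mulr_suml; apply: eq_bigr => -[a b] _ /=.
have conj_sum (J : finType) (f : J -> R[i]) : cj (\sum_j f j) = \sum_j cj (f j).
  by elim/big_rec2: _ => [|j x u _ <-]; [exact: conj0|exact: conjD].
have -> : W y * cj (W y) = \sum_(p : 'I_D * 'I_D)
   w (idx p.2) * cis ((om * (idx p.2)%:~R + k) * y) *
   (cj (w (idx p.1)) * cis (- ((om * (idx p.1)%:~R + k) * y))).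
  rewrite mulrC {1}/W conj_sum mulr_suml.
  rewrite -(pair_big xpredT xpredT (fun m j =>
     w (idx j) * cis ((om * (idx j)%:~R + k) * y) *
     (cj (w (idx m)) * cis (- ((om * (idx m)%:~R + k) * y))))) /=.
  apply: eq_bigr => m _; rewrite /W mulr_sumr; apply: eq_bigr => j _.
  by rewrite conjM cj_cis mulrC.
rewrite mulr_sumr; apply: eq_bigr => -[m j] _ /=.
rewrite /zA /qI /=.
have -> : cis (xA (a, b, (m, j)) * y) = cis (om * (a%:Z - b%:Z)%:~R * y) *
   (cis ((om * (idx j)%:~R + k) * y) * cis (- ((om * (idx m)%:~R + k) * y))).
  by rewrite -!cisD; congr cis; rewrite /xA /NA /= rmorphB rmorphD /=; ring.
ring.
Qed.

Lemma sumB_fact y : \sum_i zB i * cis (xB i * y) = nu y * (W y * W y).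
Proof.
rewrite -(pair_big xpredT xpredT (fun p r => zB (p, r) * cis (xB (p, r) * y))) /=.
rewrite /nu [in RHS]pair_big /= mulr_suml; apply: eq_bigr => -[a b] _ /=.
have -> : W y * W y = \sum_(p : 'I_D * 'I_D)
   w (idx p.2) * cis ((om * (idx p.2)%:~R + k) * y) *
   (w (idx p.1) * cis ((om * (idx p.1)%:~R + k) * y)).
  rewrite {1}/W mulr_suml.
  rewrite -(pair_big xpredT xpredT (fun m j =>
     w (idx j) * cis ((om * (idx j)%:~R + k) * y) *
     (w (idx m) * cis ((om * (idx m)%:~R + k) * y)))) /=.
  apply: eq_bigr => m _; rewrite /W mulr_sumr; apply: eq_bigr => j _.
  by rewrite mulrC.
rewrite mulr_sumr; apply: eq_bigr => -[m j] _ /=.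
rewrite /zB /qI /=.
have -> : cis (xB (a, b, (m, j)) * y) = cis (om * (a%:Z - b%:Z)%:~R * y) *
   (cis ((om * (idx j)%:~R + k) * y) * cis ((om * (idx m)%:~R + k) * y)).
  by rewrite -!cisD; congr cis; rewrite /xB /NB /= !rmorphD /=; ring.
ring.
Qed.

Let SA t := \sum_i zA i * cis (xA i * t) * (sechf (xA i))%:C.
Let SB t := \sum_i zB i * cis (xB i * t) * (sechf (xB i))%:C.

(** If [|be| <= al] then [al |W|^2 + Re (be W^2) >= 0], and multiplication by [nu >= 0] preserves
    this. The two expansions have different frequencies and are joined over the disjoint union
    [I + I]. *)
Lemma bochnerAB (al : R) (be : R[i]) : nc be <= al ->
  0 <= Re (al%:C * SA 0 + be * SB 0) /\
  forall t, 0 <= t -> Re (al%:C * SA t + be * SB t) <= expR t * Re (al%:C * SA 0 + be * SB 0).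
Proof.
move=> hbe.
pose z (s : I + I) := match s with inl i => al%:C * zA i | inr i => be * zB i end.
pose xi (s : I + I) := match s with inl i => xA i | inr i => xB i end.
have S (f : R -> R[i]) (g : R -> R[i]) : \sum_s z s * f (xi s) * g (xi s) =
    al%:C * (\sum_i zA i * f (xA i) * g (xA i)) + be * (\sum_i zB i * f (xB i) * g (xB i)).
  by rewrite big_sumType /= !mulr_sumr; congr (_ + _); apply: eq_bigr => i _; rewrite -!mulrA.
have Ez t : \sum_s z s * cis (xi s * t) * (sechf (xi s))%:C = al%:C * SA t + be * SB t.
  exact: (S (fun x => cis (x * t)) (fun x => (sechf x)%:C)).
have E0 : \sum_s z s * (sechf (xi s))%:C = al%:C * SA 0 + be * SB 0.
  by rewrite -Ez; apply: eq_bigr => s _; rewrite mulr0 cis0 mulr1.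
have [|b1 b2] := HB (z := z) (xi := xi).
  move=> y.
  have -> : \sum_s z s * cis (xi s * y) = al%:C * (nu y * (W y * cj (W y))) + be * (nu y * (W y * W y)).
    rewrite -sumA_fact -sumB_fact big_sumType /= !mulr_sumr.
    by congr (_ + _); apply: eq_bigr => i _; rewrite -mulrA.
  have [n0 n1] := nu_ge0 y.
  have -> : nu y = (Re (nu y))%:C by apply: complex_ext.
  rewrite mul_conj.
  have -> : al%:C * ((Re (nu y))%:C * (nc (W y) ^+ 2)%:C) + be * ((Re (nu y))%:C * (W y * W y)) =
     (Re (nu y))%:C * ((al * nc (W y) ^+ 2)%:C + be * (W y * W y)) by rewrite RCM; ring.
  rewrite ReC mulr_ge0 // ReD /= -lerBlDl sub0r.
  apply: (@le_trans _ _ (- nc (be * (W y * W y)))).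
    rewrite lerN2 !ncM -expr2 ler_wpM2r // sqr_ge0 //.
  by rewrite lerNl; apply: le_trans (Re_le_nc _); rewrite -normrN ler_norm.
split; first by rewrite -E0.
by move=> t t0; rewrite -Ez -E0; exact: b2.
Qed.

(* At time [T] the first sum is unchanged and the second one gains the phase
   [cis (2 k T)]; comparing the times [0] and [T] gives the gap. *)
Lemma finite_gap (th : R[i]) : nc th = 1 ->
  0 <= Re (\sum_(0 <= i < M) \sum_(0 <= j < M) q (i%:Z - j%:Z) *
    finform (fun N => ((expR T - 1 + 2 * `|cos (k * T)|) * sechf (om * N%:~R))%:C)
            (fun N => - (1 + expR T)%:C * th * (sechf (om * N%:~R + 2 * k))%:C) w L (i%:Z - j%:Z)).
Proof.
move=> th1; rewrite finsumE.
set c := `|cos (k * T)|; set e := expR T.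
have SAT : SA T = SA 0.
  apply: eq_bigr => i _; congr (_ * _ * _); rewrite mulr0 cis0 /xA.
  by have -> : om * (NA i)%:~R * T = (NA i)%:~R * (2 * pi); [rewrite -omT; ring|rewrite cis_int].
have SBT : SB T = cis (2 * (k * T)) * SB 0.
  rewrite mulr_sumr; apply: eq_bigr => i _; rewrite mulr0 cis0 mulr1 /xB.
  have -> : (om * (NB i)%:~R + 2 * k) * T = (NB i)%:~R * (2 * pi) + 2 * (k * T).
    by rewrite -omT; ring.
  by rewrite cisD cis_int; ring.
have hb1 : nc (- th) <= 1 by rewrite ncN th1.
(* Growth from time 0 to time [T] of the combination with coefficients [1] and [- th]. *)
have [_ /(_ T (ltW T0)) h1] := bochnerAB hb1.
(* The coefficients of [SB] at the two times add up to modulus [2 |cos (k T)|] instead of 2. The sum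
   of [h1] and [h2] is the assertion. *)
have [|h2 _] := @bochnerAB (2 * c) (- th * (1 + cis (2 * (k * T)))).
  by rewrite ncM ncN th1 mul1r one_add_cis ncM nc_cis mulr1 ncR normrM ger0_norm.
rewrite SAT SBT in h1.
have -> : \sum_i (zA i * ((e - 1 + 2 * c) * sechf (xA i))%:C +
     zB i * (- (1 + e)%:C * th * (sechf (xB i))%:C)) =
     (e - 1 + 2 * c)%:C * SA 0 - (1 + e)%:C * (th * SB 0).
  rewrite big_split /=; congr (_ + _).
    rewrite mulr_sumr; apply: eq_bigr => i _; rewrite mulr0 cis0 RCM; ring.
  rewrite -mulrN mulr_sumr -sumrN mulr_sumr.
  by apply: eq_bigr => i _; rewrite mulr0 cis0; ring.
move: h1 h2.
have C1 : 1%:C = 1 :> R[i] by [].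
have -> : 1%:C * SA 0 + - th * (cis (2 * (k * T)) * SB 0) = SA 0 - th * cis (2 * (k * T)) * SB 0.
  by rewrite C1; ring.
have -> : 1%:C * SA 0 + - th * SB 0 = SA 0 - th * SB 0 by rewrite C1; ring.
have -> : (2 * c)%:C * SA 0 + - th * (1 + cis (2 * (k * T))) * SB 0 =
   (2 * c)%:C * SA 0 - th * SB 0 - th * cis (2 * (k * T)) * SB 0 by ring.
rewrite !ReB !ReC.
move: (Re (SA 0)) (Re (th * SB 0)) (Re (th * cis (2 * (k * T)) * SB 0)) => x y u.
rewrite -/e; lra.
Qed.

(* The average of [cis (om N t)] over the times [j T / M] is [0] unless [N = 0]. *)
Lemma finite_lower :
  0 <= Re (\sum_(0 <= i < M) \sum_(0 <= j < M) q (i%:Z - j%:Z) *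
    finform (fun N => (sechf (om * N%:~R) - expR (- T) * (N == 0)%:R)%:C)
            (fun N => 0) w L (i%:Z - j%:Z)).
Proof.
rewrite finsumE; under eq_bigr do rewrite mulr0 addr0.
have [|h0 ht] := @bochnerAB 1 0; first by rewrite nc0.
have {}h0 : 0 <= Re (SA 0) by move: h0; rewrite mul0r addr0 (_ : 1%:C = 1) ?mul1r.
have {}ht t : 0 <= t -> Re (SA t) <= expR t * Re (SA 0).
  by move=> /ht; rewrite !mul0r !addr0 (_ : 1%:C = 1) ?mul1r.
(* With more sampling times than any [|NA i|], the discrete average separates [NA i = 0] from all
   other values exactly. *)
pose M' := (\max_i `|NA i|).+1.
have NM i : (`|NA i| < M')%N by rewrite ltnS (leq_bigmax i).
have MR : 0 < (M'%:R : R) by rewrite ltr0n.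
have avg : \sum_(0 <= l < M') SA (T * (l%:R / M'%:R)) =
    M'%:R * \sum_i zA i * (NA i == 0)%:R.
  rewrite exchange_big mulr_sumr /=; apply: eq_bigr => i _.
  transitivity (zA i * (sechf (xA i))%:C * \sum_(0 <= l < M') cis (2 * pi * (NA i)%:~R * (l%:R / M'%:R))).
    rewrite mulr_sumr; apply: eq_bigr => l _; rewrite mulrAC; congr (_ * _ * cis _).
    by rewrite /xA -omT; ring.
  rewrite cis_sum //; case: eqVneq => [N0|_]; last by rewrite !mulr0.
  by rewrite /xA N0 mulr0 sechf0 (_ : 1%:C = 1) // mulr1 mulrC.
have Re_sum (J : Type) (s : seq J) (P : pred J) (f : J -> R[i]) :
    Re (\sum_(j <- s | P j) f j) = \sum_(j <- s | P j) Re (f j).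
  by elim/big_rec2: _ => [//|j x u _ <-]; exact: ReD.
have : Re (M'%:R * \sum_i zA i * (NA i == 0)%:R) <= M'%:R * (expR T * Re (SA 0)).
  rewrite -avg Re_sum.
  apply: (@le_trans _ _ (\sum_(0 <= l < M') expR T * Re (SA 0))).
    rewrite big_nat [leRHS]big_nat; apply: ler_sum => l /andP[_ lM].
    have l1 : 0 <= (l%:R / M'%:R : R) <= 1.
      by rewrite divr_ge0 //= ler_pdivrMr // mul1r ler_nat ltnW.
    apply: le_trans (ht _ _) _; first by rewrite mulr_ge0 // ?(ltW T0) //; case/andP: l1.
    rewrite ler_wpM2r // ler_expR ler_piMr // ?(ltW T0) //; by case/andP: l1.
  by rewrite big_mkord sumr_const card_ord mulr_natl.
rewrite (_ : M'%:R = (M'%:R)%:C); last by rewrite rmorph_nat.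
rewrite ReC ler_pM2l //.
have -> : \sum_i zA i * (sechf (om * (NA i)%:~R) - expR (- T) * (NA i == 0)%:R)%:C =
   SA 0 - (expR (- T))%:C * \sum_i zA i * (NA i == 0)%:R.
  rewrite mulr_sumr -sumrB; apply: eq_bigr => i _; rewrite mulr0 cis0 mulr1 RCB RCM /xA rmorph_nat.
  by move: ((NA i == 0)%:R : R[i]) => x; ring.
rewrite ReB ReC => h; rewrite subr_ge0 expRN mulrC ler_pdivrMr ?expR_gt0 //.
by rewrite mulrC.
Qed.
End FinitePositivity.

(** * The strict gap between the moduli of [X] and [Y] *)

Section Gap.
Context {R : realType}.
Hypothesis HB : sech_bochner R.
Variables (T om k : R) (T0 : 0 < T) (om0 : 0 < om) (omT : om * T = 2 * pi).
Hypothesis kT : `|cos (k * T)| < 1.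
Variables (q : int -> R[i]) (qp : psdq q) (lam : R) (lam0 : 0 < lam) (w : int -> R[i]).
Hypothesis ew : eigw om k q lam w.
Let c := cwt om k.

Let dw : decays om w. Proof. exact (eigw_decays om0 qp lam0 ew). Qed.

Lemma csum_delta (f : int -> R[i]) n : (forall m, m != n -> f m = 0) -> csum f = f n.
Proof.
move=> fn.
have sf : csummable f.
  apply: (@csummable_le _ _ (fun m => nc (f n) * (geo 1 n)^-1 * geo 1 m)).
    move=> m; have [->|mn] := eqVneq m n; last by rewrite fn // nc0 !mulr_ge0 ?nc_ge0 ?invr_ge0 ?geo_ge0.
    by rewrite divfK // lt0r_neq0 // geo_gt0.
  exact/rsummableZ/geo_summable.
rewrite -(csum_shift n sf) (@csum_single _ (fun m => f (m + n))) ?add0r // => m m0.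
by apply: fn; rewrite -subr_eq0 addrK.
Qed.

Lemma eigw_bounded : cbounded (fun n => (c n)%:C * w n).
Proof.
exists (Re (q 0) / lam * rsum (fun m => nc (w m))) => n.
rewrite ncM ncR ger0_norm; last exact: ltW (cwt_gt0 _ _ _).
exact: (eigw_bound n qp lam0 ew).
Qed.

(** By [XX_YY] and [XY_YX], [2 pi Re Z1 = |X|^2 + |Y|^2] and [pi Z2 = X Y], so [|X| = |Y|] would
    force [|Z2| = Re Z1]. *)
Let Z1 := sform (Kdif om k) (fun n => (c n)%:C * w n) (fun n => cj (w n)).
Let Z2 := sform (Ksum om k) (fun n => (c n)%:C * w n) w.

Let toepE n : toep q w n = lam%:C * ((c n)%:C * w n).
Proof. by rewrite -(proj2 ew) RCM mulrA. Qed.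

Let pb1 : prodbound (fun n m => (c n)%:C * w n * cj (w m) * (Kdif om k n m)%:C).
Proof. exact: (kernel_prodbound om0 (Kdif_bounded k om0) eigw_bounded (decays_conj dw)). Qed.

Let pb2 : prodbound (fun n m => (c n)%:C * w n * w m * (Ksum om k n m)%:C).
Proof. exact: (kernel_prodbound om0 (Ksum_bounded k om0) eigw_bounded dw). Qed.

Let KdifE n m : Kdif om k n m = sechf (om * (n - m)%:~R).
Proof. by rewrite /Kdif /freq; congr sechf; rewrite rmorphB /=; ring. Qed.

Let KsumE n m : Ksum om k n m = sechf (om * (n + m)%:~R + 2 * k).
Proof. by rewrite /Ksum /freq; congr sechf; rewrite rmorphD /=; ring. Qed.

Let Re_comb (l e f : R) (z1 z2 : R[i]) :
  Re (l%:C * (e%:C * z1 - f%:C * z2)) = l * (e * Re z1 - f * Re z2).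
Proof. by rewrite ReC ReB !ReC. Qed.

Let ler_mul_geo (x y z u v : R) : 0 <= u * v -> x * y <= z -> x * (y * u * v) <= z * u * v.
Proof. by move=> uv xyz; rewrite -(mulrA z) -(mulrA y) mulrA ler_wpM2r. Qed.

(** The coefficients are those of [finite_gap]. Since [toep q w] is [lam] times [c w], the form with
    these kernels is [lam] times the combination of [Z1] and [Z2]. *)
Lemma gap_ineq (th : R[i]) : nc th = 1 ->
  0 <= (expR T - 1 + 2 * `|cos (k * T)|) * Re Z1 - (1 + expR T) * Re (th * Z2).
Proof.
move=> th1; set e1 := expR T - 1 + 2 * `|cos (k * T)|.
have e0 : 0 <= e1.
  by rewrite /e1 addr_ge0 ?mulr_ge0 // subr_ge0 -[leLHS]expR0 ler_expR ltW.
have [C1 hC1] := Kdif_bounded k om0; have [C2 hC2] := Ksum_bounded k om0.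
pose k1 (N : int) : R[i] := (e1 * sechf (om * N%:~R))%:C.
pose k2 (N : int) : R[i] := - (1 + expR T)%:C * th * (sechf (om * N%:~R + 2 * k))%:C.
have g0 n m : 0 <= geo (pi * om / 2) n * (geo (pi * om / 2) m)^-1.
  by rewrite mulr_ge0 ?invr_ge0 ?geo_ge0.
have CC (C : R) n m : C * geo (pi * om / 2) n * (geo (pi * om / 2) m)^-1 <=
    `|C| * geo (pi * om / 2) n * (geo (pi * om / 2) m)^-1.
  by rewrite -!(mulrA _ (geo _ n)); apply: ler_wpM2r => //; exact: ler_norm.
have e20 : 0 <= 1 + expR T by rewrite addr_ge0 ?expR_ge0.
pose K := e1 * `|C1| + (1 + expR T) * `|C2|.
have b1 n m : nc (k1 (n - m)) <= K * geo (pi * om / 2) n * (geo (pi * om / 2) m)^-1.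
  rewrite /k1 ncR normrM (ger0_norm e0) -KdifE.
  apply: le_trans (ler_wpM2l e0 (le_trans (hC1 n m) (CC C1 n m))) _.
  by apply: ler_mul_geo; [exact: g0|rewrite lerDl mulr_ge0].
have b2 n m : nc (k2 (n + m)) <= K * geo (pi * om / 2) n * (geo (pi * om / 2) m)^-1.
  rewrite /k2 !ncM ncN th1 mulr1 !ncR (ger0_norm e20) -KsumE.
  apply: le_trans (ler_wpM2l e20 (le_trans (hC2 n m) (CC C2 n m))) _.
  by apply: ler_mul_geo; [exact: g0|rewrite lerDr mulr_ge0].
have := form_ge0 om0 qp b1 b2 dw (fun M L => finite_gap HB k T0 omT qp w M L th1).
have -> : form q k1 k2 w = lam%:C * (e1%:C * Z1 - (1 + expR T)%:C * (th * Z2)).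
  transitivity (csum2 (fun n m => lam%:C * (e1%:C * ((c n)%:C * w n * cj (w m) * (Kdif om k n m)%:C) +
     (- (1 + expR T)%:C * th) * ((c n)%:C * w n * w m * (Ksum om k n m)%:C)))).
    apply: eq_csum2 => n m; rewrite toepE /k1 /k2 KdifE KsumE RCM.
    by move: (c n) => x; ring.
  have pz1 := prodboundZ e1%:C pb1; have pz2 := prodboundZ (- (1 + expR T)%:C * th) pb2.
  rewrite csum2Z; last first.
    have [f [g [s1 s2 h]]] := pz1; have [f' [g' [s1' s2' h']]] := pz2.
    exists (fun n => `|f n| + `|f' n|), (fun m => `|g m| + `|g' m|); split.
    - by apply: rsummableD; exact: rsummable_norm.
    - by apply: rsummableD; exact: rsummable_norm.
    move=> n m; apply: le_trans (ncD _ _) _.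
    have := h n m; have := h' n m; have := ler_norm (f n * g m); have := ler_norm (f' n * g' m).
    rewrite !normrM; have := normr_ge0 (f n); have := normr_ge0 (f' n).
    have := normr_ge0 (g m); have := normr_ge0 (g' m); nra.
  congr (_ * _); apply: etrans (csum2D pz1 pz2) _.
  have q1 := csum2Z e1%:C pb1; have q2 := csum2Z (- (1 + expR T)%:C * th) pb2.
  by apply: etrans (congr2 +%R q1 q2) _; rewrite mulNr mulNr -mulrA.
by rewrite Re_comb (pmulr_rge0 _ lam0).
Qed.

(** Positivity survives when [expR (- T)] times the identity is subtracted from the sech kernel
    ([finite_lower]). Together with the positive energy of [w] this makes [Re Z1] strictly positive,
    so that the gap inequality is strict. *)
Lemma lower_ineq : expR (- T) * rsum (fun n => c n * nc (w n) ^+ 2) <= Re Z1.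
Proof.
have [C1 hC1] := Kdif_bounded k om0.
pose d (N : int) : R := expR (- T) * (N == 0)%:R.
pose k1 (N : int) : R[i] := (sechf (om * N%:~R) - d N)%:C.
pose K := `|C1| + 1.
have g0 n m : 0 <= geo (pi * om / 2) n * (geo (pi * om / 2) m)^-1.
  by rewrite mulr_ge0 ?invr_ge0 ?geo_ge0.
have eT : expR (- T) <= 1 by rewrite expR_le1 oppr_le0 ltW.
have d0 N : 0 <= d N by rewrite mulr_ge0 ?expR_ge0.
have dK n m : d (n - m) <= geo (pi * om / 2) n * (geo (pi * om / 2) m)^-1.
  rewrite /d subr_eq0; case: eqVneq => [->|_]; last by rewrite mulr0.
  by rewrite mulr1 divff // lt0r_neq0 // geo_gt0.
have b1 n m : nc (k1 (n - m)) <= K * geo (pi * om / 2) n * (geo (pi * om / 2) m)^-1.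
  rewrite /k1 ncR -KdifE; apply: le_trans (ler_normB _ _) _.
  rewrite /K -mulrA mulrDl mul1r; apply: lerD; last by rewrite ger0_norm.
  apply: le_trans (hC1 n m) _; rewrite -mulrA; apply: ler_wpM2r => //; exact: ler_norm.
have K0 : 0 <= K by rewrite addr_ge0.
have b2 (n m : int) : nc ((fun=> 0 : R[i]) (n + m)) <= K * geo (pi * om / 2) n * (geo (pi * om / 2) m)^-1.
  by rewrite nc0 -mulrA mulr_ge0.
have := form_ge0 om0 qp b1 b2 dw (fun M L => finite_lower HB k T0 omT qp w M L).
pose Dl n m := (c n)%:C * w n * cj (w m) * (d (n - m))%:C.
have bK : kbounded om (fun n m => d (n - m)).
  by exists 1 => n m; rewrite mul1r ger0_norm.
have pD : prodbound Dl := kernel_prodbound om0 bK eigw_bounded (decays_conj dw).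
have Ds : csum2 Dl = (expR (- T) * rsum (fun n => c n * nc (w n) ^+ 2))%:C.
  transitivity (csum (fun n => (expR (- T) * (c n * nc (w n) ^+ 2))%:C : R[i])).
    apply: eq_csum => n; rewrite (@csum_delta _ n) /Dl.
      by rewrite /d subrr eqxx mulr1 -(mulrA _ (w n)) mul_conj -!RCM mulrC.
    by move=> m mn; rewrite /d subr_eq0 eq_sym (negbTE mn) mulr0 mulr0.
  have sD : csummable (fun n => Dl n n).
    have [f [g [s1 s2 h]]] := pD.
    apply: (@csummable_le _ _ (fun n => rsum (fun m => `|g m|) * `|f n|)).
      move=> n; apply: le_trans (h n n) _; apply: le_trans (ler_norm _) _.
      rewrite normrM mulrC ler_wpM2r //; apply: (rsum_ge_term (f := fun m => `|g m|)) => //.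
      exact: rsummable_norm.
    exact/rsummableZ/rsummable_norm.
  have sr : rsummable (fun n => c n * nc (w n) ^+ 2).
    apply: rsummable_le (rsummableZ (expR T) sD) => n.
    rewrite /Dl /d subrr eqxx mulr1 !ncM nc_conj !ncR (ger0_norm (expR_ge0 _)).
    rewrite (ger0_norm (ltW (cwt_gt0 _ _ _))) (ger0_norm (_ : 0 <= c n * _)); last first.
      by rewrite mulr_ge0 ?sqr_ge0 ?(ltW (cwt_gt0 _ _ _)).
    have -> : expR T * (c n * nc (w n) * nc (w n) * expR (- T)) =
      (expR T * expR (- T)) * (c n * nc (w n) ^+ 2) by ring.
    by rewrite expRxMexpNx_1 mul1r.
  apply: complex_ext => /=; first by rewrite rsumZ.
  apply: rsum_unique; rewrite (_ : psum _ = fun=> 0); first exact: cvg_cst.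
  by apply/funext => N; rewrite /psum big1.
have -> : form q k1 (fun=> 0) w = lam%:C * (Z1 - csum2 Dl).
  transitivity (csum2 (fun n m => lam%:C * ((c n)%:C * w n * cj (w m) * (Kdif om k n m)%:C + - Dl n m))).
    apply: eq_csum2 => n m; rewrite toepE /k1 /Dl KdifE RCB mulr0 addr0.
    by move: (c n) (d (n - m)) => x y; ring.
  have pN : prodbound (fun n m => - Dl n m).
    by apply: prodbound_le pD => n m; rewrite ncN.
  rewrite csum2Z; first by congr (_ * _); apply: etrans (csum2D pb1 pN) _; rewrite (csum2N pD).
  have [f [g [s1 s2 h]]] := pb1; have [f' [g' [s1' s2' h']]] := pN.
  exists (fun n => `|f n| + `|f' n|), (fun m => `|g m| + `|g' m|); split.
  - by apply: rsummableD; exact: rsummable_norm.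
  - by apply: rsummableD; exact: rsummable_norm.
  move=> n m; apply: le_trans (ncD _ _) _.
  have := h n m; have := h' n m; have := ler_norm (f n * g m); have := ler_norm (f' n * g' m).
  rewrite !normrM; have := normr_ge0 (f n); have := normr_ge0 (f' n).
  have := normr_ge0 (g m); have := normr_ge0 (g' m); nra.
rewrite Ds; move: Z1 => z1.
by rewrite ReC (pmulr_rge0 _ lam0) ReB subr_ge0.
Qed.

Lemma eigw_energy_summable : rsummable (fun n => c n * nc (w n) ^+ 2).
Proof.
have [B hB] := eigw_bounded.
apply: (@rsummable_le _ _ (fun n => B * nc (w n))); last exact/rsummableZ/(proj1 ew).
move=> n; have c0 := cwt_gt0 om k n.
have h : 0 <= c n * nc (w n) ^+ 2 by apply: mulr_ge0; [exact: ltW|exact: sqr_ge0].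
rewrite (ger0_norm h) expr2 mulrA; apply: ler_wpM2r; first exact: nc_ge0.
by have := hB n; rewrite ncM ncR ger0_norm // ltW.
Qed.

(** If the moduli agree, a phase [th] turns [X Y] into [|X|^2], whence [Re (th * z2) = Re z1]. The
    gap expression is then [(2 u - 2) Re z1], which is negative. *)
Lemma gap_contra (X Y z1 z2 : R[i]) (e u : R) :
  nc X ^+ 2 + nc Y ^+ 2 = 2 * pi * Re z1 -> X * Y = pi%:C * z2 ->
  (forall th, nc th = 1 -> 0 <= (e - 1 + 2 * u) * Re z1 - (1 + e) * Re (th * z2)) ->
  0 < Re z1 -> u < 1 -> nc X != nc Y.
Proof.
move=> h1 h2 gap z10 u1; apply/eqP => XY.
have [th th1 thE] : exists2 th : R[i], nc th = 1 & th * (X * Y) = (nc X ^+ 2)%:C.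
  have nXY : nc (X * Y) = nc X ^+ 2 by rewrite ncM -XY expr2.
  have [XY0|XY0] := eqVneq (X * Y) 0.
    exists 1; first exact: ComplexField.Normc.normc1.
    by rewrite -nXY XY0 nc0 mulr0.
  exists ((nc X ^+ 2)%:C / (X * Y)); last by rewrite divfK.
  rewrite ncM ncV nXY ncR (ger0_norm (sqr_ge0 _)) divff //.
  by rewrite -nXY nc_eq0.
have := gap _ th1; have -> : Re (th * z2) = Re z1.
  have pth : pi * Re (th * z2) = nc X ^+ 2 by rewrite -ReC mulrCA -h2 thE.
  have pZ : pi * Re z1 = nc X ^+ 2 by move: h1; rewrite -XY; lra.
  by apply: (mulfI (@pi_neq0 R)); rewrite pth pZ.
move: (Re z1) z10 => x x0 h.
have : (2 * u - 2) * x < 0 by rewrite pmulr_llt0 //; lra.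
lra.
Qed.

Lemma XY_neq : (exists n, w n != 0) -> nc (Xval om k w) != nc (Yval om k w).
Proof.
move=> [n0 wn0].
have E0 : 0 < rsum (fun n => c n * nc (w n) ^+ 2).
  apply: (@rsum_gt0 _ _ n0).
  - by move=> n; apply: mulr_ge0; [exact: ltW (cwt_gt0 _ _ _)|exact: sqr_ge0].
  - exact: eigw_energy_summable.
  - by apply: mulr_gt0; [exact: cwt_gt0|apply: exprn_gt0; rewrite nc_gt0].
apply: (@gap_contra _ _ Z1 Z2 (expR T) `|cos (k * T)|) => //.
- exact (XX_YY om0 dw eigw_bounded).
- exact (XY_YX om0 dw eigw_bounded).
- exact: gap_ineq.
- by apply: lt_le_trans lower_ineq; apply: mulr_gt0 => //; exact: expR_gt0.
Qed.

End Gap.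

(** * The Fourier transform of sech *)

Section ChangeOfVariables.
Context {R : realType}.
Local Notation mu := (@lebesgue_measure R).
Local Open Scope ereal_scope.

Lemma measurable_addr (c : R) : measurable_fun setT (fun x : R => x + c)%R.
Proof. by apply: continuous_measurable_fun => x; apply: cvgD; [exact: cvg_id|exact: cvg_cst]. Qed.

(** The image of Lebesgue measure under a translation has the right values on half-open intervals,
    and these determine the measure. *)
Lemma ge0_integral_shift (f : R -> \bar R) (c : R) : measurable_fun setT f ->
  (forall x, 0 <= f x) -> \int[mu]_x f (x + c)%R = \int[mu]_x f x.
Proof.
move=> mf f0; have mc := measurable_addr c.
rewrite -[LHS](@ge0_integral_pushforward _ _ (measurableTypeR R) (measurableTypeR R) R
  (fun x => x + c)%R mc mu setT f) //.
apply: eq_measure_integral => //= A mA _; apply/esym.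
apply: (@lebesgue_measure_unique R (pushforward mu _)) => // _ [[a b]] _ <-.
transitivity (mu `]a - c, b - c]%classic%R).
  by rewrite !lebesgue_measure_itv /= !lte_fin ltrD2r; case: ifP => // _; rewrite -!EFinB; congr EFin; lra.
by congr (mu _); apply/seteqP; split => x /=; rewrite !in_itv /= ltrBlDr lerBrDr.
Qed.

Lemma integral_shift (f : R -> \bar R) (c : R) : measurable_fun setT f ->
  \int[mu]_x f (x + c)%R = \int[mu]_x f x.
Proof.
move=> mf; rewrite integralE [RHS]integralE.
rewrite -(ge0_integral_shift c (measurable_funepos mf)) //.
rewrite -(ge0_integral_shift c (measurable_funeneg mf)) //.
by congr (_ - _); apply: eq_integral => x _; rewrite ?funeposE ?funenegE.
Qed.

End ChangeOfVariables.

Section Density.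
Local Open Scope ereal_scope.
Context {d} {T : measurableType d} {R : realType} (m : {measure set T -> \bar R}).
Variables (g : T -> R) (g0 : forall x, (0 <= g x)%R) (mg : measurable_fun setT g).

Let meg (D : set T) : measurable_fun D (EFin \o g).
Proof. by apply/measurable_funTS/measurable_EFinP. Qed.

(** The two proofs are arguments of the definition so that the measure structure declared below can
    recover them from the term. *)
Definition density of (forall x, (0 <= g x)%R) & measurable_fun setT g :=
  fun A : set T => \int[m]_(x in A) (g x)%:E.
Local Notation nu := (density g0 mg).

Let nu0 : nu set0 = 0. Proof. by rewrite /density integral_set0. Qed.

Let nu_ge0 A : 0 <= nu A.
Proof. by apply: integral_ge0 => x _; rewrite lee_fin. Qed.

Let nu_sigma : semi_sigma_additive nu.
Proof.
move=> /= F mF tF mUF; rewrite /density; apply: cvg_toP.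
  apply: ereal_nondecreasing_is_cvgn => p n pn.
  by apply: lee_sum_nneg_natr => // k _ _; exact: nu_ge0.
by rewrite ge0_integral_bigcup //= => x _; rewrite lee_fin g0.
Qed.

HB.instance Definition _ := isMeasure.Build _ _ _ nu nu0 nu_ge0 nu_sigma.

Import HBNNSimple.

(** By approximation from below with simple functions, which reduces the identity to indicators,
    where it is the definition of [density]. *)
Lemma ge0_integral_density (f : T -> \bar R) : (forall x, 0 <= f x) ->
  measurable_fun setT f -> \int[nu]_x f x = \int[m]_x (f x * (g x)%:E).
Proof.
move=> f0 mf; pose h := nnsfun_approx measurableT mf.
have fE x : f x = lim ((EFin \o h n) x @[n --> \oo]).
  by apply/esym/cvg_lim => //; exact: cvg_nnsfun_approx.
have -> : \int[nu]_x f x = lim (\int[nu]_x (EFin \o h n) x @[n --> \oo]).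
  under eq_integral do rewrite fE.
  apply: monotone_convergence => //.
  - by move=> n; exact/measurable_EFinP.
  - by move=> n x _ /=; rewrite lee_fin.
  - by move=> x _ a b ab; rewrite lee_fin; exact/lefP/nd_nnsfun_approx.
have -> : \int[m]_x (f x * (g x)%:E) = lim (\int[m]_x ((EFin \o h n) x * (g x)%:E) @[n --> \oo]).
  have fg x : f x * (g x)%:E = lim (((EFin \o h n) x * (g x)%:E) @[n --> \oo]).
    by apply/esym/cvg_lim => //; apply: cvgeZr => //; exact: cvg_nnsfun_approx.
  under eq_integral do rewrite fg.
  apply: monotone_convergence => //.
  - move=> n; apply: emeasurable_funM; last exact: meg.
    exact/measurable_EFinP.
  - by move=> n x _ /=; rewrite mule_ge0 ?lee_fin.
  - by move=> x _ a b ab/=; rewrite lee_wpmul2r ?lee_fin //; exact/lefP/nd_nnsfun_approx.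
congr (lim (_ @ \oo)); apply/funext => n.
transitivity (\int[nu]_x (\sum_(y \in range (h n)) (y * \1_(h n @^-1` [set y]) x)%:E)).
  by apply: eq_integral => t tE; rewrite /= fimfunE -fsumEFin.
have indich r : measurable_fun setT (fun x => (r * \1_(h n @^-1` [set r]) x)%:E).
  by apply/measurable_EFinP; exact: measurable_funM.
rewrite ge0_integral_fsum//; last by move=> y x _; exact: nnfun_muleindic_ge0.
transitivity (\int[m]_x (\sum_(y \in range (h n)) (y * \1_(h n @^-1` [set y]) x)%:E * (g x)%:E)); last first.
  apply: eq_integral => x _.
  rewrite -ge0_mule_fsuml => [|y]; last exact: nnfun_muleindic_ge0.
  by rewrite fsumEFin // -(fimfunE _ x).
rewrite ge0_integral_fsum//; last 2 first.
  - by move=> y; apply: emeasurable_funM => //; exact: meg.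
  - by move=> y x _; apply: mule_ge0; [exact: nnfun_muleindic_ge0|rewrite lee_fin].
apply: eq_fsbigr => r rhn.
under [LHS]eq_integral do rewrite EFinM.
rewrite integralZl_indic_nnsfun => //.
under [RHS]eq_integral do rewrite EFinM -muleA.
rewrite ge0_integralZl//.
- congr (_ * _); rewrite integral_indic // setIT /density.
  under [RHS]eq_integral do rewrite muleC.
  rewrite [RHS](eq_integral ((EFin \o g) \_ (h n @^-1` [set r]))); last first.
    by move=> x _; rewrite epatch_indic.
  by rewrite -integral_mkcond.
- apply: emeasurable_funM; last exact: meg.
  exact/measurable_EFinP.
- by move=> t _; rewrite mule_ge0 ?lee_fin.
- by move: rhn; rewrite inE => -[t _ <-]; rewrite lee_fin.
Qed.
End Density.

Section ExpChange.
Context {R : realType}.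
Local Notation mu := (@lebesgue_measure R).

Let exp_nd : {homo (@expR R) : x y / x <= y}.
Proof. by move=> x y; rewrite ler_expR. Qed.

Let exp_rc (x : R) : (@expR R) @ at_right x --> expR x.
Proof. by apply: cvg_within_filter; exact: continuous_expR. Qed.

HB.instance Definition _ := isCumulative.Build R _ R (@expR R) exp_nd exp_rc.

Local Open Scope ereal_scope.

Lemma measurable_Rpos : measurable (@Rpos R : set (measurableTypeR R)).
Proof. exact: measurable_itv. Qed.

Let mexp : measurable_fun setT (@expR R). Proof. exact: measurable_expR. Qed.

Lemma integral_expR_oc (a b : R) : (a <= b)%R ->
  \int[mu]_(x in `]a, b]) (expR x)%:E = (expR b - expR a)%:E.
Proof.
rewrite le_eqVlt => /orP[/eqP->|ab]; first by rewrite set_itv_ge ?bnd_simp ?ltxx // integral_set0 subrr.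
rewrite integral_itv_obnd_cbnd; last by apply/measurable_funTS/measurable_EFinP.
rewrite (@continuous_FTC2 _ _ (@expR R)) ?EFinB //.
- by apply: continuous_subspaceT => x; exact: continuous_expR.
- split; first by move=> x _; exact: derivable_expR.
  by apply: cvg_at_right_filter; exact: continuous_expR.
  by apply: cvg_at_left_filter; exact: continuous_expR.
- by move=> x _; rewrite derive1E derive_val.
Qed.

(* Both sides are the Stieltjes measure of [exp]. *)
Lemma stieltjes_expR_oc (a b : R) : (a <= b)%R ->
  lebesgue_stieltjes_measure (@expR R) `]a, b]%classic = (expR b - expR a)%:E.
Proof.
move=> ab; rewrite /lebesgue_stieltjes_measure /measure_extension measurable_mu_extE; last exact: is_ocitv.
exact: (@wlength_itv_bnd R (@expR R) a b false false ab).
Qed.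

(** The image under [ln] of Lebesgue measure on [Rpos] and the measure with density [expR] both
    agree with the Stieltjes measure of [expR] on half-open intervals; uniqueness identifies the
    three. *)
Lemma ge0_integral_ln (f : R -> \bar R) : measurable_fun setT f ->
  (forall x, 0 <= f x) ->
  \int[mu]_(x in @Rpos R) f (ln x) = \int[mu]_y (f y * (expR y)%:E).
Proof.
move=> mf f0.
have mln : measurable_fun setT (@ln R : measurableTypeR R -> measurableTypeR R) by exact: measurable_ln.
rewrite -(@ge0_integral_density _ (measurableTypeR R) R mu (@expR R) (fun x => expR_ge0 x) mexp f) //.
have i0 (x : R) : (0 <= \1_(@Rpos R) x :> R)%R by rewrite indicE; case: (_ \in _).
have mi : measurable_fun setT (\1_(@Rpos R) : R -> R) by exact: measurable_indic measurable_Rpos.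
rewrite integral_mkcond.
pose nu : {measure set (measurableTypeR R) -> \bar R} := density mu i0 mi.
transitivity (\int[nu]_x f (ln x)).
  rewrite (@ge0_integral_density _ (measurableTypeR R) R mu _ i0 mi (f \o @ln R)); [|by move=> x; exact: f0|exact: measurableT_comp].
  apply: eq_integral => x _; rewrite patchE indicE /=.
  by case: (_ \in _); rewrite ?mule1 ?mule0.
transitivity (\int[pushforward nu (@ln R : measurableTypeR R -> measurableTypeR R)]_x f x).
  by rewrite (@ge0_integral_pushforward _ _ (measurableTypeR R) (measurableTypeR R) R _ mln nu setT f).
apply: eq_measure_integral => A mA _.
rewrite -[LHS](@lebesgue_stieltjes_measure_unique R (@expR R) (pushforward nu (@ln R : measurableTypeR R -> measurableTypeR R))) //.
  apply: (@lebesgue_stieltjes_measure_unique R (@expR R) (density mu (fun x => expR_ge0 x) mexp)) => //.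
  move=> _ [[a b]] _ <-; rewrite /= /density.
  have [ab|ba] := leP a b; first by rewrite stieltjes_expR_oc // integral_expR_oc.
  by rewrite set_itv_ge ?bnd_simp -?leNgt ?ltW // measure0 integral_set0.
move=> _ [[a b]] _ <-; rewrite /= /pushforward /nu /density.
have [ab|ba] := leP a b; last first.
  by rewrite set_itv_ge ?bnd_simp -?leNgt ?ltW // preimage_set0 measure0 integral_set0.
have mlab : measurable (@ln R @^-1` `]a, b] : set (measurableTypeR R)).
  by have := mln measurableT `]a, b]%classic (measurable_itv _); rewrite setTI.
rewrite stieltjes_expR_oc // integral_indic //; last exact: measurable_Rpos.
transitivity (mu `]expR a, expR b]%classic).
  rewrite lebesgue_measure_itv /= lte_fin ltr_expR; case: ltP ab => // ba ab.
  have -> : a = b by apply/le_anti; rewrite ab.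
  by rewrite subrr.
congr (mu _); apply/seteqP; split => x /=; rewrite !in_itv /= ?andbT.
  move=> /andP[ax xb]; have x0 : (0 < x)%R by apply: (lt_trans _ ax); exact: expR_gt0.
  split; first by rewrite /Rpos /= in_itv /= x0.
  by rewrite -ltr_expR -ler_expR lnK ?posrE // ax xb.
move=> [x0]; have {}x0 : (0 < x)%R by move: x0; rewrite /Rpos /= in_itv /= andbT.
by rewrite -ltr_expR -ler_expR lnK ?posrE.
Qed.

Lemma integral_ln (f : R -> \bar R) : measurable_fun setT f ->
  \int[mu]_(x in @Rpos R) f (ln x) = \int[mu]_y (f y * (expR y)%:E).
Proof.
move=> mf; rewrite integralE [RHS]integralE.
congr (adde _ (oppe _)).
  transitivity (\int[mu]_(x in @Rpos R) funepos f (ln x)); first by apply: eq_integral => x _; rewrite !funeposE.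
  rewrite ge0_integral_ln //; last exact: measurable_funepos.
  by apply: eq_integral => y _; rewrite !funeposE maxe_pMl ?lee_fin ?expR_ge0 // mul0e.
transitivity (\int[mu]_(x in @Rpos R) funeneg f (ln x)); first by apply: eq_integral => x _; rewrite !funenegE.
rewrite ge0_integral_ln //; last exact: measurable_funeneg.
by apply: eq_integral => y _; rewrite !funenegE maxe_pMl ?lee_fin ?expR_ge0 // mul0e mulNe.
Qed.
End ExpChange.

(** * Integrals over the real line *)

Section LineIntegral.
Context {R : realType}.
Local Notation mu := (@lebesgue_measure R).
Implicit Types (f g : R -> R).

Definition lint f : R := Rintegral mu setT f.
Definition lintegrable f : Prop := mu.-integrable setT (EFin \o f).

Lemma lintegrable_measurable f : lintegrable f -> measurable_fun setT f.
Proof. by move=> /integrableP[] /measurable_EFinP. Qed.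

Lemma lintegrable_le f g : measurable_fun setT f -> lintegrable g ->
  (forall x, `|f x| <= g x) -> lintegrable f.
Proof.
move=> mf ig fg; apply: le_integrable ig => //; first exact/measurable_EFinP.
by move=> x _ /=; rewrite lee_fin; apply: le_trans (fg x) _; exact: ler_norm.
Qed.

Lemma lintegrableZ c f : lintegrable f -> lintegrable (fun x => c * f x).
Proof. by move=> h; exact: (@integrableZl _ _ _ mu setT measurableT c (EFin \o f) h). Qed.

Lemma lintegrableD f g : lintegrable f -> lintegrable g -> lintegrable (fun x => f x + g x).
Proof. by move=> hf hg; exact: (@integrableD _ _ _ mu setT measurableT (EFin \o f) (EFin \o g) hf hg). Qed.

Lemma lintegrableB f g : lintegrable f -> lintegrable g -> lintegrable (fun x => f x - g x).
Proof. by move=> hf hg; exact: (@integrableB _ _ _ mu setT measurableT (EFin \o f) (EFin \o g) hf hg). Qed.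

Lemma lintZ c f : lintegrable f -> lint (fun x => c * f x) = c * lint f.
Proof. by move=> h; exact: RintegralZl. Qed.

Lemma lintD f g : lintegrable f -> lintegrable g -> lint (fun x => f x + g x) = lint f + lint g.
Proof. by move=> hf hg; exact: RintegralD. Qed.

Lemma lintB f g : lintegrable f -> lintegrable g -> lint (fun x => f x - g x) = lint f - lint g.
Proof. by move=> hf hg; exact: RintegralB. Qed.

Lemma eq_lint f g : f =1 g -> lint f = lint g.
Proof. by move=> /funext ->. Qed.

Lemma lint_ge0 f : (forall x, 0 <= f x) -> 0 <= lint f.
Proof. by move=> h; apply: Rintegral_ge0. Qed.

Lemma le_lint f g : lintegrable f -> lintegrable g -> (forall x, f x <= g x) -> lint f <= lint g.
Proof.
by move=> hf hg fg; rewrite -subr_ge0 -lintB //; apply: lint_ge0 => x; rewrite subr_ge0.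
Qed.

Lemma norm_lint f g : lintegrable f -> lintegrable g -> (forall x, `|f x| <= g x) ->
  `|lint f| <= lint g.
Proof.
move=> hf hg fg; rewrite ler_norml -mulN1r -lintZ //; apply/andP; split; apply: le_lint => //.
- exact: lintegrableZ.
- by move=> x; have := fg x; rewrite ler_norml => /andP[+ _]; rewrite mulN1r.
- by move=> x; have := fg x; rewrite ler_norml => /andP[_].
Qed.

Lemma lint_shift f c : measurable_fun setT f -> lint (fun x => f (x + c)) = lint f.
Proof.
by move=> mf; congr fine; rewrite (@integral_shift R (EFin \o f)) //; exact/measurable_EFinP.
Qed.

Lemma lintegrable_shift f c : lintegrable f -> lintegrable (fun x => f (x + c)).
Proof.
move=> hf; have mf := lintegrable_measurable hf; apply/integrableP; split.
  by apply/measurable_EFinP; apply: measurableT_comp (measurable_addr c).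
rewrite (@ge0_integral_shift R (fun x => `|f x|%:E)%E) //; first by case/integrableP: hf.
by apply/measurable_EFinP; apply: measurableT_comp.
Qed.

Lemma lint_even f : continuous f -> (forall x, f (- x) = f x) -> (forall x, 0 <= f x) ->
  forall G (l : R), (forall x : R, is_derive x 1 G (f x)) -> G x @[x --> +oo] --> l ->
  lintegrable f /\ lint f = 2 * (l - G 0).
Proof.
move=> cf ev f0 G l dG Gl.
have E : (\int[mu]_x (f x)%:E = (2 * (l - G 0))%:E)%E.
  rewrite ge0_symfun_integralT //; last by move=> x; rewrite /= ev.
  rewrite -set_itvcy (@ge0_continuous_FTC2y _ f G 0 l) //.
  - exact: continuous_subspaceT.
  - apply: cvg_at_right_filter; apply/differentiable_continuous/derivable1_diffP; exact: ex_derive.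
  - by move=> x _; rewrite derive1E derive_val.
split; last by rewrite /lint /Rintegral E.
apply/integrableP; split; first by apply/measurable_EFinP; exact: continuous_measurable_fun.
rewrite (_ : (fun x => `|(EFin \o f) x|)%E = fun x => (f x)%:E) ?E ?ltry //.
by apply/funext => x /=; rewrite ger0_norm.
Qed.

Lemma lint_cvg (F : nat -> R -> R) f g : (forall n, measurable_fun setT (F n)) ->
  measurable_fun setT f -> (forall x, (fun n => F n x) @ \oo --> f x) ->
  lintegrable g -> (forall n x, `|F n x| <= g x) ->
  (fun n => lint (F n)) @ \oo --> lint f.
Proof.
move=> mF mf Ff ig Fg.
have [||||i _ c] := @dominated_convergence _ _ _ mu setT measurableT (fun n => EFin \o F n) (EFin \o f) (EFin \o g) _ _ _ ig _.
- by move=> n; apply/measurable_EFinP; exact: mF.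
- exact/measurable_EFinP.
- by apply: aeW => x _ /=; apply/cvg_EFin; [exact: nearW|exact: Ff].
- by apply: aeW => x n _; rewrite lee_fin.
rewrite /lint /Rintegral; apply: fine_cvg; rewrite fineK //.
exact: integrable_fin_num.
Qed.

Lemma lint_FTC G g (A B : R) : (forall x : R, is_derive x 1 G (g x)) -> continuous g ->
  lintegrable g -> (fun n : nat => G n%:R) @ \oo --> A -> (fun n : nat => G (- n%:R)) @ \oo --> B ->
  lint g = A - B.
Proof.
move=> dG cg ig GA GB.
have mg := lintegrable_measurable ig.
have cG x : {for x, continuous G}.
  by apply/differentiable_continuous/derivable1_diffP; exact: ex_derive.
(* The interval starts at [n.+1], since the fundamental theorem of calculus asks for distinct end
   points. *)
pose F n x := g x * \1_(`[- n.+1%:R, n.+1%:R]%classic : set R) x.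
have mF n : measurable_fun setT (F n).
  by apply: measurable_funM => //; exact: measurable_indic (measurable_itv _).
have FE n : lint (F n) = G n.+1%:R - G (- n.+1%:R).
  have -> : G n.+1%:R - G (- n.+1%:R) = Rintegral mu `[- n.+1%:R, n.+1%:R]%classic g.
    rewrite /Rintegral (@continuous_FTC2 _ g G) //.
    - by have := ltr0Sn R n; lra.
    - exact: continuous_subspaceT.
    - split; first by move=> x _; exact: ex_derive.
      by apply: cvg_at_right_filter; exact: cG.
      by apply: cvg_at_left_filter; exact: cG.
    - by move=> x _; rewrite derive1E derive_val.
  rewrite Rintegral_mkcond; apply: eq_lint => x; rewrite patchE /F indicE.
  by case: (_ \in _); rewrite ?mulr1 ?mulr0.
have FB n x : `|F n x| <= `|g x|.
  by rewrite /F indicE; case: (_ \in _); rewrite ?mulr1 ?mulr0 ?normr0.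
have L : (fun n => lint (F n)) @ \oo --> lint g.
  apply: (@lint_cvg F g (fun x => `|g x|)) => //; last exact: integrable_norm ig.
  move=> x; apply: cvg_near_cst; exists (Num.bound `|x|) => // n /= hn.
  rewrite /F indicE mem_set ?mulr1 //= in_itv /=.
  have h : `|x| < n.+1%:R.
    apply: lt_le_trans (archi_boundP (normr_ge0 x)) _; rewrite ler_nat.
    exact: leq_trans hn (leqnSn n).
  by move: h; rewrite ltr_norml => /andP[h1 h2]; rewrite !ltW.
have L2 : (fun n => lint (F n)) @ \oo --> A - B.
  under eq_fun do rewrite FE.
  by apply: cvgB; rewrite (cvg_shiftS (fun n => G _)) // (cvg_shiftS (fun n => G (- n%:R))).
exact: (cvg_unique _ L L2).
Qed.

Local Notation mu2 := (mu \x mu)%E.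

Lemma lint_fubini (f : R * R -> R) : mu2.-integrable setT (EFin \o f) ->
  lint (fun x => lint (fun y => f (x, y))) = lint (fun y => lint (fun x => f (x, y))).
Proof.

(* The inner integrals of an integrable function are finite only almost everywhere, so [fine] is
   removed almost everywhere. *)
have fineae (h : R -> \bar R) : mu.-integrable setT h -> lint (fun x => fine (h x)) = fine (\int[mu]_x h x)%E.
  move=> ih; congr fine; have mh := measurable_int mu ih.
  apply: ae_eq_integral => //; first exact/measurable_EFinP/measurableT_comp.
  have := integrable_ae measurableT ih; apply: filterS => x /= hx _; by rewrite fineK ?hx.
move=> hf; have mf := measurable_int (mu \x mu)%E hf.
have iF := integrable_fubini_F hf.
have iG : mu.-integrable setT (fubini_G mu (EFin \o f)).
  apply/integrableP; split; first exact (measurable_fubini_G hf).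
  apply: le_lt_trans ((integrable21ltyP _ _ mf).1 hf).
  apply: ge0_le_integral => //.
  - by apply: measurableT_comp => //; exact (measurable_fubini_G hf).
  - have ma : measurable_fun setT (abse \o (EFin \o f)) by exact: measurableT_comp.
    exact (@measurable_fun_fubini_tonelli_G _ _ (measurableTypeR R) (measurableTypeR R) R mu _ ma (fun z => abse_ge0 _)).
  - move=> y _; apply: le_abse_integral => //.
    exact: measurableT_comp.
rewrite [LHS]fineae // [RHS]fineae //; congr fine; exact (Fubini hf).
Qed.
End LineIntegral.

(** * Derivatives and elementary inequalities *)

Section Derivatives.
Context {R : realType}.
Implicit Types (f g : R -> R) (a b c x : R).

Lemma dv_eq f x a b : is_derive x (1 : R) f a -> a = b -> is_derive x (1 : R) f b.
Proof. by move=> h <-. Qed.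

Lemma dvM f g x a b : is_derive x 1 f a -> is_derive x 1 g b ->
  is_derive x (1 : R) (fun y => f y * g y) (a * g x + f x * b).
Proof. by move=> df dg; apply: is_derive_eq; rewrite /GRing.scale /=; ring. Qed.

Lemma dvD f g x a b : is_derive x 1 f a -> is_derive x 1 g b ->
  is_derive x (1 : R) (fun y => f y + g y) (a + b).
Proof. by move=> df dg; apply: is_deriveD. Qed.

Lemma dvB f g x a b : is_derive x 1 f a -> is_derive x 1 g b ->
  is_derive x (1 : R) (fun y => f y - g y) (a - b).
Proof. by move=> df dg; apply: is_deriveB. Qed.

Lemma dvZ c f x a : is_derive x 1 f a -> is_derive x (1 : R) (fun y => c * f y) (c * a).
Proof. by move=> df; apply: (@is_deriveZ _ _ _ f c x 1 a). Qed.

Lemma dvX f n x a : is_derive x 1 f a ->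
  is_derive x (1 : R) (fun y => f y ^+ n.+1) (n.+1%:R * f x ^+ n * a).
Proof.
move=> df; elim: n => [|n IH].
  by rewrite (_ : (fun y => _) = f) ?expr0 ?mul1r //; apply/funext => y; rewrite expr1.
rewrite (_ : (fun y => _) = fun y => f y * f y ^+ n.+1); last by apply/funext => y; rewrite -exprS.
by apply: (dv_eq (dvM df IH)); rewrite [f x ^+ n.+1]exprS -[n.+2%:R]natr1; ring.
Qed.

Lemma dvV f x a : f x != 0 -> is_derive x 1 f a ->
  is_derive x (1 : R) (fun y => (f y)^-1) (- a * (f x ^- 2)).
Proof.
move=> f0 df; have h := @is_deriveV R f x a 1 f0 df.
by apply: (dv_eq h); rewrite /GRing.scale /=; ring.
Qed.

Lemma dv_comp f g x a b : is_derive (g x) 1 f a -> is_derive x 1 g b ->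
  is_derive x (1 : R) (fun y => f (g y)) (a * b).
Proof. exact: is_derive1_comp. Qed.

Lemma dv_id x : is_derive x (1 : R) (fun y : R => y) 1.
Proof. exact: is_derive_id. Qed.

Lemma dv_cst c x : is_derive x (1 : R) (fun=> c) 0.
Proof. exact: is_derive_cst. Qed.

Lemma dv_lin c x : is_derive x (1 : R) (fun y => c * y) c.
Proof. by have := @dvZ c _ x _ (dv_id x); rewrite mulr1. Qed.

Lemma dv_sin c x : is_derive x (1 : R) (fun y => sin (c * y)) (c * cos (c * x)).
Proof. by rewrite mulrC; apply: (@dv_comp sin (fun y => c * y)); exact: dv_lin. Qed.

Lemma dv_cos c x : is_derive x (1 : R) (fun y => cos (c * y)) (- c * sin (c * x)).
Proof.
have -> : - c * sin (c * x) = (- sin (c * x)) * c by ring.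
by apply: (@dv_comp cos (fun y => c * y)); exact: dv_lin.
Qed.

Lemma dv_exp c x : is_derive x (1 : R) (fun y => expR (c * y)) (c * expR (c * x)).
Proof. by rewrite mulrC; apply: (@dv_comp (@expR R) (fun y => c * y)); exact: dv_lin. Qed.

Lemma dv_cosh c x : is_derive x (1 : R) (fun y => coshR (c * y)) (c * sinhR (c * x)).
Proof.
rewrite (_ : (fun y => _) = fun y => 2^-1 * (expR (c * y) + expR (- c * y))); last first.
  by apply/funext => y; rewrite /coshR mulNr mulrC.
apply: (dv_eq (dvZ 2^-1 (dvD (dv_exp c x) (dv_exp (- c) x)))).
by rewrite /sinhR !mulNr; ring.
Qed.

Lemma dv_sinh c x : is_derive x (1 : R) (fun y => sinhR (c * y)) (c * coshR (c * x)).
Proof.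
rewrite (_ : (fun y => _) = fun y => 2^-1 * (expR (c * y) - expR (- c * y))); last first.
  by apply/funext => y; rewrite /sinhR mulNr mulrC.
apply: (dv_eq (dvZ 2^-1 (dvB (dv_exp c x) (dv_exp (- c) x)))).
by rewrite /coshR !mulNr; ring.
Qed.

Lemma dv_continuous f (df : R -> R) : (forall x : R, is_derive x 1 f (df x)) -> continuous f.
Proof.
by move=> h x; apply/differentiable_continuous/derivable1_diffP; exact: ex_derive.
Qed.

Lemma dv_ndecr f (df : R -> R) a b : (forall x : R, is_derive x 1 f (df x)) ->
  (forall x, a <= x <= b -> 0 <= df x) -> a <= b -> f a <= f b.
Proof.
move=> h d0 ab.
have cf : {within `[a, b], continuous f} by apply: continuous_subspaceT; exact: dv_continuous h.
have [c] := @MVT_segment R f df a b ab (fun x _ => h x) cf.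
rewrite in_itv /= => hc E; rewrite -subr_ge0 E mulr_ge0 ?subr_ge0 //; exact: d0.
Qed.

Lemma sin_le_id x : 0 <= x -> sin x <= x.
Proof.
move=> x0; rewrite -subr_ge0.
have := @dv_ndecr (fun y => y - sin (1 * y)) _ 0 x (fun y => dvB (dv_id y) (dv_sin 1 y)).
by rewrite !mulr0 sin0 subrr mul1r; apply => // y _; rewrite !mul1r subr_ge0 cos_le1.
Qed.

Lemma one_sub_cos_le x : 1 - cos x <= x ^+ 2 / 2.
Proof.
wlog x0 : x / 0 <= x.
  move=> H; case: (leP 0 x) => [/H //|xl]; rewrite -cosN -sqrrN; apply: H; lra.
have := @dv_ndecr (fun y => 2^-1 * y ^+ 2 - (1 - cos (1 * y))) _ 0 x
  (fun y => dvB (dvZ 2^-1 (dvX 1 (dv_id y))) (dvB (dv_cst 1 y) (dv_cos 1 y))).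
rewrite expr0n /= !mulr0 cos0 !subrr mul1r => h.
suff : 0 <= 2^-1 * x ^+ 2 - (1 - cos x) by lra.
apply: h => // y /andP[y0 _].
by have := sin_le_id y0; rewrite !mul1r expr1; lra.
Qed.

Lemma mulcos_le_sin x : 0 <= x <= pi / 2 -> x * cos x <= sin x.
Proof.
move=> /andP[x0 xp]; rewrite -subr_ge0.
have := @dv_ndecr (fun y => sin (1 * y) - y * cos (1 * y)) _ 0 x
  (fun y => dvB (dv_sin 1 y) (dvM (dv_id y) (dv_cos 1 y))).
rewrite mul0r mulr0 sin0 subrr mul1r; apply => // y /andP[y0 yx]; rewrite !mul1r mulN1r.
have : 0 <= sin y by apply: sin_ge0_pi; have := pi_gt0 R; lra.
by move: (sin y) (cos y) => s c s0; nra.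
Qed.
End Derivatives.

(** * The sech weight and its moments *)

Section Kappa.
Context {R : realType}.
Implicit Types (u a : R) (n : nat).

(** Half of [sech (u / 2)], equal to [e^(u/2) / (1 + e^u)]: the weight of the Beta integral in
    logarithmic coordinates. The Hankel kernel [1 / (t + s)] produces the same weight
    ([kap_log]). *)
Definition kap u : R := (2 * coshR (2^-1 * u))^-1.

Lemma kap_gt0 u : 0 < kap u. Proof. by rewrite invr_gt0 mulr_gt0 ?coshR_gt0. Qed.
Lemma kap_ge0 u : 0 <= kap u. Proof. exact: ltW (kap_gt0 u). Qed.
Lemma kapN u : kap (- u) = kap u. Proof. by rewrite /kap mulrN coshRN. Qed.

Lemma kap_le u : kap u <= 2^-1.
Proof. by rewrite /kap -div1r ler_pdivrMr; have := coshR_ge1 (2^-1 * u); lra. Qed.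

Lemma dv_kap u : is_derive u (1 : R) kap (- (sinhR (2^-1 * u) * kap u ^+ 2)).
Proof.
have h : is_derive u (1 : R) (fun y : R => 2 * coshR (2^-1 * y)) (2 * (2^-1 * sinhR (2^-1 * u))).
  by apply: dvZ; exact: dv_cosh.
have n0 : 2 * coshR (2^-1 * u) != 0 :> R by rewrite mulf_neq0 ?coshR_neq0.
have H := @dvV _ (fun y : R => 2 * coshR (2^-1 * y)) u _ n0 h.
have -> : kap = (fun y : R => (2 * coshR (2^-1 * y))^-1) by [].
apply: (dv_eq H).
by rewrite /kap exprVn mulrA mulfV // mul1r mulNr.
Qed.

Lemma continuous_kap : continuous (kap : R -> R).
Proof. exact: dv_continuous dv_kap. Qed.

Lemma measurable_kap : measurable_fun setT (kap : R -> R).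
Proof. exact: continuous_measurable_fun continuous_kap. Qed.

Lemma kap_integral : lintegrable (kap : R -> R) /\ lint (kap : R -> R) = pi.
Proof.
have := @lint_even R kap continuous_kap kapN kap_ge0 (fun u => 2 * atan (expR (2^-1 * u))) pi.
have -> : 2 * (pi - 2 * atan (expR (2^-1 * 0))) = pi :> R.
  by rewrite mulr0 expR0 atan1; move: (pi : R) => p; lra.
apply.
  move=> u; apply: (dv_eq (dvZ 2 (dv_comp (is_derive1_atan _) (dv_exp 2^-1 u)))).
  rewrite /kap /coshR expRN; have := expR_gt0 (2^-1 * u); move: (expR _) => E E0.
  have h1 : E * E + 1 != 0 by rewrite gt_eqF //; nra.
  have h2 : 1 + E ^+ 2 != 0 by rewrite gt_eqF //; nra.
  by field; rewrite ?h1 ?h2 gt_eqF.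
rewrite [X in _ --> X](_ : _ = 2 * (pi / 2)); last by move: (pi : R) => p; lra.
apply: cvgM; first exact: cvg_cst.
apply: (@cvg_comp _ _ _ (fun x : R => expR (2^-1 * x)) atan _ (+oo)%R) => //; last exact: cvgy_atan.
apply: (@ger_cvgy _ _ _ _ (fun x : R => 2^-1 * x)); last by apply: gt0_cvgMry => //; exact: cvg_id.
by apply: nearW => x; apply: le_trans (expR_ge1Dx _); lra.
Qed.

Lemma kap_pow_le n u : kap u ^+ n.+1 <= kap u.
Proof.
rewrite exprS -[leRHS]mulr1 ler_wpM2l ?kap_ge0 // exprn_ile1 ?kap_ge0 //.
by apply: le_trans (kap_le u) _; lra.
Qed.

Lemma kap_dominated (f : R -> R) (M : R) : measurable_fun setT f ->
  (forall u, `|f u| <= M * kap u) -> lintegrable f.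
Proof.
by move=> mf h; apply: (lintegrable_le mf _ h); apply: lintegrableZ; case: kap_integral.
Qed.

Lemma kap_expR u : kap u <= expR (- (2^-1 * u)).
Proof.
have := coshR_gt0 (2^-1 * u); move=> c0; rewrite /kap -[leLHS]div1r ler_pdivrMr; last lra.
rewrite /coshR.
by have := expRxMexpNx_1 (2^-1 * u); have := expR_gt0 (- (2^-1 * u)); nra.
Qed.

Lemma kap_cvg0 : (fun n : nat => kap n%:R) @ \oo --> 0.
Proof.
rewrite -(cvg_shiftS (fun n : nat => kap n%:R)).
apply: (@squeeze_cvgr _ _ _ _ (fun=> 0) (fun n => 2 * harmonic n)).
- apply: nearW => n; rewrite kap_ge0 /=; apply: le_trans (kap_expR _) _.
  rewrite expRN /harmonic /= -[2]invrK -invfM lef_pV2 ?posrE ?expR_gt0 ?mulr_gt0 ?ltr0Sn //.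
  by apply: le_trans (expR_ge1Dx _); lra.
- exact: cvg_cst.
- by rewrite -[X in _ --> X](mulr0 2); apply: cvgM; [exact: cvg_cst|exact: cvg_harmonic].
Qed.
End Kappa.

Section SechTransform.
Context {R : realType}.
Local Notation mu := (@lebesgue_measure R).
Implicit Types (u a t : R) (n : nat).

Lemma measurable_cosl a : measurable_fun setT (fun u : R => cos (a * u)).
Proof. exact: continuous_measurable_fun (dv_continuous (dv_cos a)). Qed.

Lemma measurable_sinl a : measurable_fun setT (fun u : R => sin (a * u)).
Proof. exact: continuous_measurable_fun (dv_continuous (dv_sin a)). Qed.

Lemma cvg0_le (f g : nat -> R) (M : R) : (forall n, `|f n| <= M * g n) -> g @ \oo --> 0 ->
  f @ \oo --> 0.
Proof.
move=> fg g0; apply/norm_cvg0P; apply: (@squeeze_cvgr _ _ _ _ (fun=> 0) (fun n => M * g n)).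
- by apply: nearW => n; rewrite normr_ge0 /=.
- exact: cvg_cst.
- by rewrite -[X in _ --> X](mulr0 M); apply: cvgM => //; exact: cvg_cst.
Qed.

(** Only [sechJ 0], the Fourier transform of [kap], is wanted; the higher powers concentrate near 0
    and provide the limit in the recursion. *)
Definition sechJ n a : R := lint (fun u => cos (a * u) * kap u ^+ n.+1).

Lemma sechJ_int n a : lintegrable (fun u => cos (a * u) * kap u ^+ n.+1).
Proof.
apply: (@kap_dominated _ _ 1).
  by apply: measurable_funM; [exact: measurable_cosl|apply: measurable_funX; exact: measurable_kap].
move=> u; rewrite mul1r normrM (ger0_norm (exprn_ge0 _ (kap_ge0 u))).
apply: le_trans (ler_piMl _ (cos_max _)) (kap_pow_le _ _); exact: exprn_ge0 (kap_ge0 u).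
Qed.

Lemma kap_cosh u : 2 * coshR (2^-1 * u) * kap u = 1.
Proof. by rewrite /kap mulfV // mulf_neq0 ?coshR_neq0. Qed.

Lemma kap_sinh u : (sinhR (2^-1 * u) * kap u) ^+ 2 = 4^-1 - kap u ^+ 2.
Proof.
have := coshR_sqr (2^-1 * u); have := kap_cosh u.
move: (coshR _) (sinhR _) (kap u) => c S k e1 e2.
have -> : 4^-1 = (c * k) ^+ 2 :> R by rewrite (_ : c * k = 2^-1); [rewrite exprVn -natrX|lra].
by rewrite exprMn (_ : S ^+ 2 = c ^+ 2 - 1); [ring|lra].
Qed.

Lemma kap_sinh_le u : `|sinhR (2^-1 * u) * kap u| <= 1.
Proof.
rewrite -(@ler_pXn2r _ 2) ?nnegrE // -normrX ger0_norm ?sqr_ge0 // kap_sinh expr1n.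
by have := sqr_ge0 (kap u); lra.
Qed.

Lemma sechJ_rec n a :
  n.+2%:R * sechJ n.+2 a = (n.+1%:R / 4 + a ^+ 2 / n.+1%:R) * sechJ n a.
Proof.
set m : R := n.+1%:R; have m0 : m != 0 by rewrite pnatr_eq0.
(* The boundary term of two integrations by parts. The coefficient [a / m] makes the terms with
   [sin (a * u) * sinhR (2^-1 * u)] cancel in the derivative. *)
pose G u := cos (a * u) * (sinhR (2^-1 * u) * kap u ^+ n.+2) - a / m * (sin (a * u) * kap u ^+ n.+1).
pose g u := n.+2%:R * (cos (a * u) * kap u ^+ n.+3) - (m / 4 + a ^+ 2 / m) * (cos (a * u) * kap u ^+ n.+1).
have dG (u : R) : is_derive u 1 G (g u).
  have D := dvB (dvM (dv_cos a u) (dvM (dv_sinh 2^-1 u) (dvX n.+1 (dv_kap u))))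
    (dvZ (a / m) (dvM (dv_sin a u) (dvX n (dv_kap u)))).
  apply: (dv_eq D); rewrite /g -[n.+2%:R]natr1 -/m !exprS expr0.
  have := coshR_sqr (2^-1 * u); have := kap_cosh u.
  move: (coshR _) (sinhR _) (kap u) (cos _) (sin _) (kap u ^+ n) => c S k cs sn K e1 e2.
  (* The two sides agree only modulo [2 * c * k = 1] and [c ^+ 2 = 1 + S ^+ 2]; the added summand is
     the multiple of these relations that turns the equation into a field identity. *)
  transitivity ((m + 1) * (cs * (k * (k * (k * K)))) - (m / 4 + a * (a * 1) / m) * (cs * (k * K)) +
    cs * K * (k / 4 * (1 - (m + 1) * (2 + (2 * c * k - 1))) * (2 * c * k - 1) - (m + 1) * k ^+ 3 * (S ^+ 2 - c ^+ 2 + 1))).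
    by field.
  by rewrite e1 e2; ring.
have ig : lintegrable g by apply: lintegrableB; apply: lintegrableZ; exact: sechJ_int.
have GB u : `|G u| <= (1 + `|a|) * kap u.
  rewrite /G; apply: le_trans (ler_normB _ _) _; rewrite mulrDl; apply: lerD.
    rewrite exprS (mulrA (sinhR _)) mulrA normrM mul1r.
    have h := kap_pow_le n u; rewrite (ger0_norm (exprn_ge0 _ (kap_ge0 u))).
    apply: le_trans h; apply: ler_piMl; first exact: exprn_ge0 (kap_ge0 u).
    by rewrite normrM mulr_ile1 ?cos_max ?kap_sinh_le.
  rewrite !normrM (ger0_norm (exprn_ge0 _ (kap_ge0 u))) -!mulrA ler_wpM2l //.
  rewrite mulrA; apply: le_trans (kap_pow_le n u); apply: ler_piMl; first exact: exprn_ge0 (kap_ge0 u).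
  rewrite mulr_ile1 ?sin_max // normfV ger0_norm ?ler0n // invf_le1 ?ltr0n // ler1n //.
have := @lint_FTC R G g 0 0 dG.
rewrite subrr => H; have {H} : lint g = 0.
  apply: H => //.
  - rewrite /g; apply: (@dv_continuous _ _ (fun u => n.+2%:R * (- a * sin (a * u) * kap u ^+ n.+3 + cos (a * u) * (n.+3%:R * kap u ^+ n.+2 * (- (sinhR (2^-1 * u) * kap u ^+ 2)))) - (m / 4 + a ^+ 2 / m) * (- a * sin (a * u) * kap u ^+ n.+1 + cos (a * u) * (n.+1%:R * kap u ^+ n * (- (sinhR (2^-1 * u) * kap u ^+ 2)))))) => u.
    apply: dvB; apply: dvZ; apply: dvM; try exact: dv_cos; apply: dvX; exact: dv_kap.
  - by apply: (cvg0_le (fun n : nat => GB n%:R)); exact: kap_cvg0.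
  - by apply: (cvg0_le (fun n : nat => GB (- n%:R))); under eq_fun do rewrite kapN; exact: kap_cvg0.
rewrite /g lintB; [|by apply: lintegrableZ; exact: sechJ_int..].
by rewrite !lintZ; [move/eqP; rewrite subr_eq0 => /eqP|exact: sechJ_int..].
Qed.

Lemma sinhR_ge u : u ^+ 2 <= 16 * sinhR (2^-1 * u) ^+ 2.
Proof.
wlog u0 : u / 0 <= u.
  move=> H; case: (leP 0 u) => [/H //|ul]; rewrite -sqrrN.
  have -> : sinhR (2^-1 * u) ^+ 2 = sinhR (2^-1 * - u) ^+ 2 by rewrite mulrN sinhRN sqrrN.
  by apply: H; lra.
have h : 2^-1 * u <= 2 * sinhR (2^-1 * u).
  have v0 : 0 <= 2^-1 * u by lra.
  rewrite /sinhR expRN; have := expR_ge1Dx (2^-1 * u); move: (2^-1 * u) v0 (expR _) => v v0 E hE.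
  have E0 : 0 < E by lra.
  have hi : E^-1 <= (1 + v)^-1 by rewrite lef_pV2 ?posrE //; lra.
  have : 1 + v - (1 + v)^-1 >= v.
    have : (1 + v)^-1 <= 1 by rewrite invf_le1; lra.
    lra.
  lra.
have s0 : 0 <= sinhR (2^-1 * u) by lra.
nra.
Qed.

(** After [1 - cos (a u) <= (a u)^2 / 2], the factor [u^2] is absorbed by
    [u^2 kap^2 <= 16 (1/4 - kap^2)]. This leaves a difference of consecutive moments at [a = 0],
    which the recursion makes small of order [1 / n]. *)
Lemma sechJ_bound n a : 0 <= sechJ n.+2 0 - sechJ n.+2 a <= 2 * a ^+ 2 * (sechJ n 0 - 4 * sechJ n.+2 0).
Proof.
rewrite -lintB; [|exact: sechJ_int..]; apply/andP; split.
  apply: lint_ge0 => u; rewrite -mulrBl mulr_ge0 ?exprn_ge0 ?kap_ge0 //.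
  by rewrite mul0r cos0 subr_ge0 cos_le1.
rewrite -lintZ; last exact: sechJ_int.
have i1 := sechJ_int n.+2 0; have i2 := sechJ_int n 0.
rewrite -lintB; [|exact: i2|exact: lintegrableZ].
rewrite -lintZ; last by apply: lintegrableB => //; exact: lintegrableZ.
apply: le_lint; first by apply: lintegrableB; exact: sechJ_int.
  by apply: lintegrableZ; apply: lintegrableB => //; exact: lintegrableZ.
move=> u; rewrite mul0r cos0 !mul1r -[X in X - _]mul1r -mulrBl.
have h1 := one_sub_cos_le (a * u); have h2 := sinhR_ge u; have h3 := kap_sinh u.
have K0 : 0 <= kap u ^+ n.+1 by exact: exprn_ge0 (kap_ge0 u).
have -> : kap u ^+ n.+3 = kap u ^+ 2 * kap u ^+ n.+1 by rewrite -exprD.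
have k2 : u ^+ 2 * kap u ^+ 2 <= 16 * (4^-1 - kap u ^+ 2).
  by rewrite -h3 exprMn [leRHS]mulrA; apply: ler_wpM2r => //; exact: sqr_ge0.
have -> : 2 * a ^+ 2 * (kap u ^+ n.+1 - 4 * (kap u ^+ 2 * kap u ^+ n.+1)) =
  a ^+ 2 / 2 * (16 * (4^-1 - kap u ^+ 2)) * kap u ^+ n.+1 by field.
rewrite mulrA; apply: ler_wpM2r => //.
apply: (@le_trans _ _ (a ^+ 2 / 2 * (u ^+ 2 * kap u ^+ 2))); last first.
  by apply: ler_wpM2l => //; rewrite divr_ge0 ?sqr_ge0.
have -> : a ^+ 2 / 2 * (u ^+ 2 * kap u ^+ 2) = (a * u) ^+ 2 / 2 * kap u ^+ 2 by field.
by apply: ler_wpM2r => //; exact: sqr_ge0.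
Qed.

Local Notation H2 := (`[0, pi / 2]%classic : set R).
Definition arc (f : R -> R) : R := Rintegral mu H2 f.

Let pih0 : 0 < pi / 2 :> R. Proof. by have := pi_gt0 R; lra. Qed.

Lemma arc_int (f : R -> R) : continuous f -> mu.-integrable H2 (EFin \o f).
Proof.
by move=> cf; apply: continuous_compact_integrable; [exact: segment_compact|exact: continuous_subspaceT].
Qed.

Lemma arc_FTC (G g : R -> R) : (forall x : R, is_derive x 1 G (g x)) -> continuous g ->
  arc g = G (pi / 2) - G 0.
Proof.
move=> dG cg; rewrite /arc /Rintegral (@continuous_FTC2 _ g G) //.
- exact: continuous_subspaceT.
- split; first by move=> x _; exact: ex_derive.
  by apply: cvg_at_right_filter; exact: dv_continuous dG _.
  by apply: cvg_at_left_filter; exact: dv_continuous dG _.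
- by move=> x _; rewrite derive1E derive_val.
Qed.

Lemma arcZ c (f : R -> R) : continuous f -> arc (fun x => c * f x) = c * arc f.
Proof. by move=> cf; apply: RintegralZl => //; exact: arc_int. Qed.

Lemma arcB (f g : R -> R) : continuous f -> continuous g ->
  arc (fun x => f x - g x) = arc f - arc g.
Proof. by move=> cf cg; apply: RintegralB => //; exact: arc_int. Qed.

Lemma le_arc (f g : R -> R) : continuous f -> continuous g ->
  (forall x, 0 <= x <= pi / 2 -> f x <= g x) -> arc f <= arc g.
Proof.
move=> cf cg fg; apply: le_Rintegral => //; try exact: arc_int.
Qed.

(** Companion moments whose recursion undoes that of [sechJ]. After normalisation [sechJ] gains the
    factors [1 + 4 a^2 / (2n + 1)^2] along even indices and [cosI] loses them along odd ones, so
    Euler's product for cosh is used without ever forming an infinite product. *)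
Definition cosI n t : R := arc (fun x => cos (1 * x) ^+ n * coshR (2 * t * x)).

Lemma dv_cosX n (x : R) : is_derive x (1 : R) (fun y => cos (1 * y) ^+ n) (n%:R * cos (1 * x) ^+ n.-1 * (- 1 * sin (1 * x))).
Proof.
case: n => [|n]; last exact: (dvX n (dv_cos 1 x)).
by rewrite !mul0r; exact: dv_cst.
Qed.

Lemma cosI_cont n t : continuous (fun x : R => cos (1 * x) ^+ n * coshR (2 * t * x)).
Proof. exact: dv_continuous (fun x => dvM (dv_cosX n x) (dv_cosh (2 * t) x)). Qed.

Lemma continuousZ' c (f : R -> R) : continuous f -> continuous (fun x => c * f x).
Proof. by move=> cf x; apply: cvgM; [exact: cvg_cst|exact: cf]. Qed.

Lemma continuousB' (f g : R -> R) : continuous f -> continuous g -> continuous (fun x => f x - g x).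
Proof. by move=> cf cg x; apply: cvgB; [exact: cf|exact: cg]. Qed.

Lemma cosI_rec n t :
  n.+2%:R * n.+1%:R * cosI n t = (n.+2%:R ^+ 2 + 4 * t ^+ 2) * cosI n.+2 t.
Proof.
apply/eqP; rewrite eq_sym -subr_eq0 -!arcZ; try exact: cosI_cont.
rewrite -arcB; try by apply: continuousZ'; exact: cosI_cont.
have D (x : R) := dvD (dvZ n.+2%:R (dvM (dv_cosX n.+1 x) (dvM (dv_sin 1 x) (dv_cosh (2 * t) x))))
  (dvZ (2 * t) (dvM (dv_cosX n.+2 x) (dv_sinh (2 * t) x))).
rewrite (@arc_FTC _ _ (fun x => dv_eq (D x) _)); first last.
- by apply: continuousB'; apply: continuousZ'; exact: cosI_cont.
- move=> x /=; have := cos2Dsin2 (1 * x); rewrite -[n.+2%:R]natr1 !exprS !expr0.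
  move: (cos _) (sin _) (coshR _) (sinhR _) (cos _ ^+ n) (n.+1%:R : R) => c s ch sh K m e.
  transitivity (((m + 1) * ((m + 1) * 1) + 4 * (t * (t * 1))) * (c * (c * K) * ch) - (m + 1) * m * (K * ch)
    - (m + 1) * m * K * ch * (c * (c * 1) + s * (s * 1) - 1)); first by ring.
  by rewrite e; ring.
by rewrite !mul1r !mulr0 cos_pihalf sin0 /sinhR oppr0 subrr !exprS !(mul0r,mulr0) !addr0 subrr.
Qed.

Lemma cosI_1 t : (1 + 4 * t ^+ 2) * cosI 1 t = coshR (pi * t).
Proof.
rewrite -arcZ; last exact: cosI_cont.
have D (x : R) := dvD (dvM (dv_sin 1 x) (dv_cosh (2 * t) x))
  (dvZ (2 * t) (dvM (dv_cos 1 x) (dv_sinh (2 * t) x))).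
rewrite (@arc_FTC _ _ (fun x => dv_eq (D x) _)); first last.
- by apply: continuousZ'; exact: cosI_cont.
- by move=> x /=; rewrite expr1; ring.
rewrite !mul1r !mulr0 cos_pihalf sin_pihalf sin0 /sinhR oppr0 subrr !(mul0r,mulr0) !addr0 subr0 mul1r.
by congr coshR; field.
Qed.

Lemma cosI_gt0 n t : 0 < cosI n t.
Proof.
suff h m : 0 < cosI m t /\ 0 < cosI m.+1 t by case: (h n).
have r0 (k : nat) : 0 < k.+2%:R * k.+1%:R :> R by rewrite mulr_gt0 ?ltr0n.
elim: m => [|m [h1 h2]].
  have h1 : 0 < cosI 1 t.
    have := coshR_gt0 (pi * t); rewrite -cosI_1 pmulr_rgt0 //; have := sqr_ge0 t; lra.
  split => //; apply: lt_le_trans h1 _.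
  apply: le_arc; try exact: cosI_cont.
  move=> x hx; rewrite expr0 expr1; apply: ler_wpM2r; first exact: ltW (coshR_gt0 _).
  exact: cos_le1.
split => //; have := mulr_gt0 (r0 m) h1; rewrite cosI_rec pmulr_rgt0 //.
have : 0 < m.+2%:R :> R by rewrite ltr0n.
by have := sqr_ge0 t; nra.
Qed.

Lemma cosh_sub1_le (y : R) : 0 <= y -> coshR y - 1 <= y ^+ 2 * expR y / 2.
Proof.
move=> y0; rewrite /coshR; have h1 := expR_ge1Dx (- y); have h3 := expR_ge1Dx y; have h2 := expRxMexpNx_1 y.
have := expR_gt0 y; have := expR_gt0 (- y); move: (expR y) (expR (- y)) h1 h2 h3 => E e h1 h2 h3 e0 E0.
have a1 : E - 1 <= y * E by nra.
have a2 : 0 <= E - 1 by lra.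
have -> : (E + e) / 2 - 1 = e * (E - 1) ^+ 2 / 2 by rewrite (_ : e * (E - 1) ^+ 2 = (E * e) * E - 2 * (E * e) + e); [rewrite h2; lra|ring].
have -> : y ^+ 2 * E / 2 = e * (y * E) ^+ 2 / 2 by rewrite (_ : e * (y * E) ^+ 2 = y ^+ 2 * E * (E * e)); [rewrite h2; lra|ring].
by rewrite ler_pM2r ?invr_gt0 // ler_wpM2l ?(ltW e0) // ler_pXn2r ?nnegrE //; nra.
Qed.

(** The analogue of [sechJ_bound]: [cosh y - 1 <= y^2 e^y / 2] at [y = 2 t x <= pi t], and
    [x cos x <= sin x] turns [x^2 cos^2 x] into [1 - cos^2 x]. *)
Lemma cosI_bound n t : 0 <= t ->
  0 <= cosI n.+2 t - cosI n.+2 0 <= 2 * t ^+ 2 * expR (pi * t) * (cosI n 0 - cosI n.+2 0).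
Proof.
move=> t0; have cc k s := @cosI_cont k s.
rewrite -!arcB; try exact: cc.
rewrite -arcZ; last by apply: continuousB'; exact: cc.
apply/andP; split.
  apply: Rintegral_ge0 => x /=; rewrite in_itv /= => /andP[x0 xp].
  rewrite -mulrBr mulr_ge0 //; last by rewrite mulr0 mul0r coshR0 subr_ge0 coshR_ge1.
  by apply: exprn_ge0; rewrite mul1r cos_ge0_pihalf //; lra.
apply: le_arc.
- by apply: continuousB'; exact: cc.
- by apply: continuousZ'; apply: continuousB'; exact: cc.
move=> x /andP[x0 xp]; rewrite !mulr0 !mul0r coshR0 !mulr1 mul1r.
have c0 : 0 <= cos x by rewrite cos_ge0_pihalf //; lra.
have -> : cos x ^+ n.+2 = cos x * (cos x * cos x ^+ n) by rewrite !exprS.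
have K0 := exprn_ge0 n c0.
have hs := @mulcos_le_sin R x; have {}hs : x * cos x <= sin x by apply: hs; rewrite x0.
have hcs := cos2Dsin2 x.
have y0 : 0 <= 2 * t * x by rewrite !mulr_ge0.
have hc := cosh_sub1_le y0.
have hE : expR (2 * t * x) <= expR (pi * t) by rewrite ler_expR; nra.
set c := cos x in c0 hs hcs *; set s := sin x in hs hcs *; set K := c ^+ n in K0 *.
set E := expR (pi * t) in hE *.
have E0 : 0 < E by exact: expR_gt0.
have hcx : (c * x) ^+ 2 <= s ^+ 2 by rewrite ler_pXn2r ?nnegrE ?mulr_ge0 //; nra.
have hs2 : s ^+ 2 = 1 - c * c by rewrite -hcs expr2; ring.
have hch : coshR (2 * t * x) - 1 <= 2 * t ^+ 2 * E * x ^+ 2.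
  apply: le_trans hc _; have -> : 2 * t ^+ 2 * E * x ^+ 2 = (2 * t * x) ^+ 2 * E / 2 by field.
  by rewrite ler_pM2r ?invr_gt0 // ler_wpM2l // sqr_ge0.
have -> : c * (c * K) * coshR (2 * t * x) - c * (c * K) = (c * c * (coshR (2 * t * x) - 1)) * K by ring.
have -> : 2 * t ^+ 2 * E * (K - c * (c * K)) = (2 * t ^+ 2 * E * (1 - c * c)) * K by ring.
apply: ler_wpM2r => //; rewrite -hs2.
have T0 : 0 <= 2 * t ^+ 2 * E by rewrite !mulr_ge0 ?sqr_ge0 // ltW.
apply: (@le_trans _ _ (c * c * (2 * t ^+ 2 * E * x ^+ 2))); first by rewrite ler_wpM2l // mulr_ge0.
have -> : c * c * (2 * t ^+ 2 * E * x ^+ 2) = 2 * t ^+ 2 * E * (c * x) ^+ 2 by rewrite exprMn; ring.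
by rewrite ler_wpM2l.
Qed.
End SechTransform.

Section SechFormula.
Context {R : realType}.
Local Notation mu := (@lebesgue_measure R).
Implicit Types (u a t : R) (n : nat).

Lemma sechJ_gt0 n : 0 < sechJ n.*2 (0 : R).
Proof.
elim: n => [|n IH].
  rewrite /sechJ (eq_lint (g := kap)); last by move=> u; rewrite mul0r cos0 mul1r expr1.
  by rewrite (proj2 kap_integral) pi_gt0.
rewrite doubleS; have := @sechJ_rec R n.*2 0.
rewrite expr0n /= mul0r addr0 => h.
have : 0 < n.*2.+2%:R * sechJ n.*2.+2 (0 : R) by rewrite h mulr_gt0 // divr_gt0 ?ltr0n.
by rewrite pmulr_rgt0 // ltr0n.
Qed.

Lemma one_sub_div (x y : R) : y != 0 -> 1 - x / y = (y - x) / y.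
Proof. by move=> y0; rewrite mulrBl divff. Qed.

Lemma div_sub_one (x y : R) : y != 0 -> x / y - 1 = (x - y) / y.
Proof. by move=> y0; rewrite mulrBl divff. Qed.

Lemma cvg_of_sub0 (f : nat -> R) (l : R) : (fun n => f n - l) @ \oo --> 0 -> f @ \oo --> l.
Proof.
move=> h; have H : (fun n => (f n - l) + l) @ \oo --> 0 + l by apply: cvgD => //; exact: cvg_cst.
by move: H; rewrite add0r; under eq_fun do rewrite subrK.
Qed.

(* The recursions make [J_(n+1)(a) I_n(a)], normalised by the values at [a = 0],
   independent of [n], and the normalised factors tend to 1. *)
Lemma sech_transform a : lint (fun u => cos (a * u) * kap u) = pi / coshR (pi * a).
Proof.
wlog a0 : a / 0 <= a.
  move=> H; case: (leP 0 a) => [/H //|al].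
  rewrite -[in RHS](opprK a) mulrN coshRN -H; last lra.
  by apply: eq_lint => u; rewrite mulNr cosN.
pose x n := sechJ n.*2 a / sechJ n.*2 0; pose y n := cosI n.*2.+1 a / cosI n.*2.+1 0.
have B0 := sechJ_gt0; have C0 n := @cosI_gt0 R n 0.
have sq0 := sqr_ge0 a.
have xr n : x n.+1 = (1 + 4 * a ^+ 2 / n.*2.+1%:R ^+ 2) * x n.
  have m0 : n.*2.+1%:R != 0 :> R by rewrite pnatr_eq0.
  have m20 : n.*2.+2%:R != 0 :> R by rewrite pnatr_eq0.
  have h1 := @sechJ_rec R n.*2 a; have h2 := @sechJ_rec R n.*2 0.
  rewrite /x doubleS.
  have b := lt0r_neq0 (B0 n); have b' := lt0r_neq0 (B0 n.+1).
  move: h1 h2 b b'; rewrite doubleS expr0n /= mul0r addr0.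
  move: (sechJ n.*2.+2 a) (sechJ n.*2 a) (sechJ n.*2.+2 0) (sechJ n.*2 0) (n.*2.+1%:R : R) (n.*2.+2%:R : R) m0 m20.
  move=> j' j b' b m M m0 m20 h1 h2 b0 b'0.
  have -> : j' = (m / 4 + a ^+ 2 / m) * j / M by rewrite -h1 mulrC mulKf.
  have -> : b' = m / 4 * b / M by rewrite -h2 mulrC mulKf.
  by field; rewrite ?b0 ?b'0 ?m0 ?m20.
have yr n : y n = (1 + 4 * a ^+ 2 / n.+1.*2.+1%:R ^+ 2) * y n.+1.
  have h1 := @cosI_rec R n.*2.+1 a; have h2 := @cosI_rec R n.*2.+1 0.
  rewrite /y doubleS.
  have b := lt0r_neq0 (C0 n.*2.+1); have b' := lt0r_neq0 (C0 n.*2.+3).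
  have m0 : n.*2.+3%:R != 0 :> R by rewrite pnatr_eq0.
  have m20 : n.*2.+2%:R != 0 :> R by rewrite pnatr_eq0.
  move: h1 h2 b b'; rewrite expr0n /= mulr0 addr0.
  move: (cosI n.*2.+1 a) (cosI n.*2.+3 a) (cosI n.*2.+1 0) (cosI n.*2.+3 0) (n.*2.+3%:R : R) (n.*2.+2%:R : R) m0 m20.
  move=> j j' b b' m M m0 m20 h1 h2 b0 b'0.
  have Mm : m * M != 0 by rewrite mulf_neq0.
  have -> : j = (m ^+ 2 + 4 * a ^+ 2) * j' / (m * M) by rewrite -h1 mulrC mulKf.
  have -> : b = m ^+ 2 * b' / (m * M) by rewrite -h2 mulrC mulKf.
  by field; rewrite ?b0 ?b'0 ?m0 ?m20.
have cst n : x n.+1 * y n = x 1%N * y 0%N.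
  elim: n => // n <-; rewrite (yr n) xr; ring.
have xl : (fun n => x n.+1 - 1) @ \oo --> 0.
  apply: (@cvg0_le _ _ harmonic (8 * a ^+ 2)); last exact: cvg_harmonic.
  move=> n; have /andP[h1 h2] := @sechJ_bound R n.*2 a; have h3 := @sechJ_rec R n.*2 0.
  have := B0 n.+1; rewrite /x doubleS => b0; rewrite distrC.
  rewrite (one_sub_div _ (lt0r_neq0 b0)).
  rewrite ger0_norm; last exact: divr_ge0 h1 (ltW b0).
  rewrite (ler_pdivrMr _ _ b0); apply: le_trans h2 _; rewrite /harmonic /=.
  move: h3; rewrite expr0n /= mul0r addr0 -[n.*2.+2%:R]natr1.
  have m0 : 0 < n.*2.+1%:R :> R by rewrite ltr0n.
  have mn : n.+1%:R <= n.*2.+1%:R :> R by rewrite ler_nat ltnS -addnn leq_addr.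
  have n0 : 0 < n.+1%:R :> R by rewrite ltr0n.
  move: (n.*2.+1%:R : R) (n.+1%:R : R) (sechJ n.*2.+2 0) (sechJ n.*2 0) m0 mn n0 b0 => m N b b' m0 mn N0 b0 h3.
  have -> : b' - 4 * b = 4 / m * b.
    have -> : b' = 4 * ((m + 1) * b) / m by rewrite h3; field; exact: lt0r_neq0.
    by field; exact: lt0r_neq0.
  have iv : m^-1 <= N^-1 by rewrite lef_pV2.
  have -> : 2 * a ^+ 2 * (4 / m * b) = 8 * a ^+ 2 * m^-1 * b by ring.
  by apply: ler_wpM2r; [exact: ltW|apply: ler_wpM2l => //; lra].
have yl : (fun n => y n.+1 - 1) @ \oo --> 0.
  apply: (@cvg0_le _ _ harmonic (2 * a ^+ 2 * expR (pi * a))); last exact: cvg_harmonic.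
  move=> n; have /andP[h1 h2] := @cosI_bound R n.*2.+1 a a0; have h3 := @cosI_rec R n.*2.+1 0.
  have := C0 n.*2.+3; rewrite /y doubleS => b0.
  rewrite (div_sub_one _ (lt0r_neq0 b0)).
  rewrite ger0_norm; last exact: divr_ge0 h1 (ltW b0).
  rewrite (ler_pdivrMr _ _ b0); apply: le_trans h2 _; rewrite /harmonic /=.
  move: h3; rewrite expr0n /= mulr0 addr0 -[n.*2.+3%:R]natr1.
  have m0 : 0 < n.*2.+2%:R :> R by rewrite ltr0n.
  have mn : n.+1%:R <= n.*2.+2%:R :> R by rewrite ler_nat -addnn; lia.
  have n0 : 0 < n.+1%:R :> R by rewrite ltr0n.
  have E0 := expR_ge0 (pi * a).
  move: (n.*2.+2%:R : R) (n.+1%:R : R) (cosI n.*2.+3 0) (cosI n.*2.+1 0) m0 mn n0 b0 (expR _) E0 => m N b b' m0 mn N0 b0 E E0 h3.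
  have m1 : m + 1 != 0 by rewrite gt_eqF //; lra.
  have -> : b' - b = m^-1 * b.
    have -> : b' = (m + 1) ^+ 2 * b / ((m + 1) * m) by rewrite -h3; field; rewrite m1 gt_eqF.
    by field; rewrite m1 gt_eqF.
  have iv : m^-1 <= N^-1 by rewrite lef_pV2.
  rewrite mulrA; apply: ler_wpM2r; first exact: ltW.
  by apply: ler_wpM2l => //; rewrite !mulr_ge0.
have xl1 := cvg_of_sub0 xl.
have yl1 : y @ \oo --> (1 : R) by rewrite -(cvg_shiftS y); exact: cvg_of_sub0.
have l1 : (fun n => x n.+1 * y n) @ \oo --> (1 * 1 : R) by apply: cvgM.
have l2 : (fun n => x n.+1 * y n) @ \oo --> x 1%N * y 0%N by under eq_fun do rewrite cst; exact: cvg_cst.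
have E1 : 1 * 1 = x 1%N * y 0%N :> R by exact: (cvg_unique _ l1 l2).
(* The invariant at index 0 involves only [sechJ 0] and [cosI 1]. Its factor [1 + 4 a^2] cancels
   against [cosI_1], which supplies [coshR (pi * a)]. *)
rewrite xr /x /y /= in E1.
have c1 := @cosI_1 R a; have c2 := @cosI_1 R 0.
have j0 : sechJ 0 0 = pi :> R.
  by rewrite -(proj2 kap_integral); apply: eq_lint => u; rewrite mul0r cos0 mul1r expr1.
have ja : sechJ 0 a = lint (fun u => cos (a * u) * kap u).
  by apply: eq_lint => u; rewrite expr1.
rewrite -ja; move: E1 c1 c2; rewrite j0 expr0n /= mulr0 addr0 !mul1r mulr0 coshR0 => E1 c1 c2.
have ch0 := coshR_neq0 (pi * a); have pn := @pi_neq0 R.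
rewrite -c1 in ch0 *; move: E1 ch0; rewrite c2 divr1 expr1n.
have d0 : 1 + 4 * a ^+ 2 != 0 by rewrite gt_eqF //; lra.
move: (pi : R) pn (sechJ _ a) (cosI 1 a) => p pn J I E1 ch0.
have I0 : I != 0 by apply: contraNneq ch0 => ->; rewrite mulr0.
have -> : J = p * (1 / ((1 + 4 * a ^+ 2) * I)); last by rewrite mul1r.
have h : J * ((1 + 4 * a ^+ 2) * I) = p by rewrite -[RHS]mulr1 [in RHS]E1; field.
by rewrite -h; field; rewrite d0 I0.
Qed.

Lemma lint_sum (I : Type) (s : seq I) (F : I -> R -> R) : (forall i, lintegrable (F i)) ->
  lintegrable (fun u => \sum_(i <- s) F i u) /\
  lint (fun u => \sum_(i <- s) F i u) = \sum_(i <- s) lint (F i).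
Proof.
move=> h; elim: s => [|i s [IH1 IH2]].
  have z : (fun u : R => \sum_(i <- [::]) F i u) = (fun=> 0) by apply/funext => u; rewrite big_nil.
  rewrite z big_nil; split; first exact: integrable0.
  by rewrite /lint /Rintegral integral0.
have z : (fun u : R => \sum_(i <- i :: s) F i u) = (fun u => F i u + \sum_(i <- s) F i u).
  by apply/funext => u; rewrite big_cons.
rewrite z big_cons -IH2; split; first exact: lintegrableD.
by rewrite lintD.
Qed.

Lemma lint_opp (f : R -> R) : measurable_fun setT f -> lint (fun x => f (- x)) = lint f.
Proof.
move=> mf.
have mo : measurable_fun setT (-%R : measurableTypeR R -> measurableTypeR R) by apply: continuous_measurable_fun; exact: opp_continuous.
have ge0 (g : R -> \bar R) : measurable_fun setT g -> (forall x, 0 <= g x)%E ->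
    (\int[mu]_x g (- x)%R = \int[mu]_x g x)%E.
  move=> mg g0; rewrite -[LHS](@ge0_integral_pushforward _ _ (measurableTypeR R) (measurableTypeR R) R -%R mo mu setT g) //.
  by apply: eq_measure_integral => A mA _; exact: lebesgue_measureN.
have mef : measurable_fun setT (EFin \o f) by exact/measurable_EFinP.
congr fine; rewrite integralE [RHS]integralE.
rewrite -(ge0 _ (measurable_funepos mef)) // -(ge0 _ (measurable_funeneg mef)) //.
by congr (adde _ (oppe _)); apply: eq_integral => x _; rewrite ?funeposE ?funenegE.
Qed.

Lemma cos_kap_int a : lintegrable (fun u => cos (a * u) * kap u).
Proof. by have := @sechJ_int R 0 a; under eq_fun do rewrite expr1. Qed.

Lemma sin_kap_int a : lintegrable (fun u => sin (a * u) * kap u).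
Proof.
apply: (@kap_dominated _ _ 1).
  by apply: measurable_funM; [exact: measurable_sinl|exact: measurable_kap].
by move=> u; rewrite normrM (ger0_norm (kap_ge0 u)); apply: ler_wpM2r; [exact: kap_ge0|exact: sin_max].
Qed.

Lemma sin_transform a : lint (fun u => sin (a * u) * kap u) = 0.
Proof.
have h := lint_opp (lintegrable_measurable (sin_kap_int a)).
have : lint (fun u => sin (a * u) * kap u) = - 1 * lint (fun u => sin (a * u) * kap u).
  rewrite -lintZ; last exact: sin_kap_int.
  by rewrite -[LHS]h; apply: eq_lint => u; rewrite mulrN sinN kapN; ring.
by move: (lint _) => L; lra.
Qed.

Lemma sechf_transform xi : lint (fun u => cos (xi / 2 * u) * kap u) = pi * sechf xi.
Proof. by rewrite sech_transform /sechf; congr (_ / coshR _); ring. Qed.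

(** Since [kap] never vanishes, measurability can be read off from the integrability of
    [f * kap]. *)
Lemma measurable_div_kap (f : R -> R) :
  measurable_fun setT (fun y => f y * kap y) -> measurable_fun setT f.
Proof.
have alg (v k c : R) : 2 * c * k = 1 -> 2 * (v * k * c) = v by move=> e; transitivity (v * (2 * c * k)); [ring|rewrite e mulr1].
move=> h; have := measurable_funM h (continuous_measurable_fun (dv_continuous (fun x => dv_cosh 2^-1 x))).
move=> /(measurable_funM (measurable_cst (2 : R))); apply: eq_measurable_fun => y _ /=.
exact: alg (kap_cosh y).
Qed.

(** The logarithmic derivative of [kap] is at most 1/2 in modulus, so a translation by [2 t] costs
    at most [expR t]. *)
Lemma kap_shift_le y t : 0 <= t -> kap (y - 2 * t) <= expR t * kap y.
Proof.
move=> t0; rewrite /kap; have -> : 2^-1 * (y - 2 * t) = 2^-1 * y - t by field.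
move: (2^-1 * y) => v.
have c0 := coshR_gt0 (v - t); have c1 := coshR_gt0 v.
have A0 : 0 < 2 * coshR (v - t) by exact: mulr_gt0.
have B0 : 0 < 2 * coshR v by exact: mulr_gt0.
rewrite (ler_pdivlMr _ _ B0) mulrC (ler_pdivrMr _ _ A0).
rewrite [leRHS]mulrCA (ler_pM2l (ltr0Sn R 1)) /coshR opprB !expRD.
have := expRxMexpNx_1 t; have := expR_gt0 (- v); have := expR_ge1Dx t.
move: (expR v) (expR (- v)) (expR t) (expR (- t)) => A B E e hE Bp ee.
have -> : E * ((A * e + E * B) / 2) = (A * (E * e) + B * E ^+ 2) / 2 by ring.
by rewrite ee ler_pM2r ?invr_gt0 // mulr1 lerD2l ler_peMr ?(ltW Bp) // exprn_ege1 //; lra.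
Qed.

(** By [sechf_transform], [pi] times the sum at time [t] is the integral of [P (y / 2 + t)] against
    [kap y]; the sine parts vanish by parity. The translation is then moved from [P] to [kap], where
    [kap_shift_le] applies because [P >= 0]. *)
Lemma sech_bochner_holds : sech_bochner R.
Proof.
move=> I z xi P0.
pose P y := Re (\sum_i z i * cis (xi i * y)).
have Re_sum (f : I -> R[i]) : Re (\sum_i f i) = \sum_i Re (f i).
  by elim/big_rec2: _ => [//|j x u _ <-]; exact: ReD.
have PE y t : P (y / 2 + t) * kap y = \sum_i (Re (z i * cis (xi i * t)) * (cos (xi i / 2 * y) * kap y) +
    - Im (z i * cis (xi i * t)) * (sin (xi i / 2 * y) * kap y)).
  rewrite /P Re_sum mulr_suml; apply: eq_bigr => i _.
  have -> : xi i * (y / 2 + t) = xi i * t + xi i / 2 * y by ring.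
  rewrite cisD mulrA; move: (z i * cis (xi i * t)) => w; rewrite ReM /cis /=.
  by move: (Re w) (Im w) (cos _) (sin _) (kap y) => *; ring.
have iP t i : lintegrable (fun y => Re (z i * cis (xi i * t)) * (cos (xi i / 2 * y) * kap y) +
    - Im (z i * cis (xi i * t)) * (sin (xi i / 2 * y) * kap y)).
  by apply: lintegrableD; apply: lintegrableZ; [exact: cos_kap_int|exact: sin_kap_int].
have LP t : lintegrable (fun y => P (y / 2 + t) * kap y) /\
    lint (fun y => P (y / 2 + t) * kap y) = pi * Re (\sum_i z i * cis (xi i * t) * (sechf (xi i))%:C).
  have [h1 h2] := @lint_sum _ (index_enum I) _ (iP t).
  rewrite (funext (fun y => PE y t)); split; first exact: h1.
  rewrite h2 Re_sum mulr_sumr; apply: eq_bigr => i _.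
  have ci := cos_kap_int (xi i / 2); have si := sin_kap_int (xi i / 2).
  rewrite lintD; [|exact: lintegrableZ ci|exact: lintegrableZ si].
  rewrite (lintZ _ ci) (lintZ _ si).
  rewrite sin_transform sechf_transform mulr0 addr0 mulrCA; congr (pi * _).
  by move: (z i * cis _) (sechf _) => w s; rewrite ReM /= mulr0 subr0.
have E0 : \sum_i z i * cis (xi i * 0) * (sechf (xi i))%:C = \sum_i z i * (sechf (xi i))%:C.
  by apply: eq_bigr => i _; rewrite mulr0 cis0 mulr1.
have p0 := pi_gt0 R.
have [i0 L0] := LP 0; rewrite E0 in L0.
split.
  have : 0 <= lint (fun y => P (y / 2 + 0) * kap y).
    by apply: lint_ge0 => y; rewrite mulr_ge0 ?kap_ge0 //; exact: P0.
  by rewrite L0 pmulr_rge0.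
move=> t t0; have [it Lt] := LP t.
rewrite -(ler_pM2l p0) -Lt mulrCA -L0 -lintZ //.
have mt : measurable_fun setT (fun y : R => P (y / 2 + 0) * kap (y - 2 * t)).
  apply: measurable_funM.
    by have := measurable_div_kap (lintegrable_measurable i0).
  by apply: (measurableT_comp (@measurable_kap R)); exact: measurable_addr.
have kt y : kap (y - 2 * t) <= expR t * kap y := kap_shift_le y t0.
have -> : lint (fun y => P (y / 2 + t) * kap y) = lint (fun y => P (y / 2 + 0) * kap (y - 2 * t)).
  rewrite -[RHS](lint_shift (2 * t) mt); apply: eq_lint => y.
  by congr (P _ * kap _); field.
apply: le_lint; [|exact: lintegrableZ|].
  apply: (lintegrable_le mt (lintegrableZ (expR t) i0)) => y.
  rewrite ger0_norm ?mulr_ge0 ?kap_ge0 //; last exact: P0.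
  by rewrite mulrCA; apply: ler_wpM2l; [exact: P0|exact: kt].
by move=> y; rewrite mulrCA; apply: ler_wpM2l; [exact: P0|exact: kt].
Qed.
End SechFormula.

(** * Gamma and Beta integrals *)

Section ComplexIntegral.
Context {R : realType}.
Local Notation mu := (@lebesgue_measure R).
Implicit Types (f g : R -> R[i]).

Definition cint f : R[i] := lint (fun x => Re (f x)) +i* lint (fun x => Im (f x)).
Definition cintegrable f := lintegrable (fun x => Re (f x)) /\ lintegrable (fun x => Im (f x)).
Definition cmeasurable f := measurable_fun setT (fun x => Re (f x)) /\ measurable_fun setT (fun x => Im (f x)).

Lemma Re_cint f : Re (cint f) = lint (fun x => Re (f x)). Proof. by []. Qed.
Lemma Im_cint f : Im (cint f) = lint (fun x => Im (f x)). Proof. by []. Qed.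

Lemma eq_cint f g : f =1 g -> cint f = cint g.
Proof. by move=> /funext ->. Qed.

Lemma cintZ z f : cintegrable f -> cint (fun x => z * f x) = z * cint f.
Proof.
move=> [h1 h2]; apply: complex_ext => /=.
  rewrite ReM /= -!lintZ // -lintB; [|exact: lintegrableZ..].
  by apply: eq_lint => x; rewrite ReM.
rewrite ImM /= -!lintZ // -lintD; [|exact: lintegrableZ..].
by apply: eq_lint => x; rewrite ImM.
Qed.

Lemma cintZr z f : cintegrable f -> cint (fun x => f x * z) = cint f * z.
Proof. by move=> h; rewrite mulrC -cintZ //; apply: eq_cint => x; rewrite mulrC. Qed.

Lemma cint_shift f c : cmeasurable f -> cint (fun x => f (x + c)) = cint f.
Proof.
by move=> [m1 m2]; rewrite /cint (lint_shift c m1) (lint_shift c m2).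
Qed.

Lemma cintegrable_measurable f : cintegrable f -> cmeasurable f.
Proof. by move=> [h1 h2]; split; exact: lintegrable_measurable. Qed.

Lemma cintegrable_le f (g : R -> R) : cmeasurable f -> lintegrable g ->
  (forall x, nc (f x) <= g x) -> cintegrable f.
Proof.
move=> [m1 m2] ig fg; split; apply: (lintegrable_le _ ig) => // x; apply: le_trans (fg x).
  exact: Re_le_nc.
exact: Im_le_nc.
Qed.

Lemma lintegrable_shiftl (g : R -> R) c : lintegrable g -> lintegrable (fun x => g (c + x)).
Proof.
by move=> h; rewrite (_ : (fun x => _) = fun x => g (x + c)); [exact: lintegrable_shift|apply/funext => x; rewrite addrC].
Qed.

Lemma lint_shiftl (g : R -> R) c : measurable_fun setT g -> lint (fun x => g (c + x)) = lint g.
Proof. by move=> mg; rewrite -(lint_shift c mg); apply: eq_lint => x; rewrite addrC. Qed.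

Lemma lint_EFin (g : R -> R) : lintegrable g -> (\int[mu]_x (g x)%:E)%E = (lint g)%:E.
Proof. by move=> ig; rewrite fineK //; exact: integrable_fin_num ig. Qed.

Lemma cfubini (F : R -> R -> R[i]) :
  (mu \x mu)%E.-integrable setT (EFin \o (fun z => Re (F z.1 z.2))) ->
  (mu \x mu)%E.-integrable setT (EFin \o (fun z => Im (F z.1 z.2))) ->
  cint (fun x => cint (F x)) = cint (fun y => cint (fun x => F x y)).
Proof.
by move=> h1 h2; apply: complex_ext; rewrite /=; [exact: (lint_fubini h1)|exact: (lint_fubini h2)].
Qed.

Lemma prod_integrable1 (f : R * R -> R) (B : R -> R) : measurable_fun setT f ->
  lintegrable B -> (forall x, (\int[mu]_y `|f (x, y)|%:E <= (B x)%:E)%E) ->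
  (mu \x mu)%E.-integrable setT (EFin \o f).
Proof.
move=> mf iB fB; have mef : measurable_fun setT (EFin \o f) by exact/measurable_EFinP.
apply (@integrable12ltyP _ _ (measurableTypeR R) (measurableTypeR R) R mu mu (EFin \o f) mef).2.
apply: le_lt_trans (_ : (\int[mu]_x (B x)%:E < +oo)%E); last by rewrite lint_EFin // ltry.
apply: ge0_le_integral => //.
- by move=> x _; apply: integral_ge0.
- have ma : measurable_fun setT (abse \o (EFin \o f)) by exact: measurableT_comp.
  exact (@measurable_fun_fubini_tonelli_F _ _ (measurableTypeR R) (measurableTypeR R) R mu _ ma (fun z => abse_ge0 _)).
- by apply/measurable_EFinP; exact: lintegrable_measurable.
- by move=> x _; exact: fB.
Qed.

Lemma prod_integrable2 (f : R * R -> R) (B : R -> R) : measurable_fun setT f ->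
  lintegrable B -> (forall y, (\int[mu]_x `|f (x, y)|%:E <= (B y)%:E)%E) ->
  (mu \x mu)%E.-integrable setT (EFin \o f).
Proof.
move=> mf iB fB; have mef : measurable_fun setT (EFin \o f) by exact/measurable_EFinP.
apply (@integrable21ltyP _ _ (measurableTypeR R) (measurableTypeR R) R mu mu (EFin \o f) mef).2.
apply: le_lt_trans (_ : (\int[mu]_x (B x)%:E < +oo)%E); last by rewrite lint_EFin // ltry.
apply: ge0_le_integral => //.
- by move=> x _; apply: integral_ge0.
- have ma : measurable_fun setT (abse \o (EFin \o f)) by exact: measurableT_comp.
  exact (@measurable_fun_fubini_tonelli_G _ _ (measurableTypeR R) (measurableTypeR R) R mu _ ma (fun z => abse_ge0 _)).
- by apply/measurable_EFinP; exact: lintegrable_measurable.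
- by move=> x _; exact: fB.
Qed.

Lemma Rintegral_ln (f : R -> R) : measurable_fun setT f ->
  Rintegral mu (@Rpos R) (fun t => f (ln t)) = lint (fun y => f y * expR y).
Proof.
move=> mf; congr fine; have := @integral_ln R (EFin \o f) => /= -> //.
exact/measurable_EFinP.
Qed.
End ComplexIntegral.

(** * Gamma on the vertical lines through 1/2 and 1 *)

Section GammaLog.
Context {R : realType}.
Local Notation mu := (@lebesgue_measure R).
Implicit Types (a b s t y : R).

(** The modulus of the Gamma integrand after [t = e^y], with the Jacobian included. *)
Definition gw s y : R := expR (s * y - expR y).

Lemma continuous_gw s : continuous (gw s).
Proof.
apply: (@dv_continuous _ _ (fun y => expR (s * y - expR y) * (s - expR (1 * y) * 1))) => y.
apply: (@dv_comp _ (@expR R) (fun y => s * y - expR y)).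
apply: dvB; first exact: dv_lin.
by have := dv_exp 1 y; rewrite !mul1r mulr1; under eq_fun do rewrite mul1r.
Qed.

Lemma measurable_gw s : measurable_fun setT (gw s).
Proof. exact: continuous_measurable_fun (@continuous_gw s). Qed.

Lemma gw_half_le y : gw 2^-1 y <= kap y.
Proof.
rewrite /gw expRD /kap; have := expR_gt0 (2^-1 * y); have := expRxMexpNx_1 (2^-1 * y).
rewrite -[leRHS]div1r ler_pdivlMr; last by rewrite mulr_gt0 ?coshR_gt0.
rewrite /coshR.
have -> : expR y = expR (2^-1 * y) ^+ 2 by rewrite -expRM_natr; congr expR; field.
have := expRxMexpNx_1 (expR (2^-1 * y) ^+ 2); have := expR_ge1Dx (expR (2^-1 * y) ^+ 2).
have := expR_gt0 (- expR (2^-1 * y) ^+ 2).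
move: (expR (2^-1 * y)) (expR (- _)) => h; move: (expR (- _)) (expR (h ^+ 2)) => e' E e e0 hE Ee he h0.
nra.
Qed.

Lemma gw_one_le y : gw 1 y <= 2 * kap y.
Proof.
rewrite /gw expRD /kap mul1r; have := expR_gt0 (2^-1 * y); have := expRxMexpNx_1 (2^-1 * y).
rewrite ler_pdivlMr; last by rewrite mulr_gt0 ?coshR_gt0.
rewrite /coshR.
have -> : expR y = expR (2^-1 * y) ^+ 2 by rewrite -expRM_natr; congr expR; field.
have := expRxMexpNx_1 (expR (2^-1 * y) ^+ 2).
(* The exponential is written as a square because the linear lower bound on [expR] would give only
   degree 2 in [h], while degree 3 has to be dominated. *)
have -> : expR (expR (2^-1 * y) ^+ 2) = expR (2^-1 * expR (2^-1 * y) ^+ 2) ^+ 2.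
  by rewrite -[RHS]expRM_natr; congr expR; field.
have := expR_ge1Dx (2^-1 * expR (2^-1 * y) ^+ 2).
have := expR_gt0 (- expR (2^-1 * y) ^+ 2).
move: (expR (2^-1 * y)) (expR (- (2^-1 * y))) => h h'.
move: (expR (- h ^+ 2)) (expR (2^-1 * h ^+ 2)) => e E e0 hE Ee hh h0.
have h2 : (h + h') * h = h ^+ 2 + 1 by rewrite mulrDl (mulrC h') hh expr2.
have -> : h ^+ 2 * e * (2 * ((h + h') / 2)) = h * (h ^+ 2 + 1) * e by rewrite -h2; field.
have E2 : (1 + h ^+ 2) ^+ 2 <= 4 * E ^+ 2.
  have -> : 4 * E ^+ 2 = (2 * E) ^+ 2 by ring.
  by rewrite ler_pXn2r ?nnegrE //; have := sqr_ge0 h; nra.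
have hb : h * (h ^+ 2 + 1) <= 2 * E ^+ 2 by have := sqr_ge0 (h - 1); nra.
have : h * (h ^+ 2 + 1) * e <= 2 * E ^+ 2 * e by rewrite ler_wpM2r // ltW.
by rewrite -(mulrA 2) Ee mulr1.
Qed.

Lemma gw_half_int : lintegrable (gw 2^-1).
Proof.
apply: (@kap_dominated _ _ 1); first exact: measurable_gw.
by move=> y; rewrite mul1r ger0_norm ?expR_ge0 // gw_half_le.
Qed.

Lemma gw_one_int : lintegrable (gw 1).
Proof.
apply: (@kap_dominated _ _ 2); first exact: measurable_gw.
by move=> y; rewrite ger0_norm ?expR_ge0 // gw_one_le.
Qed.

Lemma mul_cis (x y t u : R) : x%:C * cis t * (y%:C * cis u) = (x * y)%:C * cis (t + u).
Proof. by rewrite mulrACA -RCM -cisD. Qed.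

Definition gcis s t y : R[i] := (gw s y)%:C * cis (t * y).

Lemma Re_gcis s t y : Re (gcis s t y) = gw s y * cos (t * y).
Proof. by rewrite ReC. Qed.

Lemma Im_gcis s t y : Im (gcis s t y) = gw s y * sin (t * y).
Proof. by rewrite ImM /= mul0r addr0. Qed.

Lemma gcis_measurable s t : cmeasurable (gcis s t).
Proof.
split; [under eq_fun do rewrite Re_gcis|under eq_fun do rewrite Im_gcis];
  apply: measurable_funM; try exact: measurable_gw; [exact: measurable_cosl|exact: measurable_sinl].
Qed.

Lemma nc_gcis s t y : nc (gcis s t y) = gw s y.
Proof. by rewrite ncM ncR nc_cis mulr1 ger0_norm ?expR_ge0. Qed.

Lemma gcis_int s t : s = 2^-1 \/ s = 1 -> cintegrable (gcis s t).
Proof.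
move=> hs; apply: (@cintegrable_le _ _ (gw s)); first exact: gcis_measurable.
  by case: hs => ->; [exact: gw_half_int|exact: gw_one_int].
by move=> y; rewrite nc_gcis.
Qed.

Lemma Gammac_log s t : Gammac (s +i* t) = cint (gcis s t).
Proof.
have E (h : R -> R) : measurable_fun setT h ->
    Rintegral mu (@Rpos R) (fun x => powR x (s - 1) * expR (- x) * h (ln x)) = lint (fun y => gw s y * h y).
  move=> mh; transitivity (lint (fun y => (gw (s - 1) y * h y) * expR y)); last first.
    apply: eq_lint => y; rewrite mulrAC; congr (_ * h y).
    by rewrite /gw -expRD; congr expR; ring.
  rewrite -Rintegral_ln; last by apply: measurable_funM => //; exact: measurable_gw.
  apply: eq_Rintegral => x /set_mem; rewrite /Rpos /= in_itv /= andbT => x0.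
  by rewrite /powR gt_eqF // /gw lnK ?posrE // expRD.
rewrite /Gammac /= (E (fun y => cos (t * y))); last exact: measurable_cosl.
rewrite (E (fun y => sin (t * y))); last exact: measurable_sinl.
by rewrite /cint; congr (_ +i* _); apply: eq_lint => y; rewrite ?Re_gcis ?Im_gcis.
Qed.

Lemma Gammac_conj s t : s = 2^-1 \/ s = 1 -> Gammac (s +i* (- t)) = cj (Gammac (s +i* t)).
Proof.
move=> hs; rewrite !Gammac_log; apply: complex_ext.
  by rewrite Re_conj !Re_cint; apply: eq_lint => y; rewrite !Re_gcis mulNr cosN.
rewrite Im_conj !Im_cint -[RHS]mulN1r -lintZ; last by have [] := gcis_int t hs.
by apply: eq_lint => y; rewrite !Im_gcis mulNr sinN; ring.
Qed.

Lemma Gammac_1 : Gammac (1 +i* 0 : R[i]) = 1.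
Proof.
have H : lint (gw 1 : R -> R) = 1.
  have dG (y : R) : is_derive y (1 : R) (fun y => - expR (- expR y)) (gw 1 y).
    have h1 : is_derive y (1 : R) (fun y : R => - 1 * expR y) (- 1 * expR y).
      by apply: dvZ; exact: is_derive_expR.
    have h2 := @dv_comp _ (@expR R) (fun y => - 1 * expR y) y _ _ (is_derive_expR _) h1.
    have := dvZ (- 1) h2; under eq_fun do rewrite !mulN1r.
    move=> h; apply: (dv_eq h); rewrite /gw expRD !mulN1r mul1r; ring.
  have := @lint_FTC R _ _ 0 (-1) dG (@continuous_gw 1) gw_one_int.
  rewrite opprK add0r; apply.
    apply: (@cvg0_le _ _ harmonic 1); last exact: cvg_harmonic.
    move=> n; rewrite mul1r normrN ger0_norm ?expR_ge0 // expRN /harmonic /=.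
    rewrite lef_pV2 ?posrE ?expR_gt0 ?ltr0Sn //; apply: le_trans (expR_ge1Dx _).
    by rewrite -natr1 addrC lerD2l; apply: le_trans (expR_ge1Dx _); lra.
  apply: cvg_of_sub0; apply: (@cvg0_le _ _ (fun n => expR (- n%:R)) 1); last exact: cvgn_expR.
  move=> n; rewrite opprK addrC mul1r ger0_norm; first by rewrite lerBlDr -lerBlDl; exact: expR_ge1Dx.
  by rewrite subr_ge0 -[leRHS]expR0 ler_expR oppr_le0 expR_ge0.
rewrite Gammac_log; apply: complex_ext.
  by rewrite Re_cint -[RHS]H; apply: eq_lint => y; rewrite Re_gcis mul0r cos0 mulr1.
rewrite Im_cint -[RHS](mul0r (lint (gw 1))) -lintZ; last exact: gw_one_int.
by apply: eq_lint => y; rewrite Im_gcis !mul0r sin0 mulr0.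
Qed.

Definition lse y : R := ln (1 + expR y).

Lemma expR_lse y : expR (lse y) = 1 + expR y.
Proof. by rewrite /lse lnK // posrE; have := expR_gt0 y; lra. Qed.

Lemma measurable_lse : measurable_fun setT (lse : R -> R).
Proof.
have ml : measurable_fun setT (@ln R) by exact: measurable_ln.
by apply: (measurableT_comp ml); apply: measurable_funD => //; exact: measurable_expR.
Qed.

(** The Beta integrand [t^(-1/2 + ib) / (1 + t)^(1 + i(b - a))] after [t = e^y]. *)
Definition bcis a b y : R[i] := (kap y)%:C * cis (b * y - (b - a) * lse y).

(* Fubini and the translations [y = x + u], [x -> x - lse u] turn the product of
   two Gamma integrals into a product of a Gamma and a Beta integral. *)
Lemma Gamma_Beta a b :
  Gammac (2^-1 +i* (- a)) * Gammac (2^-1 +i* b) = Gammac (1 +i* (b - a)) * cint (bcis a b).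
Proof.
have [h hE] : exists h : R, h = 2^-1 by exists 2^-1.
have ha := @gcis_int h (- a) (or_introl hE); have hb := @gcis_int h b (or_introl hE).
have h1 := @gcis_int 1 (b - a) (or_intror erefl).
rewrite !Gammac_log -hE -cintZr //.
pose F x u := gcis h (- a) x * gcis h b (x + u).
have wi : lintegrable (gw h) by rewrite hE; exact: gw_half_int.
transitivity (cint (fun x => cint (F x))).
  apply: eq_cint => x; rewrite /F cintZ; last first.
    by case: hb => i1 i2; split; [exact: (lintegrable_shiftl x i1)|exact: (lintegrable_shiftl x i2)].
  congr (_ * _); rewrite -(cint_shift x (cintegrable_measurable hb)).
  by apply: eq_cint => u; rewrite addrC.
have mF : measurable_fun setT (fun z : R * R => Re (F z.1 z.2)) /\ measurable_fun setT (fun z : R * R => Im (F z.1 z.2)).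
  have m1 : measurable_fun setT (fun z : R * R => z.1) by exact: measurable_fst.
  have m2 : measurable_fun setT (fun z : R * R => z.1 + z.2).
    by apply: measurable_funD; [exact: measurable_fst|exact: measurable_snd].
  have [a1 a2] := @gcis_measurable h (- a); have [b1 b2] := @gcis_measurable h b.
  have A1 := measurableT_comp a1 m1; have A2 := measurableT_comp a2 m1.
  have B1 := measurableT_comp b1 m2; have B2 := measurableT_comp b2 m2.
  split; [under eq_fun do rewrite ReM|under eq_fun do rewrite ImM].
    by apply: measurable_funB; apply: measurable_funM.
  by apply: measurable_funD; apply: measurable_funM.
have BB (x : R) : (\int[mu]_u (gw h x * gw h (x + u))%:E = (gw h x * lint (gw h))%:E)%E.
  rewrite lint_EFin; last first.
    by apply: lintegrableZ; exact: (lintegrable_shiftl x wi).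
  rewrite lintZ; last exact: (lintegrable_shiftl x wi).
  by rewrite (lint_shiftl x (lintegrable_measurable wi)).
have iB : lintegrable (fun x => gw h x * lint (gw h)).
  by under eq_fun do rewrite mulrC; exact: lintegrableZ.
have FB x u : nc (F x u) = gw h x * gw h (x + u) by rewrite ncM !nc_gcis.
have bnd (P : R[i] -> R) : measurable_fun setT (fun z : R * R => P (F z.1 z.2)) ->
    (forall z, `|P z| <= nc z) -> (mu \x mu)%E.-integrable setT (EFin \o (fun z : R * R => P (F z.1 z.2))).
  move=> mP hP; apply: (prod_integrable1 mP iB) => x; rewrite -BB.
  apply: ge0_le_integral => //.
  - apply/measurable_EFinP; apply: measurableT_comp => //.
    exact: (measurableT_comp mP (pair1_measurable x)).
  - apply/measurable_EFinP; apply: measurable_funM => //.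
    apply: (measurableT_comp (@measurable_gw h)).
    by rewrite (_ : +%R x = fun u => u + x); [exact: measurable_addr|apply/funext => u; rewrite addrC].
  - by move=> u _; rewrite lee_fin -FB; exact: hP.
rewrite cfubini; [|exact: (bnd Re mF.1 (@Re_le_nc R))|exact: (bnd Im mF.2 (@Im_le_nc R))].
have bi : cintegrable (bcis a b).
  have mc : measurable_fun setT (fun y : R => b * y - (b - a) * lse y).
    apply: measurable_funB; apply: measurable_funM => //; exact: measurable_lse.
  apply: (@cintegrable_le _ _ kap); last by move=> y; rewrite ncM ncR nc_cis mulr1 ger0_norm ?kap_ge0.
    split; [under eq_fun do rewrite ReC|under eq_fun do rewrite ImM /= mul0r addr0].
      apply: measurable_funM; first exact: measurable_kap.
      by apply: (measurableT_comp _ mc); exact: continuous_measurable_fun (@continuous_cos R).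
    apply: measurable_funM; first exact: measurable_kap.
    by apply: (measurableT_comp _ mc); exact: continuous_measurable_fun (@continuous_sin R).
  by case: (@kap_integral R).
rewrite -cintZ //; apply: eq_cint => u.
rewrite -[LHS](cint_shift (- lse u)); last first.
  have [m1 m2] := mF; have p2 := @pair2_measurable _ _ R R u.
  by split; [exact: (measurableT_comp m1 p2)|exact: (measurableT_comp m2 p2)].
rewrite [RHS]mulrC -cintZ //; apply: eq_cint => x.
rewrite /F /gcis /bcis !mul_cis; congr (_%:C * cis _); last by ring.
rewrite /gw -expRD.
have K : kap u = expR (h * u - lse u).
  rewrite hE expRD expRN expR_lse /kap /coshR.
  have -> : expR u = expR (2^-1 * u) ^+ 2 by rewrite -expRM_natr; congr expR; field.
  rewrite expRN; have := expR_gt0 (2^-1 * u); move: (expR _) => e e0.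
  have d : 1 + e ^+ 2 != 0 by rewrite gt_eqF //; nra.
  have d' : e * e + 1 != 0 by rewrite gt_eqF //; nra.
  by field; rewrite ?d ?d' gt_eqF.
rewrite K -expRD; congr expR.
rewrite (expRD x) expRN expR_lse (expRD _ u) (expRD x) expRN expR_lse.
have d : 1 + expR u != 0 by rewrite gt_eqF //; have := expR_gt0 u; lra.
by rewrite hE; field.
Qed.

(** The reflection formula on the critical line: for [a = b] the phase with [lse] disappears, and
    the Beta integral is the Fourier transform of [kap]. *)
Lemma Gamma_half_sqr a : Gammac (2^-1 +i* (- a)) * Gammac (2^-1 +i* a) = (pi / coshR (pi * a))%:C.
Proof.
rewrite Gamma_Beta subrr Gammac_1 mul1r; apply: complex_ext.
  by rewrite Re_cint [RHS]/= -sech_transform; apply: eq_lint => u; rewrite ReC /= subrr mul0r subr0 mulrC.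
by rewrite Im_cint [RHS]/= -(@sin_transform R a); apply: eq_lint => u; rewrite ImM /= mul0r addr0 subrr mul0r subr0 mulrC.
Qed.

Lemma Gamma_half_neq0 a : Gammac (2^-1 +i* a) != 0.
Proof.
have : (pi / coshR (pi * a))%:C != 0 :> R[i] by rewrite RC_eq0 mulf_neq0 ?pi_neq0 ?invr_eq0 ?coshR_neq0.
by rewrite -Gamma_half_sqr; apply: contraNneq => ->; rewrite mulr0.
Qed.

(** [Gamma_Beta] with first parameter 0 exhibits [Gammac (1 +i* a)] as a factor of a nonzero
    product. This justifies the division in [symb]. *)
Lemma Gamma_one_neq0 a : Gammac (1 +i* a) != 0.
Proof.
have : Gammac (2^-1 +i* (- 0)) * Gammac (2^-1 +i* a) != 0.
  by apply: mulf_neq0; exact: Gamma_half_neq0.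
by rewrite Gamma_Beta subr0; apply: contraNneq => ->; rewrite mul0r.
Qed.

Lemma beta_integral a b : cint (bcis a b) = Gammac (2^-1 +i* (- a)) * Gammac (2^-1 +i* b) / Gammac (1 +i* (b - a)).
Proof. by rewrite Gamma_Beta mulrAC mulfV ?mul1r // Gamma_one_neq0. Qed.
End GammaLog.

(** * From the Hankel form to the Toeplitz symbol *)

Section Periodic.
Context {R : realType}.
Local Notation mu := (@lebesgue_measure R).
Implicit Types (f : R -> R) (S x c : R).

(** A half-open window, so that consecutive windows add up without overlap ([seg_split]). *)
Definition seg S x : R := ((0 <= x < S)%R : bool)%:R.

Lemma seg_indic S : seg S = \1_(`[0, S[%classic : set R).
Proof.
apply/funext => x; rewrite indicE /seg; congr (_ %:R).
by rewrite mem_setE in_itv.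
Qed.

Lemma measurable_seg S : measurable_fun setT (seg S).
Proof. by rewrite seg_indic; exact: measurable_indic (measurable_itv _). Qed.

Lemma seg_ge0 S x : 0 <= seg S x. Proof. exact: ler0n. Qed.
Lemma seg_le1 S x : seg S x <= 1. Proof. by rewrite /seg lern1 leq_b1. Qed.

Lemma seg_split S S' x : 0 <= S -> 0 <= S' -> seg (S + S') x = seg S x + seg S' (x - S).
Proof.
move=> S0 S0'; rewrite /seg.
have [x0|x0] := leP 0 x; have [xS|xS] := ltP x S; have [h|h] := leP 0 (x - S);
  have [h1|h1] := ltP (x - S) S'; have [h2|h2] := ltP x (S + S'); rewrite /= ?addr0 ?add0r //; exfalso; lra.
Qed.

(** For non-integrable [f] the integral has an infinite value, which [fine] sends to 0, so both
    sides vanish. This lets constants move before integrability is known. *)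
Lemma lint_measZ c f : measurable_fun setT f -> lint (fun x => c * f x) = c * lint f.
Proof.
have nint (g : R -> R) : measurable_fun setT g -> ~ lintegrable g -> lint g = 0.
  move=> mg ng; rewrite /lint /Rintegral integralE.
  have meg : measurable_fun setT (EFin \o g) by exact/measurable_EFinP.
  have pp : (0 <= \int[mu]_x (EFin \o g)^\+ x)%E by exact: integral_ge0.
  have nn : (0 <= \int[mu]_x (EFin \o g)^\- x)%E by exact: integral_ge0.
  have ns : (\int[mu]_x `|(EFin \o g) x| = \int[mu]_x (EFin \o g)^\+ x + \int[mu]_x (EFin \o g)^\- x)%E.
    rewrite -ge0_integralD //; [|exact: measurable_funepos|exact: measurable_funeneg].
    by apply: eq_integral => x _; rewrite -/((abse \o (EFin \o g)) x) fune_abse.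
  have : ~ (\int[mu]_x `|(EFin \o g) x| < +oo)%E by move=> h; apply: ng; apply/integrableP.
  rewrite ns; move: (\int[mu]_x _)%E (\int[mu]_x _)%E pp nn => [a||] [b||] //= _ _ h.
  by exfalso; apply: h; rewrite ltry.
move=> mf; have [->|c0] := eqVneq c 0.
  rewrite mul0r (eq_lint (g := fun=> 0)); last by move=> x; rewrite mul0r.
  by rewrite /lint /Rintegral integral0.
have [h|h] := pselect (lintegrable f); first exact: lintZ.
rewrite (nint _ mf h) mulr0; apply: nint; first exact: measurable_funM.
move=> h'; apply: h; have := lintegrableZ c^-1 h'.
by under eq_fun do rewrite mulKf //.
Qed.

Variables (T : R) (T0 : 0 < T).

Lemma perZ f : (forall x, f (x + T) = f x) -> forall (m : int) x, f (x + m%:~R * T) = f x.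
Proof.
move=> fT; have n x (m : nat) : f (x + m%:R * T) = f x.
  elim: m => [|m IH]; first by rewrite mul0r addr0.
  by rewrite -natr1 mulrDl mul1r addrA fT.
case=> m x; first exact: n.
by rewrite -(n (x + _) m.+1) NegzE mulrNz mulNr subrK.
Qed.

Lemma seg_le S S' x : S <= S' -> seg S x <= seg S' x.
Proof.
move=> h; rewrite /seg ler_nat; have [x0|//] := leP 0 x; have [xS|//] := ltP x S.
by rewrite (lt_le_trans xS h).
Qed.

Lemma seg_int_le f S S' : measurable_fun setT f -> S <= S' ->
  lintegrable (fun x => seg S' x * f x) -> lintegrable (fun x => seg S x * f x).
Proof.
move=> mf SS h; apply: (lintegrable_le _ (integrable_norm h)) => [|x /=].
  by apply: measurable_funM => //; exact: measurable_seg.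
by rewrite !normrM !(ger0_norm (seg_ge0 _ _)) ler_wpM2r // seg_le.
Qed.

(** For [0 <= c < T] the translated window is cut in two and one piece is moved by a whole period;
    general [c] is reduced modulo [T]. *)
Lemma per_shift f : measurable_fun setT f -> (forall x, f (x + T) = f x) ->
  lintegrable (fun x => seg T x * f x) -> forall c,
  lintegrable (fun x => seg T x * f (x + c)) /\
  lint (fun x => seg T x * f (x + c)) = lint (fun x => seg T x * f x).
Proof.
move=> mf fT fi.
have H c : 0 <= c < T -> lintegrable (fun x => seg T x * f (x + c)) /\
  lint (fun x => seg T x * f (x + c)) = lint (fun x => seg T x * f x).
  move=> /andP[c0 cT].
  have Tc : 0 <= T - c by lra.
  pose g1 x := seg (T - c) (x - c) * f x; pose g2 x := seg c (x - T) * f x.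
  have ic : lintegrable (fun x => seg c x * f x) := seg_int_le mf (ltW cT) fi.
  have E1 : (fun x => seg T x * f x) = (fun x => seg c x * f x + g1 x).
    by apply/funext => x; rewrite /g1 -mulrDl -seg_split // subrKC.
  have i1 : lintegrable g1.
    have -> : g1 = (fun x => seg T x * f x - seg c x * f x).
      by apply/funext => x; have /= -> := congr1 (fun g : R -> R => g x) E1; rewrite addrAC subrr add0r.
    exact: lintegrableB.
  have S2 : (fun x => seg c x * f x) = (fun x => g2 (x + T)).
    by apply/funext => x; rewrite /g2 addrK fT.
  have S2' : g2 = (fun x => (fun x => seg c x * f x) (x - T)).
    by apply/funext => x; rewrite /g2 -{2}(subrK T x) fT.
  have i2 : lintegrable g2 by rewrite S2'; exact: (lintegrable_shift (- T) ic).
  have E2 : (fun x => seg T x * f (x + c)) = (fun x => (fun x => g1 x + g2 x) (x + c)).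
    apply/funext => x; rewrite /g1 /g2 -mulrDl addrK; congr (_ * _).
    have := seg_split x Tc c0; rewrite subrK => ->; congr (_ + seg c _); lra.
  rewrite E2; split; first exact: (lintegrable_shift c (lintegrableD i1 i2)).
  rewrite (lint_shift c (lintegrable_measurable (lintegrableD i1 i2))) lintD // E1 lintD // addrC; congr (_ + _).
  by rewrite S2 (lint_shift T (lintegrable_measurable i2)).
move=> c; pose m := Num.floor (c / T).
have hm : 0 <= c - m%:~R * T < T.
  have /andP[] := Num.Theory.floor_itv (c / T); rewrite -/m intrD ler_pdivlMr // ltr_pdivrMr // mulrDl [1%:~R]mulr1z mul1r.
  by move: (m%:~R * T) => v; lra.
have -> : (fun x => seg T x * f (x + c)) = (fun x => seg T x * f (x + (c - m%:~R * T))).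
  by apply/funext => x; rewrite addrA -[in RHS](perZ fT m) subrK.
exact: H.
Qed.

Lemma per_segN f : measurable_fun setT f -> (forall x, f (x + T) = f x) ->
  lintegrable (fun x => seg T x * f x) -> forall N : nat,
  lintegrable (fun x => seg (N%:R * T) x * f x) /\
  lint (fun x => seg (N%:R * T) x * f x) = N%:R * lint (fun x => seg T x * f x).
Proof.
move=> mf fT fi; elim => [|N [i1 i2]].
  have -> : (fun x => seg (0%:R * T) x * f x) = (fun=> 0).
    by apply/funext => x; rewrite /seg mul0r; case: (leP 0 x) => h; rewrite ?mul0r // ltNge h mul0r.
  by rewrite mul0r /lint /Rintegral integral0; split => //; exact: integrable0.
have NT0 : 0 <= N%:R * T by rewrite mulr_ge0 // ltW.
have E : (fun x => seg (N.+1%:R * T) x * f x) =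
    (fun x => seg (N%:R * T) x * f x + (fun x => seg T x * f x) (x - N%:R * T)).
  apply/funext => x; rewrite -natr1 mulrDl mul1r seg_split // ?(ltW T0) // mulrDl; congr (_ + _ * _).
  by have := perZ fT N%:Z (x - N%:R * T); rewrite -pmulrn subrK.
have ish := lintegrable_shift (- (N%:R * T)) fi.
rewrite E; split; first exact: lintegrableD.
rewrite lintD // i2 (lint_shift _ (lintegrable_measurable fi)) -natr1; ring.
Qed.
End Periodic.

Lemma measurable_fine_fun {R : realType} : measurable_fun setT (fine : \bar R -> R).
Proof. by []. Qed.

Lemma limr_ge_cst {R : realType} (f : nat -> R) (l : R) : f @ \oo --> l -> (forall n, 0 <= f n) -> 0 <= l.
Proof. by move=> fl f0; apply: (@filter_ler_cvg R nat \oo _ (fun=> 0) f 0 l) => //; [exact: cvg_cst|exact: nearW]. Qed.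

(** * Averaging the Hankel form over many periods *)

Section HankelPositivity.
Context {R : realType}.
Local Notation mu := (@lebesgue_measure R).
Variables (p : R -> R) (T : R).
Hypotheses (T0 : 0 < T) (pT : forall x, p (x + T) = p x) (mp : measurable_fun setT p)
  (ip : lintegrable (fun x => seg T x * p x)) (Hpsd : hankel_psd p).

Let P1 : R := lint (fun x => seg T x * `|p x|).

Let iap : lintegrable (fun x => seg T x * `|p x|).
Proof.
have := integrable_norm ip; apply: eq_integrable => // x _ /=.
by rewrite normrM ger0_norm ?seg_ge0.
Qed.

Let map_ : measurable_fun setT (fun x => `|p x|).
Proof. exact: measurableT_comp. Qed.

Let apT x : `|p (x + T)| = `|p x|. Proof. by rewrite pT. Qed.

Let shifted_int c (N : nat) : lintegrable (fun x => seg (N%:R * T) x * `|p (x + c)|) /\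
  lint (fun x => seg (N%:R * T) x * `|p (x + c)|) = N%:R * P1.
Proof.
have [h1 h2] := per_shift T0 map_ apT iap c.
have mc : measurable_fun setT (fun x : R => `|p (x + c)|).
  exact: (measurableT_comp map_ (measurable_addr c)).
have cT x : `|p (x + T + c)| = `|p (x + c)| by rewrite addrAC pT.
have [h3 h4] := per_segN T0 mc cT h1 N.
by rewrite h4 h2.
Qed.

Section Kernel.
Variables (v : R -> R -> R) (C : R) (N : nat).
Hypotheses (mv : measurable_fun setT (fun z : R * R => v z.1 z.2))
  (vC : forall x u, `|v x u| <= C * seg (N%:R * T) x).

(** With [t = e^x] and [s = e^(x+u)], [ln (t + s)] is [x + lse u], and [kap u] is
    [sqrt (t s) / (t + s)]. *)
Definition hker x u := kap u * (p (x + lse u) * v x u).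

Lemma measurable_hker : measurable_fun setT (fun z : R * R => hker z.1 z.2).
Proof.
have m1 : measurable_fun setT (fun z : R * R => z.2) by exact: measurable_snd.
apply: measurable_funM; first exact: (measurableT_comp (@measurable_kap R) m1).
apply: measurable_funM => //; apply: (measurableT_comp mp).
apply: measurable_funD; first exact: measurable_fst.
exact: (measurableT_comp (@measurable_lse R) m1).
Qed.

(** The integral in [x] is taken first: for fixed [u], translating [|p|] by [lse u] does not change
    its integral over [N] periods, and what remains is a multiple of [kap u]. *)
Lemma hker_int : (mu \x mu)%E.-integrable setT (EFin \o (fun z : R * R => hker z.1 z.2)).
Proof.
have iB : lintegrable (fun u => kap u * (C * (N%:R * P1))).
  by under eq_fun do rewrite mulrC; apply: lintegrableZ; case: (@kap_integral R).
apply: (prod_integrable2 measurable_hker iB) => u.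
have [h1 h2] := shifted_int (lse u) N.
have i2 := lintegrableZ (kap u * C) h1.
apply: (@le_trans _ _ (\int[mu]_x (kap u * C * (seg (N%:R * T) x * `|p (x + lse u)|))%:E)%E).
  apply: ge0_le_integral => //.
  - apply/measurable_EFinP; apply: measurableT_comp => //.
    exact: (measurableT_comp measurable_hker (pair2_measurable u)).
  - by apply/measurable_EFinP; exact: lintegrable_measurable i2.
  - move=> x _; rewrite lee_fin /hker /= !normrM (ger0_norm (kap_ge0 u)) -!mulrA ler_wpM2l ?kap_ge0 //.
    by rewrite mulrC mulrA ler_wpM2r.
by rewrite lint_EFin // lintZ // h2 !mulrA.
Qed.

Lemma measurable_hker_int : measurable_fun setT (fun u => lint (hker^~ u)).
Proof.
have := measurable_fubini_G hker_int => m.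
exact: (measurableT_comp (measurable_fine_fun : measurable_fun setT (fine : \bar R -> R)) m).
Qed.

Lemma measurable_hker_int1 : measurable_fun setT (fun x => lint (hker x)).
Proof.
have := measurable_fubini_F hker_int => m.
exact: (measurableT_comp (measurable_fine_fun : measurable_fun setT (fine : \bar R -> R)) m).
Qed.

Lemma hker_int_bound u : `|lint (hker^~ u)| <= kap u * (C * (N%:R * P1)).
Proof.
have [h1 h2] := shifted_int (lse u) N.
have i2 := lintegrableZ (kap u * C) h1.
have B x : `|hker x u| <= kap u * C * (seg (N%:R * T) x * `|p (x + lse u)|).
  rewrite /hker /= !normrM (ger0_norm (kap_ge0 u)) -!mulrA ler_wpM2l ?kap_ge0 //.
  by rewrite mulrC mulrA ler_wpM2r.
have mh := measurableT_comp measurable_hker (@pair2_measurable _ _ R R u).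
apply: le_trans (norm_lint (lintegrable_le mh i2 B) i2 B) _.
by rewrite lintZ // h2 !mulrA.
Qed.
End Kernel.

Section Weight.
Variables (g : R -> R) (M : R).
Hypotheses (mg : measurable_fun setT g) (gM : forall x, `|g x| <= M) (gT : forall x, g (x + T) = g x).

Let M0 : 0 <= M. Proof. exact: le_trans (normr_ge0 _) (gM 0). Qed.

(** [vN] comes from the test function cut to [N] periods, [vI] from a single period with the second
    factor left uncut; per period the former tends to the latter. *)
Let vN (N : nat) x u := seg (N%:R * T) x * g x * (seg (N%:R * T) (x + u) * g (x + u)).
Let vI x u := seg T x * (g x * g (x + u)).

Let mgu : measurable_fun setT (fun z : R * R => g (z.1 + z.2)).
Proof.
apply: (measurableT_comp mg); apply: measurable_funD; [exact: measurable_fst|exact: measurable_snd].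
Qed.

Let mvN N : measurable_fun setT (fun z : R * R => vN N z.1 z.2).
Proof.
have ms : measurable_fun setT (fun z : R * R => z.1 + z.2).
  by apply: measurable_funD; [exact: measurable_fst|exact: measurable_snd].
apply: measurable_funM; apply: measurable_funM.
- exact: (measurableT_comp (measurable_seg _) measurable_fst).
- exact: (measurableT_comp mg measurable_fst).
- exact: (measurableT_comp (measurable_seg _) ms).
- exact: mgu.
Qed.

Let mvI : measurable_fun setT (fun z : R * R => vI z.1 z.2).
Proof.
apply: measurable_funM; first exact: (measurableT_comp (measurable_seg _) measurable_fst).
by apply: measurable_funM => //; exact: (measurableT_comp mg measurable_fst).
Qed.

Let vNC N x u : `|vN N x u| <= M ^+ 2 * seg (N%:R * T) x.
Proof.
rewrite /vN !normrM !(ger0_norm (seg_ge0 _ _)) -mulrA [leRHS]mulrC ler_wpM2l ?seg_ge0 //.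
rewrite expr2 ler_pM ?mulr_ge0 ?seg_ge0 //.
by rewrite -[leRHS]mul1r ler_pM ?seg_ge0 ?seg_le1.
Qed.

Let vIC x u : `|vI x u| <= M ^+ 2 * seg (1%:R * T) x.
Proof.
rewrite /vI mul1r !normrM (ger0_norm (seg_ge0 _ _)) [leRHS]mulrC ler_wpM2l ?seg_ge0 //.
by rewrite expr2 ler_pM.
Qed.

Lemma lse_log (x y : R) : ln (expR x + expR y) = x + lse (y - x).
Proof.
have h : expR x + expR y = expR x * (1 + expR (y - x)).
  by rewrite mulrDr mulr1 -expRD subrKC.
by rewrite h lnM ?posrE ?expR_gt0 ?addr_gt0 ?expR_gt0 // expRK.
Qed.

Lemma kap_log (x y : R) : expR (x + 2^-1 * (y - x)) / (expR x + expR y) = kap (y - x).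
Proof.
have h : expR x + expR y = expR x * (1 + expR (y - x)) by rewrite mulrDr mulr1 -expRD subrKC.
rewrite h expRD; have -> : expR (y - x) = expR (2^-1 * (y - x)) ^+ 2.
  by rewrite -expRM_natr; congr expR; field.
rewrite /kap /coshR expRN; have := expR_gt0 (2^-1 * (y - x)); have := expR_gt0 x.
move: (expR x) (expR _) => X e X0 e0.
have d : 1 + e ^+ 2 != 0 by rewrite gt_eqF //; nra.
have d' : e * e + 1 != 0 by rewrite gt_eqF //; nra.
by field; rewrite ?d ?d' !gt_eqF.
Qed.

(* The quadratic form of the Hankel operator at [t^(-1/2) g(ln t)], in the
   coordinates [t = e^x], [s = e^(x+u)]. *)
Lemma hankel_form_ge0 N : 0 <= lint (fun u => lint (fun x => hker (vN N) x u)).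
Proof.
pose gN x := seg (N%:R * T) x * g x.
have mgN : measurable_fun setT gN by apply: measurable_funM => //; exact: measurable_seg.
pose ph y := expR (- (2^-1 * y)) * gN y.
have mE (c : R) : measurable_fun setT (fun y : R => expR (c * y)).
  exact: continuous_measurable_fun (dv_continuous (dv_exp c)).
have mph : measurable_fun setT ph.
  apply: measurable_funM => //; have := mE (- 2^-1); apply: eq_measurable_fun => y _.
  by rewrite mulNr.
have mln : measurable_fun setT (@ln R) by exact: measurable_ln.
have mphl : measurable_fun (@Rpos R) (fun t => ph (ln t)).
  by apply: measurable_funTS; exact: (measurableT_comp mph mln).
have igN : lintegrable (fun y => M ^+ 2 * seg (N%:R * T) y).
  have [|h _] := per_segN T0 (measurable_cst (1 : R)) (fun=> erefl) _ N.
    have : lintegrable (\1_(`[0, T[%classic : set R) : R -> R).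
      apply/integrableP; split; first by apply/measurable_EFinP; exact: measurable_indic (measurable_itv _).
      under eq_integral do rewrite /= ger0_norm //.
      rewrite integral_indic ?setIT //.
      rewrite [X in (X < _)%E](_ : _ = T%:E) ?ltry //.
      by apply: etrans (@lebesgue_measure_itv R `[0, T[) _; rewrite /= lte_fin T0 -EFinB subr0.
    by rewrite -seg_indic; under [X in _ -> lintegrable X]eq_fun do rewrite mulr1.
  by apply: lintegrableZ; move: h; under eq_fun do rewrite mulr1.
have L2 : (\int[mu]_(x in @Rpos R) ((ph (ln x)) ^+ 2)%:E < +oo)%E.
  rewrite (@ge0_integral_ln R (fun y => ((ph y) ^+ 2)%:E)) //; last 2 first.
  - by apply/measurable_EFinP; exact: measurable_funX.
  - by move=> x; rewrite lee_fin sqr_ge0.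
  have i2 : lintegrable (fun y => (gN y) ^+ 2).
    apply: (lintegrable_le _ igN); first exact: measurable_funX.
    move=> x; rewrite normrX /gN normrM (ger0_norm (seg_ge0 _ _)) exprMn [leLHS]mulrC.
    apply: ler_pM; rewrite ?sqr_ge0 //; first by rewrite ler_pXn2r ?nnegrE.
    by rewrite expr2 ler_piMl ?seg_ge0 ?seg_le1.
  have -> : (\int[mu]_y ((ph y ^+ 2)%:E * (expR y)%:E) = \int[mu]_y (gN y ^+ 2)%:E)%E; last by rewrite lint_EFin ?ltry.
  apply: eq_integral => y _; rewrite -EFinM /ph exprMn mulrAC -expRM_natr -expRD.
  by rewrite (_ : _ + y = 0) ?expR0 ?mul1r //; field.
have := Hpsd mphl L2.
have mH x : measurable_fun setT (fun y : R => hankel_kernel p (expR x + expR y)).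
  have ms : measurable_fun setT (fun y : R => expR x + expR y).
    by apply: measurable_funD => //; exact: measurable_expR.
  apply: measurable_funM; first exact: (measurableT_comp mp (measurableT_comp mln ms)).
  have := mE 1 => m1; have mi : measurable_fun setT (fun y : R => (expR x + expR (1 * y))^-1).
    apply: continuous_measurable_fun; apply: (dv_continuous (df := fun y => - (0 + 1 * expR (1 * y)) * (expR x + expR (1 * y)) ^- 2)) => y.
    have n0 : expR x + expR (1 * y) != 0 by rewrite gt_eqF // addr_gt0 ?expR_gt0.
    exact: (@dvV _ (fun y => expR x + expR (1 * y)) y _ n0 (dvD (dv_cst (expR x) y) (dv_exp 1 y))).
  by move: mi; apply: eq_measurable_fun => y _; rewrite mul1r.
pose In x := lint (fun y => hankel_kernel p (expR x + expR y) * ph y * expR y).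
have E1 (t : R) : t \in @Rpos R -> Rintegral mu (@Rpos R) (fun s => hankel_kernel p (t + s) * ph (ln s)) = In (ln t).
  move=> /set_mem; rewrite /Rpos /= in_itv /= andbT => t0.
  rewrite /In -(Rintegral_ln (f := fun y => hankel_kernel p (expR (ln t) + expR y) * ph y)); last first.
    by apply: measurable_funM => //; exact: mH.
  apply: eq_Rintegral => s /set_mem; rewrite /Rpos /= in_itv /= andbT => s0.
  by rewrite !lnK.
have E2 x : In x * ph x = expR (- x) * lint (hker (vN N) x).
  rewrite [LHS]mulrC /In -[LHS]lint_measZ; last by apply: measurable_funM; [apply: measurable_funM => //; exact: mH|exact: measurable_expR].
  rewrite -[RHS]lint_measZ; last first.
    exact: (measurableT_comp (measurable_hker (mvN N)) (pair1_measurable x)).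
  have ms : measurable_fun setT (fun y => ph x * (hankel_kernel p (expR x + expR y) * ph y * expR y)).
    by apply: measurable_funM => //; apply: measurable_funM; [apply: measurable_funM => //; exact: mH|exact: measurable_expR].
  rewrite -(lint_shift x ms); apply: eq_lint => u.
  rewrite /hankel_kernel /hker /vN lse_log addrK /ph [u + x]addrC -/(gN x) -/(gN (x + u)).
  have := kap_log x (x + u); rewrite [x + u - x]addrAC subrr add0r => <-.
  have e1 : expR (x + 2^-1 * u) = expR (- (2^-1 * x)) * expR (- (2^-1 * (x + u))) * expR (x + u) * expR x.
    by rewrite -!expRD; congr expR; field.
  rewrite e1; have e2 := expRxMexpNx_1 x.
  have -> : expR (- x) * (expR (- (2^-1 * x)) * expR (- (2^-1 * (x + u))) * expR (x + u) * expR x /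
    (expR x + expR (x + u)) * (p (x + lse u) * (gN x * gN (x + u)))) =
    (expR x * expR (- x)) * (expR (- (2^-1 * x)) * expR (- (2^-1 * (x + u))) * expR (x + u) /
    (expR x + expR (x + u)) * (p (x + lse u) * (gN x * gN (x + u)))) by ring.
  by rewrite e2 mul1r; ring.
have mI : measurable_fun setT (fun x => In x * ph x).
  under eq_fun do rewrite E2; apply: measurable_funM.
    by have := mE (- 1); apply: eq_measurable_fun => y _; rewrite mulN1r.
  exact: (measurable_hker_int1 (mvN N) (vNC N)).
have -> : Rintegral mu (@Rpos R) (fun t => Rintegral mu (@Rpos R) (fun s => hankel_kernel p (t + s) * ph (ln s)) * ph (ln t)) =
    Rintegral mu (@Rpos R) (fun t => (fun x => In x * ph x) (ln t)).
  by apply: eq_Rintegral => t ht; rewrite E1.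
rewrite (Rintegral_ln mI).
rewrite (eq_lint (g := fun x => lint (hker (vN N) x))); last first.
  by move=> x; rewrite E2 mulrAC -expRD addNr expR0 mul1r.
by rewrite (lint_fubini (hker_int (mvN N) (vNC N))).
Qed.

(** Points of the window that leave it under translation by [u] lie within [k] periods of one of its
    two ends. *)
Lemma edge_le (N k : nat) x u : `|u| <= k%:R * T ->
  seg (N%:R * T) x * (1 - seg (N%:R * T) (x + u)) <=
  seg (k%:R * T) x + seg (k%:R * T) (x - (N%:R - k%:R) * T).
Proof.
rewrite ler_norml mulrBl /seg; move: (N%:R * T) (k%:R * T) => n K /andP[h1 h2].
have [x0|x0] := leP 0 x; have [xn|xn] := ltP x n; have [a|a] := leP 0 (x + u); have [b|b] := ltP (x + u) n;
  have [c|c] := ltP x K; have [d|d] := leP 0 (x - (n - K)); have [e|e] := ltP (x - (n - K)) K;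
  rewrite /= ?mul0r ?mul1r ?subrr ?subr0 ?addr0 ?add0r ?mul1r //; try lra; exfalso; lra.
Qed.

Let Phi N u := lint ((hker (vN N))^~ u).
Let Phi0 u := lint ((hker vI)^~ u).

(** For fixed [u] the discrepancy is an edge effect, bounded independently of [N]; it disappears
    after division by [N]. *)
Let Phi_dist (N k : nat) u : `|u| <= k%:R * T ->
  `|N%:R * Phi0 u - Phi N u| <= kap u * (2 * (k%:R * (M ^+ 2 * P1))).
Proof.
move=> uk; pose f x := kap u * (p (x + lse u) * (g x * g (x + u))).
have mf : measurable_fun setT f.
  apply: measurable_funM => //; apply: measurable_funM.
    exact: (measurableT_comp mp (measurable_addr _)).
  by apply: measurable_funM => //; exact: (measurableT_comp mg (measurable_addr _)).
have fT x : f (x + T) = f x by rewrite /f (addrAC x T) pT gT (addrAC x T) gT.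
have fb (n : nat) x : seg (n%:R * T) x * `|f x| <= kap u * M ^+ 2 * (seg (n%:R * T) x * `|p (x + lse u)|).
  rewrite mulrCA ler_wpM2l ?seg_ge0 // /f !normrM (ger0_norm (kap_ge0 u)) -mulrA ler_wpM2l ?kap_ge0 //.
  by rewrite mulrC ler_wpM2r // expr2 ler_pM.
have si n := shifted_int (lse u) n.
have ib n := lintegrableZ (kap u * M ^+ 2) (si n).1.
have maf : measurable_fun setT (fun x => `|f x|) by exact: measurableT_comp.
have iaf n : lintegrable (fun x => seg (n%:R * T) x * `|f x|).
  apply: (lintegrable_le _ (ib n)); first by apply: measurable_funM => //; exact: measurable_seg.
  by move=> x; rewrite ger0_norm ?mulr_ge0 ?seg_ge0.
have if_ n : lintegrable (fun x => seg (n%:R * T) x * f x).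
  apply: (lintegrable_le _ (iaf n)); first by apply: measurable_funM => //; exact: measurable_seg.
  by move=> x; rewrite normrM ger0_norm ?seg_ge0.
have ifT : lintegrable (fun x => seg T x * f x) by have := if_ 1%N; rewrite mul1r.
have [iN eN] := per_segN T0 mf fT ifT N.
have P0E : Phi0 u = lint (fun x => seg T x * f x).
  by apply: eq_lint => x; rewrite /hker /vI /f; ring.
have iPhi : lintegrable (fun x => hker (vN N) x u).
  apply: (lintegrable_le _ (iaf N)); first exact: (measurableT_comp (measurable_hker (mvN N)) (pair2_measurable u)).
  move=> x; have -> : hker (vN N) x u = seg (N%:R * T) x * (seg (N%:R * T) (x + u) * f x) by rewrite /hker /vN /f; ring.
  rewrite !normrM !(ger0_norm (seg_ge0 _ _)) ler_wpM2l ?seg_ge0 // -normrM.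
  by rewrite -[leRHS]mul1r -normrM ler_wpM2r // seg_le1.
rewrite P0E -eN -lintB //.
pose s : R := (N%:R - k%:R) * T.
have perf x : `|f (x - s)| = `|f x|.
  have := perZ fT (k%:Z - N%:Z) x; rewrite intrB -!pmulrn => h; congr (`| _ |).
  by rewrite -h; congr f; rewrite /s; ring.
have ik := iaf k; have iks := lintegrable_shift (- s) ik.
have B x : `|seg (N%:R * T) x * f x - hker (vN N) x u| <=
    seg (k%:R * T) x * `|f x| + seg (k%:R * T) (x - s) * `|f (x - s)|.
  have -> : seg (N%:R * T) x * f x - hker (vN N) x u = seg (N%:R * T) x * (1 - seg (N%:R * T) (x + u)) * f x.
    by rewrite /hker /vN /f; ring.
  rewrite perf -mulrDl normrM ler_wpM2r // ger0_norm; first exact: edge_le.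
  by rewrite mulr_ge0 ?seg_ge0 // subr_ge0 seg_le1.
apply: le_trans (norm_lint (lintegrableB iN iPhi) (lintegrableD ik iks) B) _.
rewrite lintD // (lint_shift _ (lintegrable_measurable ik)).
have L : lint (fun x => seg (k%:R * T) x * `|f x|) <= kap u * M ^+ 2 * (k%:R * P1).
  by apply: le_trans (le_lint ik (ib k) (fb k)) _; rewrite lintZ; [rewrite (si k).2|exact: (si k).1].
have -> : kap u * (2 * (k%:R * (M ^+ 2 * P1))) = kap u * M ^+ 2 * (k%:R * P1) + kap u * M ^+ 2 * (k%:R * P1) by ring.
exact: lerD.
Qed.

(** The nonnegative Hankel forms of the cut functions, divided by the number of periods, converge
    pointwise in [u] by [Phi_dist] and are dominated by a multiple of [kap]. *)
Lemma hankel_average : lintegrable Phi0 /\ 0 <= lint Phi0.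
Proof.
have P10 : 0 <= P1 by apply: lint_ge0 => x; rewrite mulr_ge0 ?seg_ge0.
have mPhi0 : measurable_fun setT Phi0 := measurable_hker_int mvI vIC.
have iD : lintegrable (fun u => kap u * (M ^+ 2 * P1)).
  by under eq_fun do rewrite mulrC; apply: lintegrableZ; case: (@kap_integral R).
have b0 u : `|Phi0 u| <= kap u * (M ^+ 2 * P1).
  by have := hker_int_bound mvI vIC u; rewrite mul1r.
split; first exact: (lintegrable_le mPhi0 iD b0).
pose F (n : nat) u := n.+1%:R^-1 * Phi n.+1 u.
have mPhi n : measurable_fun setT (Phi n) := measurable_hker_int (mvN n) (vNC n).
have L : (fun n => lint (F n)) @ \oo --> lint Phi0.
  apply: (@lint_cvg R F Phi0 _ _ mPhi0 _ iD).
  - by move=> n; apply: measurable_funM.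
  - move=> u; have [k uk] : exists k : nat, `|u| <= k%:R * T.
      exists (Num.bound (`|u| / T)); rewrite -ler_pdivrMr //.
      by apply/ltW/archi_boundP; rewrite divr_ge0 // ltW.
    apply: cvg_of_sub0; apply: (@cvg0_le _ _ harmonic (kap u * (2 * (k%:R * (M ^+ 2 * P1))))); last exact: cvg_harmonic.
    move=> n; have h := Phi_dist n.+1 uk.
    have n0 : n.+1%:R != 0 :> R by rewrite pnatr_eq0.
    have -> : F n u - Phi0 u = - ((n.+1%:R * Phi0 u - Phi n.+1 u) * n.+1%:R^-1).
      by rewrite /F; field.
    rewrite normrN normrM [X in _ * X]ger0_norm ?invr_ge0 ?ler0n //.
    by apply: ler_wpM2r => //; rewrite invr_ge0 ler0n.
  - move=> n u; rewrite /F normrM ger0_norm ?invr_ge0 ?ler0n //.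
    have := hker_int_bound (mvN n.+1) (vNC n.+1) u => h.
    rewrite ler_pdivrMl ?ltr0n //; apply: le_trans h _.
    by rewrite le_eqVlt; apply/orP; left; apply/eqP; ring.
apply: (limr_ge_cst L) => n.
rewrite /F lintZ; first by rewrite mulr_ge0 ?invr_ge0 ?ler0n //; exact: hankel_form_ge0.
apply: (lintegrable_le (mPhi n.+1) _ (hker_int_bound (mvN n.+1) (vNC n.+1))).
by under eq_fun do rewrite mulrC; apply: lintegrableZ; case: (@kap_integral R).
Qed.
End Weight.

Lemma cint_sum (I : Type) (s : seq I) (F : I -> R -> R[i]) : (forall i, cintegrable (F i)) ->
  cintegrable (fun u => \sum_(i <- s) F i u) /\
  cint (fun u => \sum_(i <- s) F i u) = \sum_(i <- s) cint (F i).
Proof.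
move=> h.
have ReS (G : I -> R[i]) : Re (\sum_(i <- s) G i) = \sum_(i <- s) Re (G i).
  by elim/big_rec2: _ => [//|j x u _ <-]; exact: ReD.
have ImS (G : I -> R[i]) : Im (\sum_(i <- s) G i) = \sum_(i <- s) Im (G i).
  by elim/big_rec2: _ => [//|j x u _ <-]; exact: ImD.
have [a1 a2] := @lint_sum R I s (fun i x => Re (F i x)) (fun i => (h i).1).
have [b1 b2] := @lint_sum R I s (fun i x => Im (F i x)) (fun i => (h i).2).
split; first by split; [under eq_fun do rewrite ReS|under eq_fun do rewrite ImS].
apply: complex_ext; rewrite ?ReS ?ImS ?Re_cint ?Im_cint.
  by under eq_lint do rewrite ReS.
by under eq_lint do rewrite ImS.
Qed.

Lemma cintegrableZ (z : R[i]) f : cintegrable f -> cintegrable (fun x => z * f x).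
Proof.
move=> [h1 h2]; split.
  by under eq_fun do rewrite ReM; apply: lintegrableB; exact: lintegrableZ.
by under eq_fun do rewrite ImM; apply: lintegrableD; exact: lintegrableZ.
Qed.

Lemma bcis_int (a b : R) : cintegrable (bcis a b).
Proof.
have mc : measurable_fun setT (fun y : R => b * y - (b - a) * lse y).
  apply: measurable_funB; apply: measurable_funM => //; exact: measurable_lse.
apply: (@cintegrable_le _ _ kap); last by move=> y; rewrite ncM ncR nc_cis mulr1 ger0_norm ?kap_ge0.
  split; [under eq_fun do rewrite ReC|under eq_fun do rewrite ImM /= mul0r addr0].
    apply: measurable_funM; first exact: measurable_kap.
    by apply: (measurableT_comp _ mc); exact: continuous_measurable_fun (@continuous_cos R).
  apply: measurable_funM; first exact: measurable_kap.
  by apply: (measurableT_comp _ mc); exact: continuous_measurable_fun (@continuous_sin R).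
by case: (@kap_integral R).
Qed.

Let om : R := omg T.

Lemma omT : om * T = 2 * pi. Proof. by rewrite /om /omg divfK // gt_eqF. Qed.

Lemma cis_per (n : int) x : cis (om * n%:~R * (x + T)) = cis (om * n%:~R * x).
Proof.
rewrite mulrDr cisD; have -> : om * n%:~R * T = n%:~R * (2 * pi) by rewrite -omT; ring.
by rewrite cis_int mulr1.
Qed.

Definition pcis (n : int) x : R[i] := (seg T x * p x)%:C * cis (om * n%:~R * x).

Let mcis (t : R) : measurable_fun setT (fun x : R => cos (t * x)) /\ measurable_fun setT (fun x : R => sin (t * x)).
Proof. by split; [exact: measurable_cosl|exact: measurable_sinl]. Qed.

Lemma pcis_shift (n : int) c :
  cintegrable (fun x => (seg T x * p (x + c))%:C * cis (om * n%:~R * (x + c))) /\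
  cint (fun x => (seg T x * p (x + c))%:C * cis (om * n%:~R * (x + c))) = cint (pcis n).
Proof.
have [mc ms] := mcis (om * n%:~R).
have part (h : R -> R) : measurable_fun setT h -> (forall x, `|h x| <= 1) -> (forall x, h (x + T) = h x) ->
   lintegrable (fun x => seg T x * p (x + c) * h (x + c)) /\
   lint (fun x => seg T x * p (x + c) * h (x + c)) = lint (fun x => seg T x * p x * h x).
  move=> mh h1 hT; have mph : measurable_fun setT (fun x => p x * h x) by exact: measurable_funM.
  have i0 : lintegrable (fun x => seg T x * (p x * h x)).
    apply: (lintegrable_le _ iap); first by apply: measurable_funM => //; exact: measurable_seg.
    move=> x; rewrite !normrM ger0_norm ?seg_ge0 // ler_wpM2l ?seg_ge0 //.
    by rewrite -[leRHS]mulr1 ler_wpM2l.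
  have phT x : p (x + T) * h (x + T) = p x * h x by rewrite pT hT.
  have [a b] := per_shift T0 mph phT i0 c.
  rewrite (eq_lint (g := fun x => seg T x * (p (x + c) * h (x + c)))) => [|x]; last by rewrite mulrA.
  rewrite b; split; first by under eq_fun do rewrite -mulrA.
  by apply: eq_lint => x; rewrite mulrA.
have cT x : cos (om * n%:~R * (x + T)) = cos (om * n%:~R * x) by have := congr1 Re (cis_per n x).
have sT x : sin (om * n%:~R * (x + T)) = sin (om * n%:~R * x) by have := congr1 Im (cis_per n x).
have [a1 a2] := part _ mc (fun x => cos_max _) cT.
have [b1 b2] := part _ ms (fun x => sin_max _) sT.
have Er (x : R) w : Re (x%:C * w) = x * Re w by rewrite ReC.
have Ei (x : R) w : Im (x%:C * w) = x * Im w by rewrite ImM /= mul0r addr0.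
split; first by split; [under eq_fun do rewrite Er|under eq_fun do rewrite Ei].
apply: complex_ext; rewrite ?Re_cint ?Im_cint.
  rewrite (eq_lint (fun x => Er _ _)) a2; apply: eq_lint => x; by rewrite /pcis Er.
rewrite (eq_lint (fun x => Ei _ _)) b2; apply: eq_lint => x; by rewrite /pcis Ei.
Qed.

Lemma fourier_cint (l : int) : T%:C * fourier p T l = cint (pcis (- l)).
Proof.
have E (h : R -> R) : measurable_fun setT h -> (forall x, `|h x| <= 1) ->
    T * (T^-1 * Rintegral mu (I0T T) (fun x => h x * p x)) = lint (fun x => seg T x * p x * h x).
  move=> mh h1; rewrite mulrA mulfV ?gt_eqF // mul1r.
  have i0 : lintegrable (fun x => seg T x * p x * h x).
    apply: (lintegrable_le _ iap); first by apply: measurable_funM => //; apply: measurable_funM => //; exact: measurable_seg.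
    move=> x; rewrite !normrM ger0_norm ?seg_ge0 // -mulrA ler_wpM2l ?seg_ge0 //.
    by rewrite -[leRHS]mulr1 ler_wpM2l.
  have Ep : (fun x => seg T x * p x * h x) = (fun x => h x * p x) \_ (`[0, T[%classic : set R).
    by apply/funext => x; rewrite patchE seg_indic indicE; case: (_ \in _); rewrite ?mul0r ?mul1r // mulrC.
  rewrite /I0T -(Rintegral_itv_bndo_bndc (a := BLeft 0)).
    by rewrite Rintegral_mkcond -Ep.
  apply/integrable_mkcond => //; move: i0; rewrite Ep; apply: eq_integrable => // x _ /=.
  by rewrite !patchE; case: ifP.
have Er (x : R) w : Re (x%:C * w) = x * Re w by rewrite ReC.
have Ei (x : R) w : Im (x%:C * w) = x * Im w by rewrite ImM /= mul0r addr0.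
have nl (x : R) : om * (- l)%:~R * x = - (l%:~R * om * x) by rewrite mulrNz; ring.
apply: complex_ext.
  rewrite Er Re_cint (_ : Re (fourier p T l) = T^-1 * Rintegral mu (I0T T) (fun x => cos (l%:~R * om * x) * p x)) //.
  rewrite (E (fun x => cos (l%:~R * om * x))); [|exact: measurable_cosl|by move=> x; exact: cos_max].
  by apply: eq_lint => x; rewrite /pcis Er nl /= cosN.
rewrite Ei Im_cint (_ : Im (fourier p T l) = - (T^-1 * Rintegral mu (I0T T) (fun x => sin (l%:~R * om * x) * p x))) //.
rewrite mulrN (E (fun x => sin (l%:~R * om * x))); [|exact: measurable_sinl|by move=> x; exact: sin_max].
rewrite -mulN1r -lint_measZ; last first.
  by apply: measurable_funM; [apply: measurable_funM => //; exact: measurable_seg|exact: measurable_sinl].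
by apply: eq_lint => x; rewrite /pcis Ei nl /= sinN; ring.
Qed.

(** The Fourier coefficient over the third Gamma factor of the Beta function. It does not involve
    [k], which therefore acts only through the weights [c_n]. *)
Definition symb (l : int) : R[i] := fourier p T l / Gammac (1 +i* (- (om * l%:~R))).

Lemma fourierN l : fourier p T (- l) = cj (fourier p T l).
Proof.
have TC : T%:C != 0 :> R[i] by rewrite RC_eq0 gt_eqF.
apply: (mulfI TC); rewrite fourier_cint opprK -[T%:C in RHS]conjR -conjM fourier_cint.
have mp' (n : int) : measurable_fun setT (fun x => Re (pcis n x)) /\ measurable_fun setT (fun x => Im (pcis n x)).
  have [[a1 a2] _] := pcis_shift n 0; split.
    by have := lintegrable_measurable a1; apply: eq_measurable_fun => x _; rewrite addr0.
  by have := lintegrable_measurable a2; apply: eq_measurable_fun => x _; rewrite addr0.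
have E x : pcis l x = cj (pcis (- l) x).
  by rewrite /pcis conjM conjR cj_cis mulrNz; congr (_ * cis _); ring.
apply: complex_ext; rewrite ?Re_conj ?Im_conj ?Re_cint ?Im_cint.
  by apply: eq_lint => x; rewrite E Re_conj.
rewrite -[RHS]mulN1r -lint_measZ; last exact: (mp' _).2.
by apply: eq_lint => x; rewrite E Im_conj mulN1r.
Qed.

Lemma symbN l : symb (- l) = cj (symb l).
Proof.
rewrite /symb fourierN mulrNz mulrN conjM; congr (_ * _).
rewrite -[X in _ = cj X]/((Gammac (1 +i* (- (om * l%:~R))))^-1) (@Gammac_conj R 1 (- (om * l%:~R)) (or_intror erefl)).
exact: (esym (fmorphV (@conjc R) _)).
Qed.

(** Expanding the averaged form for a trigonometric polynomial: the integral over a period in [x]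
    gives a Fourier coefficient of [p], and the remaining integral in [u] is a Beta integral. *)
Lemma trig_form (M : nat) (c : nat -> R[i]) :
  0 <= Re (\sum_(i < M) \sum_(j < M) c i * cj (c j) * (T%:C * fourier p T (j%:Z - i%:Z)) *
     cint (bcis (- (om * i%:R)) (- (om * j%:R)))).
Proof.
pose ga x := \sum_(i < M) c i * cis (om * i%:R * x).
pose B := \sum_(i < M) nc (c i).
have ncs (I : Type) (s : seq I) (G : I -> R[i]) : nc (\sum_(i <- s) G i) <= \sum_(i <- s) nc (G i).
  elim/big_rec2: _ => [|j y x _ h]; first by rewrite nc0.
  by apply: le_trans (ncD _ _) _; rewrite lerD2l.
have gaB x : nc (ga x) <= B.
  apply: le_trans (ncs _ _ _) _; apply: ler_sum => i _.
  by rewrite ncM nc_cis mulr1.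
have gaT x : ga (x + T) = ga x.
  by apply: eq_bigr => i _; have := cis_per i%:Z x; rewrite -pmulrn => ->.
have ReS (G : 'I_M -> R[i]) : Re (\sum_i G i) = \sum_i Re (G i).
  by elim/big_rec2: _ => [//|j x u _ <-]; exact: ReD.
have ImS (G : 'I_M -> R[i]) : Im (\sum_i G i) = \sum_i Im (G i).
  by elim/big_rec2: _ => [//|j x u _ <-]; exact: ImD.
have mR : measurable_fun setT (fun x => Re (ga x)).
  rewrite (_ : (fun x => _) = (fun x => \sum_(i < M) (Re (c i) * cos (om * i%:R * x) - Im (c i) * sin (om * i%:R * x)))).
    apply: measurable_sum => i; apply: measurable_funB; apply: measurable_funM => //; first exact: measurable_cosl.
    exact: measurable_sinl.
  by apply/funext => x; rewrite ReS; apply: eq_bigr => i _; rewrite ReM.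
have mI : measurable_fun setT (fun x => Im (ga x)).
  rewrite (_ : (fun x => _) = (fun x => \sum_(i < M) (Re (c i) * sin (om * i%:R * x) + Im (c i) * cos (om * i%:R * x)))).
    apply: measurable_sum => i; apply: measurable_funD; apply: measurable_funM => //; first exact: measurable_sinl.
    exact: measurable_cosl.
  by apply/funext => x; rewrite ImS; apply: eq_bigr => i _; rewrite ImM.
(* [hankel_psd] tests real functions, so real and imaginary parts enter separately. Their sum is the
   real part of [ga x * cj (ga (x + u))]. *)
have [iR pR] := @hankel_average (fun x => Re (ga x)) B mR (fun x => le_trans (Re_le_nc _) (gaB x)) (fun x => congr1 Re (gaT x)).
have [iI pI] := @hankel_average (fun x => Im (ga x)) B mI (fun x => le_trans (Im_le_nc _) (gaB x)) (fun x => congr1 Im (gaT x)).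
pose K (i j : 'I_M) := c i * cj (c j) * (T%:C * fourier p T (j%:Z - i%:Z)).
pose a (i : 'I_M) : R := - (om * i%:R).
have bi (i j : 'I_M) : cintegrable (bcis (a i) (a j)) by exact: bcis_int.
have Ki (i j : 'I_M) : cintegrable (fun u => K i j * bcis (a i) (a j) u) by exact: cintegrableZ.
have S1 (i : 'I_M) := @cint_sum _ (index_enum 'I_M) (fun j u => K i j * bcis (a i) (a j) u) (Ki i).
have S2 := @cint_sum _ (index_enum 'I_M) (fun i u => \sum_(j < M) K i j * bcis (a i) (a j) u) (fun i => (S1 i).1).
have -> : \sum_(i < M) \sum_(j < M) c i * cj (c j) * (T%:C * fourier p T (j%:Z - i%:Z)) *
     cint (bcis (- (om * i%:R)) (- (om * j%:R))) =
   cint (fun u => \sum_(i < M) \sum_(j < M) K i j * bcis (a i) (a j) u).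
  rewrite S2.2; apply: eq_bigr => i _; rewrite (S1 i).2; apply: eq_bigr => j _.
  by rewrite cintZ.
rewrite Re_cint.
have := addr_ge0 pR pI; rewrite -lintD //; congr (0 <= _); apply: eq_lint => u.
have m1 (g : R -> R) (B' : R) : measurable_fun setT g -> (forall x, `|g x| <= B') -> (forall x, g (x + T) = g x) ->
    lintegrable (fun x => hker (fun x u => seg T x * (g x * g (x + u))) x u).
  move=> mg gB gT.
  have B0 : 0 <= B' := le_trans (normr_ge0 _) (gB 0).
  have [si _] := shifted_int (lse u) 1; rewrite mul1r in si.
  apply: (lintegrable_le _ (lintegrableZ (kap u * (B' * B')) si)).
    apply: measurable_funM => //; apply: measurable_funM; first exact: (measurableT_comp mp (measurable_addr _)).
    apply: measurable_funM; first exact: measurable_seg.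
    by apply: measurable_funM => //; exact: (measurableT_comp mg (measurable_addr _)).
  move=> x; rewrite /hker !normrM (ger0_norm (kap_ge0 u)) (ger0_norm (seg_ge0 _ _)) -!mulrA ler_wpM2l ?kap_ge0 //.
  have e1 (A1 A2 A3 A4 : R) : A1 * (A2 * (A3 * A4)) = (A3 * A4) * (A2 * A1) by ring.
  rewrite [leLHS]e1 [leRHS]mulrA; apply: ler_wpM2r; first by rewrite mulr_ge0 ?seg_ge0.
  exact: ler_pM.
rewrite -lintD; [|exact: (m1 _ B mR (fun x => le_trans (Re_le_nc _) (gaB x)) (fun x => congr1 Re (gaT x)))
  |exact: (m1 _ B mI (fun x => le_trans (Im_le_nc _) (gaB x)) (fun x => congr1 Im (gaT x)))].
pose F (i j : 'I_M) x := c i * cj (c j) * (kap u)%:C * cis (- (om * (i%:Z - j%:Z)%:~R * lse u) - om * j%:R * u) *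
   ((seg T x * p (x + lse u))%:C * cis (om * (i%:Z - j%:Z)%:~R * (x + lse u))).
have Fi (i j : 'I_M) : cintegrable (F i j).
  by apply: cintegrableZ; have [] := pcis_shift (i%:Z - j%:Z) (lse u).
have T1 (i : 'I_M) := @cint_sum _ (index_enum 'I_M) (F i) (Fi i).
have T2 := @cint_sum _ (index_enum 'I_M) (fun i x => \sum_(j < M) F i j x) (fun i => (T1 i).1).
transitivity (Re (cint (fun x => \sum_(i < M) \sum_(j < M) F i j x))); last first.
  congr Re; rewrite T2.2; apply: eq_bigr => i _; rewrite (T1 i).2; apply: eq_bigr => j _.
  rewrite cintZ; last by have [] := pcis_shift (i%:Z - j%:Z) (lse u).
  have [_ ->] := pcis_shift (i%:Z - j%:Z) (lse u).
  have := fourier_cint (j%:Z - i%:Z); rewrite opprB => <-.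
  rewrite /K /bcis /a.
  have -> : - (om * j%:R) * u - (- (om * j%:R) - - (om * i%:R)) * lse u =
     - (om * (i%:Z - j%:Z)%:~R * lse u) - om * j%:R * u.
    by rewrite intrB -!pmulrn; ring.
  by move: (cis _) (kap u)%:C (T%:C * _) (c i * _) => A1 A2 A3 A4; ring.
rewrite Re_cint; apply: eq_lint => x.
have -> : \sum_(i < M) \sum_(j < M) F i j x = (kap u * (seg T x * p (x + lse u)))%:C * (ga x * cj (ga (x + u))).
  have cjs (H : 'I_M -> R[i]) : cj (\sum_j H j) = \sum_j cj (H j) by exact: (rmorph_sum (@conjc R)).
  rewrite /ga cjs mulr_suml mulr_sumr; apply: eq_bigr => i _.
  rewrite mulr_sumr mulr_sumr; apply: eq_bigr => j _.
  rewrite /F conjM cj_cis !RCM.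
  transitivity (c i * cj (c j) * ((kap u)%:C * ((seg T x)%:C * (p (x + lse u))%:C)) *
    (cis (- (om * (i%:Z - j%:Z)%:~R * lse u) - om * j%:R * u) * cis (om * (i%:Z - j%:Z)%:~R * (x + lse u)))).
    by move: (cis _) (cis _) => A1 A2; ring.
  rewrite -cisD.
  have -> : - (om * (i%:Z - j%:Z)%:~R * lse u) - om * j%:R * u + om * (i%:Z - j%:Z)%:~R * (x + lse u) =
    om * i%:R * x + - (om * j%:R * (x + u)) by rewrite intrB -!pmulrn; ring.
  by rewrite cisD; move: (cis _) (cis _) => A1 A2; ring.
rewrite ReC ReM Re_conj Im_conj /hker; move: (ga x) (ga (x + u)) => w1 w2.
by move: (Re _) (Im _) (Re _) (Im _) (p _) => r1 i1 r2 i2 pp; ring.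
Qed.

Theorem hankel_psdq : psdq symb.
Proof.
split; first exact: symbN.
move=> M z; pose G (j : nat) := Gammac (2^-1 +i* (- (om * j%:R))).
have G0 j : G j != 0 := Gamma_half_neq0 _.
(* Dividing by [G j] cancels the two Gamma factors in the numerator of the Beta integral. The
   conjugation compensates for the reversed difference [j - i] in [trig_form]. *)
have := trig_form M (fun j => cj (z j / G j)).
have -> : \sum_(i < M) \sum_(j < M) cj (z i / G i) * cj (cj (z j / G j)) * (T%:C * fourier p T (j%:Z - i%:Z)) *
    cint (bcis (- (om * i%:R)) (- (om * j%:R))) =
  T%:C * \sum_(0 <= i < M) \sum_(0 <= j < M) z i * cj (z j) * symb (i%:Z - j%:Z).
  rewrite big_mkord exchange_big mulr_sumr; apply: eq_bigr => j _.
  rewrite big_mkord mulr_sumr; apply: eq_bigr => i _.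
  rewrite beta_integral opprK conjcK -[Gammac (_ +i* - (om * j%:R))]/(G j).
  have -> : Gammac (2^-1 +i* (om * i%:R)) = cj (G i).
    by rewrite /G (@Gammac_conj R 2^-1 (om * i%:R) (or_introl erefl)) conjcK.
  have -> : - (om * j%:R) + om * i%:R = - (om * (j%:Z - i%:Z)%:~R) by rewrite intrB -!pmulrn; ring.
  rewrite /symb; move: (Gammac (1 +i* _)) (fourier _ _ _) => g f.
  have -> : cj (z i / G i) = cj (z i) / cj (G i) by rewrite conjM; congr (_ * _); exact: (fmorphV (@conjc R)).
  have cG0 : cj (G i) != 0 by rewrite conjc_eq0.
  have E1 : cj (z i) / cj (G i) * cj (G i) = cj (z i) by rewrite mulfVK.
  have E2 : z j / G j * G j = z j by rewrite mulfVK.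
  transitivity ((cj (z i) / cj (G i) * cj (G i)) * (z j / G j * G j) * (T%:C * f) / g); first by ring.
  by rewrite E1 E2; ring.
by rewrite ReC pmulr_rge0.
Qed.
End HankelPositivity.

(** * Eigenvectors and their compactness *)

Section FiniteSums.
Context {R : realType}.

Lemma csum_sum {I : Type} (s : seq I) (f : I -> int -> R[i]) : (forall i, csummable (f i)) ->
  csummable (fun n => \sum_(i <- s) f i n) /\
  csum (fun n => \sum_(i <- s) f i n) = \sum_(i <- s) csum (f i).
Proof.
move=> sf; elim: s => [|i s [IH1 IH2]].
  have e : (fun n : int => \sum_(j <- [::]) f j n) = fun=> 0 by apply/funext => n; rewrite big_nil.
  rewrite e big_nil; split; first exact: csummable0.
  by apply: (@csum_delta R _ 0) => m _.
have e : (fun n : int => \sum_(j <- i :: s) f j n) = fun n => f i n + \sum_(j <- s) f j n.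
  by apply/funext => n; rewrite big_cons.
by rewrite e big_cons; split; [exact: csummableD|rewrite csumD // IH2].
Qed.

Lemma toep_pairing2 (q v w : int -> R[i]) : psdq q -> csummable v -> csummable w ->
  csum (fun n => toep q v n * cj (w n)) = csum (fun n => v n * cj (toep q w n)).
Proof.
move=> qp sv sw.
have e1 n : toep q v n * cj (w n) = csum (fun m => q (n - m) * v m * cj (w n)).
  by rewrite csumZr //; exact: toep_summable.
have e2 n : v n * cj (toep q w n) = csum (fun m => q (m - n) * v n * cj (w m)).
  rewrite /toep -csum_conj; last exact: toep_summable.
  rewrite -csumZ; last by apply: csummable_conj; exact: toep_summable.
  by apply: eq_csum => m; rewrite conjM -(qp.1) opprB; ring.
rewrite (eq_csum e1) (eq_csum e2).
rewrite (@csum_exchange R (fun n m => q (n - m) * v m * cj (w n))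
  (fun n => nc (w n)) (fun m => Re (q 0) * nc (v m))) //; last exact: rsummableZ.
move=> n m; rewrite !ncM nc_conj mulrC ler_wpM2l ?nc_ge0 // ler_wpM2r ?nc_ge0 //.
exact: psdq_bound.
Qed.

Lemma toep_sum (q : int -> R[i]) {I : Type} (s : seq I) (a : I -> R[i]) (v : I -> int -> R[i]) n :
  psdq q -> (forall i, csummable (v i)) ->
  toep q (fun m => \sum_(i <- s) a i * v i m) n = \sum_(i <- s) a i * toep q (v i) n.
Proof.
move=> qp sv.
have e m : q (n - m) * (\sum_(i <- s) a i * v i m) = \sum_(i <- s) a i * (q (n - m) * v i m).
  by rewrite mulr_sumr; apply: eq_bigr => i _; ring.
rewrite /toep (eq_csum e) (csum_sum s _).2; last by move=> i; apply: csummableZ; exact: toep_summable.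
by apply: eq_bigr => i _; rewrite csumZ //; exact: toep_summable.
Qed.

Lemma qform_ge0 (q w : int -> R[i]) : psdq q -> csummable w ->
  0 <= Re (csum (fun n => toep q w n * cj (w n))).
Proof.
move=> qp sw.
have st L : csummable (trunc L w) by apply: csummable_le sw => m; exact: trunc_le.
have tl n L : csummable (fun m => q (n - m) * trunc L w m) by apply: toep_summable => //; apply: csummable_le sw => m; exact: trunc_le.
have cv : ccvg_to \oo (fun L => csum (fun n => toep q (trunc L w) n * cj (trunc L w n)))
    (csum (fun n => toep q w n * cj (w n))).
  apply: (@csum_dominated _ _ _ _ _ _ (fun n => Re (q 0) * rsum (fun m => nc (w m)) * nc (w n))).
  - near=> L => n; rewrite ncM ler_pM ?nc_ge0 // ?nc_conj ?trunc_le //.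
    apply: (le_trans (toep_bound _ qp (st L))); apply: ler_wpM2l; first exact: le_trans (nc_ge0 _) (psdq_bound 0 qp).
    by apply: rsum_le => [m||] //; [exact: trunc_le|exact: st].
  - exact: rsummableZ.
  - move=> n; apply: ccvgM.
      apply: (@csum_dominated _ _ _ _ _ _ (fun m => Re (q 0) * nc (w m))).
      - by near=> L => m; rewrite ncM ler_pM ?nc_ge0 ?psdq_bound //; exact: trunc_le.
      - exact: rsummableZ.
      - by move=> m; apply: ccvgM; [exact: ccvg_cst|exact: trunc_cvg].
    by apply: ccvg_conj; exact: trunc_cvg.
apply: (limr_ge_cst cv.1) => L.
have e1 : csum (fun n => toep q (trunc L w) n * cj (trunc L w n)) =
    psum (fun n => psum (fun m => q (n - m) * w m) L * cj (w n)) L.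
  rewrite -csum_trunc; apply: eq_csum => n; rewrite /trunc; case: ifP => h; last by rewrite conj0 mulr0.
  congr (_ * _); rewrite /toep -csum_trunc; apply: eq_csum => m; rewrite /trunc.
  by case: ifP => _; rewrite ?mulr0.
rewrite e1; have [_ /(_ (L.*2).+1 (fun i => cj (w (i%:Z - L%:Z))))] := qp.
rewrite /psum.
suff -> : \sum_(0 <= j < (L.*2).+1) (\sum_(0 <= j0 < (L.*2).+1) q (j%:Z - L%:Z - (j0%:Z - L%:Z)) * w (j0%:Z - L%:Z)) * cj (w (j%:Z - L%:Z)) =
  \sum_(0 <= i < (L.*2).+1) \sum_(0 <= j < (L.*2).+1)
      cj (w (i%:Z - L%:Z)) * cj (cj (w (j%:Z - L%:Z))) * q (i%:Z - j%:Z) by [].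
apply: eq_bigr => i _; rewrite mulr_suml; apply: eq_bigr => j _.
rewrite (_ : i%:Z - L%:Z - (j%:Z - L%:Z) = i%:Z - j%:Z); last by ring.
by rewrite [cj (cj _)]conjcK; ring.
Unshelve. all: by end_near. Qed.

End FiniteSums.

Lemma cwtV_rsummable {R : realType} (om k : R) : 0 < om -> rsummable (fun n => (cwt om k n)^-1).
Proof.
move=> om0; apply: (@rsummable_le _ _ (fun n => 2 * pi * expR (pi * `|k|) * geo (pi * om) n)).
  by move=> n; rewrite ger0_norm ?invr_ge0 ?(ltW (cwt_gt0 _ _ _)) // cwtV_le.
by apply/rsummableZ/geo_summable; rewrite mulr_gt0 // pi_gt0.
Qed.

(** * Equivalence of the two eigenvalue equations *)

Section Reduction.
Context {R : realType}.
Variables (p : R -> R) (T k : R) (T0 : 0 < T).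
Let om := omg T.
Let q := symb p T.

Definition Gm (n : int) : R[i] := Gammac (2^-1 +i* (- freq (omg T) k n)).

Lemma Gm_conj n : Gammac (2^-1 +i* freq (omg T) k n) = cj (Gm n).
Proof. by rewrite /Gm Gammac_conj ?conjcK //; left. Qed.

Lemma Gm_neq0 n : Gm n != 0. Proof. exact: Gamma_half_neq0. Qed.

Lemma nc_Gm n : nc (Gm n) ^+ 2 = (cwt om k n)^-1.
Proof.
apply: (@complexI R); rewrite -mul_conj -Gm_conj Gamma_half_sqr; congr (_ %:C).
by rewrite -invf_div.
Qed.

(** The two arguments of the Beta function add up to [1 - i omega (n - m)], so the matrix is a
    Toeplitz matrix between a diagonal matrix and its adjoint. *)
Lemma HkE n m : Hk p T k n m = Gm n * q (n - m) * cj (Gm m).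
Proof.
rewrite /Hk /Betac -[omg T * m%:~R + k]/(freq (omg T) k m) Gm_conj /q /symb -[Gammac (2^-1 +i* - _)]/(Gm n).

rewrite (_ : (2^-1 +i* - (omg T * n%:~R + k)) + (2^-1 +i* (freq (omg T) k m)) =
  1 +i* (- (omg T * (n - m)%:~R))); first by rewrite -!mulrA; congr (_ * _); rewrite [RHS]mulrC -mulrA mulrCA.
by rewrite /freq; apply: complex_ext => /=; [field|rewrite rmorphB /=; ring].
Qed.

Lemma l2Z_summable (x : int -> R[i]) : l2Z x <-> rsummable (fun n => nc (x n) ^+ 2).
Proof.
(* [l2Z] counts the index 0 twice, which accounts for the extra summand. *)
have E N : psum (fun n => nc (x n) ^+ 2) N + nc (x 0) ^+ 2 =
    series (fun N : nat => normc' (x N%:Z) ^+ 2 + normc' (x (- N%:Z)) ^+ 2) N.+1.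
  elim: N => [|N IH]; first by rewrite psum0 /series /= big_nat1 oppr0 /normc' -!sqr_nc !sqr_sqrtr ?sqr_ge0.
  rewrite psumS; have -> : series (fun N : nat => normc' (x N%:Z) ^+ 2 + normc' (x (- N%:Z)) ^+ 2) N.+2 =
    series (fun N : nat => normc' (x N%:Z) ^+ 2 + normc' (x (- N%:Z)) ^+ 2) N.+1 +
     (nc (x N.+1%:Z) ^+ 2 + nc (x (- N.+1%:Z)) ^+ 2).
    by rewrite /series /= [LHS]big_nat_recr //= /normc' -!sqr_nc !sqr_sqrtr ?sqr_ge0.
  by rewrite -IH; ring.
split.
  move=> /cvg_seq_bounded /bounded_fun_has_ubound [B hB].
  apply: (@rsummable_ge0 _ _ B) => [n|N]; first exact: sqr_ge0.
  apply: (le_trans (y := psum (fun n => nc (x n) ^+ 2) N + nc (x 0) ^+ 2)); first by rewrite lerDl sqr_ge0.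
  by rewrite E; apply: hB; exists N.+1.
move=> [B hB]; apply: nondecreasing_is_cvgn.
  apply/nondecreasing_seqP => n; rewrite /series /= big_nat_recr //= lerDl addr_ge0 ?sqr_ge0 //.
exists (B + nc (x 0) ^+ 2) => _ [N _ <-].
case: N => [|N]; first by rewrite /series /= big_nil addr_ge0 ?sqr_ge0 // (le_trans _ (hB 0%N)) // psum0.
rewrite -E lerD2r; apply: le_trans (hB N); apply: psum_le => n; exact: ler_norm.
Qed.

Hypothesis qp : psdq q.

Let om0 : 0 < om. Proof. by rewrite /om /omg divr_gt0 // mulr_gt0 // pi_gt0. Qed.

Lemma ler_amgm (a b c : R) : 0 < c -> a ^+ 2 = c^-1 * b ^+ 2 -> 0 <= a -> 0 <= b -> a <= c^-1 + b ^+ 2.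
Proof.
move=> c0 e a0 b0; have cv : 0 < c^-1 by rewrite invr_gt0.
by move: cv e; move: (c^-1) => d d0 e; nra.
Qed.

Lemma eigenspace_eigw (lam : R) x : in_eigenspace p T k lam x ->
  eigw om k q lam (fun m => cj (Gm m) * x m).
Proof.
move=> [/l2Z_summable sx ex].
have sw : csummable (fun m => cj (Gm m) * x m).
  apply: (@csummable_le _ _ (fun n => (cwt om k n)^-1 + nc (x n) ^+ 2)); last first.
    by apply: rsummableD => //; exact: cwtV_rsummable.
  move=> n; apply: (@ler_amgm _ _ _ (cwt_gt0 om k n)); rewrite ?nc_ge0 //.
  by rewrite ncM exprMn nc_conj nc_Gm.
split=> // n; have sq := toep_summable n qp sw.
have h := csummable_cvg sq.
have h2 : ccvg_to \oo (fun N => Gm n * psum (fun m => q (n - m) * (cj (Gm m) * x m)) N) (Gm n * toep q (fun m => cj (Gm m) * x m) n).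
  by apply: ccvgM => //; exact: ccvg_cst.
have h3 : ccvg_to \oo (fun N => Gm n * psum (fun m => q (n - m) * (cj (Gm m) * x m)) N) (lam%:C * x n).
  have := ex n; rewrite /cvgC.
  suff E N : \sum_(0 <= j < (N.*2).+1) Hk p T k n (j%:Z - N%:Z) * x (j%:Z - N%:Z) =
      Gm n * psum (fun m => q (n - m) * (cj (Gm m) * x m)) N.
    have E' : (fun N : nat => \sum_(0 <= j < (N.*2).+1) Hk p T k n (j%:Z - N%:Z) * x (j%:Z - N%:Z)) =
      (fun N => Gm n * psum (fun m => q (n - m) * (cj (Gm m) * x m)) N) by apply/funext.
    by rewrite -E'.
  rewrite /psum mulr_sumr; apply: eq_bigr => j _.
  by rewrite HkE; ring.
have e := ccvg_unique h2 h3.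
apply: (mulfI (Gm_neq0 n)); rewrite e.
rewrite RCM -!mulrA; rewrite [Gm n * _]mulrCA; congr (_ * _).
rewrite (_ : Gm n * ((cwt om k n)%:C * (cj (Gm n) * x n)) = (cwt om k n)%:C * (Gm n * cj (Gm n)) * x n); last by ring.
by rewrite mul_conj nc_Gm -RCM mulfV ?gt_eqF ?cwt_gt0 // mul1r.
Qed.

(** The inverse substitution; square summability holds because [|w_n / Gm n|^2] is the energy
    density [c_n |w_n|^2]. *)
Lemma eigw_eigenspace (lam : R) w : 0 < lam -> eigw om k q lam w ->
  in_eigenspace p T k lam (fun m => w m / cj (Gm m)).
Proof.
move=> lam0 ew; split.
  apply/l2Z_summable; apply: (@rsummable_le _ _ (fun n => cwt om k n * nc (w n) ^+ 2)); last first.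
    exact: (eigw_energy_summable qp lam0 ew).
  move=> n.
  by rewrite ger0_norm ?sqr_ge0 // ncM ncV nc_conj exprMn exprVn nc_Gm invrK mulrC.
move=> n; have [sw ewn] := ew; have sq := toep_summable n qp sw.
have h2 : ccvg_to \oo (fun N => Gm n * psum (fun m => q (n - m) * w m) N) (Gm n * toep q w n).
  by apply: ccvgM; [exact: ccvg_cst|exact: csummable_cvg].
suff [<- <-] : (fun N => Gm n * psum (fun m => q (n - m) * w m) N) =
   (fun N : nat => \sum_(0 <= j < (N.*2).+1) Hk p T k n (j%:Z - N%:Z) * (w (j%:Z - N%:Z) / cj (Gm (j%:Z - N%:Z)))) /\
   Gm n * toep q w n = lam%:C * (w n / cj (Gm n)) by exact: h2.
have cG m : cj (Gm m) != 0 by rewrite -nc_eq0 nc_conj nc_eq0 Gm_neq0.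
split.
  apply/funext => N; rewrite /psum mulr_sumr; apply: eq_bigr => j _.
  by rewrite [in RHS]HkE -!mulrA [cj _ * (_ * _)]mulrCA mulfV ?mulr1.
rewrite -ewn RCM; apply: (mulIf (cG n)); rewrite -[RHS]mulrA divfK //.
rewrite (_ : Gm n * (lam%:C * (cwt om k n)%:C * w n) * cj (Gm n) = lam%:C * ((cwt om k n)%:C * (Gm n * cj (Gm n))) * w n); last by ring.
by rewrite mul_conj nc_Gm -RCM mulfV ?gt_eqF ?cwt_gt0 // mulr1.
Qed.

End Reduction.

(** * Limits along ultrafilters *)

Section Ultralimits.
Context {R : realType}.

Lemma fmap_ultra {T V : Type} (f : T -> V) (U : set_system T) : UltraFilter U -> UltraFilter (f @ U).
Proof.
move=> UU; have PU : ProperFilter (f @ U) by exact: fmap_proper_filter.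
split => // G PG fG; apply/seteqP; split => [A GA|]; last exact: fG.
have [//|h] := in_ultra_setVsetC (f @^-1` A) UU.
have GC : G (~` A) by apply: fG.
by case: (@filter_not_empty _ G _); rewrite -(setICr A); exact: filterI.
Qed.

Lemma ultra_real {T : Type} {U : set_system T} (UU : UltraFilter U) (f : T -> R) (B : R) :
  (\forall t \near U, `|f t| <= B) -> exists l : R, f t @[t --> U] --> l.
Proof.
move=> fB; have := @segment_compact R (- B) B; rewrite compact_ultra.
move=> /(_ (f @ U) (fmap_ultra f UU)) [|l [_ hl]]; last by exists l.
by apply: filterS fB => t /=; rewrite in_itv /= ler_norml.
Qed.

Lemma ultra_complex {T : Type} {U : set_system T} (UU : UltraFilter U) (f : T -> R[i]) (B : R) :
  (\forall t \near U, nc (f t) <= B) -> exists l, ccvg_to U f l.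
Proof.
move=> fB.
have [a ha] : exists l : R, Re (f t) @[t --> U] --> l.
  by apply: (ultra_real UU (B := B)); apply: filterS fB => t; apply: le_trans; exact: Re_le_nc.
have [b hb] : exists l : R, Im (f t) @[t --> U] --> l.
  by apply: (ultra_real UU (B := B)); apply: filterS fB => t; apply: le_trans; exact: Im_le_nc.
by exists (a +i* b).
Qed.

(** Convergence may be tested on finer ultrafilters. There every bounded quantity has a limit, and
    only its value has to be identified. *)
Lemma ultra_cvg {T : Type} {V : topologicalType} {F : set_system T} {FF : ProperFilter F} (f : T -> V) (l : V) :
  (forall U, UltraFilter U -> F `<=` U -> f @ U --> l) -> f @ F --> l.
Proof.
move=> h A lA; apply: contrapT => nA.
pose G := filter_from F (fun D => D `&` (~` (f @^-1` A))).
have GF : Filter G.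
  apply: filter_from_filter; first by exists setT; exact: filterT.
  move=> B C FB FC; exists (B `&` C); first exact: filterI.
  by move=> x [[Bx Cx] nx].
have PG : ProperFilter G.
  apply: filter_from_proper => D FD; apply/set0P/eqP => D0; apply: nA.
  suff : F (f @^-1` A) by [].
  apply: (@filterS _ F _ D) FD => x Dx; apply: contrapT => nx.
  by have : (D `&` (~` (f @^-1` A))) x; [split|rewrite D0].
have [U [UU GU]] := @ultraFilterLemma T G PG.
have FU : F `<=` U by move=> D FD; apply: GU; exists D => // x [].
have h1 : U (f @^-1` A) := h U UU FU A lA.
have h2 : U (~` (f @^-1` A)) by apply: GU; exists setT; [exact: filterT|move=> x []].
have h3 : U set0 by rewrite -(setICr (f @^-1` A)); exact: filterI.
exact: (@filter_not_empty _ U (@ultra_proper _ _ UU)).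
Qed.

Lemma coshR_continuous : continuous (@coshR R).
Proof.
move=> x; rewrite /coshR; apply: cvgMl; apply: cvgD; first exact: continuous_expR.
by apply: (@continuous_comp _ _ _ (fun x : R => - x) expR); [exact: cvgN|exact: continuous_expR].
Qed.

Lemma cwt_cvg {T : Type} {F : set_system T} {FF : Filter F} om (kf : T -> R) k n :
  kf t @[t --> F] --> k -> cwt om (kf t) n @[t --> F] --> cwt om k n.
Proof.
move=> h; apply: cvgMl; apply: continuous_cvg; first exact: coshR_continuous.
by apply: cvgMr; apply: cvgD => //; exact: cvg_cst.
Qed.

End Ultralimits.

Section EigenCompactness.
Context {R : realType} {T : Type} {U : set_system T}.
Variables (UU : UltraFilter U) (om : R) (om0 : 0 < om).
Variables (kf : T -> R) (qf : T -> int -> R[i]) (lf : T -> R) (wf : T -> int -> R[i]).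
Variables (k lam mu Q0 K : R) (q : int -> R[i]).
Hypotheses (mu0 : 0 < mu) (qp : psdq q).
Hypothesis good : \forall i \near U,
  [/\ psdq (qf i), Re (qf i 0) <= Q0, `|kf i| <= K, mu <= lf i &
      eigw om (kf i) (qf i) (lf i) (wf i) /\ rsum (fun n => nc (wf i n)) = 1].
Hypotheses (kk : kf i @[i --> U] --> k) (ll : lf i @[i --> U] --> lam)
  (qq : forall n, ccvg_to U (fun i => qf i n) (q n)).

(* The limit is taken along an ultrafilter, so that every bounded sequence of
   coefficients converges and no subsequence has to be extracted. *)
Lemma eigw_compact : exists w C, [/\ eigw om k q lam w, forall n, ccvg_to U (fun i => wf i n) (w n),
  exists n, w n != 0, rsum (fun n => nc (w n)) = 1 & \forall i \near U, forall n, nc (wf i n) <= C * geo (pi * om) n].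
Proof.
pose C := Q0 / mu * (2 * pi * expR (pi * K)).
have b : \forall i \near U, forall n, nc (wf i n) <= C * geo (pi * om) n.
  apply: filterS good => i [qpi Qi Ki mi [ei r1]] n.
  have li : 0 < lf i by exact: lt_le_trans mi.
  have q0 : 0 <= Re (qf i 0) by apply: le_trans (nc_ge0 _) (psdq_bound 0 qpi).
  have h m : cwt om (kf i) m * nc (wf i m) <= Q0 / mu.
    apply: (le_trans (eigw_bound m qpi li ei)); rewrite r1 mulr1.
    by rewrite ler_pM ?invr_ge0 ?(ltW li) // lef_pV2 ?posrE.
  apply: (le_trans (bounded_decays om0 h n)).
  rewrite ler_wpM2r ?(ltW (geo_gt0 _ _)) // ler_wpM2l //.
    by rewrite mulr_ge0 ?invr_ge0 ?(ltW mu0) // (le_trans q0).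
  rewrite ler_wpM2l ?mulr_ge0 ?pi_ge0 //.
  by rewrite ler_expR ler_wpM2l ?pi_ge0.
have /choice [w wl] : forall n, exists l, ccvg_to U (fun i => wf i n) l.
  by move=> n; apply: (ultra_complex UU (B := C * geo (pi * om) n)); apply: filterS b => i; apply.
have gs : rsummable (fun n => C * geo (pi * om) n).
  by apply/rsummableZ/geo_summable; rewrite mulr_gt0 ?pi_gt0.
have wb n : nc (w n) <= C * geo (pi * om) n.
  apply: (filter_ler_cvg (ccvg_nc (wl n)) (cvg_cst _)).
  by apply: filterS b => i; apply.
have sw : csummable w by exact: csummable_le wb gs.
(* The uniform exponential majorant prevents mass from escaping to infinity, so the normalisation
   passes to the limit and the limit is nonzero. *)
have r1 : rsum (fun n => nc (w n)) = 1.
  have h : rsum (fun n => nc (wf i n)) @[i --> U] --> rsum (fun n => nc (w n)).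
    apply: (@rsum_dominated _ _ _ _ _ _ (fun n => C * geo (pi * om) n)) => //.
    - by apply: filterS b => i bi n; rewrite ger0_norm ?nc_ge0.
    - by move=> n; rewrite ger0_norm ?nc_ge0.
    - by move=> n; exact: ccvg_nc.
  have h2 : rsum (fun n => nc (wf i n)) @[i --> U] --> (1 : R).
    by apply: cvg_near_cst; apply: filterS good => i [_ _ _ _ [_ ->]].
  exact: (cvg_unique _ h h2).
exists w, C; split => //.
- split=> // n.
  have h1 : ccvg_to U (fun i => (lf i * cwt om (kf i) n)%:C * wf i n) ((lam * cwt om k n)%:C * w n).
    by apply: ccvgM => //; apply: ccvgR; apply: cvgM => //; exact: cwt_cvg.
  have h2 : ccvg_to U (fun i => toep (qf i) (wf i) n) (toep q w n).
    apply: (@csum_dominated _ _ _ _ _ _ (fun m => Q0 * (C * geo (pi * om) m))).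
    - near=> i => m; rewrite ncM ler_pM ?nc_ge0 //.
        have [qpi Qi _ _ _] : [/\ psdq (qf i), Re (qf i 0) <= Q0, `|kf i| <= K, mu <= lf i &
           eigw om (kf i) (qf i) (lf i) (wf i) /\ rsum (fun n => nc (wf i n)) = 1] by near: i.
        by apply: le_trans Qi; exact: psdq_bound.
      by move: m; near: i.
    - exact: rsummableZ.
    - by move=> m; apply: ccvgM.
  have h3 : ccvg_to U (fun i => toep (qf i) (wf i) n) ((lam * cwt om k n)%:C * w n).
    have e : \forall i \near U, (lf i * cwt om (kf i) n)%:C * wf i n = toep (qf i) (wf i) n.
      by apply: filterS good => i [_ _ _ _ [[_ ->]]].
    split; [move: h1.1|move: h1.2]; apply: cvg_trans; apply: near_eq_cvg;
      by apply: filterS e => i ->.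
  exact: ccvg_unique h3 h2.
- apply: contrapT => nw; have z n : w n = 0.
    by apply/eqP; apply: contrapT => h; apply: nw; exists n; apply/negP.
  have : rsum (fun n => nc (w n)) = 0.
    rewrite (eq_rsum (g := fun=> 0)); last by move=> n; rewrite z nc0.
    apply: rsum_unique; rewrite (_ : psum _ = fun=> 0); first exact: cvg_cst.
    by apply/funext => N; rewrite /psum big1.
  by rewrite r1 => /eqP; rewrite oner_eq0.
Unshelve. all: by end_near. Qed.

End EigenCompactness.

(** * The max-min principle *)

Section Energy.
Context {R : realType}.
Variables (om k : R) (om0 : 0 < om).
Implicit Types (v w y q : int -> R[i]).
Let c := cwt om k.

(** The equation [toep q w = lam c w] is self-adjoint for the inner product [cp] with weight [c].
    Finite energy plays the role of membership in the Hilbert space, and [gq] is the form whose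
    quotient by [en] is maximised. *)
Definition fin w := rsummable (fun n => cwt om k n * nc (w n) ^+ 2).
Definition en w : R := rsum (fun n => cwt om k n * nc (w n) ^+ 2).
Definition cp v w : R[i] := csum (fun n => (cwt om k n)%:C * v n * cj (w n)).
Definition gq q v w : R[i] := csum (fun n => toep q v n * cj (w n)).

Let c0 n : 0 < c n. Proof. exact: cwt_gt0. Qed.
Let ct0 w n : 0 <= c n * nc (w n) ^+ 2. Proof. by rewrite mulr_ge0 ?sqr_ge0 // ltW. Qed.

Let Cs := rsum (fun n => (cwt om k n)^-1).

Lemma en_ge0 w : fin w -> 0 <= en w.
Proof. by move=> fw; apply: rsum_ge0. Qed.

Lemma en_gt0 w n : fin w -> w n != 0 -> 0 < en w.
Proof. by move=> fw wn; apply: (rsum_gt0 (n := n)) => //; rewrite mulr_gt0 ?c0 // exprn_gt0 // nc_gt0. Qed.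

Lemma amgm_le (t d x : R) : 0 < t -> 0 < d -> 2 * t * x <= t ^+ 2 * (d * x ^+ 2) + d^-1.
Proof.
move=> t0 d0; have e : d * d^-1 = 1 by rewrite divff ?gt_eqF.
have dv : 0 < d^-1 by rewrite invr_gt0.
have : 0 <= d^-1 * (t * d * x - 1) ^+ 2 by rewrite mulr_ge0 ?sqr_ge0 // ltW.
have -> : d^-1 * (t * d * x - 1) ^+ 2 = t ^+ 2 * x ^+ 2 * d * (d * d^-1) - 2 * t * x * (d * d^-1) + d^-1 by ring.
by rewrite e; lra.
Qed.

Lemma fin_csummable w : fin w -> csummable w.
Proof.
move=> fw; apply: (@csummable_le _ _ (fun n => c n * nc (w n) ^+ 2 + (c n)^-1)).
  move=> n; have := @amgm_le 1 (c n) (nc (w n)) ltr01 (c0 n).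
  by rewrite expr1n mul1r mulr1; have := nc_ge0 (w n); lra.
by apply: rsummableD => //; exact: cwtV_rsummable.
Qed.

(** Cauchy-Schwarz against [1 / c_n], obtained by optimising the inequality [amgm_le] over the
    parameter [t]. *)
Lemma rsum_sqr_le w : fin w -> rsum (fun n => nc (w n)) ^+ 2 <= Cs * en w.
Proof.
move=> fw; set r := rsum _.
have r0 : 0 <= r by apply: rsum_ge0 => [n|]; [exact: nc_ge0|exact: fin_csummable].
have e0 := en_ge0 fw.
have h t : 0 < t -> 2 * t * r <= t ^+ 2 * en w + Cs.
  move=> t0; rewrite /r /Cs /en -!rsumZ //; last exact: fin_csummable.
  rewrite -rsumD; [|exact: rsummableZ|exact: cwtV_rsummable].
  apply: rsum_le => [n||]; first exact: amgm_le.
    by apply: rsummableZ; exact: fin_csummable.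
  by apply: rsummableD; [exact: rsummableZ|exact: cwtV_rsummable].
have C0 : 0 <= Cs by apply: rsum_ge0 => [n|]; [rewrite invr_ge0 ltW //; exact: c0|exact: cwtV_rsummable].
have [->|rn] := eqVneq r 0; first by rewrite expr0n mulr_ge0.
have rp : 0 < r by rewrite lt_def rn.
have [e|en0] := eqVneq (en w) 0.
  have tp : 0 < (Cs + 1) / r by rewrite divr_gt0 // ltr_wpDl.
  have := h _ tp; rewrite e mulr0 add0r -mulrA divfK //; lra.
have ep : 0 < en w by rewrite lt_def en0.
(* The optimal value of [t]. *)
have tp : 0 < r / en w by rewrite divr_gt0.
have := h _ tp; rewrite (_ : (r / en w) ^+ 2 * en w = r / en w * r); last by field.
move=> h1; have : r / en w * r <= Cs by move: h1; move: (r / en w) => z; lra.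
by rewrite mulrAC ler_pdivrMr // -expr2.
Qed.

Lemma fin_comb v w (a b : R[i]) : fin v -> fin w -> fin (fun n => a * v n + b * w n).
Proof.
move=> fv fw.
apply: (@rsummable_le _ _ (fun n => 2 * nc a ^+ 2 * (c n * nc (v n) ^+ 2) + 2 * nc b ^+ 2 * (c n * nc (w n) ^+ 2))).
  move=> n; rewrite ger0_norm; last by rewrite mulr_ge0 ?sqr_ge0 // ltW // c0.
  have h : nc (a * v n + b * w n) ^+ 2 <= 2 * (nc a * nc (v n)) ^+ 2 + 2 * (nc b * nc (w n)) ^+ 2.
    have := ncD (a * v n) (b * w n); rewrite !ncM; have := nc_ge0 (a * v n + b * w n).
    move: (nc _) (nc a * _) (nc b * _) => x y z x0 xyz.
    have : x ^+ 2 <= (y + z) ^+ 2 by rewrite ler_pXn2r ?nnegrE //; exact: le_trans xyz.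
    have : 0 <= (y - z) ^+ 2 by exact: sqr_ge0.
    nra.
  apply: (le_trans (ler_wpM2l (ltW (c0 n)) h)); rewrite !exprMn.
  by rewrite le_eqVlt; apply/orP; left; apply/eqP; rewrite /c; ring.
by apply: rsummableD; exact: rsummableZ.
Qed.

Lemma fin0 : fin (fun=> 0).
Proof.
apply: (@rsummable_le _ _ (fun=> 0)) => [n|]; first by rewrite nc0 expr0n mulr0 normr0.
by exists 0 => N; rewrite /psum big1 // => j _; rewrite normr0.
Qed.

Lemma fin_ext v w : v =1 w -> fin v -> fin w.
Proof. by move=> /funext ->. Qed.

Lemma fin_sum {I : Type} (s : seq I) (a : I -> R[i]) (f : I -> int -> R[i]) :
  (forall i, fin (f i)) -> fin (fun n => \sum_(i <- s) a i * f i n).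
Proof.
move=> ff; elim: s => [|i s IH].
  by apply: (fin_ext _ fin0) => n; rewrite big_nil.
by apply: (fin_ext _ (fin_comb (a i) 1 (ff i) IH)) => n; rewrite big_cons mul1r.
Qed.

Lemma cp_summable v w : fin v -> fin w -> csummable (fun n => (c n)%:C * v n * cj (w n)).
Proof.
move=> fv fw; apply: (@csummable_le _ _ (fun n => c n * nc (v n) ^+ 2 + c n * nc (w n) ^+ 2)).
  move=> n; rewrite !ncM nc_conj ncR gtr0_norm // -mulrDr -mulrA ler_wpM2l ?(ltW (c0 n)) //.
  by have := nc_ge0 (v n); have := nc_ge0 (w n); nra.
exact: rsummableD.
Qed.

Lemma gq_summable q v w : psdq q -> fin v -> fin w -> csummable (fun n => toep q v n * cj (w n)).
Proof.
move=> qp fv fw; apply: (@csummable_le _ _ (fun n => Re (q 0) * rsum (fun m => nc (v m)) * nc (w n))).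
  by move=> n; rewrite ncM nc_conj ler_wpM2r ?nc_ge0 // toep_bound //; exact: fin_csummable.
by apply: rsummableZ; exact: fin_csummable.
Qed.

Lemma cpC v w : fin v -> fin w -> cp w v = cj (cp v w).
Proof.
move=> fv fw; rewrite /cp -csum_conj; last exact: cp_summable.
by apply: eq_csum => n; rewrite !conjM conjR [cj (cj _)]conjcK; ring.
Qed.

Lemma gqC q v w : psdq q -> fin v -> fin w -> gq q w v = cj (gq q v w).
Proof.
move=> qp fv fw; rewrite /gq -csum_conj; last exact: gq_summable.
rewrite toep_pairing2 //; try exact: fin_csummable.
by apply: eq_csum => n; rewrite conjM [cj (cj _)]conjcK mulrC.
Qed.

Lemma cpp v : fin v -> cp v v = (en v)%:C.
Proof.
move=> fv; apply: csum_unique.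
have e n : (c n)%:C * v n * cj (v n) = (c n * nc (v n) ^+ 2)%:C by rewrite -mulrA mul_conj RCM.
rewrite (_ : psum _ = fun N => (psum (fun n => c n * nc (v n) ^+ 2) N)%:C).
  by apply: ccvgR; exact: rsummable_cvg.
apply/funext => N; rewrite (eq_psum _ e) /psum.
by rewrite (rmorph_sum (@real_complex R)).
Qed.

Lemma cp_suml {I : Type} (s : seq I) (a : I -> R[i]) (f : I -> int -> R[i]) w :
  (forall i, fin (f i)) -> fin w ->
  cp (fun n => \sum_(i <- s) a i * f i n) w = \sum_(i <- s) a i * cp (f i) w.
Proof.
move=> ff fw.
have e n : (c n)%:C * (\sum_(i <- s) a i * f i n) * cj (w n) = \sum_(i <- s) a i * ((c n)%:C * f i n * cj (w n)).
  by rewrite mulr_sumr mulr_suml; apply: eq_bigr => i _; ring.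
rewrite /cp (eq_csum e) (csum_sum s _).2; last by move=> i; apply: csummableZ; exact: cp_summable.
by apply: eq_bigr => i _; rewrite csumZ //; exact: cp_summable.
Qed.

Lemma gq_suml q {I : Type} (s : seq I) (a : I -> R[i]) (f : I -> int -> R[i]) w :
  psdq q -> (forall i, fin (f i)) -> fin w ->
  gq q (fun n => \sum_(i <- s) a i * f i n) w = \sum_(i <- s) a i * gq q (f i) w.
Proof.
move=> qp ff fw.
have e n : toep q (fun n => \sum_(i <- s) a i * f i n) n * cj (w n) = \sum_(i <- s) a i * (toep q (f i) n * cj (w n)).
  rewrite toep_sum //; last by move=> i; exact: fin_csummable.
  by rewrite mulr_suml; apply: eq_bigr => i _; rewrite mulrA.
rewrite /gq (eq_csum e) (csum_sum s _).2; last by move=> i; apply: csummableZ; exact: gq_summable.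
by apply: eq_bigr => i _; rewrite csumZ //; exact: gq_summable.
Qed.

Lemma cp_combl v v' w (a b : R[i]) : fin v -> fin v' -> fin w ->
  cp (fun n => a * v n + b * v' n) w = a * cp v w + b * cp v' w.
Proof.
move=> fv fv' fw; rewrite /cp -!csumZ; try exact: cp_summable.
rewrite -csumD; try by apply: csummableZ; exact: cp_summable.
by apply: eq_csum => n; ring.
Qed.

Lemma toep_comb q v w n (a b : R[i]) : psdq q -> csummable v -> csummable w ->
  toep q (fun n => a * v n + b * w n) n = a * toep q v n + b * toep q w n.
Proof.
move=> qp fv fw; rewrite /toep -!csumZ; try exact: toep_summable.
rewrite -csumD; try by apply: csummableZ; exact: toep_summable.
by apply: eq_csum => m; ring.
Qed.

Lemma gq_combl q v v' w (a b : R[i]) : psdq q -> fin v -> fin v' -> fin w ->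
  gq q (fun n => a * v n + b * v' n) w = a * gq q v w + b * gq q v' w.
Proof.
move=> qp fv fv' fw; rewrite /gq -!csumZ; try exact: gq_summable.
rewrite -csumD; try by apply: csummableZ; exact: gq_summable.
by apply: eq_csum => n; rewrite toep_comb //; try exact: fin_csummable; ring.
Qed.

Lemma gq_bound q v : psdq q -> fin v -> Re (gq q v v) <= Re (q 0) * Cs * en v.
Proof.
move=> qp fv; apply: (le_trans (ler_norm _)); apply: (le_trans (Re_le_nc _)).
have q0 : 0 <= Re (q 0) by apply: le_trans (nc_ge0 _) (psdq_bound 0 qp).
rewrite -mulrA; apply: (le_trans _ (ler_wpM2l q0 (rsum_sqr_le fv))).
rewrite expr2 mulrA -rsumZ; last exact: fin_csummable.
apply: nc_csum => [n|]; last by apply: rsummableZ; exact: fin_csummable.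
by rewrite ncM nc_conj ler_wpM2r ?nc_ge0 // toep_bound //; exact: fin_csummable.
Qed.

Lemma eigw_fin q (lam : R) w : psdq q -> 0 < lam -> eigw om k q lam w -> fin w.
Proof. by move=> qp l0 ew; exact: (eigw_energy_summable qp l0 ew). Qed.

Lemma eigw_gq q (lam : R) w y : eigw om k q lam w -> fin w -> fin y -> gq q w y = lam%:C * cp w y.
Proof.
move=> [_ ew] fw fy; rewrite /gq /cp -csumZ; last exact: cp_summable.
by apply: eq_csum => n; rewrite -ew RCM !mulrA.
Qed.

Lemma eigw_orth q (l l' : R) w w' : psdq q -> 0 < l -> 0 < l' -> eigw om k q l w -> eigw om k q l' w' ->
  l != l' -> cp w w' = 0.
Proof.
move=> qp l0 l0' ew ew' ll.
have fw := eigw_fin qp l0 ew; have fw' := eigw_fin qp l0' ew'.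
have := gqC qp fw fw'; rewrite (eigw_gq ew) // (eigw_gq ew') // conjM conjR (cpC fw fw') => e.
have : cj (cp w w') * (l' - l)%:C = 0 by rewrite RCB mulrBr ![_ * _%:C]mulrC e subrr.
move/eqP; rewrite mulf_eq0 RC_eq0 subr_eq0 [l' == l]eq_sym (negbTE ll) orbF.
by rewrite -nc_eq0 nc_conj nc_eq0 => /eqP.
Qed.

Lemma eigw_comb q (l : R) w w' (a b : R[i]) : psdq q -> eigw om k q l w -> eigw om k q l w' ->
  eigw om k q l (fun n => a * w n + b * w' n).
Proof.
move=> qp [sw ew] [sw' ew']; split; first by apply: csummableD; exact: csummableZ.
by move=> n; rewrite toep_comb // -ew -ew'; ring.
Qed.

Lemma eigw_pos q (l : R) w : psdq q -> eigw om k q l w -> fin w -> (exists n, w n != 0) -> 0 <= l.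
Proof.
move=> qp ew fw [n wn]; have := qform_ge0 qp ew.1.
rewrite -/(gq q w w) (eigw_gq ew) // cpp // ReC /= pmulr_lge0 //.
exact: en_gt0 wn.
Qed.

Definition dl (n m : int) : R[i] := (m == n)%:R.

Lemma dl_fin n : fin (dl n).
Proof.
have e m : c m * nc (dl n m) ^+ 2 <= c n * expR (`|n%:~R|) * geo 1 m.
  rewrite /dl; have [->|h] := eqVneq m n; last first.
    have -> : nc (false%:R : R[i]) = 0 by exact: nc0.
    by rewrite expr0n mulr0 mulr_ge0 ?(ltW (geo_gt0 _ _)) // mulr_ge0 ?expR_ge0 // ltW.
  by rewrite /geo mul1r -mulrA -expRD subrr expR0 -[1%:R]/(1%:C) ncR normr1 expr1n.
apply: (@rsummable_le _ _ (fun m => c n * expR (`|n%:~R|) * geo 1 m)).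
  by move=> m; rewrite ger0_norm.
by apply: rsummableZ; exact: geo_summable.
Qed.

Lemma cp_dl w n : cp w (dl n) = (c n)%:C * w n.
Proof.
rewrite /cp (@csum_delta R _ n); first by rewrite /dl eqxx conj1 mulr1.
by move=> m /negbTE mn; rewrite /dl mn conj0 mulr0.
Qed.

Lemma gq_dl q w n : gq q w (dl n) = toep q w n.
Proof.
rewrite /gq (@csum_delta R _ n); first by rewrite /dl eqxx conj1 mulr1.
by move=> m /negbTE mn; rewrite /dl mn conj0 mulr0.
Qed.

End Energy.

Section Simplicity.
Context {R : realType}.
Variables (om k T : R) (om0 : 0 < om) (T0 : 0 < T) (omT : om * T = 2 * pi).
Hypothesis kT : `|cos (k * T)| < 1.

Lemma eigw_simple (q w w' : int -> R[i]) (l : R) : psdq q -> 0 < l ->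
  eigw om k q l w -> (exists n, w n != 0) -> eigw om k q l w' ->
  exists a, forall n, w' n = a * w n.
Proof.
move=> qp l0 ew wn ew'.
have dw := eigw_decays om0 qp l0 ew; have dw' := eigw_decays om0 qp l0 ew'.
have XY u : eigw om k q l u -> (exists n, u n != 0) -> Xval om k u != Yval om k u.
  move=> eu un; have := XY_neq (@sech_bochner_holds R) T0 om0 omT kT qp l0 eu un.
  by apply: contraNneq => ->.
pose d u := Xval om k u - Yval om k u.
have d0 : d w != 0 by rewrite subr_eq0 XY.
pose a := d w' / d w; exists a.
pose u n := 1 * w' n + (- a) * w n.
have eu : eigw om k q l u by exact: eigw_comb.
have lin (s : R) : `|s| = pi / 2 -> csum (fun n => u n * (expR (s * freq om k n))%:C) =
    csum (fun n => w' n * (expR (s * freq om k n))%:C) - a * csum (fun n => w n * (expR (s * freq om k n))%:C).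
  move=> sE; rewrite -csumZ; last exact: expR_summable.
  rewrite -csumB; [|exact: expR_summable|by apply: csummableZ; exact: expR_summable].
  by apply: eq_csum => n; rewrite /u; ring.
have u0 : d u = 0.
  rewrite /d /Xval /Yval (lin _ norm_Npihalf) (lin _ norm_pihalf) -/(Xval om k w) -/(Yval om k w)
    -/(Xval om k w') -/(Yval om k w').
  by rewrite (_ : _ - _ = d w' - a * d w); [rewrite /a divfK // subrr|rewrite /d; ring].
move=> n; apply/eqP; apply: contraT => h.
have un : exists n, u n != 0 by exists n; rewrite /u mul1r mulNr subr_eq0.
by have := XY u eu un; rewrite -subr_eq0 -/(d u) u0 eqxx.
Qed.

Lemma flux_neq0 (q w : int -> R[i]) (l : R) : psdq q -> 0 < l ->
  eigw om k q l w -> (exists n, w n != 0) -> flux om k w != 0.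
Proof.
move=> qp l0 ew wn; have := XY_neq (@sech_bochner_holds R) T0 om0 omT kT qp l0 ew wn.
apply: contraNneq => f0; have := wronskian om0 qp l0 ew; rewrite f0 mulr0 => /eqP.
by rewrite subr_eq0 eqrXn2 ?nc_ge0.
Qed.

End Simplicity.

Lemma comb_alg (F : comRingType) (t f g h : F) : 1 * (- (t * g) * f) + - (t * f) * (g + - (t * g) * h) =
  t ^+ 2 * (f * g) * h - (t * (f * g) + t * (f * g)).
Proof. by ring. Qed.

Section MaxMin.
Context {R : realType}.
Variables (om k : R) (om0 : 0 < om) (q : int -> R[i]) (qp : psdq q).
Implicit Types (v w y : int -> R[i]).
Let c := cwt om k.
Local Notation fin := (fin om k).
Local Notation en := (en om k).
Local Notation cp := (cp om k).

Definition isev (l : R) := 0 < l /\ exists w, eigw om k q l w /\ exists n, w n != 0.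

(* The zero sequence when [l] is not an eigenvalue. *)
Definition evec (l : R) : int -> R[i] := xget (fun=> 0) [set w | eigw om k q l w /\ exists n, w n != 0].

Lemma evecP l : isev l -> eigw om k q l (evec l) /\ exists n, evec l n != 0.
Proof. by move=> [_ [w hw]]; rewrite /evec; case: xgetP => [y -> //|/(_ w)]. Qed.

Lemma evec_fin l : isev l -> fin (evec l).
Proof. by move=> h; exact: (eigw_fin qp h.1 (evecP h).1). Qed.

Lemma evec_en l : isev l -> 0 < en (evec l).
Proof. by move=> h; have [_ [n hn]] := evecP h; exact: en_gt0 (evec_fin h) hn. Qed.

Lemma evec_orth l l' : isev l -> isev l' -> l != l' -> cp (evec l) (evec l') = 0.
Proof. move=> h h' n; have [e _] := evecP h; have [e' _] := evecP h'.
exact: eigw_orth qp h.1 h'.1 e e' n. Qed.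

Let Cs := rsum (fun n => (c n)^-1).
Let q0 := Re (q 0).
(** A summable majorant of all vectors of energy at most 1. It lets [gq] pass to coordinatewise
    limits inside the energy ball. *)
Let sg n := Num.sqrt ((c n)^-1).

Let sg_summable : rsummable sg.
Proof.
apply: (@rsummable_le _ _ (fun n => Num.sqrt (2 * pi * expR (pi * `|k|)) * geo (pi * om / 2) n)).
  move=> n; rewrite ger0_norm ?sqrtr_ge0 // -(ler_pXn2r (ltn0Sn 1)) ?nnegrE ?sqrtr_ge0 //; last first.
    by rewrite mulr_ge0 ?sqrtr_ge0 // ltW // geo_gt0.
  have p0 : 0 <= 2 * pi * expR (pi * `|k|) :> R by rewrite !mulr_ge0 ?pi_ge0 ?expR_ge0.
  rewrite exprMn !sqr_sqrtr //; last by rewrite invr_ge0 ltW // cwt_gt0.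
  by rewrite [_ ^+ 2]expr2 -geo_half cwtV_le.
by apply/rsummableZ/geo_summable; exact: pihalf_om_gt0.
Qed.

Let nc_sg v : fin v -> en v <= 1 -> forall n, nc (v n) <= sg n.
Proof.
move=> fv e1 n; rewrite -(ler_pXn2r (ltn0Sn 1)) ?nnegrE ?nc_ge0 ?sqrtr_ge0 //.
have c0 := cwt_gt0 om k n.
rewrite sqr_sqrtr ?invr_ge0 ?(ltW c0) // -(ler_pM2l c0) mulfV ?gt_eqF //.
apply: le_trans e1; apply: (@rsum_ge_term _ (fun m => cwt om k m * nc (v m) ^+ 2) n) => // m.
by rewrite mulr_ge0 ?sqr_ge0 // ltW // cwt_gt0.
Qed.

Let scale_fin v (t : R) : fin v -> fin (fun n => t%:C * v n).
Proof. move=> fv; have h : fin (fun n => t%:C * v n + 0 * v n) by exact: fin_comb.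
by apply: fin_ext h => n; rewrite mul0r addr0. Qed.

Let scale_en v (t : R) : fin v -> en (fun n => t%:C * v n) = t ^+ 2 * en v.
Proof.
move=> fv; rewrite /en -rsumZ //; apply: eq_rsum => n.
by rewrite ncM exprMn ncR real_normK ?num_real //; ring.
Qed.

Let gq_scale v (t : R) : fin v -> Re (gq q (fun n => t%:C * v n) (fun n => t%:C * v n)) = t ^+ 2 * Re (gq q v v).
Proof.
move=> fv; have sv := fin_csummable om0 fv.
rewrite -ReC /gq -csumZ; last exact: (gq_summable om0 qp fv fv).
congr (Re _); apply: eq_csum => n.
have -> : toep q (fun n => t%:C * v n) n = t%:C * toep q v n.
  by rewrite /toep -csumZ; [apply: eq_csum => m; ring|exact: toep_summable].
by rewrite conjM conjR expr2 RCM; ring.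
Qed.

Section Maximum.
Variables (s : seq R) (us : uniq s) (sev : forall l, l \in s -> isev l).
Variables (v0 : int -> R[i]) (mu : R).
Hypotheses (fv0 : fin v0) (v0s : forall l, l \in s -> cp v0 (evec l) = 0).
Hypotheses (mu0 : 0 < mu) (ev0 : 0 < en v0) (mv0 : mu * en v0 <= Re (gq q v0 v0)).

Let inW v := fin v /\ forall l, l \in s -> cp v (evec l) = 0.
(** The ball [en v <= 1] replaces the sphere because a coordinatewise limit may lose energy;
    positivity of [S] shows afterwards that a maximiser has energy exactly 1. *)
Let vals := [set Re (gq q v v) | v in [set v | inW v /\ en v <= 1]].
Let S := sup vals.

Let inW_scale v (t : R) : inW v -> inW (fun n => t%:C * v n).
Proof.
move=> [fv ov]; split; first exact: scale_fin.
move=> l ls; have fe := evec_fin (sev ls).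
have -> : (fun n => t%:C * v n) = (fun n => t%:C * v n + 0 * v n) by apply/funext => n; rewrite mul0r addr0.
by rewrite cp_combl // ov // !mulr0 addr0.
Qed.

Let unit_scale v : fin v -> 0 < en v -> en (fun n => (Num.sqrt (en v))^-1%:C * v n) <= 1.
Proof.
by move=> fv e; rewrite scale_en // exprVn sqr_sqrtr ?(ltW e) // mulVf ?gt_eqF.
Qed.

Let q0_ge0 : 0 <= q0. Proof. by apply: le_trans (nc_ge0 _) (psdq_bound 0 qp). Qed.
Let Cs_ge0 : 0 <= Cs.
Proof. by apply: rsum_ge0 => [n|]; [rewrite invr_ge0 ltW // cwt_gt0|exact: cwtV_rsummable]. Qed.

Let vals_sup : has_sup vals.
Proof.
split.
  exists (Re (gq q (fun n => (Num.sqrt (en v0))^-1%:C * v0 n) (fun n => (Num.sqrt (en v0))^-1%:C * v0 n))).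
  by exists (fun n => (Num.sqrt (en v0))^-1%:C * v0 n) => //; split; [exact: inW_scale|exact: unit_scale].
exists (q0 * Cs) => _ [v [[fv _] e1] <-].
apply: (le_trans (gq_bound om0 qp fv)); rewrite -[leRHS]mulr1; apply: ler_wpM2l => //.
exact: mulr_ge0.
Qed.

Let S_ge v : inW v -> Re (gq q v v) <= S * en v.
Proof.
move=> hv; have [fv _] := hv; have e0 := en_ge0 fv.
have [z|nz] := eqVneq (en v) 0.
  by apply: (le_trans (gq_bound om0 qp fv)); rewrite z !mulr0.
have ep : 0 < en v by rewrite lt_def nz.
rewrite -ler_pdivrMr //.
have -> : Re (gq q v v) / en v = Re (gq q (fun n => (Num.sqrt (en v))^-1%:C * v n) (fun n => (Num.sqrt (en v))^-1%:C * v n)).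
  rewrite [RHS](gq_scale ((Num.sqrt (en v))^-1) fv) exprVn (sqr_sqrtr e0); exact: mulrC.
apply: ub_le_sup; first exact: vals_sup.2.
by exists (fun n => (Num.sqrt (en v))^-1%:C * v n) => //; split; [exact: inW_scale|exact: unit_scale].
Qed.

Let mu_le_S : mu <= S.
Proof.
rewrite -(ler_pM2r ev0); apply: (le_trans mv0); exact: S_ge.
Qed.

Let maximizer : exists w, [/\ inW w, 0 < en w & Re (gq q w w) = S * en w].
Proof.
have S0 : 0 < S by exact: lt_le_trans mu_le_S.
have /choice [vf hvf] : forall j : nat, exists v, [/\ inW v, en v <= 1 & S - j.+1%:R^-1 < Re (gq q v v)].
  move=> j; have jp : (0 : R) < j.+1%:R^-1 by rewrite invr_gt0 ltr0n.
  by have [_ [v [hv e1] <-] hj] := sup_adherent jp vals_sup; exists v.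
have [U [UU oU]] := @ultraFilterLemma nat \oo _.
have nU (P : nat -> Prop) : (forall j, P j) -> \forall j \near U, P j by move=> h; exact: filterE.
have vb j n : nc (vf j n) <= sg n by have [[fv _] e1 _] := hvf j; exact: nc_sg.
have /choice [w wl] : forall n, exists l, ccvg_to U (fun j => vf j n) l.
  by move=> n; apply: (ultra_complex UU (B := sg n)); exact: nU.
have wp N : psum (fun n => c n * nc (w n) ^+ 2) N <= 1.
  have h : psum (fun n => c n * nc (vf j n) ^+ 2) N @[j --> U] --> psum (fun n => c n * nc (w n) ^+ 2) N.
    apply: psum_cvg => n; apply: cvgMr; have h : nc (vf j n) @[j --> U] --> nc (w n) by exact: ccvg_nc.
    by rewrite expr2; under eq_fun do rewrite expr2; exact: cvgM.
  apply: (filter_ler_cvg h (cvg_cst _)); apply: nU => j; have [[fv _] e1 _] := hvf j.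
  by apply: le_trans e1; apply: le_psum_rsum => // n; rewrite mulr_ge0 ?sqr_ge0 // ltW // cwt_gt0.
have fw : fin w.
  by apply: (@rsummable_ge0 _ _ 1) => // n; rewrite mulr_ge0 ?sqr_ge0 // ltW // cwt_gt0.
have ew : en w <= 1 by exact: rsum_bound.
have ss : rsummable sg := sg_summable.
have tc n : ccvg_to U (fun j => toep q (vf j) n) (toep q w n).
  apply: (@csum_dominated _ _ _ _ _ _ (fun m => q0 * sg m)).
  - by apply: nU => j m; rewrite ncM ler_pM ?nc_ge0 // psdq_bound.
  - exact: rsummableZ.
  - by move=> m; apply: ccvgM => //; exact: ccvg_cst.
have gc : ccvg_to U (fun j => gq q (vf j) (vf j)) (gq q w w).
  apply: (@csum_dominated _ _ _ _ _ _ (fun m => q0 * rsum sg * sg m)).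
  - apply: nU => j m; rewrite ncM nc_conj ler_pM ?nc_ge0 //.
    have [[fv _] _ _] := hvf j.
    apply: (le_trans (toep_bound _ qp (fin_csummable om0 fv))); apply: ler_wpM2l => //.
    by apply: rsum_le => //; exact: (fin_csummable om0 fv).
  - exact: rsummableZ.
  - by move=> m; apply: ccvgM => //; exact: ccvg_conj.
have Sw : S <= Re (gq q w w).
  have h1 : S - j.+1%:R^-1 @[j --> U] --> S - 0.
    by apply: cvgB; [exact: cvg_cst|move=> A hA; apply: oU; exact: (@cvg_harmonic R A hA)].
  rewrite subr0 in h1; apply: (filter_ler_cvg h1 gc.1).
  by apply: nU => j; have [_ _ /ltW] := hvf j.
have inw : inW w.
  split=> // l ls; have fe := evec_fin (sev ls); have [ee _] := evecP (sev ls).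
  have [B hB] := eigw_bounded qp (sev ls).1 ee.
  have h : ccvg_to U (fun j => cp (vf j) (evec l)) (cp w (evec l)).
    apply: (@csum_dominated _ _ _ _ _ _ (fun m => B * sg m)).
    - apply: nU => j m; rewrite (_ : (cwt om k m)%:C * vf j m * cj (evec l m) = (cwt om k m)%:C * cj (evec l m) * vf j m); last by ring.
      rewrite ncM ler_pM ?nc_ge0 //; apply: le_trans (hB m).
      by rewrite !ncM nc_conj.
    - exact: rsummableZ.
    - move=> m; apply: ccvgM; [apply: ccvgM => //|]; exact: ccvg_cst.
  have h2 : ccvg_to U (fun j => cp (vf j) (evec l)) 0.
    rewrite (_ : (fun j => _) = fun=> 0); first exact: ccvg_cst.
    by apply/funext => j; have [[_ ->]] := hvf j.
  exact: ccvg_unique h h2.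
have h := S_ge inw; have hS := le_trans Sw h.
have e1 : 1 <= en w by rewrite -(ler_pM2l S0) mulr1.
have e : en w = 1 by apply/eqP; rewrite eq_le ew.
exists w; split => //; first by rewrite e.
by apply/eqP; rewrite eq_le h e mulr1.
Qed.

(** The linear term in [t] would dominate for small [t] and make the expression negative;
    [t = 1 / (1 + |A|)] is already small enough. *)
Lemma psd_null (A : R) (f : R[i]) : (forall t : R, 0 < t -> 0 <= t ^+ 2 * nc f ^+ 2 * A - 2 * t * nc f ^+ 2) -> f = 0.
Proof.
move=> h; apply/eqP; rewrite -nc_eq0 -sqrf_eq0; apply: contraT => f0.
have fp : 0 < nc f ^+ 2 by rewrite lt_def f0 sqr_ge0.
pose t := (1 + `|A|)^-1.
have A1 : 0 < 1 + `|A| by rewrite ltr_pwDl.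
have t0 : 0 < t by rewrite invr_gt0.
have tA : t * A <= 1.
  rewrite /t mulrC ler_pdivrMr // mul1r; have := ler_norm A; lra.
have := h t t0; rewrite (_ : _ - _ = t * nc f ^+ 2 * (t * A - 2)); last by ring.
have z : 0 < t * nc f ^+ 2 by exact: mulr_gt0.
by rewrite (pmulr_rge0 _ z) => h1; lra.
Qed.

(* A maximiser of the form on the unit ball of the complement of the eigenvectors
   of [s] is an eigenvector. *)
Lemma max_eigen : exists l, [/\ isev l, mu <= l & l \notin s \/ exists w, [/\ eigw om k q l w, exists n, w n != 0 &
   forall l', l' \in s -> cp w (evec l') = 0]].
Proof.
have [w [inw ew0 Sw]] := maximizer; have [fw ow] := inw.
have S0 : 0 < S by exact: lt_le_trans mu_le_S.
(* A Hermitian form that is nonnegative on the complement of the eigenvectors and null at the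
   maximiser [w]; a variation argument then gives [F w y = 0] for every [y] of the complement. *)
pose F v y := S%:C * cp v y - gq q v y.
have FC v y : fin v -> fin y -> F y v = cj (F v y).
  by move=> fv fy; rewrite /F conjB conjM conjR -(cpC fv fy) -(gqC om0 qp fv fy).
have Fl v v' y (a b : R[i]) : fin v -> fin v' -> fin y -> F (fun n => a * v n + b * v' n) y = a * F v y + b * F v' y.
  by move=> fv fv' fy; rewrite /F cp_combl // (gq_combl om0 _ _ qp fv fv' fy); ring.
have ReF v : fin v -> Re (F v v) = S * en v - Re (gq q v v).
  by move=> fv; rewrite /F cpp // -RCM ReB.
have Fp v : inW v -> 0 <= Re (F v v).
  move=> hv; have [fv _] := hv; rewrite ReF // subr_ge0; exact: S_ge.
have Fw : F w w = 0.
  have e : Re (F w w) = 0 by rewrite ReF // Sw subrr.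
  apply: complex_ext; first by [].
  by have := FC w w fw fw; move/(congr1 Im); rewrite Im_conj /=; lra.
have Fwy y : inW y -> F w y = 0.
  move=> hy; have [fy oy] := hy.
  apply: (@psd_null (Re (F y y))) => t t0.
  pose b := - (t%:C * F w y).
  pose z n := 1 * w n + b * y n.
  have fz : fin z by exact: fin_comb.
  have iz : inW z.
    by split => // l ls; rewrite cp_combl //; [rewrite ow // oy // !mulr0 addr0|exact: evec_fin (sev ls)].
  have := Fp z iz; congr (_ <= _).
  have -> : F z z = 1 * F w z + b * F y z by exact: Fl.
  have -> : F w z = cj b * F w y.
    by rewrite (FC z w fz fw) [F z w](Fl w y w 1 b fw fy fw) Fw mulr0 add0r conjM -(FC y w fy fw).
  have -> : F y z = cj (F w y) + cj b * F y y.
    rewrite (FC z y fz fy); have -> : F z y = 1 * F w y + b * F y y by exact: (Fl w y y 1 b fw fy fy).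
    by rewrite mul1r conjD conjM; congr (_ + _ * _); rewrite -(FC y y fy fy).
  rewrite /b !conjN !conjM conjR.
  rewrite (_ : _ + _ = ((t ^+ 2 * nc (F w y) ^+ 2)%:C * F y y - (2 * t * nc (F w y) ^+ 2)%:C)).
    by rewrite ReB ReC.
  have -> : (t ^+ 2 * nc (F w y) ^+ 2)%:C = t%:C ^+ 2 * (F w y * cj (F w y)) by rewrite RCM mul_conj expr2 RCM -expr2.
  have -> : (2 * t * nc (F w y) ^+ 2)%:C = t%:C * (F w y * cj (F w y)) + t%:C * (F w y * cj (F w y)).
    by rewrite mul_conj -RCM -RCD; congr (_ %:C); ring.
  exact: comb_alg.
have wl l : l \in s -> F w (evec l) = 0.
  move=> ls; have fe := evec_fin (sev ls); have [ee _] := evecP (sev ls).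
  rewrite /F ow // mulr0 (gqC om0 qp fe fw) (eigw_gq ee) // (cpC fw fe) ow //.
  by rewrite conj0 mulr0 conj0 subrr.
have ewS : eigw om k q S w.
  split; first exact: (fin_csummable om0 fw).
  move=> n; have fd := dl_fin om k n.
  pose al l := cp (dl n) (evec l) / (en (evec l))%:C.
  (* The projection of [dl n] onto the known eigenvectors. The test [l \in s] makes the family of
     finite energy for every real [l], as the sum lemmas require. *)
  pose P m := \sum_(l <- s) al l * (if l \in s then evec l m else 0).
  have ff l : fin (fun m => if l \in s then evec l m else 0).
    by case h : (l \in s); [exact: evec_fin (sev h)|exact: fin0].
  have fP : fin P by exact: fin_sum.
  (* The component of the unit vector in the complement. As [F w] also vanishes on the known
     eigenvectors, it vanishes on [dl n], and this is the eigenvalue equation at [n]. *)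
  pose y m := 1 * dl n m + (-1) * P m.
  have fy : fin y by exact: fin_comb.
  have iy : inW y.
    split=> // l ls; have fe := evec_fin (sev ls); rewrite cp_combl // cp_suml //.
    rewrite (bigD1_seq l) //= big1_seq ?addr0; last first.
      move=> l' /andP[ll l's]; rewrite (_ : (fun m => _) = evec l'); last by apply/funext => m; rewrite l's.
      by rewrite evec_orth ?mulr0 //; exact: sev.
    rewrite (_ : (fun m => _) = evec l); last by apply/funext => m; rewrite ls.
    rewrite cpp // /al divfK ?mul1r ?mulN1r ?subrr //.
    by rewrite RC_eq0 gt_eqF // evec_en //; exact: sev.
  have h1 := Fwy y iy.
  have FP : F w P = 0.
    rewrite (FC P w) // /F cp_suml // (gq_suml om0 s al qp ff fw).
    rewrite mulr_sumr -sumrB big1_seq ?conj0 // => l /andP[_ ls].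
    have fe := evec_fin (sev ls).
    rewrite (_ : (fun m => _) = evec l); last by apply/funext => m; rewrite ls.
    rewrite (_ : _ - _ = al l * F (evec l) w); last by rewrite /F; ring.
    by rewrite (FC w _) // wl // conj0 mulr0.
  have : F y w = 1 * F (dl n) w + (-1) * F P w by exact: Fl.
  rewrite (FC w y) // h1 (FC w P) // FP !conj0 mulr0 addr0 mul1r => /esym h2.
  have : F w (dl n) = 0 by rewrite (FC (dl n) w) // h2 conj0.
  by rewrite /F cp_dl gq_dl RCM -mulrA => /eqP; rewrite subr_eq0 => /eqP.
have wn : exists n, w n != 0.
  apply: contrapT => h; have z n : w n = 0.
    by apply/eqP; apply: contraT => h2; case: h; exists n.
  move: ew0; rewrite /en (eq_rsum (g := fun=> 0)); last by move=> n; rewrite z nc0 expr0n mulr0.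
  rewrite (@rsum_unique _ _ 0) ?ltxx //; rewrite (_ : psum _ = fun=> 0); first exact: cvg_cst.
  by apply/funext => N; rewrite /psum big1.
exists S; split; [by split => //; exists w|exact: mu_le_S|].
by right; exists w.
Qed.

End Maximum.

Hypothesis simple : forall l w w', 0 < l -> eigw om k q l w -> (exists n, w n != 0) ->
  eigw om k q l w' -> exists a, forall n, w' n = a * w n.

(** If the eigenvalue found were already in [s], simplicity would make the new eigenvector
    proportional to the old one, to which it is orthogonal. *)
Lemma max_eigen_new s v0 (mu : R) : uniq s -> (forall l, l \in s -> isev l) ->
  fin v0 -> (forall l, l \in s -> cp v0 (evec l) = 0) -> 0 < mu -> 0 < en v0 -> mu * en v0 <= Re (gq q v0 v0) ->
  exists l, [/\ isev l, mu <= l & l \notin s].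
Proof.
move=> us sev fv0 ov0 mu0 e0 m0.
have [l [el ml [ns|[w [ew wn ow]]]]] := max_eigen us sev fv0 ov0 mu0 e0 m0; first by exists l.
exists l; split => //; apply/negP => ls.
have [ee en0] := evecP el; have [a ha] := simple el.1 ew wn ee.
have fw := eigw_fin qp el.1 ew.
have := ow l ls; rewrite (cpC (evec_fin el) fw).
have -> : evec l = fun n => a * w n + 0 * w n by apply/funext => n; rewrite ha mul0r addr0.
rewrite cp_combl // cpp // mul0r addr0 => /eqP.
rewrite -nc_eq0 nc_conj nc_eq0 mulf_eq0 RC_eq0; have [n wn0] := wn.
rewrite (gt_eqF (en_gt0 fw wn0)) orbF => /eqP a0.
by have [m] := en0; rewrite ha a0 mul0r eqxx.
Qed.

(** Eigenvalues are collected one at a time. With [r < m] of them found, the span of [v] contains a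
    nonzero vector orthogonal to their eigenvectors, since an [m] by [r] matrix has a nonzero left
    kernel vector, and [max_eigen_new] applies to it. *)
Lemma max_min (m : nat) (v : 'I_m -> int -> R[i]) (mu : R) : 0 < mu -> (forall i, fin (v i)) ->
  (forall a : 'I_m -> R[i], (exists i, a i != 0) ->
     let y := fun n => \sum_i a i * v i n in 0 < en y /\ mu * en y <= Re (gq q y y)) ->
  exists s : seq R, [/\ uniq s, size s = m & forall l, l \in s -> isev l /\ mu <= l].
Proof.
move=> mu0 fv hv.
suff H : forall r, (r <= m)%N -> exists s : seq R, [/\ uniq s, size s = r & forall l, l \in s -> isev l /\ mu <= l] by exact: H.
elim=> [_|r IH rm]; first by exists [::].
have [s [us ss hs]] := IH (ltnW rm).
pose M : 'M[R[i]]_(m, r) := \matrix_(i, j) cp (v i) (evec (nth 0 s j)).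
have : kermx M != 0.
  rewrite kermx_eq0; apply/negP => /eqP rf; have := rank_leq_col M; rewrite rf; lia.
move=> /rowV0Pn [a ak a0].
have aM : a *m M = 0 by apply/sub_kermxP.
have [i ai] : exists i, a 0 i != 0.
  apply: contrapT => h; case/negP: a0; apply/eqP/matrixP => x y; rewrite ord1 mxE.
  by apply/eqP; apply: contraT => h2; case: h; exists y.
have [e0 m0] := hv (fun i => a 0 i) (ex_intro _ i ai).
have fy : fin (fun n => \sum_i a 0 i * v i n) by exact: fin_sum.
have oy l : l \in s -> cp (fun n => \sum_i a 0 i * v i n) (evec l) = 0.
  move=> ls; have [el _] := hs l ls; rewrite cp_suml //; last exact: evec_fin.
  have jr : (index l s < r)%N by rewrite -ss index_mem.
  have := congr1 (fun A : 'rV_r => A 0 (Ordinal jr)) aM; rewrite !mxE => e.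
  by rewrite -[RHS]e; apply: eq_bigr => j _; rewrite mxE /= nth_index.
have [l [el ml ns]] := max_eigen_new us (fun l ls => (hs l ls).1) fy oy mu0 e0 m0.
exists (l :: s); split; rewrite /= ?ns ?us ?ss //.
by move=> l'; rewrite inE => /orP[/eqP ->//|]; exact: hs.
Qed.

End MaxMin.

(** * Ranks of eigenvalues *)

Section FiniteLists.
Context {R : realType}.

Lemma seq_max (u : seq R) : u != [::] -> exists2 x, x \in u & forall y, y \in u -> y <= x.
Proof.
elim: u => // a [|b u] IH _; first by exists a => [|y]; rewrite inE // => /eqP ->.
have [x xu hx] := IH isT; have [ax|xa] := leP a x.
  by exists x; [rewrite inE xu orbT|move=> y; rewrite inE => /orP[/eqP ->|/hx]].
exists a; first by rewrite inE eqxx.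
by move=> y; rewrite inE => /orP[/eqP -> //|/hx yx]; exact: le_trans yx (ltW xa).
Qed.

Lemma seq_pos_lb (u : seq R) : (forall x, x \in u -> 0 < x) ->
  exists2 mu, 0 < mu & forall x, x \in u -> mu <= x.
Proof.
elim: u => [|a u IH] h; first by exists 1.
have [|mu m0 hm] := IH; first by move=> x xu; apply: h; rewrite inE xu orbT.
exists (Num.min a mu); first by rewrite lt_min m0 h // inE eqxx.
by move=> x; rewrite inE => /orP[/eqP ->|/hm]; rewrite ge_min ?lexx // => ->; rewrite orbT.
Qed.

Lemma seq_rank (u : seq R) n : uniq u -> (n < size u)%N ->
  exists2 l, l \in u & count (fun x => l < x) u = n.
Proof.
move: {2}(size u) (erefl (size u)) => N; elim: N u n => [|N IH] u n us uu nu; first by rewrite us in nu.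
have [|x xu hx] := @seq_max u; first by rewrite -size_eq0 us.
have pu := perm_to_rem xu.
case: n nu => [|n] nu.
  exists x => //; apply/eqP; rewrite -leqn0 leqNgt -has_count; apply/hasPn => y /hx.
  by rewrite -leNgt.
have su : size (rem x u) = N by rewrite size_rem // us.
have [||l lu cl] := IH (rem x u) n su; first exact: rem_uniq.
  by rewrite su; move: nu; rewrite us.
move: lu; rewrite mem_rem_uniq // !inE => /andP[lx lu].
exists l => //; rewrite (permP pu) /= cl lt_def eq_sym lx hx //.
Qed.

End FiniteLists.

(** * Eigenvalues counted from above *)

Section Spectrum.
Context {R : realType}.
Variables (om k : R) (om0 : 0 < om).
Implicit Types (v w y q : int -> R[i]).
Local Notation fin := (fin om k).
Local Notation en := (en om k).
Local Notation cp := (cp om k).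
Local Notation isev := (isev om k).
Let Cs := rsum (fun n => (cwt om k n)^-1).

Lemma nvec_ex q l : psdq q -> isev q l -> exists w, eigw om k q l w /\ rsum (fun n => nc (w n)) = 1.
Proof.
move=> qp el; have [ee [n en0]] := evecP el.
have r0 : 0 < rsum (fun n => nc (evec om k q l n)).
  by apply: (rsum_gt0 (n := n)) => [m||]; [exact: nc_ge0|exact: ee.1|rewrite nc_gt0].
set r := rsum _ in r0.
exists (fun n => (r^-1)%:C * evec om k q l n + 0 * evec om k q l n); split; first exact: eigw_comb.
rewrite (eq_rsum (g := fun n => r^-1 * nc (evec om k q l n))).
  by rewrite rsumZ ?mulVf ?gt_eqF //; exact: ee.1.
by move=> m; rewrite mul0r addr0 ncM ncR ger0_norm // invr_ge0 ltW.
Qed.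

(** Normalised by the sum of moduli, as [eigw_compact] requires; the phase is left arbitrary. *)
Definition nvec q l : int -> R[i] := xget (fun=> 0) [set w | eigw om k q l w /\ rsum (fun n => nc (w n)) = 1].

Lemma nvecP q l : psdq q -> isev q l -> eigw om k q l (nvec q l) /\ rsum (fun n => nc (nvec q l n)) = 1.
Proof. by move=> qp /(nvec_ex qp) [w hw]; rewrite /nvec; case: xgetP => [y -> //|/(_ w)]. Qed.

Lemma unit_nz w : rsum (fun n => nc (w n)) = 1 -> exists n, w n != 0.
Proof.
move=> r1; apply: contrapT => nw; have z n : w n = 0.
  by apply/eqP; apply: contraT => h; case: nw; exists n.
have : rsum (fun n => nc (w n)) = 0.
  rewrite (eq_rsum (g := fun=> 0)); last by move=> n; rewrite z nc0.
  apply: rsum_unique; rewrite (_ : psum _ = fun=> 0); first exact: cvg_cst.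
  by apply/funext => N; rewrite /psum big1.
by rewrite r1 => /eqP; rewrite oner_eq0.
Qed.

Lemma isev_bound q l : psdq q -> isev q l -> l <= Re (q 0) * Cs.
Proof.
move=> qp el; have [ee _] := evecP el; have fe := evec_fin qp el; have e0 := evec_en qp el.
have := gq_bound om0 qp fe; rewrite (eigw_gq ee) // cpp // -RCM -/Cs.
by rewrite -[X in X <= _]/(l * en (evec om k q l)) ler_pM2r.
Qed.

(** Infinitely many eigenvalues above [mu] would give normalised, mutually orthogonal eigenvectors
    with a nonzero ultralimit. The limit is orthogonal to each of them, hence to itself. *)
Lemma isev_finite q (mu : R) : psdq q -> 0 < mu ->
  exists u : seq R, uniq u /\ forall l, l \in u <-> isev q l /\ mu <= l.
Proof.
move=> qp mu0; pose A := [set l | isev q l /\ mu <= l].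
have [/finite_seqP [u hu]|/infiniteP /pcard_leP /unsquash f] := pselect (finite_set A).
  exists (undup u); split; first exact: undup_uniq.
  move=> l; rewrite mem_undup; split=> h; first by have : A l by rewrite hu.
  by have : A l by []; rewrite hu.
have fA j : A (f j) by exact: (@funS _ _ _ _ f j I).
have finj i j : i != j -> f i != f j by apply: contra_neq => h; apply: (@inj _ _ _ f i j) => //; rewrite inE.
have fe j : isev q (f j) by case: (fA j).
have [U [UU oU]] := @ultraFilterLemma nat \oo _.
pose wf j := nvec q (f j).
have wfP j : eigw om k q (f j) (wf j) /\ rsum (fun n => nc (wf j n)) = 1 by exact: nvecP.
have [lam hlam] : exists lam : R, f j @[j --> U] --> lam.
  apply: (ultra_real UU (B := Re (q 0) * Cs)); apply: filterE => j.
  by rewrite ger0_norm ?isev_bound // ltW // (fe j).1.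
have lam0 : 0 < lam.
  apply: lt_le_trans mu0 _; apply: (filter_ler_cvg (cvg_cst _) hlam).
  by apply: filterE => j; case: (fA j).
have [|w [C [ew wc wn _ wb]]] := @eigw_compact R nat U UU om om0 (fun=> k) (fun=> q) f wf k lam mu (Re (q 0)) `|k| q
    mu0 _ (cvg_cst _) hlam (fun=> ccvg_cst _).
  by apply: filterE => j; have [_ mj] := fA j; have w1 := wfP j; split.
have fw := eigw_fin qp lam0 ew.
have ff j := eigw_fin qp (fe j).1 (wfP j).1.
have gs : rsummable (fun n => C * geo (pi * om) n).
  by apply/rsummableZ/geo_summable; rewrite mulr_gt0 ?pi_gt0.
have lim l v : 0 < l -> eigw om k q l v -> ccvg_to U (fun j => cp (wf j) v) (cp w v).
  move=> l0 ev; have [B hB] := eigw_bounded qp l0 ev.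
  apply: (@csum_dominated _ _ _ _ _ _ (fun m => B * (C * geo (pi * om) m))).
  - apply: filterS wb => j hj m.
    rewrite (_ : _ * _ = (cwt om k m)%:C * cj (v m) * wf j m); last by ring.
    rewrite ncM ler_pM ?nc_ge0 //; apply: le_trans (hB m).
    by rewrite !ncM nc_conj.
  - exact: rsummableZ.
  - by move=> m; apply: ccvgM; [apply: ccvgM => //|]; exact: ccvg_cst.
have h1 i : cp w (wf i) = 0.
  have h := lim (f i) (wf i) (fe i).1 (wfP i).1.
  have h2 : \forall j \near U, cp (wf j) (wf i) = 0.
    have : \forall j \near U, (i < j)%N by apply: oU; exact: nbhs_infty_gt.
    apply: filterS => j ij; have ji : f j != f i by apply: finj; rewrite gtn_eqF.
    exact (eigw_orth om0 qp (fe j).1 (fe i).1 (wfP j).1 (wfP i).1 ji).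
  have h3 : ccvg_to U (fun j => cp (wf j) (wf i)) 0.
    by split; apply: cvg_near_cst; apply: filterS h2 => j ->.
  exact: ccvg_unique h h3.
have h4 : ccvg_to U (fun j => cp (wf j) w) 0.
  rewrite (_ : (fun j => _) = fun=> 0); first exact: ccvg_cst.
  by apply/funext => j; rewrite (cpC fw (ff j)) h1 conj0.
have : cp w w = 0 by exact: ccvg_unique (lim lam w lam0 ew) h4.
have [n wn0] := wn.
by rewrite cpp // => /eqP; rewrite RC_eq0 gt_eqF //; exact: en_gt0 wn0.
Qed.

(** Distinct values are counted, not multiplicities. This is the usual rank because eigenvalues are
    simple for the [k] in question. *)
Definition rk q l n := isev q l /\ exists s : seq R, [/\ uniq s, size s = n &
  forall l', l' \in s <-> isev q l' /\ l < l'].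

Lemma rk_ge q l n (mu : R) s : rk q l n -> uniq s -> size s = n.+1 ->
  (forall l', l' \in s -> isev q l' /\ mu <= l') -> mu <= l.
Proof.
move=> [_ [s' [us' ss' hs']]] us ss hs; rewrite leNgt; apply/negP => lmu.
have : (size s <= size s')%N.
  by apply: uniq_leq_size => // l' /hs [el ml]; apply/hs'; split => //; exact: lt_le_trans ml.
by rewrite ss ss' ltnn.
Qed.

Lemma rk_list q l n : rk q l n -> exists s : seq R, [/\ uniq s, size s = n.+1 &
  forall l', l' \in s -> isev q l' /\ l <= l'].
Proof.
move=> [el [s [us ss hs]]]; exists (l :: s); split => /=; rewrite ?ss ?us ?andbT //.
  by apply/negP => /hs [_]; rewrite ltxx.
by move=> l'; rewrite inE => /orP[/eqP ->//|/hs [? /ltW]].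
Qed.

Lemma rk_uniq q l l' n : rk q l n -> rk q l' n -> l = l'.
Proof.
move=> h h'; have [s [us ss hs]] := rk_list h; have [s' [us' ss' hs']] := rk_list h'.
by apply/eqP; rewrite eq_le (rk_ge h us' ss' hs') (rk_ge h' us ss hs).
Qed.

Lemma rk_exists q n s : psdq q -> uniq s -> size s = n.+1 -> (forall l, l \in s -> isev q l) ->
  exists l, rk q l n.
Proof.
move=> qp us ss hs.
have [|mu mu0 hmu] := @seq_pos_lb _ s; first by move=> x /hs [].
have [u [uu hu]] := isev_finite qp mu0.
have nu : (n < size u)%N.
  by rewrite -ss; apply: uniq_leq_size => // l ls; apply/hu; split; [exact: hs|exact: hmu].
have [l lu cl] := seq_rank uu nu; have [el ml] := (hu l).1 lu.
exists l; split => //; exists ([seq x <- u | l < x]); split.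
- exact: filter_uniq.
- by rewrite size_filter.
- move=> l'; rewrite mem_filter; split.
    by move=> /andP[ll /hu [? _]].
  by move=> [el' ll]; rewrite ll; apply/hu; split => //; exact: le_trans ml (ltW ll).
Qed.

Lemma rk_of q l : psdq q -> isev q l -> exists n, rk q l n.
Proof.
move=> qp el; have [u [uu hu]] := isev_finite qp el.1.
exists (size ([seq x <- u | l < x])); split => //.
exists ([seq x <- u | l < x]); split => //; first exact: filter_uniq.
move=> l'; rewrite mem_filter; split; first by move=> /andP[ll /hu []].
by move=> [el' ll]; rewrite ll; apply/hu; split => //; exact: ltW.
Qed.

Definition simple q := forall l w w', 0 < l -> eigw om k q l w -> (exists n, w n != 0) ->
  eigw om k q l w' -> exists a, forall n, w' n = a * w n.

(** Weyl's inequality: the span of the eigenvectors of [qa] at level [mu] is a test space for [qb]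
    at level [mu - d] in the max-min principle. *)
Lemma ev_transfer qa qb (d mu : R) s : psdq qa -> psdq qb -> simple qb ->
  (forall y, fin y -> Re (gq qa y y) - d * en y <= Re (gq qb y y)) ->
  uniq s -> (forall l, l \in s -> isev qa l /\ mu <= l) -> 0 < mu - d ->
  exists s' : seq R, [/\ uniq s', size s' = size s & forall l, l \in s' -> isev qb l /\ mu - d <= l].
Proof.
move=> pa pb sb hd us hs md.
pose v (i : 'I_(size s)) := evec om k qa (nth 0 s i).
have hv (i : 'I_(size s)) : isev qa (nth 0 s i) /\ mu <= nth 0 s i by apply: hs; exact: mem_nth.
have fv i : fin (v i) by exact: evec_fin (hv i).1.
have [s' [us' ss' hs']] : exists s' : seq R, [/\ uniq s', size s' = size s & forall l, l \in s' -> isev qb l /\ mu - d <= l].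
  apply: (max_min om0 pb sb md fv) => a [i0 ai0] y.
  have fy : fin y by exact: fin_sum.
  have cvy i : cp (v i) y = cj (a i) * (en (v i))%:C.
    rewrite (cpC fy (fv i)) cp_suml // (bigD1 i) //= big1 ?addr0.
      by rewrite cpp // conjM conjR.
    move=> j ji; rewrite evec_orth ?mulr0 //; try exact: (hv _).1.
    by rewrite nth_uniq.
  have eE : en y = \sum_i nc (a i) ^+ 2 * en (v i).
    apply: (@complexI R); rewrite -cpp // cp_suml // (rmorph_sum (@real_complex R)).
    by apply: eq_bigr => i _; rewrite cvy mulrA mul_conj -RCM.
  have gE : Re (gq qa y y) = \sum_(i < size s) nth 0 s i * (nc (a i) ^+ 2 * en (v i)).
    suff -> : gq qa y y = (\sum_(i < size s) nth 0 s i * (nc (a i) ^+ 2 * en (v i)))%:C by [].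
    rewrite (gq_suml om0 _ a pa fv fy) (rmorph_sum (@real_complex R)).
    apply: eq_bigr => i _; have [ee _] := evecP (hv i).1.
    have -> : gq qa (v i) y = (nth 0 s i)%:C * cp (v i) y by exact: eigw_gq.
    rewrite -[RHS]/((nth 0 s i * (nc (a i) ^+ 2 * en (v i)))%:C).
    rewrite (@RCM R (nth 0 s i) (nc (a i) ^+ 2 * en (v i))) (@RCM R (nc (a i) ^+ 2) (en (v i))).
    by rewrite -mul_conj cvy mulrCA -mulrA.
  have e0 : 0 < en y.
    rewrite eE (bigD1 i0) //= ltr_pwDl //.
      by rewrite mulr_gt0 ?exprn_gt0 ?nc_gt0 //; apply: evec_en => //; exact: (hv i0).1.
    by apply: sumr_ge0 => i _; rewrite mulr_ge0 ?sqr_ge0 //; exact: en_ge0.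
  split => //; apply: le_trans (hd y fy); rewrite mulrBl lerD2r eE mulr_sumr gE.
  apply: ler_sum => i _; apply: ler_wpM2r; last exact: (hv i).2.
  by rewrite mulr_ge0 ?sqr_ge0 //; exact: en_ge0.
by exists s'.
Qed.

Lemma rk_transfer qa qb (d l l' : R) n : psdq qa -> psdq qb -> simple qb ->
  (forall y, fin y -> Re (gq qa y y) - d * en y <= Re (gq qb y y)) ->
  rk qa l n -> rk qb l' n -> l - d <= l'.
Proof.
move=> pa pb sb hd ra rb; have [h|h] := leP (l - d) 0; first by apply: le_trans h (ltW rb.1.1).
have [s [us ss hs]] := rk_list ra.
have [s' [us' ss' hs']] := ev_transfer pa pb sb hd us hs h.
by apply: (rk_ge rb us' _ hs'); rewrite ss'.
Qed.

Lemma nc_unit w w' (a : R[i]) : rsum (fun n => nc (w n)) = 1 -> rsum (fun n => nc (w' n)) = 1 ->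
  csummable w -> (forall n, w' n = a * w n) -> nc a = 1.
Proof.
move=> r1 r2 sw h; rewrite -r2 (eq_rsum (g := fun n => nc a * nc (w n))).
  by rewrite rsumZ // r1 mulr1.
by move=> n; rewrite h ncM.
Qed.

Lemma flux_scale w w' (a : R[i]) : rsummable (fun n => sinhR (pi * freq om k n) * nc (w n) ^+ 2) ->
  (forall n, w' n = a * w n) -> flux om k w' = nc a ^+ 2 * flux om k w.
Proof.
move=> sw h; rewrite /flux -rsumZ //; apply: eq_rsum => n.
by rewrite h ncM; ring.
Qed.

Lemma en_scale w w' (a : R[i]) : fin w -> (forall n, w' n = a * w n) -> en w' = nc a ^+ 2 * en w.
Proof.
move=> sw h; rewrite /en -rsumZ //; apply: eq_rsum => n.
by rewrite h ncM; ring.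
Qed.

Lemma sinhR_le_coshR (x : R) : `|sinhR x| <= coshR x.
Proof.
rewrite /sinhR /coshR ler_norml; have := expR_gt0 x; have := expR_gt0 (- x) => a b.
by apply/andP; split; lra.
Qed.

Lemma flux_summable w : fin w -> rsummable (fun n => sinhR (pi * freq om k n) * nc (w n) ^+ 2).
Proof.
move=> fw; apply: (rsummable_le _ (rsummableZ pi fw)) => n.
rewrite normrM (ger0_norm (sqr_ge0 _)) mulrA ler_wpM2r ?sqr_ge0 //.
by rewrite /cwt [leRHS]mulrC divfK ?gt_eqF ?pi_gt0 // sinhR_le_coshR.
Qed.

Lemma cosh_geo n : coshR (pi * freq om k n) <= expR (pi * `|k|) * (geo (pi * om) n)^-1.
Proof.
rewrite /geo -expRN opprK -expRD.
have h : coshR (pi * freq om k n) <= expR `|pi * freq om k n|.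
  have := @expR_gt0 R `|pi * freq om k n|; rewrite /coshR; move: (pi * _) => x.
  have := expR_gt0 x; have := expR_gt0 (- x).
  have h1 : expR x <= expR `|x| by rewrite ler_expR ler_norm.
  have h2 : expR (- x) <= expR `|x| by rewrite ler_expR -normrN ler_norm.
  by lra.
apply: (le_trans h); rewrite ler_expR normrM (ger0_norm (pi_ge0 _)).
rewrite -mulrA -mulrDr ler_wpM2l ?pi_ge0 // addrC; exact: freq_abs_le.
Qed.

End Spectrum.

Lemma min_max_sign {R : realType} (x y : R) : x != 0 -> y != 0 -> x * y <= 0 ->
  Num.min x y <= 0 <= Num.max x y.
Proof.
move=> x0 y0 h; rewrite ge_min le_max; have [a|a|a] := ltgtP x 0; last by rewrite a eqxx in x0.
  have [b|b|b] := ltgtP y 0; rewrite ?orbT //.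
  by move: h; rewrite leNgt nmulr_rgt0 // b.
have [b|b|b] := ltgtP y 0; rewrite ?orbT //.
by move: h; rewrite leNgt (mulr_gt0 a b).
Qed.

Lemma lip_alg {R : realType} (s s' G Z d D e A B : R) : A = (1 - s) * G + s * Z -> B = (1 - s') * G + s' * Z ->
  `|s - s'| <= d -> 0 <= G <= D * e -> 0 <= Z <= D * e -> B - d * D * e <= A.
Proof.
move=> -> -> l1 /andP[g0 g1] /andP[z0 z1]; rewrite -mulrA.
move: (D * e) g1 z1 => E g1 z1.
have h : `|(s - s') * (G - Z)| <= d * E.
  by rewrite normrM ler_pM // ler_norml; apply/andP; split; lra.
move: h; rewrite ler_norml => /andP[]; lra.
Qed.

(* The [m] with [|om m + k| < |om j + k|], for any [0 < k < om / 2]. *)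
Definition absless (j : int) : seq int :=
  if (0 <= j)%R then [seq i%:Z - j | i <- iota 0 (`|j|.*2)] else [seq i%:Z + j + 1 | i <- iota 0 (`|j|.*2).-1].

Lemma mem_absless (j m : int) :
  (m \in absless j) = if (0 <= j)%R then (- j <= m < j)%R else (j < m < - j)%R.
Proof.
rewrite /absless; case: ifP => j0.
  apply/mapP/idP => [[i hi ->]|h]; first by move: hi; rewrite mem_iota; lia.
  by exists (absz (m + j)); rewrite ?mem_iota; lia.
apply/mapP/idP => [[i hi ->]|h]; first by move: hi; rewrite mem_iota; lia.
by exists (absz (m - j - 1 : int)); rewrite ?mem_iota; lia.
Qed.

Lemma uniq_absless j : uniq (absless j).
Proof. by rewrite /absless; case: ifP => _; rewrite map_inj_uniq ?iota_uniq // => a b; lia. Qed.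

Lemma sign_absless {R : realType} (j : int) : (-1) ^+ size (absless j) = (if (0 <= j)%R then 1 else -1) :> R.
Proof.
rewrite /absless; case: ifP => j0; rewrite size_map size_iota -signr_odd; first by rewrite odd_double.
by rewrite (_ : odd _ = true) ?expr1 //; lia.
Qed.

Lemma absless_sym (j m : int) : m \notin absless j -> j \notin absless m -> m = j.
Proof. by rewrite !mem_absless; case: (leP 0 j) => ?; case: (leP 0 m) => ?; lia. Qed.

(** * Deformation of the symbol and the sign of the flux *)

Section Homotopy.
Context {R : realType}.
Variables (om k T : R) (om0 : 0 < om) (T0 : 0 < T) (omT : om * T = 2 * pi).
Hypothesis kom : 0 < k < om / 2.
Implicit Types (v w y q : int -> R[i]).
Local Notation fin := (fin om k).
Local Notation en := (en om k).
Local Notation isev := (isev om k).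
Local Notation rk := (rk om k).
Let Cs := rsum (fun n => (cwt om k n)^-1).

Let kT : `|cos (k * T)| < 1.
Proof.
have [k0 k1] := andP kom.
have p0 := @pi_gt0 R.
have h0 : 0 < k * T by rewrite mulr_gt0.
have h1 : k * T < pi.
  have : k * T < om / 2 * T by rewrite ltr_pM2r.
  by rewrite mulrAC omT; move: (pi : R) => x; lra.
have c1 : cos (k * T) < 1.
  rewrite -(@cos0 R) ltr_cos ?in_itv /= ?lexx ?(ltW p0) ?(ltW h0) ?(ltW h1) //.
have c2 : - 1 < cos (k * T).
  by rewrite -(@cospi R) ltr_cos ?in_itv /= ?lexx ?(ltW p0) ?(ltW h0) ?(ltW h1).
by rewrite ltr_norml c2.
Qed.

Lemma simple_psd q : psdq q -> simple om k q.
Proof. by move=> qp l w w' l0 ew wn ew'; exact: (eigw_simple om0 T0 omT kT qp l0 ew wn ew'). Qed.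

Lemma flux_nz q w (l : R) : psdq q -> 0 < l -> eigw om k q l w -> (exists n, w n != 0) -> flux om k w != 0.
Proof. exact: (flux_neq0 om0 T0 omT kT). Qed.

Lemma flux_unit q w w' (l : R) : psdq q -> 0 < l -> eigw om k q l w -> eigw om k q l w' ->
  rsum (fun n => nc (w n)) = 1 -> rsum (fun n => nc (w' n)) = 1 ->
  flux om k w' = flux om k w /\ en w' = en w.
Proof.
move=> qp l0 ew ew' r1 r2; have [a ha] := simple_psd qp l0 ew (unit_nz r1) ew'.
have a1 := nc_unit r1 r2 ew.1 ha.
have fw := eigw_fin qp l0 ew.
by rewrite (flux_scale (flux_summable fw) ha) (en_scale fw ha) a1 expr1n !mul1r.
Qed.

Section FluxLimit.
Context {I : Type} {U : set_system I}.
Hypothesis (UU : UltraFilter U).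
Lemma flux_cvg (wf : I -> int -> R[i]) w C : 
  (forall n, ccvg_to U (fun i => wf i n) (w n)) ->
  (\forall i \near U, forall n, nc (wf i n) <= C * geo (pi * om) n) ->
  flux om k (wf i) @[i --> U] --> flux om k w.
Proof.
move=> wc wb.
have wbl n : nc (w n) <= C * geo (pi * om) n.
  apply: (filter_ler_cvg (ccvg_nc (wc n)) (cvg_cst _)).
  by apply: filterS wb => i; apply.
have bd v n : nc (v n) <= C * geo (pi * om) n ->
    `|sinhR (pi * freq om k n) * nc (v n) ^+ 2| <= expR (pi * `|k|) * C ^+ 2 * geo (pi * om) n.
  move=> hv; rewrite normrM (ger0_norm (sqr_ge0 _)).
  have h1 := le_trans (sinhR_le_coshR _) (cosh_geo k om0 n).
  have g0 := geo_gt0 (pi * om) n.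
  have h2 : nc (v n) ^+ 2 <= (C * geo (pi * om) n) ^+ 2.
    by rewrite ler_pXn2r ?nnegrE ?nc_ge0 // (le_trans (nc_ge0 _) hv).
  apply: (le_trans (ler_pM (normr_ge0 _) (sqr_ge0 _) h1 h2)).
  rewrite le_eqVlt; apply/orP; left; apply/eqP; field.
  by rewrite gt_eqF.
apply: (@rsum_dominated _ _ _ _ _ _ (fun n => expR (pi * `|k|) * C ^+ 2 * geo (pi * om) n)).
- by apply: filterS wb => i hi n; apply: bd.
- by move=> n; apply: bd.
- by apply/rsummableZ/geo_summable; rewrite mulr_gt0 ?pi_gt0.
- move=> n; apply: cvgMr; have h : nc (wf i n) @[i --> U] --> nc (w n) by exact: ccvg_nc.
  by rewrite expr2; under eq_fun do rewrite expr2; exact: cvgM.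
Qed.
End FluxLimit.

(* [clamp] extends the deformation from [[0, 1]] to all of [R], which avoids
   restricting continuity statements to the interval. *)
Definition clamp (t : R) : R := Num.max 0 (Num.min t 1).

Lemma clamp_itv t : 0 <= clamp t <= 1.
Proof. by rewrite /clamp le_max lexx /= ge_max ler01 ge_min lexx orbT. Qed.

Lemma clamp_id t : 0 <= t <= 1 -> clamp t = t.
Proof. by move=> /andP[t0 t1]; rewrite /clamp min_l // max_r. Qed.

Lemma clampE t : clamp t = if t <= 0 then 0 else if 1 <= t then 1 else t.
Proof.
rewrite /clamp; case: (leP t 0) => h; first by rewrite (min_l (_ : t <= 1)) ?max_l //; lra.
by case: (leP 1 t) => h1; rewrite max_r // ltW.
Qed.

Lemma clamp_lip t t' : `|clamp t - clamp t'| <= `|t - t'|.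
Proof.
have := ler_norm (t - t'); have := ler_norm (t' - t); rewrite (distrC t' t) !clampE.
by case: (leP t 0) => h1; case: (leP t' 0) => h2; case: (leP 1 t) => h3; case: (leP 1 t') => h4 a b;
  rewrite ler_norml; apply/andP; split; lra.
Qed.

Variable q : int -> R[i].
Hypothesis qp : psdq q.
Let q0 := Re (q 0).
Hypothesis q00 : 0 < q0.

Definition homot (t : R) (l : int) : R[i] :=
  (1 - clamp t)%:C * q l + (clamp t * Re (q 0))%:C * (l == 0)%:R.

Lemma homot0 l : homot 0 l = q l.
Proof. by rewrite /homot clamp_id ?lexx ?ler01 // subr0 mul0r mul1r mul0r addr0. Qed.

Lemma homot_psd t : psdq (homot t).
Proof.
have /andP[t0 t1] := clamp_itv t; rewrite /homot; move: (clamp t) t0 t1 => s s0 s1; split.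
  move=> l; rewrite conjD !conjM !conjR (qp.1) oppr_eq0; congr (_ + _ * _).
  by case: eqP => _; rewrite ?conj1 ?conj0.
move=> M z.
have E : \sum_(0 <= i < M) \sum_(0 <= j < M) z i * cj (z j) *
    ((1 - s)%:C * q (i%:Z - j%:Z) + (s * Re (q 0))%:C * (i%:Z - j%:Z == 0)%:R) =
  (1 - s)%:C * \sum_(0 <= i < M) \sum_(0 <= j < M) z i * cj (z j) * q (i%:Z - j%:Z) +
  (s * Re (q 0))%:C * \sum_(0 <= i < M) (nc (z i) ^+ 2)%:C.
  rewrite !mulr_sumr -big_split /=; apply: eq_big_nat => i /andP[_ iM].
  rewrite mulr_sumr (eq_bigr (fun j => (1 - s)%:C * (z i * cj (z j) * q (i%:Z - j%:Z)) +
    (s * Re (q 0))%:C * (z i * cj (z j)) * (i%:Z - j%:Z == 0)%:R)); last by move=> j _; ring.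
  rewrite big_split /=; congr (_ + _).
  rewrite big_mkord (bigD1 (Ordinal iM)) //= subrr eqxx mulr1 mul_conj big1 ?addr0 // => j ji.
  rewrite (_ : (i%:Z - j%:Z == 0) = false) ?mulr0 //.
  by apply/negbTE; apply: contra ji; rewrite subr_eq0 => /eqP [ij]; apply/eqP/val_inj.
rewrite E ReD !ReC; apply: addr_ge0.
  by apply: mulr_ge0; [lra|exact: qp.2].
apply: mulr_ge0; first by rewrite mulr_ge0 // ltW.
rewrite -(rmorph_sum (@real_complex R)) /=.
by apply: sumr_ge0 => i _; exact: sqr_ge0.
Qed.

Let ss y := rsum (fun n => nc (y n) ^+ 2).

Let cs0 n : 0 < cwt om k n. Proof. exact: cwt_gt0. Qed.

Let ss_summable y : fin y -> rsummable (fun n => nc (y n) ^+ 2).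
Proof.
move=> fy; have sy := fin_csummable om0 fy.
apply: (@rsummable_le _ _ (fun n => rsum (fun m => nc (y m)) * nc (y n))).
  move=> n; rewrite ger0_norm ?sqr_ge0 // expr2 ler_wpM2r ?nc_ge0 //.
  by apply: (@rsum_ge_term _ (fun m => nc (y m)) n) => // m; exact: nc_ge0.
exact: rsummableZ.
Qed.

Let ss_le y : fin y -> ss y <= Cs * en y.
Proof.
move=> fy; have sy := fin_csummable om0 fy.
apply: le_trans (rsum_sqr_le om0 fy); rewrite expr2 -rsumZ //; apply: rsum_le.
- move=> n; rewrite expr2 ler_wpM2r ?nc_ge0 //.
  by apply: (@rsum_ge_term _ (fun m => nc (y m)) n) => // m; exact: nc_ge0.
- exact: ss_summable.
- exact: rsummableZ.
Qed.

Let ss_ge0 y : fin y -> 0 <= ss y.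
Proof. by move=> fy; apply: rsum_ge0 => [n|]; [exact: sqr_ge0|exact: ss_summable]. Qed.

Lemma homot_toep t y n : csummable y ->
  toep (homot t) y n = (1 - clamp t)%:C * toep q y n + (clamp t * q0)%:C * y n.
Proof.
move=> sy; rewrite /toep -csumZ; last exact: toep_summable.
have -> : (clamp t * q0)%:C * y n = csum (fun m => (clamp t * q0)%:C * (dl n m * y m)).
  rewrite (@csum_delta R _ n); first by rewrite /dl eqxx mul1r.
  by move=> m /negbTE mn; rewrite /dl mn mul0r mulr0.
have sd : csummable (fun m => dl n m * y m).
  apply: csummable_le sy => m; rewrite /dl ncM; case: eqP => _.
    by rewrite -[true%:R]/(1%:C) ncR normr1 mul1r.
  by rewrite -[false%:R]/(0%:C) ncR normr0 mul0r nc_ge0.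
rewrite -csumD; [|by apply: csummableZ; exact: toep_summable|exact: csummableZ].
apply: eq_csum => m; rewrite /homot /dl subr_eq0 [n == m]eq_sym -/q0.
by move: ((m == n)%:R : R[i]) => x; ring.
Qed.

Lemma homot_gq t y : fin y ->
  Re (gq (homot t) y y) = (1 - clamp t) * Re (gq q y y) + clamp t * (q0 * ss y).
Proof.
move=> fy; have sy := fin_csummable om0 fy.
have e n : toep (homot t) y n * cj (y n) =
   (1 - clamp t)%:C * (toep q y n * cj (y n)) + (clamp t * q0)%:C * (nc (y n) ^+ 2)%:C.
  by rewrite homot_toep // -mul_conj; ring.
have sq : csummable (fun n => (nc (y n) ^+ 2)%:C).
  by apply: csummable_le (ss_summable fy) => n; rewrite ncR ger0_norm ?sqr_ge0.
have sg := gq_summable om0 qp fy fy.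
rewrite /gq (eq_csum e) csumD ?csumZ //; try exact: csummableZ.
by rewrite ReD !ReC mulrA.
Qed.

Let D := q0 * Cs.

Let gq_bounds y : fin y -> 0 <= Re (gq q y y) <= D * en y.
Proof.
by move=> fy; rewrite qform_ge0 //=; [exact: (gq_bound om0 qp)|exact: (fin_csummable om0 fy)].
Qed.

(** Both end forms lie between 0 and [D * en y], so their convex combinations vary with Lipschitz
    constant [D] relative to the energy. *)
Lemma homot_lip t t' y : fin y ->
  Re (gq (homot t') y y) - `|t - t'| * D * en y <= Re (gq (homot t) y y).
Proof.
move=> fy; have s0 := ss_ge0 fy; have s1 := ss_le fy.
apply: (lip_alg (homot_gq t fy) (homot_gq t' fy) (clamp_lip t t') (gq_bounds fy)).
by rewrite mulr_ge0 ?(ltW q00) //= /D -mulrA ler_wpM2l // ltW.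
Qed.

Let Dge0 : 0 <= D.
Proof. by rewrite /D mulr_ge0 ?(ltW q00) //; apply: rsum_ge0 => [n|]; [rewrite invr_ge0 ltW|exact: cwtV_rsummable]. Qed.

Lemma homot_rk_lip t t' l l' n : rk (homot t) l n -> rk (homot t') l' n -> `|l - l'| <= `|t - t'| * D.
Proof.
move=> r r'; have p := homot_psd t; have p' := homot_psd t'.
have h1 := rk_transfer om0 p p' (simple_psd p') (fun y fy => homot_lip t' t fy) r r'.
have h2 := rk_transfer om0 p' p (simple_psd p) (fun y fy => homot_lip t t' fy) r' r.
by rewrite (distrC t') in h1; rewrite ler_norml; lra.
Qed.

(** For a positive parameter the symbol contains a positive multiple of [delta_0], whose form is
    bounded below on the span of [n + 1] unit vectors. So every rank is attained, even if [q] itself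
    has finite rank; at parameter 0 the rank is supplied by [rk0]. *)
Lemma homot_rk_exists t n : 0 < clamp t -> exists l, rk (homot t) l n.
Proof.
move=> t0.
pose M := \sum_(i < n.+1) cwt om k i%:Z.
have M0 : 0 < M by rewrite /M big_ord_recl ltr_pwDl // sumr_ge0 // => i _; rewrite ltW.
pose mu := clamp t * q0 / M.
have mu0 : 0 < mu by rewrite !mulr_gt0 ?invr_gt0.
have p := homot_psd t.
have [s [us ss' hs]] : exists s : seq R, [/\ uniq s, size s = n.+1 & forall l, l \in s -> isev (homot t) l /\ mu <= l].
  apply: (max_min om0 p (simple_psd p) mu0 (fun i => dl_fin om k i%:Z)) => a [i0 ai0] y.
  have fy : fin y by apply: fin_sum => i; exact: dl_fin.
  have yi (i : 'I_n.+1) : y i%:Z = a i.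
    rewrite /y (bigD1 i) //= /dl eqxx mulr1 big1 ?addr0 // => j ji.
    by rewrite (_ : (i%:Z == j%:Z) = false) ?mulr0 //; apply/negbTE; apply: contra ji => /eqP [ij]; apply/eqP/val_inj.
  have yM m : cwt om k m * nc (y m) ^+ 2 <= M * nc (y m) ^+ 2.
    have [->|ym] := eqVneq (y m) 0; first by rewrite nc0 expr0n !mulr0.
    apply: ler_wpM2r; first exact: sqr_ge0.
    have [i ->] : exists i : 'I_n.+1, m = i%:Z.
      apply: contrapT => h; case/negP: ym; apply/eqP; rewrite /y big1 // => i _.
      by rewrite /dl; case: eqP => [e|_]; [case: h; exists i|rewrite mulr0].
    rewrite /M (bigD1 i) //= lerDl sumr_ge0 // => j _; exact: ltW.
  have e0 : 0 < en y by apply: (en_gt0 (n := i0%:Z) fy); rewrite yi.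
  split => //; rewrite (homot_gq t fy).
  have eM : en y <= M * ss y.
    by rewrite /ss -rsumZ; [apply: rsum_le => //; apply: rsummableZ|]; exact: ss_summable.
  have /andP[g0 _] := gq_bounds fy; have /andP[_ c1] := clamp_itv t.
  apply: (le_trans (y := clamp t * (q0 * ss y))); last by rewrite lerDr mulr_ge0 // subr_ge0.
  rewrite mulrA /mu -[_ / M * _]mulrA; apply: ler_wpM2l; first by rewrite mulr_ge0 // ltW.
  by rewrite ler_pdivrMl.
by apply: (rk_exists om0 p us ss') => l /hs [].
Qed.

Section Rank.
Variables (n : nat) (l0 : R).
Hypothesis rk0 : rk q l0 n.

Let hq0 : homot 0 = q. Proof. by apply/funext => l; exact: homot0. Qed.

Let L_ex t : exists l, rk (homot t) l n.
Proof.
have [c0|c0] := ltP 0 (clamp t); first exact: homot_rk_exists.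
have e : clamp t = 0 by apply/eqP; rewrite eq_le c0; case/andP: (clamp_itv t).
exists l0; rewrite (_ : homot t = q) //; apply/funext => l.
by rewrite /homot e subr0 mul0r mul1r mul0r addr0.
Qed.

Let L t := projT1 (cid (L_ex t)).
Let Lrk t : rk (homot t) (L t) n. Proof. exact: (projT2 (cid (L_ex t))). Qed.
Let nv t := nvec om k (homot t) (L t).
Let nvP t : eigw om k (homot t) (L t) (nv t) /\ rsum (fun m => nc (nv t m)) = 1.
Proof. by apply: nvecP; [exact: homot_psd|exact: (Lrk t).1]. Qed.
Let phi t := flux om k (nv t).

Let Lcont : continuous L.
Proof.
move=> t; apply/cvgrPdist_le => e e0.
have D1 : 0 < D + 1 by rewrite ltr_wpDl.
have ep : 0 < e / (D + 1) by rewrite divr_gt0.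
near=> t'.
apply: (le_trans (homot_rk_lip (Lrk t) (Lrk t'))).
have h : `|t - t'| <= e / (D + 1).
  by near: t'; apply: (@cvgr_dist_le R R R (nbhs t) _ id t cvg_id).
apply: (le_trans (ler_wpM2r Dge0 h)).
by rewrite mulrAC ler_pdivrMr // ler_wpM2l ?(ltW e0) // lerDl.
Unshelve. all: by end_near. Qed.

Let homot_cvg t m (U : set_system R) (UU : UltraFilter U) : nbhs t `<=` U -> ccvg_to U (fun s => homot s m) (homot t m).
Proof.
move=> tU.
have c : clamp s @[s --> U] --> clamp t.
  have : clamp s @[s --> t] --> clamp t.
    apply/cvgrPdist_le => e e0; near=> t'; apply: (le_trans (clamp_lip _ _)).
    by near: t'; apply: (@cvgr_dist_le R R R (nbhs t) _ id t cvg_id).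
  by move=> h A hA; apply: tU; exact: (h A hA).
rewrite /homot; apply: ccvgD; apply: ccvgM; try exact: ccvg_cst; apply: ccvgR.
  by apply: cvgB => //; exact: cvg_cst.
by apply: cvgMl.
Unshelve. all: by end_near. Qed.

(** The vectors [nv t] carry arbitrary phases and need not be continuous. The flux does not see
    phases, and by simplicity every ultralimit of nearby vectors has the flux of [nv t]. *)
Let phi_cont : continuous phi.
Proof.
move=> t; suff h : phi @ nbhs (t : R) --> phi t by exact: h.
apply: (@ultra_cvg R R (nbhs (t : R)) (nbhs_pfilter (t : R)) phi (phi t)) => U UU tU.
pose mu := L t / 2.
have Lt0 : 0 < L t := (Lrk t).1.1.
have mu0 : 0 < mu by rewrite divr_gt0.
have LU : L s @[s --> U] --> L t by move=> A hA; apply: tU; exact: (Lcont hA).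
have idU : \forall s \near U, mu <= L s.
  apply: filterS (cvgr_gt _ LU mu _) => [s /ltW //|]; rewrite /mu; lra.
have [|w [C [ew wc wn r1 wb]]] := @eigw_compact R R U UU om om0 (fun=> k) homot L nv k (L t) mu q0 `|k| (homot t)
    mu0 _ (cvg_cst _) LU (fun m => homot_cvg m UU tU).
  apply: filterS idU => s ms; have h1 := homot_psd s; have h2 := nvP s; split => //.
  rewrite /homot eqxx mulr1 ReD ReC -/q0 [Re (_ %:C)]/= -/q0; lra.
have -> : phi t = flux om k w.
  exact: (flux_unit (homot_psd t) Lt0 ew (nvP t).1 r1 (nvP t).2).1.
exact: (flux_cvg UU wc wb).
Qed.

Let phi_nz t : phi t != 0.
Proof.
apply: (flux_nz (homot_psd t) (Lrk t).1.1 (nvP t).1); exact: unit_nz (nvP t).2.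
Qed.

Let phi_sign : 0 < phi 0 * phi 1.
Proof.
rewrite ltNge; apply/negP => h.
have cp : {within `[0, 1], continuous phi} by apply: continuous_subspaceT; exact: phi_cont.
have [|c _ e] := IVT ler01 cp (v := 0); last by have := phi_nz c; rewrite e eqxx.
exact: min_max_sign (phi_nz 0) (phi_nz 1) h.
Qed.

Lemma freq_norm_lt (j m : int) : (`|freq om k m| < `|freq om k j|) =
  if (0 <= j)%R then (- j <= m < j)%R else (j < m < - j)%R.
Proof.
have [k0 k1] := andP kom.
have fe (i : int) : 0 <= i -> `|freq om k i| = om * i%:~R + k.
  by move=> i0; rewrite ger0_norm // addr_ge0 ?mulr_ge0 ?ler0z // ltW.
have fn (i : int) : i < 0 -> `|freq om k i| = om * (- i)%:~R - k.
  move=> i0; have : (i%:~R : R) <= -1 by rewrite -[-1]/((-1)%:~R) ler_int; lia.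
  move=> h; rewrite ler0_norm /freq; first by rewrite mulrNz; ring.
  have : om * i%:~R <= om * (-1) by rewrite ler_pM2l.
  lra.
have cmp (a b : int) : (a <= b)%R -> om * a%:~R <= om * b%:~R by move=> ab; rewrite ler_pM2l // ler_int.
have cmp1 (a b : int) : (a < b)%R -> om * a%:~R + om <= om * b%:~R.
  by move=> ab; have := cmp (a + 1) b; rewrite rmorphD /= mulrDr mulr1; apply; lia.
case: (leP 0 j) => j0; case: (leP 0 m) => m0.
- rewrite (fe j j0) (fe m m0); have [h|h] := ltP m j.
    rewrite (_ : (- j <= m)%R = true) /=; last by lia.
    by have := cmp1 _ _ h; lra.
  rewrite andbF; apply/negbTE; rewrite -leNgt; have := cmp _ _ h; lra.
- rewrite (fe j j0) (fn m m0); have [h|h] := leP (- j) m.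
    have -> : (m < j)%R = true by lia.
    have c : (- m <= j)%R by lia.
    by have := cmp _ _ c; rewrite /=; lra.
  have c : (j < - m)%R by lia.
  by rewrite /=; apply/negbTE; rewrite -leNgt; have := cmp1 _ _ c; lra.
- rewrite (fn j j0) (fe m m0) (_ : (j < m)%R = true) /=; last by lia.
  have [h|h] := ltP m (- j); first by have := cmp1 _ _ h; lra.
  by apply/negbTE; rewrite -leNgt; have := cmp _ _ h; lra.
- rewrite (fn j j0) (fn m m0); have [h|h] := ltP j m.
    have -> : (m < - j)%R = true by lia.
    have c : (- m < - j)%R by lia.
    by have := cmp1 _ _ c; rewrite /=; lra.
  have c : (- j <= - m)%R by lia.
  by rewrite /=; apply/negbTE; rewrite -leNgt; have := cmp _ _ c; lra.
Qed.

Lemma cwt_lt (j m : int) : (cwt om k m < cwt om k j) = (`|freq om k m| < `|freq om k j|).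
Proof.
rewrite /cwt ltr_pM2r ?invr_gt0 ?pi_gt0 // ltr_coshR !normrM ltr_pM2l // normr_gt0 pi_neq0 //.
Qed.

Lemma freq_norm_inj (j m : int) : cwt om k m = cwt om k j -> m = j.
Proof.
by move=> e; apply: absless_sym; rewrite mem_absless -freq_norm_lt -cwt_lt e ltxx.
Qed.

Let dl_ev (j : int) : isev (homot 1) (q0 / cwt om k j) /\ eigw om k (homot 1) (q0 / cwt om k j) (dl j).
Proof.
have sd := fin_csummable om0 (dl_fin om k j).
have e : eigw om k (homot 1) (q0 / cwt om k j) (dl j).
  split => // m; rewrite homot_toep // clamp_id ?ler01 ?lexx // subrr mul0r add0r mul1r.
  rewrite /dl; case: eqP => [->|_]; last by rewrite !mulr0.
  by rewrite divfK ?gt_eqF.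
split => //; split; first exact: divr_gt0.
by exists (dl j); split => //; exists j; rewrite /dl eqxx oner_eq0.
Qed.

Let ev_dl l w : eigw om k (homot 1) l w -> forall j, w j != 0 -> l = q0 / cwt om k j.
Proof.
move=> [sw ew] j wj; have := ew j.
rewrite homot_toep // clamp_id ?ler01 ?lexx // subrr mul0r add0r mul1r => /(mulIf wj) /complexI <-.
by rewrite mulfK ?gt_eqF.
Qed.

(** For the symbol [q_0 delta_0] the eigenvector is supported at one index [j] and its rank is the
    number of [m] with [c_m < c_j]. That number is even exactly when [j >= 0], and the flux has the
    sign of [a_j]. *)
Let phi1_sign : 0 < (-1) ^+ n * phi 1.
Proof.
have [ew r1] := nvP 1; have [j wj] := unit_nz r1.
have lE := ev_dl ew wj.
have w0 m : m != j -> nv 1 m = 0.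
  move=> mj; apply/eqP; apply: contraT => wm; have := ev_dl ew wm; rewrite lE.
  move/(mulfI (lt0r_neq0 q00)) => /invr_inj /freq_norm_inj e.
  by rewrite e eqxx in mj.
have pE : phi 1 = sinhR (pi * freq om k j) * nc (nv 1 j) ^+ 2.
  have -> : phi 1 = Re (csum (fun m => (sinhR (pi * freq om k m) * nc (nv 1 m) ^+ 2)%:C)) by [].
  rewrite (@csum_delta R _ j) // => m mj.
  by rewrite w0 // nc0 expr0n mulr0.
pose lst := absless j.
have lstP m : (m \in lst) = (cwt om k m < cwt om k j) by rewrite cwt_lt freq_norm_lt mem_absless.
have ul : uniq lst by exact: uniq_absless.
have [el [s [us sz hs]]] := Lrk 1.
have perm : s =i [seq q0 / cwt om k m | m <- lst].
  move=> l; apply/idP/mapP => [/hs [[lp [w [ewl [m wm]]]] ll]|[m ml ->]].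
    exists m; last exact: (ev_dl ewl).
    rewrite lstP; move: ll; rewrite (ev_dl ewl wm) lE ltr_pM2l // ltf_pV2 ?posrE //.
  apply/hs; split; first exact: (dl_ev m).1.
  by rewrite lE ltr_pM2l // ltf_pV2 ?posrE // -lstP.
have u2 : uniq [seq q0 / cwt om k m | m <- lst].
  rewrite map_inj_in_uniq // => a b _ _ /(mulfI (lt0r_neq0 q00)) /invr_inj.
  exact: freq_norm_inj.
have nE : n = size lst by have := uniq_size_uniq us perm; rewrite u2 size_map sz => /esym/eqP.
have [k0 k1] := andP kom.
have wj2 : 0 < nc (nv 1 j) ^+ 2 by rewrite exprn_gt0 // nc_gt0.
rewrite pE mulrA pmulr_lgt0 // nE sign_absless; case: (leP 0 j) => j0.
  by rewrite mul1r sinhR_gt0 mulr_gt0 ?pi_gt0 // ltr_wpDl // mulr_ge0 ?ler0z // ltW.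
have j1 : (j%:~R : R) <= -1 by rewrite -[-1]/((-1)%:~R) ler_int -ltzD1.
rewrite mulN1r oppr_gt0 sinhR_lt0 pmulr_rlt0 ?pi_gt0 //.
have : om * j%:~R <= om * (-1) by rewrite ler_pM2l.
rewrite /freq; lra.
Qed.

Lemma rank_flux_sign w : eigw om k q l0 w -> (exists m, w m != 0) -> 0 < (-1) ^+ n * flux om k w.
Proof.
move=> ew wn; have l00 := rk0.1.1.
have e0 : eigw om k q l0 (nv 0).
  have := (nvP 0).1; rewrite hq0; have := Lrk 0; rewrite hq0 => r.
  by rewrite (rk_uniq r rk0).
have [a ha] := simple_psd qp l00 ew wn e0.
have p0 : phi 0 = nc a ^+ 2 * flux om k w.
  by apply: flux_scale => //; apply: flux_summable; exact: eigw_fin ew.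
have an : 0 < nc a ^+ 2.
  rewrite exprn_gt0 // nc_gt0; apply/eqP => a0; have := phi_nz 0.
  by rewrite p0 a0 nc0 expr0n mul0r eqxx.
have h : 0 < ((-1) ^+ n * phi 1) * ((-1) ^+ n * phi 0).
  by rewrite mulrACA -expr2 sqrr_sign mul1r mulrC.
by move: h; rewrite (pmulr_rgt0 _ phi1_sign) p0 mulrCA (pmulr_rgt0 _ an).
Qed.

End Rank.
End Homotopy.

(** * Derivatives of the band functions *)

Section Analytic.
Context {R : realType}.

(** The terms of the series at distance [d = r / 2] are bounded by some [M]; within [d / 2] of [x0]
    the series is then dominated by a geometric one with ratio at most 1/2, which gives a Lipschitz
    bound at [x0]. *)
Lemma real_analytic_continuous (f : R -> R) : real_analytic f -> continuous f.
Proof.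
move=> af x0; have [r r0 [a ha]] := af x0.
pose u x := series (fun n => a n * (x - x0) ^+ n).
pose d := r / 2; have d0 : 0 < d by rewrite divr_gt0.
have [M M0 hM] : exists2 M, 0 < M & forall n, `|a n| * d ^+ n <= M.
  have h1 : u (x0 + d) @ \oo --> f (x0 + d).
    by apply: ha; rewrite addrAC subrr add0r gtr0_norm // /d; lra.
  have /cvgP /cvg_series_cvg_0 /cvgP /cvg_seq_bounded h2 := h1.
  have [M [Mr hM]] := h2; exists (`|M| + 1); first by rewrite ltr_pwDr.
  have L : M < `|M| + 1 by apply: le_lt_trans (ler_norm M) _; rewrite ltrDl.
  by move=> n; have := hM _ L n I; rewrite /= addrAC subrr add0r normrM normrX (gtr0_norm d0).
have B x : `|x - x0| <= d / 2 -> `|f x - a 0%N| <= 2 * M / d * `|x - x0|.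
  move=> xd; set y := `|x - x0| in xd *; have y0 : 0 <= y by exact: normr_ge0.
  pose z := y / d; have z0 : 0 <= z by rewrite divr_ge0 // ltW.
  have z1 : 2 * z <= 1 by rewrite /z mulrA ler_pdivrMr // mul1r; lra.
  have t n : `|a n * (x - x0) ^+ n| <= M * z ^+ n.
    rewrite normrM normrX -/y (_ : y = d * z); last by rewrite /z mulrC divfK // gt_eqF.
    by rewrite exprMn mulrA ler_wpM2r ?exprn_ge0.
  have s N : `|u x N.+1 - a 0%N| <= 2 * M * z - 2 * M * z ^+ N.+1.
    elim: N => [|N IH].
      by rewrite /u /series /= big_nat1 expr0 mulr1 subrr normr0 expr1 subrr.
    rewrite /u /series /= big_nat_recr //= -/(series _ N.+1) -/(u x) addrAC.
    apply: (le_trans (ler_normD _ _)); apply: (le_trans (lerD IH (t _))).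
    have p : 0 <= M * z ^+ N.+1 by rewrite mulr_ge0 ?exprn_ge0 // ltW.
    have : 2 * z * (M * z ^+ N.+1) <= 1 * (M * z ^+ N.+1) by rewrite ler_wpM2r.
    rewrite [z ^+ N.+2]exprS; lra.
  have lx : u x N.+1 @[N --> \oo] --> f x.
    have := ha x (_ : `|x - x0| < r); rewrite -(@cvg_shiftS R (u x)); apply.
    by rewrite -/y; move: xd; rewrite /d; lra.
  have l2 : `|u x N.+1 - a 0%N| @[N --> \oo] --> `|f x - a 0%N|.
    by apply: cvg_norm; apply: cvgB => //; exact: cvg_cst.
  apply: (filter_ler_cvg l2 (cvg_cst _)); apply: nearW => N.
  apply: (le_trans (s N)); rewrite (_ : 2 * M / d * y = 2 * M * z); last by rewrite /z; ring.
  by rewrite gerBl !mulr_ge0 ?exprn_ge0 // ltW.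
have f0 : f x0 = a 0%N.
  have := B x0; rewrite subrr normr0 mulr0 => /(_ _); rewrite divr_ge0 ?(ltW d0) // => /(_ isT).
  by rewrite normr_le0 subr_eq0 => /eqP.
apply/cvgrPdist_le => e e0.
have K0 : 0 < 2 * M / d by rewrite !mulr_gt0 // invr_gt0.
have d20 : 0 < d / 2 by rewrite divr_gt0.
have ep : 0 < e / (2 * M / d) by rewrite divr_gt0.
near=> x; rewrite f0 distrC.
have h1 : `|x - x0| <= d / 2 by rewrite distrC; near: x; apply: (@cvgr_dist_le R R R (nbhs x0) _ id x0 cvg_id).
have h2 : `|x - x0| <= e / (2 * M / d) by rewrite distrC; near: x; apply: (@cvgr_dist_le R R R (nbhs x0) _ id x0 cvg_id).
apply: (le_trans (B x h1)).
by rewrite mulrC -ler_pdivlMr.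
Unshelve. all: by end_near. Qed.

Lemma expR_quot (s : R) : h^-1 * (expR (s * h) - 1) @[h --> 0^'] --> s.
Proof.
have d : is_derive (0 : R) (1 : R) (fun h : R => expR (s * h)) s.
  have d1 : is_derive (0 : R) (1 : R) (fun h : R => s * h) s.
    by apply: (@dv_eq R _ _ _ _ (@dvZ R s id 0 1 _)); rewrite ?mulr1 //; exact: is_derive_id.
  apply: (@dv_eq R _ _ _ _ (@dv_comp R expR (fun h => s * h) 0 (expR (s * 0)) s _ d1)).
  by rewrite mulr0 expR0 mul1r.
have ex := @ex_derive _ _ _ _ _ _ _ d.
have h : h^-1 *: (((fun h : R => expR (s * h)) \o shift 0) (h *: 1) - expR (s * 0)) @[h --> 0^'] --> s.
  by rewrite -[X in _ --> X](@derive_val _ _ _ _ _ _ _ d); exact: ex.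
move: h; rewrite mulr0 expR0; apply: cvg_trans; apply: near_eq_cvg; apply: nearW => h /=.
by rewrite addr0 /GRing.scale /= mulr1.
Qed.

Lemma sinhR_continuous : continuous (@sinhR R).
Proof.
move=> x; rewrite /sinhR; apply: cvgMl; apply: cvgB; first exact: continuous_expR.
by apply: (@continuous_comp _ _ _ (fun x : R => - x) expR); [exact: cvgN|exact: continuous_expR].
Qed.

Lemma coshR_quot (s : R) : h^-1 * (coshR (s * h) - 1) @[h --> 0^'] --> 0.
Proof.
have e : 2^-1 * (s + (- s)) = 0 :> R by rewrite subrr mulr0.
have h : 2^-1 * (h^-1 * (expR (s * h) - 1) + h^-1 * (expR (- s * h) - 1)) @[h --> 0^'] --> 2^-1 * (s + (- s)).
  by apply: cvgMr; apply: cvgD; exact: expR_quot.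
rewrite e in h; move: h; apply: cvg_trans; apply: near_eq_cvg; apply: nearW => h /=.
rewrite /coshR mulNr; move: (expR _) (expR _) (h^-1) => x y z; lra.
Qed.

Lemma sinhR_quot (s : R) : h^-1 * sinhR (s * h) @[h --> 0^'] --> s.
Proof.
have e : 2^-1 * (s - (- s)) = s :> R by lra.
have h : 2^-1 * (h^-1 * (expR (s * h) - 1) - h^-1 * (expR (- s * h) - 1)) @[h --> 0^'] --> 2^-1 * (s - (- s)).
  by apply: cvgMr; apply: cvgB; exact: expR_quot.
rewrite e in h; move: h; apply: cvg_trans; apply: near_eq_cvg; apply: nearW => h /=.
rewrite /sinhR mulNr; move: (expR _) (expR _) (h^-1) => x y z; lra.
Qed.

End Analytic.

(** * The derivative of an eigenvalue *)

Section HellmannFeynman.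
Context {R : realType}.
Variables (om T : R) (om0 : 0 < om) (T0 : 0 < T) (omT : om * T = 2 * pi).
Variables (q : int -> R[i]) (qp : psdq q) (f : R -> R).
Hypothesis fc : continuous f.
Hypothesis fe : forall k, 0 < k < om / 2 -> isev om k q (f k).
Variables (k0 : R) (k0i : 0 < k0 < om / 2).

Let x n := pi * freq om k0 n.

(** The addition theorem confines [h] to two scalar factors, so difference quotients are taken
    outside the sums over [n]. *)
Let cwt_shift h n : (cwt om (h + k0) n)%:C =
  (pi^-1)%:C * ((coshR (pi * h))%:C * (coshR (x n))%:C + (sinhR (pi * h))%:C * (sinhR (x n))%:C) :> R[i].
Proof.
rewrite -!RCM -RCD -RCM /cwt /x; congr (_ %:C).
rewrite (_ : pi * freq om (h + k0) n = pi * freq om k0 n + pi * h); last by rewrite /freq; ring.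
by rewrite coshRD; move: (pi^-1 : R) => y; ring.
Qed.

Lemma hf_alg (l l' A B P cc ss hi : R) : P = pi^-1 * (cc * A + ss * B) -> l' * P = l * (pi^-1 * A) ->
  hi * (l' - l) * P = - l * pi^-1 * (hi * (cc - 1) * A + hi * ss * B).
Proof.
move=> e1 e2; rewrite -mulrA mulrBl e2 e1; move: (pi^-1 : R) => y; ring.
Qed.

Lemma hf_alg2 (y s e fl l : R) : y != 0 -> s != 0 -> e != 0 ->
  - l * (y * fl) / (y * e) = - l * s^-1 * (0 * (s * e) + s * fl) / e.
Proof. by move=> y0 s0 e0; field; rewrite y0 s0 e0. Qed.

(** The eigenvector at [k0 + h] is paired with one at [k0]. As [q] does not depend on [k],
    self-adjointness relates [f (k0 + h)] and [f k0] through two weighted pairings, and the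
    difference quotient of [f] becomes an explicit ratio. Continuity of [f] and compactness of
    eigenvectors suffice for its limit. *)
Lemma hellmann_feynman w0 : eigw om k0 q (f k0) w0 -> (exists n, w0 n != 0) ->
  derive1 f k0 = - f k0 * flux om k0 w0 / en om k0 w0.
Proof.
move=> ew0 w0n; apply: cvg_lim => //.
have l0 : 0 < f k0 by exact: (fe k0i).1.
have p0 : 0 < pi :> R by exact: pi_gt0.
apply: (@ultra_cvg R R (0^' : set_system R) _ (fun h => h^-1 *: (f (h + k0) - f k0))) => U UU dU.
have nU : nbhs (0 : R) `<=` U by move=> A [e e0 hA]; apply: dU; exists e => // z ze _; exact: hA.
have hU : h @[h --> U] --> (0 : R) by move=> A hA; exact: nU.
have kk : h + k0 @[h --> U] --> k0.
  by rewrite -[X in _ --> X]add0r; apply: cvgD => //; exact: cvg_cst.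
have ll : f (h + k0) @[h --> U] --> f k0 by apply: continuous_cvg => //; exact: fc.
have [k1 k2] := andP k0i.
have gd : \forall h \near U, 0 < h + k0 < om / 2.
  have g1 : \forall h \near U, 0 < h + k0 by exact: cvgr_gt kk 0 k1.
  have g2 : \forall h \near U, h + k0 < om / 2 by exact: cvgr_lt kk (om / 2) k2.
  by apply: filterS2 g1 g2 => h -> ->.
pose mu := f k0 / 2; have mu0 : 0 < mu by rewrite divr_gt0.
have gm : \forall h \near U, mu <= f (h + k0).
  by apply: filterS (cvgr_gt _ ll mu _) => [h /ltW //|]; rewrite /mu; lra.
pose wf h := nvec om (h + k0) q (f (h + k0)).
have wfP h : 0 < h + k0 < om / 2 -> eigw om (h + k0) q (f (h + k0)) (wf h) /\ rsum (fun n => nc (wf h n)) = 1.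
  by move=> hi; apply: nvecP => //; exact: fe.
have [|w [C [ew wc wn r1 wb]]] := @eigw_compact R R U UU om om0 (fun h => h + k0) (fun=> q) (fun h => f (h + k0)) wf
    k0 (f k0) mu (Re (q 0)) (om / 2) q mu0 _ kk ll (fun=> ccvg_cst _).
  apply: filterS2 gd gm => h hi hm; have h2 := wfP h hi; split => //.
  by rewrite ger0_norm; [exact/ltW/(andP hi).2|exact/ltW/(andP hi).1].
have fw := eigw_fin qp l0 ew.
have [a ha] := simple_psd om0 T0 omT k0i qp l0 ew wn ew0.
have a0 : 0 < nc a ^+ 2.
  rewrite exprn_gt0 // nc_gt0; apply/eqP => az; have [n] := w0n.
  by rewrite ha az mul0r eqxx.
have [n1 wn1] := wn.
have enw : 0 < en om k0 w by exact: en_gt0 wn1.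
rewrite (flux_scale (flux_summable fw) ha) (en_scale fw ha).
have -> : - f k0 * (nc a ^+ 2 * flux om k0 w) / (nc a ^+ 2 * en om k0 w) = - f k0 * pi^-1 * (0 * (pi * en om k0 w) + pi * flux om k0 w) / en om k0 w.
  exact: hf_alg2 (lt0r_neq0 a0) (lt0r_neq0 p0) (lt0r_neq0 enw).
pose As h := csum (fun n => (coshR (x n))%:C * (wf h n * cj (w n))).
pose Bs h := csum (fun n => (sinhR (x n))%:C * (wf h n * cj (w n))).
have wbl n : nc (w n) <= C * geo (pi * om) n.
  apply: (filter_ler_cvg (ccvg_nc (wc n)) (cvg_cst _)).
  by apply: filterS wb => i; apply.
pose K := expR (pi * `|k0|) * C ^+ 2.
have gs : rsummable (fun n => K * geo (pi * om) n).
  by apply/rsummableZ/geo_summable; rewrite mulr_gt0.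
have bd (y : R) v n : `|y| <= coshR (x n) -> nc (v n) <= C * geo (pi * om) n ->
    nc (y%:C * (v n * cj (w n))) <= K * geo (pi * om) n.
  move=> hy hv; rewrite !ncM ncR nc_conj.
  have h1 := le_trans hy (cosh_geo k0 om0 n).
  have g0 := geo_gt0 (pi * om) n.
  apply: (le_trans (ler_pM (normr_ge0 _) _ h1 (ler_pM (nc_ge0 _) (nc_ge0 _) hv (wbl n)))).
    by rewrite mulr_ge0 ?nc_ge0.
  rewrite le_eqVlt; apply/orP; left; apply/eqP; rewrite /K; field.
  by rewrite gt_eqF.
have cc n : `|coshR (x n)| <= coshR (x n) by rewrite gtr0_norm ?coshR_gt0.
have cs n : `|sinhR (x n)| <= coshR (x n) by exact: sinhR_le_coshR.
have lim (y : int -> R) : (forall n, `|y n| <= coshR (x n)) ->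
    ccvg_to U (fun h => csum (fun n => (y n)%:C * (wf h n * cj (w n)))) (csum (fun n => (y n)%:C * (w n * cj (w n)))).
  move=> hy; apply: (@csum_dominated _ _ _ _ _ _ (fun n => K * geo (pi * om) n)) => //.
  - by apply: filterS wb => h hb n; apply: bd.
  - by move=> n; apply: ccvgM; [exact: ccvg_cst|apply: ccvgM => //; exact: ccvg_cst].
have limA : Re (As h) @[h --> U] --> pi * en om k0 w.
  have e : csum (fun n => (coshR (x n))%:C * (w n * cj (w n))) = (pi * en om k0 w)%:C.
    rewrite RCM -cpp // /cp -csumZ; last exact: cp_summable.
    apply: eq_csum => n; have <- : pi * cwt om k0 n = coshR (x n) by rewrite /cwt mulrC divfK ?gt_eqF.
    by rewrite RCM -!mulrA.
  by have := (lim _ cc).1; rewrite e.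
have limB : Re (Bs h) @[h --> U] --> flux om k0 w.
  have e : Re (csum (fun n => (sinhR (x n))%:C * (w n * cj (w n)))) = flux om k0 w.
    by apply: eq_rsum => n; rewrite ReC mul_conj.
  by have := (lim _ cs).1; rewrite e.
pose P h := csum (fun n => (cwt om (h + k0) n)%:C * (wf h n * cj (w n))).
have sw := ew.1.
have AP : \forall h \near U, Re (P h) = pi^-1 * (coshR (pi * h) * Re (As h) + sinhR (pi * h) * Re (Bs h)) /\
    f (h + k0) * Re (P h) = f k0 * (pi^-1 * Re (As h)).
  apply: filterS2 gd wb => h hi hb; have [ew' _] := wfP h hi; have sw' := ew'.1.
  have sA : csummable (fun n => (coshR (x n))%:C * (wf h n * cj (w n))).
    by apply: csummable_le gs => n; apply: bd.
  have sB : csummable (fun n => (sinhR (x n))%:C * (wf h n * cj (w n))).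
    by apply: csummable_le gs => n; apply: bd.
  have PE : P h = (pi^-1)%:C * ((coshR (pi * h))%:C * As h + (sinhR (pi * h))%:C * Bs h).
    rewrite /P /As /Bs -!csumZ // -csumD; try exact: csummableZ.
    rewrite -csumZ; last by apply: csummableD; exact: csummableZ.
    by apply: eq_csum => n; rewrite cwt_shift; ring.
  have sP : csummable (fun n => (cwt om (h + k0) n)%:C * (wf h n * cj (w n))).
    apply: (@csummable_ext _ (fun n => (pi^-1)%:C * ((coshR (pi * h))%:C * ((coshR (x n))%:C * (wf h n * cj (w n))) +
       (sinhR (pi * h))%:C * ((sinhR (x n))%:C * (wf h n * cj (w n)))))).
      by move=> n; rewrite cwt_shift; ring.
    by apply/csummableZ/csummableD; exact: csummableZ.
  have pair := toep_pairing2 qp sw' sw.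
  have e1 : csum (fun n => toep q (wf h) n * cj (w n)) = (f (h + k0))%:C * P h.
    by rewrite /P -csumZ //; apply: eq_csum => n; rewrite -ew'.2 RCM -!mulrA.
  have e2 : csum (fun n => wf h n * cj (toep q w n)) = (f k0 * pi^-1)%:C * As h.
    rewrite /As -csumZ //; apply: eq_csum => n; have ce : cwt om k0 n = pi^-1 * coshR (x n) by rewrite /cwt mulrC.
    by rewrite -ew.2 conjM conjR ce !RCM; ring.
  split; first by rewrite PE ReC ReD !ReC.
  by rewrite -ReC -e1 pair e2 ReC mulrA.
have limP : Re (P h) @[h --> U] --> en om k0 w.
  have h1 : pi^-1 * (coshR (pi * h) * Re (As h) + sinhR (pi * h) * Re (Bs h)) @[h --> U] -->
      pi^-1 * (coshR (pi * 0) * (pi * en om k0 w) + sinhR (pi * 0) * flux om k0 w).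
    have hp : pi * h @[h --> U] --> pi * 0 by apply: cvgMr.
    have c1 : coshR (pi * h) @[h --> U] --> coshR (pi * 0) by apply: continuous_cvg hp; exact: coshR_continuous.
    have c2 : sinhR (pi * h) @[h --> U] --> sinhR (pi * 0) by apply: continuous_cvg hp; exact: sinhR_continuous.
    by apply: cvgMr; apply: cvgD; apply: cvgM.
  have e : pi^-1 * (coshR (pi * 0) * (pi * en om k0 w) + sinhR (pi * 0) * flux om k0 w) = en om k0 w.
    by rewrite mulr0 coshR0 (_ : sinhR 0 = 0) ?mul0r ?addr0 ?mul1r ?mulKf ?gt_eqF //; apply/eqP; rewrite sinhR_eq0.
  rewrite -[X in _ --> X]e; move: h1; apply: cvg_trans; apply: near_eq_cvg.
  by apply: filterS AP => h [-> _].
pose N h := - f k0 * pi^-1 * (h^-1 * (coshR (pi * h) - 1) * Re (As h) + h^-1 * sinhR (pi * h) * Re (Bs h)).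
have limN : N h @[h --> U] --> - f k0 * pi^-1 * (0 * (pi * en om k0 w) + pi * flux om k0 w).
  have c1 : h^-1 * (coshR (pi * h) - 1) @[h --> U] --> (0 : R) by move=> A hA; apply: dU; exact: (@coshR_quot R pi A hA).
  have c2 : h^-1 * sinhR (pi * h) @[h --> U] --> (pi : R) by move=> A hA; apply: dU; exact: (@sinhR_quot R pi A hA).
  by apply: cvgMr; apply: cvgD; apply: cvgM.
have limQ : N h / Re (P h) @[h --> U] --> - f k0 * pi^-1 * (0 * (pi * en om k0 w) + pi * flux om k0 w) / en om k0 w.
  by apply: cvgM => //; apply: cvgV => //; rewrite gt_eqF.
move: limQ; apply: cvg_trans; apply: near_eq_cvg.
have P0 : \forall h \near U, 0 < Re (P h) by exact: cvgr_gt limP 0 enw.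
apply: filterS2 AP P0 => h [a1 a2] a3.
rewrite /N -(hf_alg h^-1 a1 a2) mulfK ?gt_eqF //.
Qed.
End HellmannFeynman.

Lemma sign_const {R : realType} (g : R -> R) (b k k' : R) : continuous g ->
  (forall x, 0 < x < b -> g x != 0) -> 0 < k < b -> 0 < k' < b -> 0 < g k -> 0 < g k'.
Proof.
move=> gc g0 kb kb' gk; rewrite ltNge; apply/negP => gk'.
have [k0 kb1] := andP kb; have [k0' kb1'] := andP kb'.
have cw (x y : R) : {within `[x, y], continuous g} by apply: continuous_subspaceT.
have [kk|kk] := leP k k'.
  have [|c ci e] := @IVT R g k k' 0 kk (cw _ _); first by rewrite ge_min le_max gk' (ltW gk) orbT.
  move: ci; rewrite in_itv /= => /andP[c1 c2].
  by have := g0 c; rewrite e eqxx (lt_le_trans k0 c1) (le_lt_trans c2 kb1') => /(_ isT).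
have [|c ci e] := @IVT R g k' k 0 (ltW kk) (cw _ _); first by rewrite ge_min le_max gk' (ltW gk) orbT.
move: ci; rewrite in_itv /= => /andP[c1 c2].
by have := g0 c; rewrite e eqxx (lt_le_trans k0' c1) (le_lt_trans c2 kb1) => /(_ isT).
Qed.

(** * Band functions on the open half-zone *)

Section Bands.
Context {R : realType}.
Variables (p : R -> R) (T : R) (T0 : 0 < T).
Let om := omg T.
Let q := symb p T.
Hypothesis qp : psdq q.
Let om0 : 0 < om. Proof. by rewrite /om /omg divr_gt0 // mulr_gt0 // pi_gt0. Qed.
Let oT : om * T = 2 * pi. Proof. exact: omT. Qed.
Local Notation isev := (fun k => isev om k q).

Section Multiplicity.
Variables (k : R) (kom : 0 < k < om / 2).
Let spl := simple_psd om0 T0 oT kom qp.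

Lemma cj_Gm_neq0 m : cj (Gm T k m) != 0.
Proof. by rewrite -nc_eq0 nc_conj nc_eq0 Gm_neq0. Qed.

Lemma in_eigenspace_ev (lam : R) x n : lam != 0 -> in_eigenspace p T k lam x -> x n != 0 -> isev k lam.
Proof.
move=> l0 hx xn; have ew := eigenspace_eigw T0 qp hx.
have wn : exists m, cj (Gm T k m) * x m != 0 by exists n; rewrite mulf_neq0 ?cj_Gm_neq0.
have fw : fin om k (fun m => cj (Gm T k m) * x m).
  apply: (rsummable_le _ ((l2Z_summable x).1 hx.1)) => m.
  rewrite ncM nc_conj exprMn nc_Gm mulrA mulfV ?gt_eqF ?cwt_gt0 // mul1r ger0_norm ?sqr_ge0 //.
split; last by exists (fun m => cj (Gm T k m) * x m).
by rewrite lt_def l0 (eigw_pos qp ew fw wn).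
Qed.

Lemma eig_mult1 (lam : R) : isev k lam -> eig_mult p T k lam 1.
Proof.
move=> el; split.
  have [ee [n en0]] := evecP el.
  exists (fun _ m => evec om k q lam m / cj (Gm T k m)); split.
    by move=> i; exact: (eigw_eigenspace qp el.1 ee).
  move=> c /(_ n); rewrite big_ord1 => /eqP; rewrite !mulf_eq0 invr_eq0 (negbTE en0) (negbTE (cj_Gm_neq0 n)) !orbF.
  by move=> /eqP c0 i; rewrite ord1.
move=> [v [hv ind]].
have [n vn] : exists n, v ord0 n != 0.
  apply: contrapT => h; have := ind (fun i => (i == ord0)%:R) _ ord0; rewrite eqxx => h1.
  have := h1 _; move=> /(_ _) /eqP; rewrite oner_eq0 => h2; apply: notF; apply: h2 => n.
  rewrite big_ord_recl big_ord1 eqxx mul1r /= mul0r addr0.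
  by apply/eqP; apply: contraT => h3; case: h; exists n.
have e0 := eigenspace_eigw T0 qp (hv ord0); have e1 := eigenspace_eigw T0 qp (hv (lift ord0 ord0)).
have [|a ha] := spl el.1 e0 _ e1; first by exists n; rewrite mulf_neq0 ?cj_Gm_neq0.
have := ind (fun i => if i == ord0 then a else -1) _ (lift ord0 ord0) => /=.
move=> /(_ _)/eqP; rewrite oppr_eq0 oner_eq0 => h; apply: notF; apply: h => m.
rewrite big_ord_recl big_ord1 /=; apply: (mulfI (cj_Gm_neq0 m)).
have := ha m; rewrite mulr0 mulrDr mulN1r mulrN => ->; ring.
Qed.

Lemma eig_mult0 (lam : R) : lam != 0 -> ~ isev k lam -> eig_mult p T k lam 0.
Proof.
move=> l0 nl; split; first by exists (fun _ _ => 0); split => [[]|c _ []].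
move=> [v [hv ind]]; apply: nl.
have [n vn] : exists n, v ord0 n != 0; last exact: in_eigenspace_ev l0 (hv ord0) vn.
apply: contrapT => h; have := ind (fun=> 1) _ ord0.
move=> /(_ _)/eqP; rewrite oner_eq0 => h2; apply: notF; apply: h2 => n.
rewrite big_ord1 mul1r.
by apply/eqP; apply: contraT => h3; case: h; exists n.
Qed.

End Multiplicity.

Variables (Nb : option nat) (E : nat -> R -> R) (HE : band_functions p T Nb E).

Section Fixed.
Variables (k : R) (kom : 0 < k < om / 2).

Lemma band_ev j : in_idx Nb j -> isev k (E j k).
Proof.
move=> hj; apply: contrapT => h; have l0 : E j k != 0 by exact: (HE.1 j hj).2.
have [s [_ [/size0nil s0 hs]]] := (HE.2 k _ 0%N l0).1 (eig_mult0 l0 h).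
by have := (hs j).2 (conj hj erefl); rewrite s0.
Qed.

Lemma ev_band (lam : R) : isev k lam -> exists j, in_idx Nb j /\ E j k = lam.
Proof.
move=> el; have l0 : lam != 0 by rewrite gt_eqF //; exact: el.1.
have [s [_ [ss hs]]] := (HE.2 k lam 1%N l0).1 (eig_mult1 kom el).
case: s ss hs => // j s _ hs; exists j; apply/hs; exact: mem_head.
Qed.

Lemma band_inj i j : in_idx Nb i -> in_idx Nb j -> E i k = E j k -> i = j.
Proof.
move=> hi hj e; have el := band_ev hj; have l0 : E j k != 0 by exact: (HE.1 j hj).2.
have [s [_ [ss hs]]] := (HE.2 k _ 1%N l0).1 (eig_mult1 kom el).
have := (hs i).2 (conj hi e); have := (hs j).2 (conj hj erefl).
by case: s ss hs => [|a [|b s]] // _ _; rewrite !inE => /eqP -> /eqP ->.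
Qed.

(* Unlike [rk], the index set [I] does not depend on [k] as long as the band
   functions do not cross. *)
Definition irk j n := exists I : seq nat, [/\ uniq I, size I = n &
  forall i, i \in I <-> in_idx Nb i /\ E j k < E i k].

Lemma irk_rk j n : in_idx Nb j -> irk j n -> rk om k q (E j k) n.
Proof.
move=> hj [I [uI sI hI]]; split; first exact: band_ev.
exists [seq E i k | i <- I]; split; rewrite ?size_map //.
  by rewrite map_inj_in_uniq // => a b /hI [ha _] /hI [hb _]; exact: band_inj.
move=> l; split.
  by move=> /mapP [i /hI [hi ij] ->]; split => //; exact: band_ev.
move=> [/ev_band [i [hi <-]] ij]; apply/mapP; exists i => //; exact/hI.
Qed.

Lemma rk_irk j n : rk om k q (E j k) n -> irk j n.
Proof.
move=> [_ [s [us ss hs]]].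
have /choice [g hg] : forall l, exists i, isev k l -> in_idx Nb i /\ E i k = l.
  move=> l; have [el|nl] := pselect (isev k l); last by exists 0%N.
  by have [i hi] := ev_band el; exists i.
exists [seq g l | l <- s]; split; rewrite ?size_map //.
  rewrite map_inj_in_uniq // => a b /hs [ha _] /hs [hb _] e.
  by rewrite -(hg a ha).2 e (hg b hb).2.
move=> i; split.
  by move=> /mapP [l /hs [el ll] ->]; have [h1 h2] := hg l el; rewrite h2.
move=> [hi ij]; apply/mapP; exists (E i k); first by apply/hs; split => //; exact: band_ev.
by have [h1 h2] := hg _ (band_ev hi); apply: band_inj.
Qed.

End Fixed.

Lemma band_deriv k j n : 0 < k < om / 2 -> in_idx Nb j -> rk om k q (E j k) n ->
  0 < (-1) ^+ n.+1 * derive1 (E j) k.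
Proof.
move=> kom hj r; have el := band_ev k hj; have [ee en0] := evecP el.
(* Eigenvalues are bounded by a multiple of [q_0], so the existence of one excludes [q_0 = 0]. *)
have q00 : 0 < Re (q 0).
  have q0 : 0 <= Re (q 0) by apply: le_trans (nc_ge0 _) (psdq_bound 0 qp).
  rewrite lt_def q0 andbT; apply/eqP => z; have := isev_bound om0 qp el.
  by rewrite z mul0r leNgt el.1.
have fs := rank_flux_sign om0 T0 oT kom qp q00 r ee en0.
have -> : derive1 (E j) k = - E j k * flux om k (evec om k q (E j k)) / en om k (evec om k q (E j k)).
  apply: (hellmann_feynman om0 T0 oT qp _ _ kom ee en0).
    by apply: real_analytic_continuous; exact: (HE.1 j hj).1.
  by move=> x xom; exact: band_ev.
have e0 := evec_en qp el; have l0 := el.1.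
move: (flux _ _ _) (en _ _ _) fs e0 => fl e fs e0.
have -> : (-1) ^+ n.+1 * (- E j k * fl / e) = E j k / e * ((-1) ^+ n * fl) by rewrite exprS; ring.
by apply: mulr_gt0 fs; exact: divr_gt0.
Qed.

Lemma half_band : 0 < om / 4 < om / 2.
Proof. by move: om0; move: om => x x0; apply/andP; split; lra. Qed.

Lemma no_flat_band j : in_idx Nb j -> ~ exists c : R, forall k, E j k = c.
Proof.
move=> hj [c hc]; have kom := half_band.
have [n r] := rk_of om0 qp (band_ev (om / 4) hj).
have := band_deriv kom hj r; have -> : E j = cst c by apply/funext.
by rewrite derive1_cst mulr0 ltxx.
Qed.

(** Simple eigenvalues prevent two bands from meeting inside the interval, so their difference keeps
    its sign. *)
Lemma band_order k k' i j : 0 < k < om / 2 -> 0 < k' < om / 2 -> in_idx Nb i -> in_idx Nb j ->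
  E j k < E i k -> E j k' < E i k'.
Proof.
move=> kom kom' hi hj h; have ij : i != j by apply/eqP => e; rewrite e ltxx in h.
rewrite -subr_gt0; apply: (@sign_const R (fun x => E i x - E j x) (om / 2) k k') => //; last by rewrite subr_gt0.
  have ci := real_analytic_continuous (HE.1 i hi).1; have cj := real_analytic_continuous (HE.1 j hj).1.
  by move=> x; apply: cvgB; [exact: ci|exact: cj].
move=> x xom; rewrite subr_eq0; apply: contraNneq ij => e; apply/eqP; exact: (band_inj xom hi hj e).
Qed.

Lemma irk_const k k' j n : 0 < k < om / 2 -> 0 < k' < om / 2 -> in_idx Nb j -> irk k j n -> irk k' j n.
Proof.
move=> kom kom' hj [I [uI sI hI]]; exists I; split => // i; rewrite hI.
by split=> -[hi h]; split => //; [exact: (band_order kom)|exact: (band_order kom')].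
Qed.

Lemma idx_le i n : in_idx Nb n -> (i <= n)%N -> in_idx Nb i.
Proof. by case: Nb => [N|] //=; move=> h1 h2; exact: leq_ltn_trans h1. Qed.

Lemma irk_exists k n : 0 < k < om / 2 -> in_idx Nb n -> exists j, in_idx Nb j /\ irk k j n.
Proof.
move=> kom hn.
have hi i : i \in iota 0 n.+1 -> in_idx Nb i by rewrite mem_iota /= add0n ltnS; exact: idx_le.
have us : uniq [seq E i k | i <- iota 0 n.+1].
  by rewrite map_inj_in_uniq ?iota_uniq // => a b /hi ha /hi hb; exact: band_inj.
have sz : size [seq E i k | i <- iota 0 n.+1] = n.+1 by rewrite size_map size_iota.
have ev l : l \in [seq E i k | i <- iota 0 n.+1] -> isev k l.
  by move=> /mapP [i /hi h ->]; exact: band_ev.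
have [l r] := rk_exists om0 qp us sz ev.
have [j [hj e]] := ev_band kom r.1; exists j; split => //.
by apply: rk_irk => //; rewrite e.
Qed.

Lemma irk_idx k j n : in_idx Nb j -> irk k j n -> in_idx Nb n.
Proof.
move=> hj [I [uI sI hI]]; move: hj hI; case: Nb => [N|] //= hj hI.
have : (size (j :: I) <= size (iota 0 N))%N.
  apply: uniq_leq_size; rewrite /= ?uI ?andbT; first by apply/negP => /hI [_]; rewrite ltxx.
  by move=> i; rewrite inE mem_iota => /orP[/eqP ->|/hI []].
by rewrite /= sI size_iota.
Qed.

Lemma rank_strict k a b n : rk om k q a n -> rk om k q b n.+1 -> b < a.
Proof.
move=> [ea [s1 [u1 z1 h1]]] [eb [s2 [u2 z2 h2]]]; rewrite ltNge; apply/negP => ab.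
have : (size s2 <= size s1)%N.
  by apply: uniq_leq_size => // l /h2 [el bl]; apply/h1; split => //; exact: le_lt_trans bl.
by rewrite z1 z2 ltnn.
Qed.

Lemma bands_sorted : exists sigma : nat -> nat,
    (forall n, in_idx Nb n -> in_idx Nb (sigma n)) /\
    (forall j, in_idx Nb j -> exists2 n, in_idx Nb n & sigma n = j) /\
    forall k : R, 0 < k < omg T / 2 ->
      (forall n, in_idx Nb n -> 0 < E (sigma n) k) /\
      (forall n, in_idx Nb n.+1 -> E (sigma n.+1) k < E (sigma n) k) /\
      (forall n, in_idx Nb n -> 0 < (-1) ^+ n.+1 * derive1 (E (sigma n)) k).
Proof.
have kom := half_band.
(* The bands are ranked at the reference point [om / 4]; the order is the same throughout the
   interval by [irk_const]. *)
have /choice [sigma hs] : forall n, exists j, in_idx Nb n -> in_idx Nb j /\ irk (om / 4) j n.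
  move=> n; have [hn|hn] := pselect (in_idx Nb n); last by exists 0%N.
  by have [j hj] := irk_exists kom hn; exists j.
have hi n : in_idx Nb n -> in_idx Nb (sigma n) by move=> /hs [].
have hr k n : 0 < k < om / 2 -> in_idx Nb n -> rk om k q (E (sigma n) k) n.
  move=> kom' /hs [hj r]; apply: irk_rk => //; exact: irk_const r.
exists sigma; split => //; split.
  move=> j hj; have [n r] := rk_of om0 qp (band_ev (om / 4) hj).
  have hn := irk_idx hj (rk_irk kom r); exists n => //.
  by apply: (band_inj kom (hi n hn) hj); exact: rk_uniq (hr _ _ kom hn) r.
move=> k kom'; split; first by move=> n hn; exact: (band_ev k (hi n hn)).1.
split=> n hn; last exact: (band_deriv kom' (hi n hn) (hr k n kom' hn)).
by apply: rank_strict (hr k n kom' (idx_le hn (leqnSn n))) (hr k n.+1 kom' hn).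
Qed.

End Bands.

Unset Implicit Arguments.
Theorem theorem7p2 (R : realType) (p : R -> R) (T : R)
    (Hp : smooth_periodic_symbol p T) (Hpsd : hankel_psd p)
    (Nb : option nat) (E : nat -> R -> R) (HE : band_functions p T Nb E) :
  (forall j, in_idx Nb j -> ~ exists c : R, forall k, E j k = c) /\
  exists sigma : nat -> nat,
    (forall n, in_idx Nb n -> in_idx Nb (sigma n)) /\
    (forall j, in_idx Nb j -> exists2 n, in_idx Nb n & sigma n = j) /\
    forall k : R, 0 < k < omg T / 2 ->
      (forall n, in_idx Nb n -> 0 < E (sigma n) k) /\
      (forall n, in_idx Nb n.+1 -> E (sigma n.+1) k < E (sigma n) k) /\
      (forall n, in_idx Nb n -> 0 < (-1) ^+ n.+1 * derive1 (E (sigma n)) k).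
Proof.
have [T0 [pT [mp [ip _]]]] := Hp.
(* [I0T] is the closed period, whereas [seg] is half-open. *)
have ip' : lintegrable (fun x => seg T x * p x).
  have sub : `[0, T[ `<=` I0T T.
    by move=> x; rewrite /I0T /= !in_itv /= => /andP[h1 h2]; rewrite h1 (ltW h2).
  have h := @integrableS _ _ _ (@lebesgue_measure R) _ _ _ (measurable_itv _) (measurable_itv _) sub ip.
  move: h; rewrite integrable_mkcond //; apply: eq_integrable => // x _.
  rewrite /= patchE seg_indic indicE mem_setE; case: ifP => _ /=; rewrite ?mul1r ?mul0r //.
have qp := hankel_psdq T0 pT mp ip' Hpsd.
by split; [move=> j; exact: (no_flat_band T0 qp HE)|exact: (bands_sorted T0 qp HE)].
Qed.
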